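(* Let $N\geq 2$ be an integer, $d\in(0,1)\cup\mathbb{N}$ (where $\mathbb N=\{1,2,\dots\}$), $p>1$, $0<-\alpha<\min(2d,N)$, and set $p_c=\frac{N(p-1)}{2d+\alpha}$. Let $q>1$ satisfy $q>\max\left\{p_c,\frac{Np}{N+\alpha}\right\}$. Let $\zeta:(0,\infty)\to(0,\infty)$ be a continuous function such that, for some $\sigma>-1$ and $m\in\mathbb{R}$, $\zeta(t)\sim t^{\sigma}$ as $t\to0$ and $\zeta(t)\sim t^{m}$ as $t\to\infty$. Let $u_0,\mathbf{w}\in L^q(\mathbb{R}^N)$. Then there exist $T=T(u_0)>0$ and a unique $u\in C([0,T];L^q(\mathbb{R}^N))$ which is a mild solution of $$u_t+(-\Delta)^d u=|x|^{\alpha}|u|^p+\zeta(t)\mathbf{w}(x),\qquad u(0)=u_0.$$ Moreover, let $T_{\max}$ be the maximal time of existence of this solution. If $T_{\max}<\infty$, then $$\lim_{t\to T_{\max}}\|u(t)\|_{L^q(\mathbb{R}^N)}=\infty.$$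
   Context: For $d\in\mathbb{N}$, $(-\Delta)^d$ is the $d$-fold composition of $-\Delta$; for $d\in(0,1)$ it is the fractional Laplacian, $(-\Delta)^d u=\mathcal{F}^{-1}(|\xi|^{2d}\mathcal{F}u)$. The semigroup generated is $e^{-t(-\Delta)^d}\varphi=E_d(\cdot,t)*\varphi$, $t>0$, where $E_d(\cdot,t)$ is the kernel whose Fourier multiplier is $e^{-t|\xi|^{2d}}$; at $t=0$ it is the identity. The notation $f(t)\sim g(t)$ means asymptotic equivalence (the ratio tends to $1$). A mild solution on $[0,T]$ is a function $u$ satisfying, for $t\in[0,T]$, the Duhamel formula $$u(t)=e^{-t(-\Delta)^d}u_0+\int_0^t e^{-(t-s)(-\Delta)^d}\left(|\cdot|^{\alpha}|u(s)|^p\right)ds+\int_0^t\zeta(s)\,e^{-(t-s)(-\Delta)^d}\mathbf{w}\,ds.$$ The maximal time of existence $T_{\max}\in(0,\infty]$ is the supremum of all $T'>0$ for which a mild solution in $C([0,T'];L^q(\mathbb{R}^N))$ exists. *)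

(* Defs.v *)
From HB Require Import structures.
From mathcomp Require Import all_boot all_order all_algebra.
From mathcomp Require Import all_classical all_reals all_analysis.
From mathcomp Require Import measurable_realfun.
From mathcomp.real_closed Require Import complex.

Set Implicit Arguments.
Unset Strict Implicit.
Unset Printing Implicit Defensive.

Import Order.TTheory GRing.Theory Num.Theory.
Import numFieldNormedType.Exports.

Local Open Scope classical_set_scope.
Local Open Scope ring_scope.

(** * Euclidean space and its Lebesgue measure *)

Notation Rn R n := (n.-tuple (measurableTypeR R)).

Section lebesgue_tuple.
Context {R : realType}.
Local Open Scope ereal_scope.

Definition consn n (z : measurableTypeR R * Rn R n) : Rn R n.+1 :=
  [tuple of z.1 :: z.2].

Definition unconsn n (x : Rn R n.+1) : measurableTypeR R * Rn R n :=
  (thead x, [tuple of behead x]).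

Lemma measurable_consn n : measurable_fun [set: _] (@consn n).
Proof. exact: measurable_cons. Qed.

Lemma measurable_unconsn n : measurable_fun [set: _] (@unconsn n).
Proof.
apply: measurable_fun_pair; last exact: measurable_behead.
exact: measurable_tnth.
Qed.

Lemma consnK n : cancel (@consn n) (@unconsn n).
Proof.
by move=> [a x]; rewrite /unconsn /consn/=; congr pair; exact/val_inj.
Qed.

Lemma unconsnK n : cancel (@unconsn n) (@consn n).
Proof. by move=> x; rewrite /consn/= -tuple_eta. Qed.

Section step.
Context (n : nat) (l : {sigma_finite_measure set (measurableTypeR R) -> \bar R}).
Context (m : {sigma_finite_measure set (Rn R n) -> \bar R}).

Definition product_step : set (Rn R n.+1) -> \bar R :=
  pushforward (l \x m) (@consn n).

Let step0 : product_step set0 = 0.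
Proof. by rewrite /product_step /pushforward preimage_set0 measure0. Qed.

Let step_ge0 A : 0 <= product_step A.
Proof. by rewrite /product_step /pushforward measure_ge0. Qed.

Let step_sigma_additive : semi_sigma_additive product_step.
Proof.
move=> F mF tF mUF; rewrite /product_step /pushforward preimage_bigcup.
have mc A : measurable A -> measurable (@consn n @^-1` A).
  by move=> mA; rewrite -[X in measurable X]setTI; exact: measurable_consn.
apply: measure_semi_sigma_additive.
- by move=> k; exact: mc.
- apply/trivIsetP => /= i j _ _ ij; rewrite -preimage_setI.
  by move/trivIsetP : tF => /(_ _ _ _ _ ij) ->//; rewrite preimage_set0.
- by rewrite -preimage_bigcup; exact: mc.
Qed.

HB.instance Definition _ := isMeasure.Build _ _ _ product_step
  step0 step_ge0 step_sigma_additive.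

Let step_sigma_finite : sigma_finite [set: Rn R n.+1] product_step.
Proof.
have /sigma_finiteP[F [TF ndF Foo]] := sigma_finiteT l.
have /sigma_finiteP[G [TG ndG Goo]] := sigma_finiteT m.
exists (fun k => @unconsn n @^-1` (F k `*` G k)).
  rewrite -preimage_bigcup [X in _ @^-1` X](_ : _ = setT) ?preimage_setT//.
  apply/seteqP; split => // -[x y] _.
  have [i _ Fix] : (\bigcup_k F k) x by rewrite -TF.
  have [j _ Gjy] : (\bigcup_k G k) y by rewrite -TG.
  exists (maxn i j) => //; split => /=.
  - by move: x Fix; exact/subsetPset/ndF/leq_maxl.
  - by move: y Gjy; exact/subsetPset/ndG/leq_maxr.
move=> k; have [mF Fk] := Foo k; have [mG Gk] := Goo k; split.
  rewrite -[X in measurable X]setTI; apply: measurable_unconsn => //.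
  exact: measurableX.
rewrite /product_step /pushforward (_ : _ @^-1` _ = F k `*` G k).
  by rewrite product_measure1E// lte_mul_pinfty// ge0_fin_numE.
rewrite -comp_preimage (_ : _ \o _ = id) ?preimage_id//.
by apply/funext => z; exact: consnK.
Qed.

HB.instance Definition _ := Measure_isSigmaFinite.Build _ _ _ product_step
  step_sigma_finite.

End step.

Fixpoint lebesgue_Rn n : {sigma_finite_measure set (Rn R n) -> \bar R} :=
  match n with
  | 0 => [the sigma_finite_measure _ _ of \d_ ([tuple] : Rn R 0)]
  | k.+1 => [the sigma_finite_measure _ _ of product_step lebesgue_measure (lebesgue_Rn k)]
  end.

Lemma lebesgue_Rn_box n (A : 'I_n -> set (measurableTypeR R)) :
  (forall i, measurable (A i)) ->
  lebesgue_Rn n [set x | forall i, A i (tnth x i)] =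
  \prod_(i < n) lebesgue_measure (A i).
Proof.
elim: n A => [|n IH] A mA.
  rewrite big_ord0 /= diracE mem_set//.
  by move=> -[].
rewrite big_ord_recl -IH//= /product_step /pushforward/=.
have mB : measurable [set x : Rn R n | forall i, A (lift ord0 i) (tnth x i)].
  rewrite (_ : [set x | _] =
      \big[setI/setT]_(i < n) ((fun x : Rn R n => tnth x i) @^-1` A (lift ord0 i))).
    apply: bigsetI_measurable => i _; rewrite -[X in measurable X]setTI.
    exact: measurable_tnth.
  rewrite -bigcap_seq; apply/seteqP; split => x /= Ax i; first by move=> _; exact: Ax.
  by apply: Ax; rewrite /= mem_index_enum.
rewrite -product_measure1E//; congr (_ _).
apply/seteqP; split => -[a x] /=.
  move=> h; split => /=; first exact: (h ord0).
  by move=> i; have := h (lift ord0 i); rewrite tnthS.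
move=> [/= Aa Ax] i.
case: (unliftP ord0 i) => [j ->|->]; last by [].
by rewrite tnthS.
Qed.

End lebesgue_tuple.
Arguments lebesgue_Rn R n : clear implicits.

Section euclidean.
Context {R : realType} {N : nat}.
Implicit Types x y : Rn R N.

Definition dot x y : R := \sum_(i < N) (tnth x i : R) * (tnth y i : R).

Definition enorm x : R := Num.sqrt (dot x x).

Definition vsub x y : Rn R N := [tuple (tnth x i : R) - (tnth y i : R) | i < N].

Definition conv (f g : Rn R N -> R) : Rn R N -> R :=
  fun x => (\int[lebesgue_Rn R N]_y (f (vsub x y) * g y))%R.

(* Inverse Fourier transform of a real symbol [m], normalised so that
   [F (E * f) = F E * F f]: real and imaginary parts of
   [(2 pi)^-N * int e^(i x.xi) m(xi) dxi]. *)
Definition inv_fourier (m : Rn R N -> R) (x : Rn R N) : R[i] :=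
  Complex
    ((2 * pi) ^- N * (\int[lebesgue_Rn R N]_xi (cos (dot x xi) * m xi))%R)
    ((2 * pi) ^- N * (\int[lebesgue_Rn R N]_xi (sin (dot x xi) * m xi))%R).

(* The symbol is even, so the imaginary part of its inverse transform is 0. *)
Definition heat_kernel (d t : R) : Rn R N -> R :=
  fun x => complex.Re (inv_fourier (fun xi => expR (- t * enorm xi `^ (2 * d))) x).

Definition semigroup (d t : R) (f : Rn R N -> R) : Rn R N -> R :=
  if t == 0 then f else conv (heat_kernel d t) f.

End euclidean.

(** * Bochner integral in [L^q] and mild solutions *)

(* Elements of [L^q] are represented by functions belonging to [Lfun]; two
   functions represent the same element when they are equal almost everywhere. *)

Section mild.
Context {R : realType} {N : nat}.
Local Notation leb := (lebesgue_Rn R N).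
Local Notation "''N_' q [ f ]" := (Lnorm leb q%:E (EFin \o f)).

(* [g] is the [L^q]-valued Bochner integral of [F] over [D]: the limit of the
   integrals of simple functions [s |-> \sum_j \1_(A k j) s *: phi k j]
   approximating [F] in [L^1(D; L^q)]. *)
Definition is_Bochner (q : R) (D : set R)
    (F : R -> Rn R N -> R) (g : Rn R N -> R) : Prop :=
  [/\ g \in Lfun leb q%:E,
      forall s, D s -> F s \in Lfun leb q%:E &
      exists (n : nat -> nat)
             (A : forall k, 'I_(n k) -> set R)
             (phi : forall k, 'I_(n k) -> Rn R N -> R),
        let err k s :=
          'N_q[F s \- (fun x => \sum_(j < n k) \1_(A k j) s * phi k j x)] in
        [/\ forall k j, [/\ measurable (A k j), A k j `<=` D,
                            (lebesgue_measure (A k j) < +oo)%E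
                          & phi k j \in Lfun leb q%:E],
            forall k, measurable_fun D (err k),
            (\int[lebesgue_measure]_(s in D) err k s)%E @[k --> \oo] --> 0%E
          & 'N_q[g \- (fun x => \sum_(j < n k)
                         fine (lebesgue_measure (A k j)) * phi k j x)]
              @[k --> \oo] --> 0%E]].

Definition continuous_Lq (q T : R) (u : R -> Rn R N -> R) : Prop :=
  (forall t, 0 <= t <= T -> u t \in Lfun leb q%:E) /\
  (forall t, 0 <= t <= T ->
     'N_q[u s \- u t] @[s --> within `[0, T] (nbhs t)] --> 0%E).

Definition mild_solution (d alpha p q : R) (zeta : R -> R)
    (u0 w : Rn R N -> R) (T : R) (u : R -> Rn R N -> R) : Prop :=
  forall t, 0 <= t <= T ->
    exists I1 I2 : Rn R N -> R,
      [/\ is_Bochner q `]0, t[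
            (fun s => semigroup d (t - s)
                        (fun x => enorm x `^ alpha * `|u s x| `^ p)) I1,
          is_Bochner q `]0, t[
            (fun s x => zeta s * semigroup d (t - s) w x) I2
        & {ae leb, forall x, u t x = semigroup d t u0 x + I1 x + I2 x}].

Definition mild_solution_Lq (d alpha p q : R) (zeta : R -> R)
    (u0 w : Rn R N -> R) (T : R) (u : R -> Rn R N -> R) : Prop :=
  continuous_Lq q T u /\ mild_solution d alpha p q zeta u0 w T u.

Definition Tmax (d alpha p q : R) (zeta : R -> R) (u0 w : Rn R N -> R) : \bar R :=
  ereal_sup [set T%:E | T in
    [set T | 0 < T /\ exists u, mild_solution_Lq d alpha p q zeta u0 w T u]].

Definition maximal_solution (d alpha p q : R) (zeta : R -> R)
    (u0 w : Rn R N -> R) (u : R -> Rn R N -> R) : Prop :=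
  forall T, 0 < T -> (T%:E < Tmax d alpha p q zeta u0 w)%E ->
    mild_solution_Lq d alpha p q zeta u0 w T u.

End mild.

(* Main.v *)
(* The heat kernel is integrable: for d < 1 its symbol is, by subordination, a limit of mixtures of
   products of positive definite functions, so the kernel is nonnegative and its integral is the
   symbol at 0; for integer d repeated integration by parts gives decay at infinity. Scaling then
   gives the sup bound t^(-N/2d). Splitting |x|^alpha at |x| = 1 into a piece in some L^s and a
   bounded piece, Hoelder's and Young's inequalities bound the map
   h |-> e^(-t(-Delta)^d) (|.|^alpha h) from L^(q/p) to L^q by C (t^(-b1) + t^(-b2)) with b1, b2 < 1;
   this is where q > p_c and q > Np/(N + alpha) are used. As u |-> |u|^p is locally Lipschitz from
   L^q to L^(q/p), the Duhamel formula has a locally Lipschitz right-hand side with an integrable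
   singularity in time. Composing the nonlinearity with the radial retraction onto a ball makes it
   globally Lipschitz; the truncated equation is solved on any time interval by Picard iteration in
   the norm weighted by e^(-lambda t), and solutions of the original equation are those of the
   truncated one that stay in the ball. If the norm of a maximal solution does not tend to infinity,
   then restarting it close to T_max from a bounded value keeps it bounded up to T_max, and the
   truncated solution continues it beyond T_max. *)
Require Import Defs.
From mathcomp Require Import all_boot all_order all_algebra.
From mathcomp Require Import all_classical all_reals all_analysis.
From mathcomp Require Import measurable_realfun.
From mathcomp Require Import ring lra zify.
From mathcomp.real_closed Require Import complex.

Set Implicit Arguments.
Unset Strict Implicit.
Unset Printing Implicit Defensive.

Import Order.TTheory GRing.Theory Num.Theory.
Import numFieldNormedType.Exports.

Local Open Scope classical_set_scope.
Local Open Scope ring_scope.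

(** * Lebesgue measure on Euclidean space *)

(** Two obstacles shape the proof. The kernel is given only by an oscillatory integral, so its
    integrability and the semigroup law both have to be derived; as the symbols are even, real
    cosine transforms suffice, and the regularisers are products whose transforms are computed one
    coordinate at a time. Secondly, |x|^alpha |u|^p need not belong to L^q, so the abstract equation
    never mentions the nonlinearity: it uses a family [Phi t], standing for the semigroup at time t
    applied to it, and the law S s (Phi t x) = Phi (s + t) x, up to seminorm zero. Elements of L^q
    stay functions, hence the abstract theory lives in a complete seminormed space and its
    equalities are vanishing seminorms. One comparison of Bochner integrals over nested intervals,
    through a bounded operator, yields uniqueness of integrals, continuity in time and the restarted
    Duhamel formula. *)

Section affine1.
Context {R : realType}.
Local Notation mu := (@lebesgue_measure R).
Local Open Scope ereal_scope.

(** Uniqueness of Lebesgue measure reduces this to intervals []x, y]]. For c < 0 the preimage is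
    closed on the left instead of on the right, which does not change its length. *)
Lemma lebesgue_measure_affine (c b : R) (A : set (measurableTypeR R)) : (c != 0)%R ->
  measurable A ->
  mu A = (`|c|)%R%:E * mu ((fun x : R => c * x + b)%R @^-1` A).
Proof.
move=> c0 mA.
pose phi0 := (fun x : measurableTypeR R => (c * x + b)%R : measurableTypeR R).
have mphi : measurable_fun setT phi0.
  by apply: measurable_funD => //; exact: measurable_funM.
have k0 : (0 <= `|c|)%R by [].
pose nu := mscale (NngNum k0) (pushforward mu phi0).
suff : mu A = nu mphi A by [].
apply: lebesgue_measure_unique => // _ [[x y]] _ <-.
change (mu `]x, y]%classic = (`|c|)%R%:E * mu (phi0 @^-1` `]x, y]%classic)).
have [c1|c1] := ltP 0%R c.
  have -> : phi0 @^-1` `]x, y]%classic = (`](x - b) / c, (y - b) / c]%classic)%R.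
    apply/seteqP; split => z; rewrite /phi0/= !in_itv/= ltr_pdivrMr// ler_pdivlMr//;
      rewrite ltrBlDr lerBrDr mulrC; by [].
  rewrite !lebesgue_measure_itv/= !lte_fin ltr_pM2r ?invr_gt0// ltrD2r.
  case: ifPn => _; last by rewrite mule0.
  by rewrite gtr0_norm// -!EFinD -EFinM; congr EFin; field; rewrite gt_eqF.
have {}c1 : (c < 0)%R by rewrite lt_neqAle c0 c1.
have -> : phi0 @^-1` `]x, y]%classic = (`[(y - b) / c, (x - b) / c[%classic)%R.
  apply/seteqP; split => z; rewrite /phi0/= !in_itv/= ltr_ndivlMr// ler_ndivrMr//;
    rewrite ltrBlDr lerBrDr mulrC => /andP[-> ->]; by [].
rewrite !lebesgue_measure_itv/= !lte_fin ltr_nM2r ?invr_lt0// ltrD2r.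
case: ifPn => _; last by rewrite mule0.
by rewrite ltr0_norm// -!EFinD -EFinM; congr EFin; field; rewrite lt_eqF.
Qed.

Lemma ge0_integral_affine (c b : R) (f : measurableTypeR R -> \bar R) : (c != 0)%R ->
  measurable_fun setT f -> (forall x, 0 <= f x) ->
  \int[mu]_x f (c * x + b)%R = (`|c|^-1)%:E * \int[mu]_x f x.
Proof.
move=> c0 mf f0.
pose phi0 := (fun x : measurableTypeR R => (c * x + b)%R : measurableTypeR R).
have mphi : measurable_fun setT phi0.
  by apply: measurable_funD => //; exact: measurable_funM.
have k0 : (0 <= `|c|)%R by [].
pose nu := mscale (NngNum k0) (pushforward mu phi0).
transitivity (\int[pushforward mu phi0]_x f x).
  by rewrite ge0_integral_pushforward.
have -> : \int[mu]_x f x = \int[nu mphi]_x f x.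
  by apply: eq_measure_integral => A mA _; exact: (lebesgue_measure_affine b).
rewrite ge0_integral_mscale//= muleA -EFinM mulVf ?mul1e//.
by rewrite normr_eq0.
Qed.

End affine1.

Section RnInt.
Context {R : realType}.
Local Notation mu := (@lebesgue_measure R).
Local Open Scope ereal_scope.

Lemma ge0_integral_RnS n (f : Rn R n.+1 -> \bar R) :
  measurable_fun setT f -> (forall x, 0 <= f x) ->
  \int[lebesgue_Rn R n.+1]_x f x =
  \int[mu]_a \int[lebesgue_Rn R n]_x f (consn (a, x)).
Proof.
move=> mf f0.
have := @ge0_integral_pushforward _ _ _ _ _ _ (@measurable_consn R n)
  (mu \x lebesgue_Rn R n)%E setT f measurableT mf (fun x _ => f0 x).
rewrite preimage_setT fubini_tonelli1//=.
by apply: measurableT_comp => //; exact: measurable_consn.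
Qed.

Lemma measurable_ge0_integral_Rn n (f : Rn R n.+1 -> \bar R) :
  measurable_fun setT f -> (forall x, 0 <= f x) ->
  measurable_fun setT (fun a => \int[lebesgue_Rn R n]_x f (consn (a, x))).
Proof.
move=> mf f0.
apply: (@measurable_fun_fubini_tonelli_F _ _ _ _ _ (lebesgue_Rn R n) (f \o @consn R n)); last by move=> x; exact: f0.
by apply: measurableT_comp => //; exact: measurable_consn.
Qed.

(** One map covers dilations, translations and reflections: [vsub], [vopp], [vshift] and [shrink]
    all reduce to it, so a single change of variables serves throughout. *)
Definition aff n (c : R) (b x : Rn R n) : Rn R n :=
  [tuple (c * (tnth x i : R) + (tnth b i : R))%R | i < n].

Lemma measurable_aff n (c : R) (b : Rn R n) : measurable_fun setT (aff c b).
Proof.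
apply/measurable_fun_tnthP => i.
rewrite (_ : _ \o _ = (fun x : Rn R n => c * (tnth x i : R) + (tnth b i : R))%R); last first.
  by apply/funext => x/=; rewrite tnth_mktuple.
by apply: measurable_funD => //; apply: measurable_funM => //; exact: measurable_tnth.
Qed.

Lemma aff_consn n (c : R) b0 (b : Rn R n) a x :
  aff c (consn (b0, b)) (consn (a, x)) = consn ((c * a + b0)%R : measurableTypeR R, aff c b x).
Proof.
apply: eq_from_tnth => i; rewrite tnth_mktuple /consn/=.
by case: (unliftP ord0 i) => [j ->|->]; rewrite ?tnthS ?tnth_mktuple// !tnth0.
Qed.

Lemma ge0_integral_aff n (c : R) (b : Rn R n) (f : Rn R n -> \bar R) : (c != 0)%R ->
  measurable_fun setT f -> (forall x, 0 <= f x) ->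
  \int[lebesgue_Rn R n]_x f (aff c b x) =
  (`|c|%R ^- n)%:E * \int[lebesgue_Rn R n]_x f x.
Proof.
move=> c0; elim: n b f => [|n IH] b f mf f0.
  rewrite expr0 invr1 mul1e; apply: eq_integral => x _.
  by have -> : aff c b x = x by apply: eq_from_tnth => -[].
have mfa : measurable_fun setT (fun x => f (aff c b x)).
  by apply: measurableT_comp => //; exact: measurable_aff.
rewrite !ge0_integral_RnS//.
have mfc a : measurable_fun setT (fun x => f (consn (a, x))).
  apply: (measurableT_comp mf); apply: (measurableT_comp (@measurable_consn R n)).
  exact: measurable_fun_pair.
have := unconsnK b; set b0 := (unconsn b).1; set b' := (unconsn b).2 => bE.
transitivity (\int[mu]_a ((`|c|%R ^- n)%:E * \int[lebesgue_Rn R n]_x f (consn ((c * a + b0)%R : measurableTypeR R, x)))).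
  apply: eq_integral => a _.
  rewrite -(IH b' (fun x => f (consn ((c * a + b0)%R : measurableTypeR R, x))))//.
  by apply: eq_integral => x _; rewrite -bE aff_consn.
rewrite ge0_integralZl_EFin//; last 2 first.
- by move=> *; exact: integral_ge0.
- apply: (measurableT_comp (measurable_ge0_integral_Rn mf f0)).
  by apply: measurable_funD => //; exact: measurable_funM.
rewrite (@ge0_integral_affine R c b0 (fun a => \int[lebesgue_Rn R n]_x f (consn (a, x)))%E)//.
- by rewrite muleA -EFinM -invfM -exprSr.
- exact: measurable_ge0_integral_Rn.
- by move=> x; exact: integral_ge0.
Qed.

End RnInt.

Section prod.
Context {R : realType}.
Local Notation mu := (@lebesgue_measure R).
Local Open Scope ereal_scope.

Lemma tnth_consn0 n (a : R) (x : Rn R n) : tnth (consn (a, x)) ord0 = a.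
Proof. by rewrite /consn tnth0. Qed.

Lemma tnth_consnS n (a : R) (x : Rn R n) (j : 'I_n) :
  tnth (consn (a, x)) (lift ord0 j) = tnth x j.
Proof. by rewrite /consn tnthS. Qed.

Lemma measurable_consn1 n (a : R) : measurable_fun setT (fun x : Rn R n => consn (a, x)).
Proof.
by apply: (measurableT_comp (@measurable_consn R n)); exact: measurable_fun_pair.
Qed.

Lemma emeasurable_prod_Rn n (f : 'I_n -> measurableTypeR R -> \bar R) :
  (forall i, measurable_fun setT (f i)) ->
  measurable_fun setT (fun x : Rn R n => \prod_(i < n) f i (tnth x i)).
Proof.
move=> mf; elim: (index_enum _) => [|i s ih].
  by under eq_fun do rewrite big_nil; exact: measurable_cst.
under eq_fun do rewrite big_cons.
apply: emeasurable_funM => //.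
by apply: (measurableT_comp (mf i)); exact: measurable_tnth.
Qed.

Lemma ge0_integral_prod_Rn n (f : 'I_n -> measurableTypeR R -> \bar R) :
  (forall i, measurable_fun setT (f i)) -> (forall i x, 0 <= f i x) ->
  \int[lebesgue_Rn R n]_x (\prod_(i < n) f i (tnth x i)) = \prod_(i < n) \int[mu]_y f i y.
Proof.
elim: n f => [|n IH] f mf f0.
  under eq_integral do rewrite big_ord0.
  by rewrite big_ord0 integral_cst// mul1e; exact: diracT.
rewrite ge0_integral_RnS; last 2 first.
- exact: (emeasurable_prod_Rn mf).
- by move=> x; apply: prode_ge0 => // i _; exact: f0.
rewrite big_ord_recl -(IH (fun i => f (lift ord0 i)))//.
rewrite -ge0_integralZr//; last by apply: integral_ge0 => x _; apply: prode_ge0 => // i _; exact: f0.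
apply: eq_integral => a _.
rewrite -ge0_integralZl//.
- by apply: eq_integral => x _; rewrite big_ord_recl tnth_consn0; under eq_bigr do rewrite tnth_consnS.
- by apply: (emeasurable_prod_Rn (f := fun i => f (lift ord0 i))).
- by move=> x _; apply: prode_ge0 => // i _; exact: f0.
Qed.

End prod.

Lemma measurable_fun2 d1 d2 d3 d4 (T1 : measurableType d1) (T2 : measurableType d2)
    (T3 : measurableType d3) (T4 : measurableType d4) (F : T2 * T3 -> T4)
    (f : T1 -> T2) (g : T1 -> T3) :
  measurable_fun setT F -> measurable_fun setT f -> measurable_fun setT g ->
  measurable_fun setT (fun x => F (f x, g x)).
Proof. by move=> mF mf mg; exact: (measurableT_comp mF (measurable_fun_pair mf mg)). Qed.

Section meas.
Context {R : realType} {n : nat}.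

Lemma measurable_dot : measurable_fun setT (fun z : Rn R n * Rn R n => dot z.1 z.2).
Proof.
apply: measurable_sum => i; apply: measurable_funM.
  by apply: (measurableT_comp (@measurable_tnth _ _ n i)).
by apply: (measurableT_comp (@measurable_tnth _ _ n i)).
Qed.

Lemma measurable_dotr (x : Rn R n) : measurable_fun setT (dot x).
Proof. exact: (measurable_fun2 measurable_dot (measurable_cst x) (@measurable_id _ _ _)). Qed.

Lemma measurable_dotxx : measurable_fun setT (fun x : Rn R n => dot x x).
Proof. exact: (measurable_fun2 measurable_dot (@measurable_id _ _ _) (@measurable_id _ _ _)). Qed.

Lemma measurable_sqrt : measurable_fun setT (@Num.sqrt R).
Proof. by apply: continuous_measurable_fun; exact: sqrt_continuous. Qed.

Lemma measurable_enorm : measurable_fun setT (@enorm R n).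
Proof. exact: (measurableT_comp measurable_sqrt measurable_dotxx). Qed.

Lemma measurable_vsub : measurable_fun setT (fun z : Rn R n * Rn R n => vsub z.1 z.2).
Proof.
apply/measurable_fun_tnthP => i.
rewrite (_ : _ \o _ = (fun z : Rn R n * Rn R n => (tnth z.1 i : R) - (tnth z.2 i : R))); last first.
  by apply/funext => z; rewrite /= tnth_mktuple.
apply: measurable_funB; by apply: (measurableT_comp (@measurable_tnth _ _ n i)).
Qed.

Lemma vsubE (x y : Rn R n) : vsub x y = aff (-1) x y.
Proof. by apply: eq_from_tnth => i; rewrite !tnth_mktuple mulN1r addrC. Qed.

Lemma measurable_vsubr (x : Rn R n) : measurable_fun setT (vsub x).
Proof. by rewrite (_ : vsub x = aff (-1) x) ?funeqE; [exact: measurable_aff|exact: vsubE]. Qed.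

Lemma vsubEl (x y : Rn R n) : vsub x y = aff 1 (aff (-1) [tuple 0 | i < n] y) x.
Proof. by apply: eq_from_tnth => i; rewrite !tnth_mktuple mulN1r addr0 mul1r. Qed.

Lemma ge0_integral_vsubr (x : Rn R n) (f : Rn R n -> \bar R) :
  measurable_fun setT f -> (forall x, (0 <= f x)%E) ->
  (\int[lebesgue_Rn R n]_y f (vsub x y) = \int[lebesgue_Rn R n]_y f y)%E.
Proof.
move=> mf f0; under eq_integral do rewrite vsubE.
by rewrite ge0_integral_aff ?oppr_eq0// normrN1 expr1n invr1 mul1e.
Qed.

Lemma ge0_integral_vsubl (y : Rn R n) (f : Rn R n -> \bar R) :
  measurable_fun setT f -> (forall x, (0 <= f x)%E) ->
  (\int[lebesgue_Rn R n]_x f (vsub x y) = \int[lebesgue_Rn R n]_x f x)%E.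
Proof.
move=> mf f0; under eq_integral do rewrite vsubEl.
by rewrite ge0_integral_aff// normr1 expr1n invr1 mul1e.
Qed.

Lemma dotxxE (x : Rn R n) : dot x x = \sum_(i < n) (tnth x i : R) ^+ 2.
Proof. by apply: eq_bigr => i _; rewrite expr2. Qed.

Lemma dotxx_ge0 (x : Rn R n) : 0 <= dot x x.
Proof. by rewrite dotxxE sumr_ge0// => i _; exact: sqr_ge0. Qed.

Lemma enorm_ge0 (x : Rn R n) : 0 <= enorm x.
Proof. exact: sqrtr_ge0. Qed.

Lemma sqr_enorm (x : Rn R n) : enorm x ^+ 2 = dot x x.
Proof. by rewrite sqr_sqrtr// dotxx_ge0. Qed.

Lemma sqr_tnth_le_dot (x : Rn R n) i : (tnth x i : R) ^+ 2 <= dot x x.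
Proof.
rewrite dotxxE (bigD1 i)//= lerDl sumr_ge0// => j _; exact: sqr_ge0.
Qed.

Lemma abs_tnth_le_enorm (x : Rn R n) i : `|tnth x i : R| <= enorm x.
Proof. by rewrite -sqrtr_sqr ler_wsqrtr// sqr_tnth_le_dot. Qed.

Lemma dotC (x y : Rn R n) : dot x y = dot y x.
Proof. by apply: eq_bigr => i _; rewrite mulrC. Qed.

Lemma dot_aff (c : R) (b x y : Rn R n) : dot (aff c b x) y = c * dot x y + dot b y.
Proof.
rewrite /dot mulr_sumr -big_split/=; apply: eq_bigr => i _.
by rewrite tnth_mktuple mulrDl mulrA.
Qed.

Lemma dot_vsub (x y z : Rn R n) : dot (vsub x y) z = dot x z - dot y z.
Proof. by rewrite vsubE dot_aff mulN1r addrC. Qed.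

(** Standard integrable majorant. The exponent n makes the comparison with the product of the 1 / (1
    + x_i^2) work factor by factor. *)
Definition weight (x : Rn R n) : R := (1 + dot x x) ^- n.

Lemma measurable_weight : measurable_fun setT weight.
Proof.
rewrite (_ : weight = (fun x => (1 + dot x x) `^ (- n%:R))); last first.
  by apply/funext => x; rewrite powR_invn// addr_ge0// dotxx_ge0.
apply: (measurableT_comp (measurable_powR _)).
by apply: measurable_funD => //; exact: measurable_dotxx.
Qed.

End meas.

(** * Integrability of the polynomial weight *)

Section weight.
Context {R : realType}.
Local Notation mu := (@lebesgue_measure R).

Lemma integral_oneDsqr : (\int[mu]_x ((1 + x ^+ 2)^-1)%:E = pi%:E)%E.
Proof.
rewrite ge0_symfun_integralT//.
- rewrite (_ : [set x | 0 <= x] = `[0, +oo[%classic) ?integral0y_oneDsqr; last first.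
    by apply/seteqP; split => x/=; rewrite in_itv/= andbT.
  by rewrite -EFinM mulrC divfK.
- by move=> x; rewrite invr_ge0 addr_ge0// sqr_ge0.
- exact: continuous_oneDsqrV.
- by move=> x /=; rewrite sqrrN.
Qed.

Lemma integral_prod_oneDsqr n :
  (\int[lebesgue_Rn R n]_x (\prod_(i < n) (1 + (tnth x i : R) ^+ 2)^-1)%:E = (pi ^+ n)%:E)%E.
Proof.
under eq_integral do rewrite -prodEFin.
rewrite (ge0_integral_prod_Rn (f := fun _ x => ((1 + x ^+ 2)^-1)%:E)).
- by under eq_bigr do rewrite integral_oneDsqr; rewrite prodEFin prodr_const card_ord.
- move=> _; apply/measurable_EFinP; apply: continuous_measurable_fun.
  exact: continuous_oneDsqrV.
- by move=> _ x; rewrite lee_fin invr_ge0 addr_ge0// sqr_ge0.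
Qed.

Lemma weight_gt0 n (x : Rn R n) : 0 < weight x.
Proof. by rewrite invr_gt0 exprn_gt0// ltr_pwDl// dotxx_ge0. Qed.

Lemma weight_le_prod n (x : Rn R n) : weight x <= \prod_(i < n) (1 + (tnth x i : R) ^+ 2)^-1.
Proof.
rewrite prodfV lef_pV2 ?posrE ?exprn_gt0 ?prodr_gt0//.
- have -> : (1 + dot x x) ^+ n = \prod_(i < n) (1 + dot x x) by rewrite prodr_const card_ord.
  apply: ler_prod => i _.
  by rewrite addr_ge0 ?sqr_ge0//= lerD2l sqr_tnth_le_dot.
- by rewrite ltr_pwDl// dotxx_ge0.
- by move=> i _; rewrite ltr_pwDl// sqr_ge0.
Qed.

Lemma integrable_weight n : (lebesgue_Rn R n).-integrable setT (EFin \o @weight R n).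
Proof.
have mw : measurable_fun setT (EFin \o @weight R n).
  by apply/measurable_EFinP; exact: measurable_weight.
apply/integrableP; split => //.
apply: (@le_lt_trans _ _ (pi ^+ n)%:E); last exact: ltry.
rewrite -integral_prod_oneDsqr; apply: ge0_le_integral => //.
- exact: measurableT_comp.
- under eq_fun do rewrite -prodEFin.
  apply: (emeasurable_prod_Rn (f := fun _ x => ((1 + x ^+ 2)^-1)%:E)) => _.
  apply/measurable_EFinP; apply: continuous_measurable_fun.
  exact: continuous_oneDsqrV.
- by move=> x _; rewrite /= ger0_norm ?lee_fin ?weight_le_prod// ltW// weight_gt0.
Qed.

End weight.


Lemma integrable_ge0_finite d (T : measurableType d) {R : realType}
    (mu : {measure set T -> \bar R}) (f : T -> R) (c : R) :
  measurable_fun setT f -> (forall x, 0 <= f x) ->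
  (\int[mu]_x (f x)%:E <= c%:E)%E -> mu.-integrable setT (EFin \o f).
Proof.
move=> mf f0 fc; apply/integrableP; split; first exact/measurable_EFinP.
apply: (le_lt_trans _ (ltry c)); apply: le_trans fc.
by rewrite le_eqVlt; apply/orP; left; apply/eqP/eq_integral => x _; rewrite /= ger0_norm.
Qed.

Lemma le_integrable_bound d (T : measurableType d) {R : realType}
    (mu : {measure set T -> \bar R}) (f g : T -> R) :
  measurable_fun setT f -> mu.-integrable setT (EFin \o g) ->
  (forall x, `|f x| <= g x) -> mu.-integrable setT (EFin \o f).
Proof.
move=> mf ig fg; apply: le_integrable ig => //; first exact/measurable_EFinP.
by move=> x _; rewrite /= lee_fin (le_trans (fg x))// ler_norm.
Qed.

Section dct.
Context d (T : measurableType d) {R : realType} (mu : {measure set T -> \bar R}).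

Lemma Rdominated_convergence (f_ : nat -> T -> R) (f g : T -> R) :
  (forall k, measurable_fun setT (f_ k)) ->
  (forall x, f_ ^~ x @ \oo --> f x) ->
  mu.-integrable setT (EFin \o g) -> (forall k x, `|f_ k x| <= g x) ->
  [/\ measurable_fun setT f, mu.-integrable setT (EFin \o f),
      (\int[mu]_x `|f_ k x - f x|)%R @[k --> \oo] --> 0 &
      (\int[mu]_x f_ k x)%R @[k --> \oo] --> (\int[mu]_x f x)%R].
Proof.
move=> mf_ ff ig fg.
have mf : measurable_fun setT f by apply: (measurable_fun_cvg mf_) => x _; exact: ff.
have [||| |i1 i2 i3] := @dominated_convergence _ _ _ mu setT measurableT
    (fun k => EFin \o f_ k) (EFin \o f) (EFin \o g) _ _ _ ig.
- by move=> k; exact/measurable_EFinP.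
- exact/measurable_EFinP.
- by apply: nearW => x _; apply: cvg_EFin; [exact: nearW|exact: ff].
- by apply: nearW => x k _; rewrite /= lee_fin.
split => //.
- exact: (fine_cvg i2).
- apply: (@fine_cvg _ _ _ _ _ (\int[mu]_x f x)%R).
  rewrite /Rintegral fineK//; exact: integrable_fin_num.
Qed.
End dct.

(** * Integrals of powers near zero *)

Section powint.
Context {R : realType}.
Local Notation mu := (@lebesgue_measure R).

Lemma integral_powR (s a b : R) : -1 < s -> 0 < a -> a < b ->
  (\int[mu]_(x in `[a, b]) (x `^ s)%:E = ((b `^ (s + 1) - a `^ (s + 1)) / (s + 1))%:E)%E.
Proof.
move=> s1 a0 ab.
have s10 : 0 < s + 1 by rewrite -ltrBlDr sub0r.
have b0 : 0 < b by apply: lt_trans ab.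
have dF (x : R) : 0 < x -> is_derive x 1 (fun x : R => x `^ (s + 1) / (s + 1) : R) (x `^ s).
  move=> x0; have H := is_derive1_powR (s + 1) x0.
  rewrite (_ : (fun x : R => _) = (s + 1)^-1 \*: (fun x : R => x `^ (s + 1))); last first.
    by apply/funext => y; rewrite /= mulrC.
  apply: is_derive_eq; rewrite /= addrK; rewrite /GRing.scale/= mulrA mulVf ?mul1r//.
  by rewrite gt_eqF.
have cF (x : R) : 0 < x -> {for x, continuous (fun x : R => x `^ (s + 1) / (s + 1) : R)}.
  move=> x0; apply: differentiable_continuous; apply/derivable1_diffP.
  by have [] := dF _ x0.
rewrite (@continuous_FTC2 _ _ (fun x : R => x `^ (s + 1) / (s + 1) : R))//.
- by rewrite -EFinB mulrBl.
- apply: continuous_in_subspaceT => x; rewrite inE/= in_itv/= => /andP[ax _].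
  have x0 : 0 < x by apply: lt_le_trans ax.
  apply: differentiable_continuous; apply/derivable1_diffP.
  by have [] := is_derive1_powR s x0.
- split.
  + move=> x; rewrite in_itv/= => /andP[ax _].
    have x0 : 0 < x by apply: lt_trans ax.
    by have [] := dF _ x0.
  + by apply: cvg_at_right_filter; exact: cF.
  + by apply: cvg_at_left_filter; exact: cF.
- move=> x; rewrite in_itv/= => /andP[ax _].
  have x0 : 0 < x by apply: lt_trans ax.
  by rewrite derive1E; have [_ ->] := dF _ x0.
Qed.

Lemma measurable_powRE (s : R) : measurable_fun setT (fun x : R => (x `^ s)%:E).
Proof. by apply/measurable_EFinP; exact: measurable_powR. Qed.

Lemma integral_powR0 (s a : R) : -1 < s -> 0 < a ->
  (\int[mu]_(x in `]0%R, a]) (x `^ s)%:E = (a `^ (s + 1) / (s + 1))%:E)%E.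
Proof.
move=> s1 a0.
have s10 : 0 < s + 1 by rewrite -ltrBlDr sub0r.
(* The denominators start at 2, so that every interval is nondegenerate, as the strict inequality in
   [integral_powR] requires. *)
pose F (n : nat) : set (measurableTypeR R) := `[a / n.+2%:R, a]%classic.
have UF : \bigcup_n F n = `]0, a]%classic.
  apply/seteqP; split => x /=.
    move=> [n _]; rewrite /F/= !in_itv/= => /andP[h ->]; rewrite andbT.
    by apply: lt_le_trans h; rewrite divr_gt0.
  rewrite in_itv/= => /andP[x0 xa].
  exists (Num.truncn (a / x)) => //; rewrite /F/= in_itv/= xa andbT.
  rewrite ler_pdivrMr// mulrC -ler_pdivrMr//.
  have := truncnS_gt (a / x); move/ltW/le_trans; apply.
  by rewrite ler_nat.
have := @ge0_nondecreasing_set_cvg_integral _ _ _ F (fun x => (x `^ s)%:E) mu.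
rewrite UF => /(_ _ _ _ _) H.
have {}H : (\int[mu]_(x in F n) (x `^ s)%:E @[n --> \oo] --> \int[mu]_(x in `]0%R, a]) (x `^ s)%:E)%E.
  apply: H.
  - move=> n m nm; rewrite subsetEset => x; rewrite /F/= !in_itv/= => /andP[h ->]; rewrite andbT.
    apply: le_trans h; rewrite ler_pM2l// lef_pV2 ?posrE// ler_nat; lia.
  - by move=> n; exact: measurable_itv.
  - by move=> n; apply: measurable_funS (measurable_powRE s).
  - by move=> n x _; rewrite lee_fin powR_ge0.
have E n : (\int[mu]_(x in F n) (x `^ s)%:E)%E =
    ((a `^ (s + 1) - (a / n.+2%:R) `^ (s + 1)) / (s + 1))%:E.
  rewrite integral_powR//; first by rewrite divr_gt0.
  by rewrite ltr_pdivrMr// ltr_pMr// (_ : 1 = 1%:R)// ltr_nat.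
rewrite (_ : (fun n => _) = (fun n => ((a `^ (s + 1) - (a / n.+2%:R) `^ (s + 1)) / (s + 1))%:E)) in H; last first.
  by apply/funext => n; exact: E.
apply: (cvg_unique _ H) => //.
apply: cvg_EFin; first exact: nearW.
apply: cvgM; last exact: cvg_cst.
rewrite -[X in _ --> X]subr0.
apply: cvgB; first exact: cvg_cst.
have /cvg_at_rightP := @powR_cvg0 R _ s10; apply; split.
  by move=> n; rewrite divr_gt0.
rewrite -[X in _ --> X](mulr0 a); apply: cvgM; first exact: cvg_cst.
by have := @cvg_harmonic R; rewrite -cvg_shiftS.
Qed.

End powint.

Section affine_Rintegral.
Context {R : realType} {n : nat}.
Local Notation leb := (lebesgue_Rn R n).

Lemma integrable_aff (c : R) (b : Rn R n) (f : Rn R n -> R) : c != 0 ->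
  leb.-integrable setT (EFin \o f) ->
  leb.-integrable setT (EFin \o (fun x => f (aff c b x))).
Proof.
move=> c0 /integrableP[mf fi]; apply/integrableP; split.
  exact: (measurableT_comp mf (measurable_aff c b)).
rewrite (@ge0_integral_aff R n c b (fun x => `|(f x)%:E|%E))//.
- by rewrite lte_mul_pinfty// lee_fin invr_ge0 exprn_ge0.
- exact: measurableT_comp.
Qed.

Lemma Rintegral_aff (c : R) (b : Rn R n) (f : Rn R n -> R) : c != 0 ->
  leb.-integrable setT (EFin \o f) ->
  (\int[leb]_x f (aff c b x) = `|c| ^- n * \int[leb]_x f x)%R.
Proof.
move=> c0 fi; have mf := measurable_int _ fi.
rewrite /Rintegral.
rewrite integralE (integralE leb setT (EFin \o f)).
have Ep := @ge0_integral_aff R n c b (EFin \o f)^\+%E c0 (measurable_funepos mf) (fun x => funepos_ge0 _ x).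
have En := @ge0_integral_aff R n c b (EFin \o f)^\-%E c0 (measurable_funeneg mf) (fun x => funeneg_ge0 _ x).
transitivity (fine ((`|c| ^- n)%:E * \int[leb]_x (EFin \o f)^\+ x -
                    (`|c| ^- n)%:E * \int[leb]_x (EFin \o f)^\- x)%E).
  by congr fine; congr (_ - _)%E; rewrite -?Ep -?En; apply: eq_integral => x _; rewrite ?funeposE ?funenegE.
have fp := integrable_pos_fin_num measurableT fi.
have fn := integrable_neg_fin_num measurableT fi.
rewrite -muleBr// ?fineM//.
  by rewrite fin_numB fp fn.
by rewrite fin_num_adde_defl// fin_numN.
Qed.

Lemma integrable_vsub (x : Rn R n) (f : Rn R n -> R) :
  leb.-integrable setT (EFin \o f) ->
  leb.-integrable setT (EFin \o (fun y => f (vsub x y))).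
Proof.
move=> fi; rewrite (_ : (fun y => f (vsub x y)) = (fun y => f (aff (-1) x y))).
  by apply: integrable_aff; rewrite ?oppr_eq0.
by apply/funext => y; rewrite vsubE.
Qed.

Lemma Rintegral_vsub (x : Rn R n) (f : Rn R n -> R) :
  leb.-integrable setT (EFin \o f) ->
  (\int[leb]_y f (vsub x y) = \int[leb]_y f y)%R.
Proof.
move=> fi; rewrite (_ : (fun y => f (vsub x y)) = (fun y => f (aff (-1) x y))).
  by rewrite Rintegral_aff ?oppr_eq0// normrN1 expr1n invr1 mul1r.
by apply/funext => y; rewrite vsubE.
Qed.

End affine_Rintegral.

(** * Local integrability of negative powers of the norm *)

Section radial.
Context {R : realType}.
Local Notation mu := (@lebesgue_measure R).

Let bump (s : R) (y : measurableTypeR R) : \bar R :=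
  (((y `^ (- s)) * \1_(`]0, 1]%classic : set R) y)%:E).

Let measurable_bump s : measurable_fun setT (bump s).
Proof.
apply/measurable_EFinP; apply: measurable_funM; first exact: measurable_powR.
by apply: measurable_indic.
Qed.

Let bump_ge0 s y : (0 <= bump s y)%E.
Proof. by rewrite lee_fin mulr_ge0// powR_ge0. Qed.

Let integral_bump s : s < 1 -> (\int[mu]_y bump s y = (1 / (1 - s))%:E)%E.
Proof.
move=> s1.
transitivity (\int[mu]_(y in `]0%R, 1%R]) (y `^ (- s))%:E)%E.
  rewrite [RHS]integral_mkcond; apply: eq_integral => y _.
  rewrite /bump patchE indicE; case: ifPn => yin; first by rewrite mulr1.
  by rewrite mulr0.
rewrite integral_powR0//; last by rewrite ltrN2.
by rewrite powR1 addrC.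
Qed.

(** Majorant of |y|^(-s) on [-1, 1] with value +oo at the origin: the product over the coordinates
    must also dominate at points with a vanishing coordinate, where [bump] is 0. The added mass sits
    on a null set. *)
Let h (s : R) (y : measurableTypeR R) : \bar R :=
  (bump s y + bump s (- y)%R + (+oo) * (\1_[set 0 : R] y)%:E)%E.

Let h_ge0 s y : (0 <= h s y)%E.
Proof. by rewrite /h !adde_ge0// mule_ge0// lee_fin. Qed.

Let measurable_h s : measurable_fun setT (h s).
Proof.
apply: emeasurable_funD.
  apply: emeasurable_funD; first exact: measurable_bump.
  by apply: (measurableT_comp (measurable_bump s)); exact: measurable_funN.
apply: emeasurable_funM => //; apply/measurable_EFinP; exact: measurable_indic.
Qed.

Let integral_h s : s < 1 -> (\int[mu]_y h s y = (2 / (1 - s))%:E)%E.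
Proof.
move=> s1.
have mN : measurable_fun setT (fun y : measurableTypeR R => bump s (- y)%R).
  by apply: (measurableT_comp (measurable_bump s)); exact: measurable_funN.
have m1 : measurable_fun setT (fun y : measurableTypeR R => ((\1_[set 0 : R] y)%:E : \bar R)).
  by apply/measurable_EFinP; exact: measurable_indic.
rewrite ge0_integralD//; last 3 first.
- by move=> y _; rewrite adde_ge0.
- exact: emeasurable_funD.
- exact: emeasurable_funM.
rewrite ge0_integralD// integral_bump//.
have -> : (\int[mu]_x bump s (- x)%R = (1 / (1 - s))%:E)%E.
  rewrite -integral_bump//.
  have := @ge0_integral_affine R (-1) 0 (bump s); rewrite oppr_eq0 oner_eq0 => /(_ isT) H.
  rewrite -[RHS]mul1e -[1%E]/(1%:E) -[X in (X%:E * _)%E](_ : `|-1|^-1 = 1); last by rewrite normrN1 invr1.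
  by rewrite -H//; apply: eq_integral => y _; rewrite mulN1r addr0.
rewrite ge0_integralZl// integral_indic// setIT [X in (+oo * X)%E](_ : _ = 0%E) ?mule0 ?adde0; last exact: (@lebesgue_measure_set1 R).
by rewrite -EFinD -mulrDl.
Qed.

(** Polar coordinates are avoided: since |x| dominates every |x_i|, the function |x|^(-g) is at most
    the product of the |x_i|^(-g/n), and g/n < 1 makes each factor integrable near 0. *)
Lemma integral_enorm_powR_lty n (g : R) : (0 < n)%N -> 0 <= g -> g < n%:R ->
  (\int[lebesgue_Rn R n]_x (if (enorm x <= 1)%R then enorm x `^ (- g) else 0)%:E < +oo)%E.
Proof.
move=> n0 g0 gn; pose s := g / n%:R.
have n0' : 0 < n%:R :> R by rewrite ltr0n.
have s1 : s < 1 by rewrite ltr_pdivrMr// mul1r.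
have s0 : 0 <= s by rewrite divr_ge0// ltW.
apply: (@le_lt_trans _ _ (\int[lebesgue_Rn R n]_x (\prod_(i < n) h s (tnth x i)))%E); last first.
  rewrite (ge0_integral_prod_Rn (f := fun=> h s))// (eq_bigr (fun=> (2 / (1 - s))%:E)); last by move=> *; exact: integral_h.
  by rewrite prodEFin ltry.
apply: ge0_le_integral => //.
- by move=> x _; rewrite lee_fin; case: ifP => // _; exact: powR_ge0.
- apply/measurable_EFinP; apply: measurable_fun_ifT => //.
    by apply: measurable_fun_ler => //; exact: measurable_enorm.
  by apply: (measurableT_comp (measurable_powR _)); exact: measurable_enorm.
- exact: (emeasurable_prod_Rn (f := fun=> h s)).
move=> x _; case: ifPn => [x1|_]; last by apply: prode_ge0 => *; exact: h_ge0.
have hx i : tnth x i != 0 -> ((`|tnth x i : R| `^ (- s))%:E <= h s (tnth x i))%E.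
  move=> xi0; have := abs_tnth_le_enorm x i; move/le_trans => /(_ _ x1).
  move: xi0; set y := tnth x i; move=> y0 y1.
  have [yp|yn] := ltP 0 (y : R).
    rewrite gtr0_norm// in y1 *; rewrite /h (@le_trans _ _ (bump s y))//.
      by rewrite /bump indicE mem_set ?mulr1//= in_itv/= yp.
    by rewrite -addeA leeDl// adde_ge0// mule_ge0// lee_fin.
  have {}yn : y < 0 by rewrite lt_neqAle y0.
  rewrite ltr0_norm// in y1 *; rewrite /h (@le_trans _ _ (bump s (- y)%R))//.
    by rewrite /bump indicE mem_set ?mulr1//= in_itv/= oppr_gt0 yn.
  by rewrite addeAC leeDr// adde_ge0// mule_ge0// lee_fin.
have [/existsP[i0 /eqP xi0]|] := boolP [exists i : 'I_n, (tnth x i : R) == 0].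
  rewrite (bigD1 i0)//=.
  have -> : h s (tnth x i0) = +oo%E.
    rewrite xi0 /h oppr0 indicE mem_set// mule1 addey//.
  rewrite gt0_mulye ?leey//.
  elim/big_rec : _ => // i y _ y0; rewrite mule_gt0//.
  have [xi|xi] := eqVneq (tnth x i : R) 0.
    rewrite xi /h indicE mem_set// mule1 addey// ?ltey//.
  apply: lt_le_trans (hx _ xi); rewrite lte_fin powR_gt0// normr_gt0//.
rewrite negb_exists => /forallP x0.
apply: (@le_trans _ _ (\prod_(i < n) (`|tnth x i : R| `^ (- s))%:E)%E); last first.
  elim: (index_enum _) => [|i l ih]; rewrite ?big_nil// !big_cons.
  apply: lee_pmul => //; last exact: hx (x0 i).
  by apply: prode_ge0.
rewrite prodEFin lee_fin.
have -> : enorm x `^ (- g) = \prod_(i < n) (enorm x `^ (- s)).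
  rewrite prodr_const card_ord -powR_mulrn ?powR_ge0// -powRrM mulNr divfK//.
  by rewrite gt_eqF.
apply: ler_prod => i _; rewrite powR_ge0/= !powRN lef_pV2 ?posrE ?powR_gt0 ?normr_gt0//.
  by rewrite ge0_ler_powR ?nnegrE ?enorm_ge0// abs_tnth_le_enorm.
by apply: lt_le_trans (abs_tnth_le_enorm x i); rewrite normr_gt0.
Qed.

End radial.

(** * Fubini's theorem for dominated real integrands *)

Section RFubini.
Context d1 d2 (T1 : measurableType d1) (T2 : measurableType d2) (R : realType).
Variables (m1 : {sigma_finite_measure set T1 -> \bar R}).
Variables (m2 : {sigma_finite_measure set T2 -> \bar R}).

Lemma integrable_prod_bound (f : T1 * T2 -> R) (g1 : T1 -> R) (g2 : T2 -> R) :
  measurable_fun setT f -> m1.-integrable setT (EFin \o g1) ->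
  m2.-integrable setT (EFin \o g2) ->
  (forall x y, `|f (x, y)| <= g1 x * g2 y) ->
  (m1 \x m2)%E.-integrable setT (EFin \o f).
Proof.
move=> mf i1 i2 fg; apply/integrable12ltyP; first exact/measurable_EFinP.
have [[mg1 f1] [mg2 f2]] := (integrableP _ _ _ i1, integrableP _ _ _ i2).
have m1n : measurable_fun setT (fun x => `|(g1 x)%:E|%E) by exact: measurableT_comp.
have m2n : measurable_fun setT (fun x => `|(g2 x)%:E|%E) by exact: measurableT_comp.
apply: (@le_lt_trans _ _ (\int[m1]_x (`|(g1 x)%:E| * \int[m2]_y `|(g2 y)%:E|))%E).
  apply: ge0_le_integral => //.
  - by move=> x _; exact: integral_ge0.
  - apply: (@measurable_fun_fubini_tonelli_F _ _ _ _ _ m2 (fun z => `|(f z)%:E|%E)) => //.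
    by apply: measurableT_comp => //; exact/measurable_EFinP.
  - by apply: emeasurable_funM.
  move=> x _; rewrite -ge0_integralZl//.
  apply: ge0_le_integral => //.
  - have mfx := measurable_fun2 mf (measurable_cst x) (@measurable_id _ _ _).
    by apply: measurableT_comp => //; exact/measurable_EFinP.
  - exact: emeasurable_funM.
  by move=> y _; rewrite /= -EFinM lee_fin -normrM (le_trans (fg _ _))// ler_norm.
rewrite ge0_integralZr//; last exact: integral_ge0.
by rewrite lte_mul_pinfty ?integral_ge0// fin_real// (lt_le_trans _ (integral_ge0 _ _)).
Qed.

Lemma RFubini (f : T1 * T2 -> R) (g1 : T1 -> R) (g2 : T2 -> R) :
  measurable_fun setT f -> m1.-integrable setT (EFin \o g1) ->
  m2.-integrable setT (EFin \o g2) ->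
  (forall x y, `|f (x, y)| <= g1 x * g2 y) ->
  (\int[m1]_x \int[m2]_y f (x, y) = \int[m2]_y \int[m1]_x f (x, y))%R.
Proof.
move=> mf i1 i2 fg.
have := Fubini (integrable_prod_bound mf i1 i2 fg).
have i2x x : m2.-integrable setT (EFin \o (fun y => f (x, y))).
  apply: (le_integrable_bound (g := fun y => g1 x * g2 y)) => //.
    exact: (measurable_fun2 mf (measurable_cst x) (@measurable_id _ _ _)).
  exact: (integrableZl measurableT (g1 x) i2).
have i1x y : m1.-integrable setT (EFin \o (fun x => f (x, y))).
  apply: (le_integrable_bound (g := fun x => g1 x * g2 y)) => //.
    exact: (measurable_fun2 mf (@measurable_id _ _ _) (measurable_cst y)).
  exact: (integrableZr measurableT (g2 y) i1).
rewrite /Rintegral => E; congr fine.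
rewrite (eq_integral (fun x => \int[m2]_y (f (x, y))%:E)%E); last first.
  by move=> x _; rewrite fineK//; exact: integrable_fin_num (i2x x).
rewrite [RHS](eq_integral (fun y => \int[m1]_x (f (x, y))%:E)%E)//.
by move=> y _; rewrite fineK//; exact: integrable_fin_num (i1x y).
Qed.

Lemma measurable_Rintegral2 (f : T1 * T2 -> R) :
  measurable_fun setT f -> measurable_fun setT (fun x => \int[m2]_y f (x, y))%R.
Proof.
move=> mf; apply: (@measurableT_comp _ _ _ _ _ _ fine) => //.
rewrite (_ : (fun x => _) = (fun x => (\int[m2]_y ((EFin \o f)^\+ (x, y)) - \int[m2]_y ((EFin \o f)^\- (x, y))))%E); last first.
  apply/funext => x; rewrite integralE; congr (_ - _)%E;
    by apply: eq_integral => y _; rewrite ?funeposE ?funenegE.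
have mf' : measurable_fun setT (EFin \o f) by exact/measurable_EFinP.
apply: emeasurable_funB.
  by apply: (@measurable_fun_fubini_tonelli_F _ _ _ _ _ m2 ((EFin \o f)^\+)%E) => //; exact: measurable_funepos.
by apply: (@measurable_fun_fubini_tonelli_F _ _ _ _ _ m2 ((EFin \o f)^\-)%E) => //; exact: measurable_funeneg.
Qed.

End RFubini.

(** * Transform of the exponential and the Poisson kernel *)

Section poisson1.
Context {R : realType}.
Local Notation mu := (@lebesgue_measure R).

Let pexp (e x : R) : R := expR (- (e * `|x|)).

Let continuous_pexp e : continuous (pexp e).
Proof.
move=> x; apply: continuous_comp; last exact: continuous_expR.
apply: continuousN; apply: continuousM; first exact: cvg_cst.
exact: norm_continuous.
Qed.

(** The summand 1 makes the integrand nonnegative, so that symmetry and the fundamental theorem on a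
    half-line apply; the transform of the exponential alone follows by subtracting the case without
    cosine. *)
Let integral_1Dcos_pexp (e x : R) : 0 < e ->
  (\int[mu]_y ((1 + cos (x * y)) * pexp e y)%:E = (2 * (e^-1 + e / (e ^+ 2 + x ^+ 2)))%:E)%E.
Proof.
move=> e0.
have ex0 : 0 < e ^+ 2 + x ^+ 2 by rewrite ltr_pwDl ?exprn_gt0// sqr_ge0.
have cxy y : {for y, continuous (fun y => x * y : R)} by apply: continuousM; [exact: cvg_cst|exact: cvg_id].
have ccos : continuous (fun y : R => cos (x * y)).
  by move=> y; apply: continuous_comp; [exact: cxy|exact: continuous_cos].
have c1 : continuous (fun y => (1 + cos (x * y)) * pexp e y).
  move=> y; apply: cvgM; last exact: continuous_pexp.
  by apply: cvgD; [exact: cvg_cst|exact: ccos].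
have p0 y : 0 <= (1 + cos (x * y)) * pexp e y.
  by rewrite mulr_ge0 ?expR_ge0// -lerBlDl sub0r cos_geN1.
rewrite ge0_symfun_integralT//; last first.
  by move=> y; rewrite /pexp/= mulrN cosN normrN.
rewrite EFinM; congr *%E.
rewrite (_ : [set x | _] = `[0, +oo[%classic); last first.
  by apply/seteqP; split => z/=; rewrite in_itv/= andbT.
(* Explicit antiderivative for y >= 0, normalised to vanish at infinity. *)
pose F (y : R) : R := expR (- (e * y)) * ((x * sin (x * y) - e * cos (x * y)) / (e ^+ 2 + x ^+ 2) - e^-1).
pose f (y : R) : R := (1 + cos (x * y)) * expR (- (e * y)).
have dF y : is_derive (y : R) 1 F (f y).
  have e1 : e != 0 by rewrite gt_eqF.
  have e2 : e ^+ 2 + x ^+ 2 != 0 by rewrite gt_eqF.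
  rewrite /F /f; apply: is_derive_eq.
  have scE (a b : R) : a *: (b : R^o) = a * b by [].
  rewrite !scE; field; exact/andP.
have cF : continuous F.
  by move=> y; apply: differentiable_continuous; apply/derivable1_diffP; have [] := dF y.
have cf : continuous f.
  move=> y; apply: cvgM; first by apply: cvgD; [exact: cvg_cst|exact: ccos].
  apply: continuous_comp; last exact: continuous_expR.
  by apply: cvgN; apply: cvgM; [exact: cvg_cst|exact: cvg_id].
transitivity (\int[mu]_(y in `[0%R, +oo[) (f y)%:E)%E.
  apply: eq_integral => y; rewrite inE/= in_itv/= andbT => y0; rewrite /f /pexp ger0_norm//.
rewrite (@ge0_continuous_FTC2y _ f F 0 0)//.
- rewrite /F !mulr0 oppr0 expR0 sin0 cos0 mulr0 mulr1 mul1r sub0r sub0e -EFinN; congr EFin.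
  by field; rewrite !gt_eqF.
- move=> y y0; have := p0 y; rewrite /pexp ger0_norm//.
- exact: continuous_subspaceT.
- have FE y : `|F y| <= ((`|x| + e) / (e ^+ 2 + x ^+ 2) + e^-1) * expR (- (e * y)).
    rewrite /F mulrC normrM (ger0_norm (expR_ge0 _)) ler_wpM2r ?expR_ge0//.
    rewrite (le_trans (ler_normB _ _))// lerD//; last by rewrite ger0_norm ?invr_ge0 ?(ltW e0).
    rewrite normrM [X in _ * X]ger0_norm ?invr_ge0 ?(ltW ex0)// ler_wpM2r ?invr_ge0 ?(ltW ex0)//.
    rewrite (le_trans (ler_normB _ _))// !normrM (ger0_norm (ltW e0)) lerD//.
      by rewrite ler_piMr// sin_max.
    by rewrite ler_piMr ?(ltW e0)// cos_max.
  apply: norm_cvg0; apply: (@squeeze_cvgr _ _ _ _ (cst 0) (fun y => ((`|x| + e) / (e ^+ 2 + x ^+ 2) + e^-1) * expR (- (e * y)))).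
  + by near=> y; rewrite /= normr_ge0 FE.
  + exact: cvg_cst.
  + rewrite -[X in _ --> X](mulr0 ((`|x| + e) / (e ^+ 2 + x ^+ 2) + e^-1)).
    apply: cvgM; first exact: cvg_cst.
    apply: (@cvg_comp _ _ _ (fun y => e * y) (fun z => expR (- z))); last exact: cvgr_expR.
    by apply: gt0_cvgMry => //; exact: cvg_id.
- by apply: cvg_at_right_filter; exact: cF.
- by move=> y _; rewrite derive1E; have [_ ->] := dF y.
Unshelve. all: by end_near. Qed.

Lemma integral_pexp (e : R) : 0 < e -> (\int[mu]_y (expR (- (e * `|y|)))%:E = (2 / e)%:E)%E.
Proof.
move=> e0; have := integral_1Dcos_pexp 0 e0.
rewrite (eq_integral (fun y : measurableTypeR R => 2%:E * (pexp e y)%:E)%E); last first.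
  by move=> y _; rewrite mul0r cos0 -EFinM.
rewrite ge0_integralZl_EFin//; last 2 first.
- by move=> y _; rewrite lee_fin expR_ge0.
- by apply/measurable_EFinP; apply: continuous_measurable_fun; exact: continuous_pexp.
rewrite expr0n/= addr0 expr2 invfM mulrA mulfV ?gt_eqF// mul1r EFinM.
move=> /(congr1 (fun z => (2^-1)%:E * z)%E); rewrite !muleA -!EFinM mulVf// !mul1r mul1e => ->.
by congr EFin; lra.
Qed.

Lemma integrable_pexp (e : R) : 0 < e ->
  mu.-integrable setT (EFin \o (fun y : R => expR (- (e * `|y|)))).
Proof.
move=> e0; apply: (@integrable_ge0_finite _ _ _ _ _ (2 / e)).
- by apply: continuous_measurable_fun; exact: continuous_pexp.
- by move=> y; exact: expR_ge0.
- by rewrite integral_pexp.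
Qed.

Lemma Rintegral_cos_pexp (e x : R) : 0 < e ->
  (\int[mu]_y (cos (x * y) * expR (- (e * `|y|))) = 2 * e / (e ^+ 2 + x ^+ 2))%R.
Proof.
move=> e0; have ie := integrable_pexp e0.
have mcos : measurable_fun setT (fun y : measurableTypeR R => cos (x * y)).
  apply: continuous_measurable_fun => y.
  by apply: continuous_comp; [apply: cvgM; [exact: cvg_cst|exact: cvg_id]|exact: continuous_cos].
have ic : mu.-integrable setT (EFin \o (fun y : R => cos (x * y) * expR (- (e * `|y|)))).
  apply: (le_integrable_bound _ ie).
    apply: measurable_funM => //; apply: continuous_measurable_fun; exact: continuous_pexp.
  by move=> y; rewrite normrM (ger0_norm (expR_ge0 _)) ler_piMl ?expR_ge0// cos_max.
have := integral_1Dcos_pexp x e0.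
rewrite (eq_integral (fun y : measurableTypeR R => (expR (- (e * `|y : R|)))%:E + (cos (x * y) * expR (- (e * `|y : R|)))%:E)%E); last first.
  by move=> y _; rewrite -EFinD mulrDl mul1r.
rewrite integralD//= integral_pexp// => H.
rewrite /Rintegral.
have := integrable_fin_num measurableT ic; move: H; rewrite /=.
case: (\int[mu]_x0 _)%E => // r [] H _ /=; move: H; rewrite mulrDr mulrA => /addrI; exact.
Qed.

Lemma Rintegral_sin_pexp (e x : R) : 0 < e ->
  (\int[mu]_y (sin (x * y) * expR (- (e * `|y|))) = 0)%R.
Proof.
move=> e0; set f := fun y : measurableTypeR R => sin (x * y) * expR (- (e * `|y : R|)).
have mf : measurable_fun setT f.
  apply: continuous_measurable_fun => y; apply: cvgM; last exact: continuous_pexp.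
  by apply: continuous_comp; [apply: cvgM; [exact: cvg_cst|exact: cvg_id]|exact: continuous_sin].
have {}mf : measurable_fun setT (EFin \o f) by exact/measurable_EFinP.
rewrite /Rintegral integralE.
rewrite [X in fine (X - _)](_ : _ = \int[mu]_y ((EFin \o f)^\- y))%E; last first.
  have := @ge0_integral_affine R (-1) 0 ((EFin \o f)^\-)%E; rewrite oppr_eq0 oner_eq0.
  rewrite normrN1 invr1 mul1e => <- //; last exact: measurable_funeneg.
  apply: eq_integral => y _; rewrite funeposE funenegE mulN1r addr0 /f/=.
  by rewrite mulrN sinN normrN mulNr opprK.
by case: (\int[mu]_y _)%E => [r| |]//=; rewrite subrr.
Qed.

End poisson1.

Section poissonN.
Context {R : realType}.
Local Notation mu := (@lebesgue_measure R).

Lemma dot_consn n (a b : R) (x y : Rn R n) :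
  dot (consn (a, x)) (consn (b, y)) = a * b + dot x y.
Proof.
rewrite /dot big_ord_recl !tnth_consn0; congr (_ + _).
by apply: eq_bigr => i _; rewrite !tnth_consnS.
Qed.

Lemma Rintegral_RnS n (f : Rn R n.+1 -> R) (g1 : measurableTypeR R -> R) (g2 : Rn R n -> R) :
  measurable_fun setT f -> mu.-integrable setT (EFin \o g1) ->
  (lebesgue_Rn R n).-integrable setT (EFin \o g2) ->
  (forall a x, `|f (consn (a, x))| <= g1 a * g2 x) ->
  (\int[lebesgue_Rn R n.+1]_x f x =
   \int[mu]_a \int[lebesgue_Rn R n]_x f (consn (a, x)))%R.
Proof.
move=> mf i1 i2 fg.
have mF : measurable_fun setT (f \o @consn R n).
  exact: (measurableT_comp mf (@measurable_consn R n)).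
have iF := integrable_prod_bound mF i1 i2 fg.
have i2x a : (lebesgue_Rn R n).-integrable setT (EFin \o (fun y => f (consn (a, y)))).
  apply: (le_integrable_bound (g := fun y => g1 a * g2 y)) => //.
    exact: (measurableT_comp mf (measurable_consn1 a)).
  exact: (integrableZl measurableT (g1 a) i2).
rewrite /Rintegral; congr fine.
have mf' : measurable_fun setT (EFin \o f) by exact/measurable_EFinP.
have := @integral_pushforward _ _ _ _ R _ (@measurable_consn R n)
  (mu \x lebesgue_Rn R n)%E setT (EFin \o f) mf'.
rewrite preimage_setT => /(_ iF measurableT) H.
transitivity (\int[(mu \x lebesgue_Rn R n)%E]_x (EFin \o (f \o @consn R n)) x)%E; first exact: H.
rewrite -(integral12_prod_meas1 iF).
by apply: eq_integral => a _; rewrite fineK//; exact: (integrable_fin_num _ (i2x a)).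
Qed.

Lemma integrable_prod_Rn n (f : measurableTypeR R -> R) :
  measurable_fun setT f -> (forall x, 0 <= f x) -> mu.-integrable setT (EFin \o f) ->
  (lebesgue_Rn R n).-integrable setT (EFin \o (fun x => \prod_(i < n) f (tnth x i))).
Proof.
move=> mf f0 fi.
have E x : (\prod_(i < n) f (tnth x i))%:E = (\prod_(i < n) (f (tnth x i))%:E)%E.
  by rewrite prodEFin.
apply/integrableP; split.
  rewrite (_ : _ \o _ = (fun x => \prod_(i < n) (f (tnth x i))%:E)%E); last by apply/funext => x; rewrite /= E.
  by apply: (emeasurable_prod_Rn (f := fun=> (EFin \o f))) => _; exact/measurable_EFinP.
rewrite (eq_integral (fun x => \prod_(i < n) (f (tnth x i))%:E)%E); last first.
  by move=> x _; rewrite /= -E ger0_norm// prodr_ge0.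
rewrite (ge0_integral_prod_Rn (f := fun=> (EFin \o f)))//; last by move=> _; exact/measurable_EFinP.
have := integrable_fin_num measurableT fi; move/fineK => <-.
by rewrite prodEFin ltry.
Qed.

(** Regulariser exp(-e (|x_1| + ... + |x_n|)): a product over the coordinates, so that its transform
    factors. *)
Definition pexpn n (e : R) (x : Rn R n) : R := \prod_(i < n) expR (- (e * `|tnth x i : R|)).

Lemma integrable_pexpn n (e : R) : 0 < e ->
  (lebesgue_Rn R n).-integrable setT (EFin \o @pexpn n e).
Proof.
move=> e0; apply: (@integrable_prod_Rn n (fun y : measurableTypeR R => expR (- (e * `|y : R|)))).
- by apply/measurable_EFinP; exact: measurable_int _ (integrable_pexp e0).
- by move=> x; exact: expR_ge0.
- exact: integrable_pexp.
Qed.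

Lemma measurable_pexpn n (e : R) : 0 < e -> measurable_fun setT (@pexpn n e).
Proof. by move=> /(@integrable_pexpn n)/measurable_int/measurable_EFinP. Qed.

Lemma pexpn_ge0 n (e : R) x : 0 <= @pexpn n e x.
Proof. by apply: prodr_ge0 => i _; exact: expR_ge0. Qed.

Lemma pexpn_le1 n (e : R) x : 0 <= e -> @pexpn n e x <= 1.
Proof.
move=> e0; have -> : 1 = \prod_(i < n) (1 : R) by rewrite prodr_const expr1n.
by apply: ler_prod => i _; rewrite expR_ge0/= expR_le1 oppr_le0 mulr_ge0.
Qed.

(** The cosine transform of [pexpn]: a product of one-dimensional Poisson kernels, not the
    rotation-invariant one. *)
Definition poisson n (e : R) (x : Rn R n) : R := \prod_(i < n) (2 * e / (e ^+ 2 + (tnth x i : R) ^+ 2)).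

Lemma measurable_cosdot n (t : R) (x : Rn R n) : measurable_fun setT (fun y => cos (t + dot x y)).
Proof.
apply: (@measurableT_comp _ _ _ _ _ _ (@cos R)).
  by apply: continuous_measurable_fun; exact: continuous_cos.
by apply: measurable_funD => //; exact: measurable_dotr.
Qed.

(** The phase [t] is what lets the induction on the dimension close: the contribution of the first
    coordinate is absorbed in the phase of the remaining ones. In the last integration the sine term
    vanishes by oddness. *)
Lemma Rintegral_cos_pexpn n (e t : R) (x : Rn R n) : 0 < e ->
  (\int[lebesgue_Rn R n]_y (cos (t + dot x y) * pexpn e y) = cos t * poisson e x)%R.
Proof.
move=> e0; elim: n x t => [|n IH] x t.
  transitivity (\int[lebesgue_Rn R 0]_y cos t)%R.
    by apply: eq_Rintegral => y _; rewrite /pexpn /dot !big_ord0 addr0 mulr1.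
  by rewrite Rintegral_cst// /poisson big_ord0 [X in fine X](_ : _ = 1%E)//; exact: diracT.
have := unconsnK x; set a := (unconsn x).1; set x' := (unconsn x).2 => xE.
have E1 b y : pexpn e (consn (b, y)) = expR (- (e * `|b : R|)) * pexpn e y :> R.
  by rewrite /pexpn big_ord_recl tnth_consn0; under eq_bigr do rewrite tnth_consnS.
rewrite (Rintegral_RnS (g1 := fun b => expR (- (e * `|b : R|))) (g2 := pexpn e)); first last.
- move=> b y; have p0 : 0 <= expR (- (e * `|b : R|)) * pexpn e y.
    by rewrite mulr_ge0 ?expR_ge0// pexpn_ge0.
  by rewrite E1 normrM (ger0_norm p0) ler_piMl// cos_max.
- exact: integrable_pexpn.
- exact: integrable_pexp.
- apply: measurable_funM; first exact: measurable_cosdot.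
  exact: measurable_pexpn.
transitivity (\int[mu]_b ((cos (t + a * b) * expR (- (e * `|b : R|))) * poisson e x'))%R.
  apply: eq_Rintegral => b _; rewrite -xE.
  under eq_Rintegral do rewrite dot_consn addrA E1 mulrCA.
  rewrite RintegralZl//; last first.
    apply: (le_integrable_bound _ (integrable_pexpn n e0)).
      by apply: measurable_funM; [exact: measurable_cosdot|exact: measurable_pexpn].
    by move=> y; rewrite normrM (ger0_norm (pexpn_ge0 _ _)) ler_piMl ?pexpn_ge0// cos_max.
  by rewrite IH mulrCA mulrA mulrC.
rewrite /poisson -xE big_ord_recl tnth_consn0; under [in RHS]eq_bigr do rewrite tnth_consnS.
rewrite -/(poisson e x') mulrA.
have ie := integrable_pexp e0.
have mc (g : R -> R) : continuous g -> measurable_fun setT (fun b : measurableTypeR R => g (a * b) * expR (- (e * `|b : R|))).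
  move=> cg; apply: measurable_funM; last by apply/measurable_EFinP; exact: measurable_int _ ie.
  apply: continuous_measurable_fun => y; apply: (@continuous_comp _ _ _ (fun y : R => a * y) g); last exact: cg.
  by apply: cvgM; [exact: cvg_cst|exact: cvg_id].
have ic : mu.-integrable setT (EFin \o (fun b : R => cos (a * b) * expR (- (e * `|b|)))).
  apply: (le_integrable_bound _ ie); first by apply: (mc cos); exact: continuous_cos.
  by move=> y; rewrite normrM (ger0_norm (expR_ge0 _)) ler_piMl ?expR_ge0// cos_max.
have isn : mu.-integrable setT (EFin \o (fun b : R => sin (a * b) * expR (- (e * `|b|)))).
  apply: (le_integrable_bound _ ie); first by apply: (mc sin); exact: continuous_sin.
  by move=> y; rewrite normrM (ger0_norm (expR_ge0 _)) ler_piMl ?expR_ge0// sin_max.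
rewrite RintegralZr//; last first.
  apply: (le_integrable_bound _ ie); last first.
    by move=> y; rewrite normrM (ger0_norm (expR_ge0 _)) ler_piMl ?expR_ge0// cos_max.
  apply: measurable_funM; last by apply/measurable_EFinP; exact: measurable_int _ ie.
  apply: continuous_measurable_fun => y; apply: (@continuous_comp _ _ _ (fun y : R => t + a * y) cos); last exact: continuous_cos.
  by apply: cvgD; [exact: cvg_cst|apply: cvgM; [exact: cvg_cst|exact: cvg_id]].
congr (_ * _).
transitivity (\int[mu]_b (cos t * (cos (a * b) * expR (- (e * `|b : R|)))
   - sin t * (sin (a * b) * expR (- (e * `|b : R|)))))%R.
  by apply: eq_Rintegral => b _; rewrite cosD mulrBl !mulrA.
rewrite RintegralB//; last 2 first.
- exact: (integrableZl measurableT (cos t) ic).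
- exact: (integrableZl measurableT (sin t) isn).
by rewrite !RintegralZl// Rintegral_cos_pexp// Rintegral_sin_pexp// mulr0 subr0.
Qed.

Lemma poisson_ge0 n (e : R) x : 0 < e -> 0 <= @poisson n e x.
Proof.
move=> e0; apply: prodr_ge0 => i _; apply: divr_ge0; first by rewrite mulr_ge0// ltW.
by rewrite addr_ge0 ?sqr_ge0.
Qed.

Lemma integral_poisson1 n : (\int[lebesgue_Rn R n]_x (poisson 1 x)%:E = ((2 * pi) ^+ n)%:E)%E.
Proof.
have mf : measurable_fun setT (fun y : measurableTypeR R => ((1 + y ^+ 2)^-1)%:E : \bar R).
  by apply/measurable_EFinP; apply: continuous_measurable_fun; exact: continuous_oneDsqrV.
rewrite (eq_integral (fun x : Rn R n => \prod_(i < n) (2%:E * ((1 + (tnth x i : R) ^+ 2)^-1)%:E))%E); last first.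
  by move=> x _; rewrite /poisson -prodEFin; apply: eq_bigr => i _; rewrite mulr1 expr1n -EFinM.
rewrite (ge0_integral_prod_Rn (f := fun _ y => 2%:E * ((1 + y ^+ 2)^-1)%:E)%E); last 2 first.
- by move=> _; exact: emeasurable_funM.
- by move=> _ x; rewrite mule_ge0// lee_fin invr_ge0 addr_ge0// sqr_ge0.
under eq_bigr.
  move=> i _; rewrite ge0_integralZl//; last by move=> x _; rewrite lee_fin invr_ge0 addr_ge0// sqr_ge0.
  rewrite integral_oneDsqr -EFinM; over.
by rewrite prodEFin prodr_const card_ord.
Qed.

Lemma measurable_poisson n (e : R) : measurable_fun setT (@poisson n e).
Proof.
apply: measurable_prod => i _.
rewrite (_ : (fun x => _) = (fun x : Rn R n => 2 * e * (e ^+ 2 + (tnth x i : R) ^+ 2) `^ (-1))); last first.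
  by apply/funext => x; rewrite powR_inv1// addr_ge0 ?sqr_ge0.
apply: measurable_funM => //; apply: (measurableT_comp (measurable_powR _)).
by apply: measurable_funD => //; apply: measurable_funX; exact: measurable_tnth.
Qed.

Lemma integrable_poisson1 n : (lebesgue_Rn R n).-integrable setT (EFin \o poisson 1).
Proof.
apply: (@integrable_ge0_finite _ _ _ _ _ ((2 * pi) ^+ n)).
- exact: measurable_poisson.
- by move=> x; exact: poisson_ge0.
- by rewrite integral_poisson1.
Qed.

Lemma poisson_scale n (e : R) (b x : Rn R n) : 0 < e ->
  poisson e (vsub (aff e b x) b) = e ^- n * poisson 1 x.
Proof.
move=> e0; rewrite /poisson -exprVn.
have -> : e^-1 ^+ n = \prod_(i < n) e^-1 by rewrite prodr_const card_ord.
rewrite -big_split/=; apply: eq_bigr => i _; rewrite !tnth_mktuple addrK.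
rewrite expr1n mulr1 exprMn.
have y0 : 1 + (tnth x i : R) ^+ 2 != 0 by rewrite gt_eqF// ltr_pwDl// sqr_ge0.
have -> : e ^+ 2 + e ^+ 2 * (tnth x i : R) ^+ 2 = e ^+ 2 * (1 + (tnth x i : R) ^+ 2).
  by rewrite mulrDr mulr1.
by field; rewrite y0 gt_eqF.
Qed.

End poissonN.

(** * Inversion of the cosine transform *)

Section integrableR.
Context d (T : measurableType d) {R : realType} (mu : {measure set T -> \bar R}).
Implicit Types f g : T -> R.

Lemma integrableRZ (c : R) f : mu.-integrable setT (EFin \o f) ->
  mu.-integrable setT (EFin \o (fun x => c * f x)).
Proof. by move=> fi; exact: (integrableZl measurableT c fi). Qed.

Lemma integrableRD f g : mu.-integrable setT (EFin \o f) -> mu.-integrable setT (EFin \o g) ->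
  mu.-integrable setT (EFin \o (fun x => f x + g x)).
Proof. by move=> fi gi; exact: (integrableD measurableT fi gi). Qed.

Lemma integrableRB f g : mu.-integrable setT (EFin \o f) -> mu.-integrable setT (EFin \o g) ->
  mu.-integrable setT (EFin \o (fun x => f x - g x)).
Proof. by move=> fi gi; exact: (integrableB measurableT fi gi). Qed.

End integrableR.

Lemma half_mulVKf {R : realFieldType} (c p : R) : c != 0 ->
  p = c^-1 * (2^-1 * (c * p + c * p)).
Proof. by move=> c0; field. Qed.

Lemma eq_oppr_eq0 {R : realFieldType} (r : R) : r = -1 * r -> r = 0.
Proof. by lra. Qed.

Section inversion.
Context {R : realType} {n : nat}.
Local Notation leb := (lebesgue_Rn R n).
Implicit Types (h phi : Rn R n -> R) (x y z : Rn R n).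

Definition vzero : Rn R n := [tuple 0 | i < n].
Definition vopp x : Rn R n := aff (-1) vzero x.

Lemma dot_vopp x y : dot (vopp x) y = - dot x y.
Proof.
rewrite dot_aff mulN1r (_ : dot vzero y = 0) ?addr0//.
by rewrite /dot big1// => i _; rewrite tnth_mktuple mul0r.
Qed.

(** For even [h] this is the Fourier transform, the sine part being zero. *)
Definition ctr h x : R := (\int[leb]_y (cos (dot x y) * h y))%R.

Lemma measurable_cosdot0 x : measurable_fun setT (fun y => cos (dot x y)).
Proof.
rewrite (_ : (fun y => _) = (fun y => cos (0 + dot x y))); first exact: measurable_cosdot.
by apply/funext => y; rewrite add0r.
Qed.

Lemma measurable_sindot0 x : measurable_fun setT (fun y => sin (dot x y)).
Proof.
apply: (@measurableT_comp _ _ _ _ _ _ (@sin R)); last exact: measurable_dotr.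
by apply: continuous_measurable_fun; exact: continuous_sin.
Qed.

Lemma integrable_cosM h x : leb.-integrable setT (EFin \o h) ->
  leb.-integrable setT (EFin \o (fun y => cos (dot x y) * h y)).
Proof.
move=> ih; have mh : measurable_fun setT h by apply/measurable_EFinP; exact: measurable_int _ ih.
apply: (le_integrable_bound _ (integrable_norm ih)).
  by apply: measurable_funM => //; exact: measurable_cosdot0.
by move=> y; rewrite normrM ler_piMl// cos_max.
Qed.

Lemma integrable_sinM h x : leb.-integrable setT (EFin \o h) ->
  leb.-integrable setT (EFin \o (fun y => sin (dot x y) * h y)).
Proof.
move=> ih; have mh : measurable_fun setT h by apply/measurable_EFinP; exact: measurable_int _ ih.
apply: (le_integrable_bound _ (integrable_norm ih)).
  by apply: measurable_funM => //; exact: measurable_sindot0.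
by move=> y; rewrite normrM ler_piMl// sin_max.
Qed.

(** Continuity is required only along lines, which is all that dilating an approximate identity
    around [x] uses; boundedness by 1 then gives the domination. *)
Definition symbol phi :=
  [/\ forall y, 0 <= phi y <= 1, leb.-integrable setT (EFin \o phi),
      forall y, phi (vopp y) = phi y &
      forall x z (e : nat -> R), e @ \oo --> 0 -> phi (aff (e k) x z) @[k --> \oo] --> phi x].

(** Normalised as in [inv_fourier], so that [heat_kernelE] holds by conversion. *)
Definition fker phi x : R := (2 * pi) ^- n * ctr phi x.

Lemma measurable_sym phi : leb.-integrable setT (EFin \o phi) -> measurable_fun setT phi.
Proof. by move=> ih; apply/measurable_EFinP; exact: measurable_int _ ih. Qed.

Lemma measurable_ctr h : measurable_fun setT h -> measurable_fun setT (ctr h).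
Proof.
move=> mh.
apply: (@measurable_Rintegral2 _ _ _ _ R leb (fun z : Rn R n * Rn R n => cos (dot z.1 z.2) * h z.2)).
apply: measurable_funM; last exact: (measurableT_comp mh).
apply: (@measurableT_comp _ _ _ _ _ _ (@cos R)); last exact: measurable_dot.
by apply: continuous_measurable_fun; exact: continuous_cos.
Qed.

Lemma measurable_fker phi : leb.-integrable setT (EFin \o phi) -> measurable_fun setT (fker phi).
Proof. by move=> /measurable_sym/measurable_ctr mc; exact: measurable_funM. Qed.

Lemma ctr_le phi x : leb.-integrable setT (EFin \o phi) -> (forall y, 0 <= phi y) ->
  `|ctr phi x| <= (\int[leb]_y phi y)%R.
Proof.
move=> ip p0; apply: (le_trans (le_normr_Rintegral measurableT (integrable_cosM x ip))).
apply: le_Rintegral => //.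
  exact: (integrable_norm (integrable_cosM x ip)).
by move=> y _; rewrite normrM (ger0_norm (p0 y)) ler_piMl// cos_max.
Qed.

Lemma pi2_gt0 : 0 < (2 * pi) ^+ n :> R.
Proof. by rewrite exprn_gt0// mulr_gt0// pi_gt0. Qed.

Lemma poisson_le (e : R) x : 0 < e -> poisson e x <= (2 / e) ^+ n.
Proof.
move=> e0; have -> : (2 / e) ^+ n = \prod_(i < n) (2 / e) by rewrite prodr_const card_ord.
apply: ler_prod => i _.
have h : 0 < e ^+ 2 + (tnth x i : R) ^+ 2 by rewrite ltr_pwDl ?exprn_gt0// sqr_ge0.
apply/andP; split; first by rewrite divr_ge0 ?mulr_ge0// ltW.
rewrite ler_pdivrMr// mulrAC ler_pdivlMr// -mulrA ler_pM2l// -expr2 lerDl sqr_ge0//.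
Qed.

(** The substitution y = x + e z turns the concentrating kernel into the fixed [poisson 1], of mass
    (2 pi)^n, and moves e into the argument of [phi], where dominated convergence applies. *)
Lemma poisson_approx phi x : symbol phi ->
  (\int[leb]_y (phi y * poisson (harmonic k) (vsub y x)))%R @[k --> \oo] -->
  (2 * pi) ^+ n * phi x.
Proof.
move=> [p01 ip _ cp].
have mp := measurable_sym ip.
have mvl : measurable_fun setT (fun y => vsub y x).
  exact: (measurable_fun2 measurable_vsub (@measurable_id _ _ _) (measurable_cst x)).
have E k : (\int[leb]_y (phi y * poisson (harmonic k) (vsub y x)) =
    \int[leb]_z (phi (aff (harmonic k) x z) * poisson 1 z))%R.
  set e := harmonic k; have e0 : 0 < e :> R by rewrite /e /harmonic/= invr_gt0.
  have iF : leb.-integrable setT (EFin \o (fun y => phi y * poisson e (vsub y x))).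
    apply: (le_integrable_bound (g := fun y => phi y * (2 / e) ^+ n)) => //.
    - by apply: measurable_funM => //; exact: (measurableT_comp (measurable_poisson _)).
    - exact: (integrableZr measurableT ((2 / e) ^+ n) ip).
    move=> y; have /andP[p0 _] := p01 y.
    by rewrite ger0_norm ?mulr_ge0 ?poisson_ge0// ler_wpM2l// poisson_le.
  have := Rintegral_aff x (lt0r_neq0 e0) iF.
  rewrite (gtr0_norm e0).
  under eq_Rintegral do rewrite poisson_scale// mulrCA.
  have iP : leb.-integrable setT (EFin \o (fun z => phi (aff e x z) * poisson 1 z)).
    apply: (le_integrable_bound _ (@integrable_poisson1 R n)).
      apply: measurable_funM; last exact: measurable_poisson.
      exact: (measurableT_comp mp (measurable_aff e x)).
    move=> z; have /andP[p0 p1] := p01 (aff e x z).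
    by rewrite ger0_norm ?mulr_ge0 ?poisson_ge0// ler_piMl// poisson_ge0.
  rewrite RintegralZl//; move/mulfI => <- //.
  by rewrite invr_eq0 expf_neq0// gt_eqF.
rewrite (eq_cvg _ _ E).
have iP := @integrable_poisson1 R n.
have -> : (2 * pi) ^+ n * phi x = (\int[leb]_z (phi x * poisson 1 z))%R.
  by rewrite RintegralZl// mulrC /Rintegral integral_poisson1.
have [|||//] := @Rdominated_convergence _ _ R leb (fun k z => phi (aff (harmonic k) x z) * poisson 1 z)
  (fun z => phi x * poisson 1 z) (poisson 1) _ _ iP.
- move=> k; apply: measurable_funM; last exact: measurable_poisson.
  exact: (measurableT_comp mp (measurable_aff _ x)).
- move=> z; apply: cvgM; last exact: cvg_cst.
  by apply: cp; exact: cvg_harmonic.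
- move=> k z; have /andP[p0 p1] := p01 (aff (harmonic k) x z).
  by rewrite ger0_norm ?mulr_ge0 ?poisson_ge0// ler_piMl// poisson_ge0.
Qed.

Lemma cvg_pexpn x : pexpn (harmonic k) x @[k --> \oo] --> (1 : R).
Proof.
rewrite /pexpn.
suff H l : \prod_(i <- l) expR (- (harmonic k * `|tnth x i : R|)) @[k --> \oo] --> (1 : R).
  exact: H.
elim: l => [|i l ih].
  by under eq_fun do rewrite big_nil; exact: cvg_cst.
have E k : \prod_(j <- i :: l) expR (- (harmonic k * `|tnth x j : R|)) =
  expR (- (harmonic k * `|tnth x i : R|)) * \prod_(j <- l) expR (- (harmonic k * `|tnth x j : R|)).
  by rewrite big_cons.
rewrite (eq_cvg _ _ E).
have H : expR (- (harmonic k * `|tnth x i : R|)) @[k --> \oo] --> (1 : R).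
  rewrite -[X in _ --> X]expR0.
  apply: (@cvg_comp _ _ _ (fun k => - (harmonic k * `|tnth x i : R|)) expR); last exact: continuous_expR.
  have := cvgN (cvgM (@cvg_harmonic R) (cvg_cst `|tnth x i : R|)).
  by rewrite mul0r oppr0; exact.
by have := cvgM H ih; rewrite mulr1; exact.
Qed.

Lemma Rintegral_coscos_pexpn (e : R) x y : 0 < e ->
  (\int[leb]_z (cos (dot x z) * (cos (dot y z) * pexpn e z)) =
  2^-1 * (poisson e (vsub y x) + poisson e (vsub y (vopp x))))%R.
Proof.
move=> e0.
have iC w : leb.-integrable setT (EFin \o (fun z => cos (dot w z) * pexpn e z)).
  by apply: integrable_cosM; exact: integrable_pexpn.
have PE w : poisson e w = (\int[leb]_z (cos (dot w z) * pexpn e z))%R.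
  rewrite -[LHS]mul1r -cos0 -Rintegral_cos_pexpn//.
  by apply: eq_Rintegral => z _; rewrite add0r.
rewrite !PE -RintegralD// -RintegralZl//; last exact: (integrableD _ (iC _) (iC _)).
apply: eq_Rintegral => z _; rewrite !dot_vsub dot_vopp opprK cosB cosD.
by field.
Qed.

(* Inverting the cosine transform against the Poisson kernel avoids Gaussian integrals. *)
Lemma regularized_inversion phi x (e : R) : symbol phi -> 0 < e ->
  (\int[leb]_z (cos (dot x z) * (pexpn e z * fker phi z)) =
  (2 * pi) ^- n * (2^-1 * (\int[leb]_y (phi y * poisson e (vsub y x)) +
                           \int[leb]_y (phi y * poisson e (vsub y (vopp x))))))%R.
Proof.
move=> [p01 ip _ _] e0.
have mp := measurable_sym ip.
have ie := @integrable_pexpn R n e e0.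
have iP w : leb.-integrable setT (EFin \o (fun y => phi y * poisson e (vsub y w))).
  apply: (le_integrable_bound (g := fun y => phi y * (2 / e) ^+ n)) => //.
  - apply: measurable_funM => //; apply: (measurableT_comp (measurable_poisson _)).
    exact: (measurable_fun2 measurable_vsub (@measurable_id _ _ _) (measurable_cst w)).
  - exact: (integrableZr measurableT ((2 / e) ^+ n) ip).
  move=> y; have /andP[p0 _] := p01 y.
  by rewrite ger0_norm ?mulr_ge0 ?poisson_ge0// ler_wpM2l// poisson_le.
transitivity (\int[leb]_z \int[leb]_y ((2 * pi) ^- n * (phi y * (cos (dot x z) * (cos (dot y z) * pexpn e z)))))%R.
  apply: eq_Rintegral => z _.
  have -> : cos (dot x z) * (pexpn e z * fker phi z) = ((2 * pi) ^- n * (cos (dot x z) * pexpn e z)) * ctr phi z.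
    by rewrite /fker; ring.
  rewrite -RintegralZl//; last exact: integrable_cosM.
  by apply: eq_Rintegral => y _; rewrite (dotC y z); ring.
have mcos2 : measurable_fun setT (fun z : Rn R n * Rn R n => cos (dot z.2 z.1)).
  apply: (@measurableT_comp _ _ _ _ _ _ (@cos R)).
    by apply: continuous_measurable_fun; exact: continuous_cos.
  by apply: (measurable_fun2 measurable_dot).
rewrite (@RFubini _ _ _ _ R leb leb (fun zy => (2 * pi) ^- n * (phi zy.2 * (cos (dot x zy.1) * (cos (dot zy.2 zy.1) * pexpn e zy.1))))
  (fun z => (2 * pi) ^- n * pexpn e z) phi)//.
- transitivity (\int[leb]_y ((2 * pi) ^- n * (2^-1 * (phi y * poisson e (vsub y x) + phi y * poisson e (vsub y (vopp x))))))%R.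
    apply: eq_Rintegral => y _.
    have iC : leb.-integrable setT (EFin \o (fun z => cos (dot x z) * (cos (dot y z) * pexpn e z))).
      by apply: integrable_cosM; exact: integrable_cosM.
    rewrite /= RintegralZl//; last exact: (integrableZl measurableT (phi y) iC).
    by rewrite RintegralZl// Rintegral_coscos_pexpn//; ring.
  rewrite RintegralZl//; last by apply: integrableRZ; exact: integrableRD.
  rewrite RintegralZl//; last exact: integrableRD.
  by rewrite RintegralD.
- apply: measurable_funM => //; apply: measurable_funM; first exact: (measurableT_comp mp).
  apply: measurable_funM; first exact: (measurableT_comp (measurable_cosdot0 x)).
  apply: measurable_funM => //; apply: measurableT_comp => //; exact: measurable_pexpn.
- exact: (integrableZl measurableT ((2 * pi) ^- n) ie).
move=> z y; have /andP[p0 _] := p01 y.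
have E0 := pexpn_ge0 e z; have c0 : 0 <= (2 * pi) ^- n :> R by rewrite invr_ge0 ltW// pi2_gt0.
rewrite !normrM (ger0_norm p0) (ger0_norm E0) (ger0_norm c0) -mulrA ler_wpM2l//.
rewrite mulrC ler_wpM2r// -[leRHS]mul1r mulrA ler_wpM2r//.
by rewrite -[leRHS]mulr1 ler_pM// cos_max.
Qed.

(** Let e tend to 0 in [regularized_inversion]: integrability of the kernel dominates the left side,
    and on the right the values at x and at its reflection coincide because [phi] is even. *)
Lemma inversion phi x : symbol phi -> leb.-integrable setT (EFin \o fker phi) ->
  (\int[leb]_z (cos (dot x z) * fker phi z) = phi x)%R.
Proof.
move=> sp iK; have [p01 ip ev cp] := sp.
have mK := measurable_fker ip.
have h0 k : 0 < harmonic k :> R by rewrite /harmonic/= invr_gt0.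
have [|||_ _ _ L1] := @Rdominated_convergence _ _ R leb
  (fun k z => cos (dot x z) * (pexpn (harmonic k) z * fker phi z))
  (fun z => cos (dot x z) * fker phi z) (fun z => `|fker phi z|) _ _ (integrable_norm iK).
- move=> k; apply: measurable_funM; first exact: measurable_cosdot0.
  by apply: measurable_funM => //; exact: measurable_pexpn.
- move=> z; apply: cvgM; first exact: cvg_cst.
  rewrite -[X in _ --> X]mul1r; apply: cvgM; last exact: cvg_cst.
  exact: cvg_pexpn.
- move=> k z; rewrite !normrM mulrA ler_piMl//.
  rewrite -[leRHS]mulr1 ler_pM// ?cos_max//.
  by rewrite ger0_norm ?pexpn_ge0// pexpn_le1// ltW.
apply: (cvg_unique _ L1) => //.
rewrite (_ : (fun k => _) = (fun k => (2 * pi) ^- n *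
   (2^-1 * (\int[leb]_y (phi y * poisson (harmonic k) (vsub y x)) +
            \int[leb]_y (phi y * poisson (harmonic k) (vsub y (vopp x))))))%R); last first.
  by apply/funext => k; exact: regularized_inversion.
have -> : phi x = (2 * pi) ^- n * (2^-1 * ((2 * pi) ^+ n * phi x + (2 * pi) ^+ n * phi (vopp x))).
  rewrite ev; apply: half_mulVKf; exact: lt0r_neq0 pi2_gt0.
apply: cvgM; first exact: cvg_cst.
apply: cvgM; first exact: cvg_cst.
by apply: cvgD; exact: poisson_approx.
Qed.

Lemma fker_vopp phi x : fker phi (vopp x) = fker phi x.
Proof.
rewrite /fker /ctr; congr (_ * _).
by apply: eq_Rintegral => y _; rewrite dot_vopp cosN.
Qed.

Lemma inversion_sin phi x : symbol phi -> leb.-integrable setT (EFin \o fker phi) ->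
  (\int[leb]_z (sin (dot x z) * fker phi z) = 0)%R.
Proof.
move=> sp iK.
have iS := integrable_sinM x iK.
have N1 : -1 != 0 :> R by rewrite oppr_eq0 oner_eq0.
set g := fun z => sin (dot x z) * fker phi z in iS *.
have H := Rintegral_aff vzero N1 iS; rewrite normrN1 expr1n invr1 mul1r in H.
have E : (\int[leb]_z g (aff (-1) vzero z) = -1 * \int[leb]_z g z)%R.
  rewrite -(RintegralZl (-1) measurableT iS).
  apply: eq_Rintegral => z _; rewrite /g -/(vopp z) fker_vopp dotC dot_vopp dotC sinN.
  by rewrite mulN1r mulNr.
exact: (eq_oppr_eq0 (etrans (esym H) E)).
Qed.

(** A nonnegative kernel is integrable for free: at the origin the regularised integrals have
    nonnegative integrands and converge to the value of [phi] there, which is at most 1, and Fatou's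
    lemma passes to the limit. *)
Lemma ge0_fker_integrable phi : symbol phi -> (forall x, 0 <= fker phi x) ->
  leb.-integrable setT (EFin \o fker phi).
Proof.
move=> sp K0; have [p01 ip ev cp] := sp.
have mK := measurable_fker ip.
have h0 k : 0 < harmonic k :> R by rewrite /harmonic/= invr_gt0.
apply: (@integrable_ge0_finite _ _ _ _ _ 1) => //.
pose F k z := (pexpn (harmonic k) z * fker phi z)%:E.
have F0 k z : (0 <= F k z)%E by rewrite lee_fin mulr_ge0 ?pexpn_ge0.
have mF k : measurable_fun setT (F k).
  by apply/measurable_EFinP; apply: measurable_funM => //; exact: measurable_pexpn.
have iF k : leb.-integrable setT (F k).
  have cK z : `|fker phi z| <= (2 * pi) ^- n * (\int[leb]_y phi y)%R.
    rewrite normrM ger0_norm ?invr_ge0 ?(ltW pi2_gt0)// ler_wpM2l ?invr_ge0 ?(ltW pi2_gt0)//.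
    by apply: ctr_le => // y; have /andP[] := p01 y.
  apply: (le_integrable_bound (g := fun z => ((2 * pi) ^- n * (\int[leb]_y phi y)%R) * pexpn (harmonic k) z)).
  - by apply: measurable_funM => //; exact: measurable_pexpn.
  - by apply: integrableRZ; exact: integrable_pexpn.
  by move=> z; rewrite mulrC normrM (ger0_norm (pexpn_ge0 _ _)) ler_wpM2r ?pexpn_ge0.
have L : (\int[leb]_z F k z @[k --> \oo] --> (phi vzero)%:E)%E.
  have E k : (\int[leb]_z F k z = ((2 * pi) ^- n *
      (2^-1 * (\int[leb]_y (phi y * poisson (harmonic k) (vsub y vzero)) +
             \int[leb]_y (phi y * poisson (harmonic k) (vsub y (vopp vzero)))))%R)%:E)%E.
    rewrite -regularized_inversion//.
    rewrite -[LHS]fineK ?(integrable_fin_num _ (iF k))//; congr EFin.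
    apply: eq_Rintegral => z _; rewrite (_ : dot vzero z = 0) ?cos0 ?mul1r//.
    by rewrite /dot big1// => i _; rewrite tnth_mktuple mul0r.
  rewrite (eq_cvg _ _ E); apply: cvg_EFin; first exact: nearW.
  have -> : phi vzero = (2 * pi) ^- n * (2^-1 * ((2 * pi) ^+ n * phi vzero + (2 * pi) ^+ n * phi (vopp vzero))).
    rewrite ev; apply: half_mulVKf; exact: lt0r_neq0 pi2_gt0.
  apply: cvgM; first exact: cvg_cst.
  apply: cvgM; first exact: cvg_cst.
  by apply: cvgD; exact: poisson_approx.
have := @fatou _ _ R leb setT measurableT F mF (fun k z _ => F0 k z).
rewrite (cvg_limn_einf_sup L).1.
have /andP[_ p1] := p01 vzero.
rewrite -lee_fin in p1; move=> /le_trans/(_ p1); apply: le_trans.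
rewrite le_eqVlt; apply/orP; left; apply/eqP; apply: eq_integral => z _.
have Lz : F ^~ z @ \oo --> (fker phi z)%:E.
  apply: cvg_EFin; first exact: nearW.
  rewrite -[X in _ --> X]mul1r; apply: cvgM; last exact: cvg_cst.
  exact: cvg_pexpn.
by rewrite (cvg_limn_einf_sup Lz).1.
Qed.

Lemma Rintegral_fker phi : symbol phi -> leb.-integrable setT (EFin \o fker phi) ->
  (\int[leb]_z fker phi z = phi vzero)%R.
Proof.
move=> sp iK; rewrite -(inversion vzero sp iK); apply: eq_Rintegral => z _.
rewrite (_ : dot vzero z = 0) ?cos0 ?mul1r//.
by rewrite /dot big1// => i _; rewrite tnth_mktuple mul0r.
Qed.

(** After Fubini the inner integral is the transform of [fker psi] against cos((x - y).z); inversion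
    returns cos(x.z) psi(z), the sine term being zero. *)
Lemma conv_fker phi psi x : symbol phi -> symbol psi ->
  leb.-integrable setT (EFin \o fker psi) ->
  Defs.conv (fker phi) (fker psi) x = fker (fun y => phi y * psi y) x.
Proof.
move=> sp sq iK; have [p01 ip ev cp] := sp; have [q01 iq _ _] := sq.
have mp := measurable_sym ip; have mK := measurable_fker iq.
rewrite /Defs.conv.
transitivity (\int[leb]_y \int[leb]_z ((2 * pi) ^- n * (phi z * (cos (dot (vsub x y) z) * fker psi y))))%R.
  apply: eq_Rintegral => y _; rewrite {1}/fker /ctr -mulrA [X in _ * X]mulrC.
  rewrite -RintegralZl//; last exact: integrable_cosM.
  rewrite -RintegralZl//; last by apply: integrableRZ; exact: integrable_cosM.
  by apply: eq_Rintegral => z _; ring.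
rewrite (@RFubini _ _ _ _ R leb leb (fun yz => (2 * pi) ^- n * (phi yz.2 * (cos (dot (vsub x yz.1) yz.2) * fker psi yz.1)))
  (fun y => (2 * pi) ^- n * `|fker psi y|) phi)//.
- rewrite [in RHS]/fker [in RHS]/ctr -RintegralZl//; last first.
    apply: integrable_cosM; apply: (le_integrable_bound _ ip).
      by apply: measurable_funM => //; exact: measurable_sym.
    move=> y; have /andP[a0 _] := p01 y; have /andP[b0 b1] := q01 y.
    by rewrite ger0_norm ?mulr_ge0// ler_piMr.
  apply: eq_Rintegral => z _ /=.
  have iC := integrable_cosM z iK; have iS := integrable_sinM z iK.
  transitivity (\int[leb]_y ((2 * pi) ^- n * phi z * (cos (dot x z) * (cos (dot z y) * fker psi y)
    + sin (dot x z) * (sin (dot z y) * fker psi y))))%R.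
    apply: eq_Rintegral => y _; rewrite dot_vsub cosB (dotC y z); ring.
  rewrite RintegralZl//; last by apply: integrableRD; exact: integrableRZ.
  rewrite RintegralD//; [|exact: integrableRZ|exact: integrableRZ].
  rewrite !RintegralZl// inversion// inversion_sin//; ring.
- apply: measurable_funM => //; apply: measurable_funM; first exact: (measurableT_comp mp).
  apply: measurable_funM; last exact: (measurableT_comp mK).
  apply: (@measurableT_comp _ _ _ _ _ _ (@cos R)).
    by apply: continuous_measurable_fun; exact: continuous_cos.
  apply: (measurable_fun2 measurable_dot) => //.
  exact: (measurable_fun2 measurable_vsub (measurable_cst x)).
- by apply: integrableRZ; exact: integrable_norm iK.
move=> y z; have /andP[p0 _] := p01 z.
have c0 : 0 <= (2 * pi) ^- n :> R by rewrite invr_ge0 ltW// pi2_gt0.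
rewrite /=; move: (fker psi y) => Ky.
rewrite !normrM (ger0_norm p0) (ger0_norm c0) -mulrA ler_wpM2l//.
by rewrite mulrC ler_wpM2r// ler_piMl// cos_max.
Qed.

End inversion.

(** * Positivity of the stable heat kernel *)

Section PD.
Context {R : realType} {n : nat}.
Local Notation leb := (lebesgue_Rn R n).
Implicit Types (h m : Rn R n -> R) (x y z : Rn R n).

(* Multipliers preserving nonnegativity of the cosine transform: this replaces Bochner's theorem
   on positive definite functions, and is closed under products, mixtures and limits. *)
Definition pdm m := [/\ measurable_fun setT m, (exists B : R, forall y, `|m y| <= B) &
  forall h, leb.-integrable setT (EFin \o h) -> (forall x, 0 <= ctr h x) ->
  forall x, 0 <= ctr (fun y => m y * h y) x].

Lemma integrable_bddM m h (B : R) : measurable_fun setT m -> (forall y, `|m y| <= B) ->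
  leb.-integrable setT (EFin \o h) ->
  leb.-integrable setT (EFin \o (fun y => m y * h y)).
Proof.
move=> mm mB ih.
apply: (le_integrable_bound (g := fun y => B * `|h y|)).
- by apply: measurable_funM => //; exact: measurable_sym.
- by apply: integrableRZ; exact: integrable_norm ih.
by move=> y; rewrite normrM ler_wpM2r.
Qed.

Lemma pdm_mul m1 m2 : pdm m1 -> pdm m2 -> pdm (fun y => m1 y * m2 y).
Proof.
move=> [mm1 [B1 b1] p1] [mm2 [B2 b2] p2]; split.
- exact: measurable_funM.
- by exists (B1 * B2) => y; rewrite normrM ler_pM.
move=> h ih h0 x.
rewrite (_ : (fun y => _) = (fun y => m1 y * (m2 y * h y))); last by apply/funext => y; rewrite mulrA.
apply: p1; first exact: (integrable_bddM _ b2).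
exact: p2.
Qed.

Lemma pdm_cst (c : R) : 0 <= c -> pdm (cst c).
Proof.
move=> c0; split => //; first by exists `|c|.
move=> h ih h0 x; rewrite (_ : ctr _ x = c * ctr h x) ?mulr_ge0//.
rewrite /ctr -RintegralZl//; last exact: integrable_cosM.
by apply: eq_Rintegral => y _; rewrite mulrCA.
Qed.

Lemma pdm_add m1 m2 : pdm m1 -> pdm m2 -> pdm (fun y => m1 y + m2 y).
Proof.
move=> [mm1 [B1 b1] p1] [mm2 [B2 b2] p2]; split.
- exact: measurable_funD.
- by exists (B1 + B2) => y; rewrite (le_trans (ler_normD _ _))// lerD.
move=> h ih h0 x.
rewrite (_ : ctr _ x = ctr (fun y => m1 y * h y) x + ctr (fun y => m2 y * h y) x).
  by rewrite addr_ge0// ?p1 ?p2.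
rewrite /ctr -RintegralD//.
- by apply: eq_Rintegral => y _; rewrite -mulrDr mulrDl.
- by apply: integrable_cosM; exact: (integrable_bddM _ b1).
- by apply: integrable_cosM; exact: (integrable_bddM _ b2).
Qed.

Lemma pdm_exp_nat m k : pdm m -> pdm (fun y => m y ^+ k).
Proof.
move=> pm; elim: k => [|k ih]; first exact: (pdm_cst ler01).
rewrite (_ : (fun y => _) = (fun y => m y * m y ^+ k)); last by apply/funext => y; rewrite exprS.
exact: pdm_mul.
Qed.

Lemma pdm_sum (I : Type) (s : seq I) (F : I -> Rn R n -> R) :
  (forall i, pdm (F i)) -> pdm (fun y => \sum_(i <- s) F i y).
Proof.
move=> pF; elim: s => [|i s ih].
  rewrite (_ : (fun y => _) = cst 0); last by apply/funext => y; rewrite big_nil.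
  exact: pdm_cst.
rewrite (_ : (fun y => _) = (fun y => F i y + \sum_(j <- s) F j y)); last by apply/funext => y; rewrite big_cons.
exact: pdm_add.
Qed.

Lemma pdm_prod (I : Type) (s : seq I) (F : I -> Rn R n -> R) :
  (forall i, pdm (F i)) -> pdm (fun y => \prod_(i <- s) F i y).
Proof.
move=> pF; elim: s => [|i s ih].
  rewrite (_ : (fun y => _) = cst 1); last by apply/funext => y; rewrite big_nil.
  exact: pdm_cst.
rewrite (_ : (fun y => _) = (fun y => F i y * \prod_(j <- s) F j y)); last by apply/funext => y; rewrite big_cons.
exact: pdm_mul.
Qed.

Lemma pdm_lim (m_ : nat -> Rn R n -> R) m (B : R) : (forall k, pdm (m_ k)) ->
  (forall k y, `|m_ k y| <= B) -> (forall y, m_ ^~ y @ \oo --> m y) -> pdm m.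
Proof.
move=> pm mB mm.
have mmm : measurable_fun setT m.
  by apply: (measurable_fun_cvg (h := m_)) => [k|y _]; [have [] := pm k|exact: mm].
split=> //.
  exists B => y.
  by apply: (ler_cvg_to (cvg_norm (mm y)) (cvg_cst B)); apply: nearW => k; exact: mB.
move=> h ih h0 x.
have [||||_ _ _ L] := @Rdominated_convergence _ _ R leb (fun k y => cos (dot x y) * (m_ k y * h y))
   (fun y => cos (dot x y) * (m y * h y)) (fun y => B * `|h y|).
- move=> k; apply: measurable_funM; first exact: measurable_cosdot0.
  by apply: measurable_funM; [have [] := pm k|exact: measurable_sym].
- move=> y; apply: cvgM; first exact: cvg_cst.
  by apply: cvgM; [exact: mm|exact: cvg_cst].
- by apply: integrableRZ; exact: integrable_norm ih.
- move=> k y; rewrite !normrM; rewrite (@le_trans _ _ (`|m_ k y| * `|h y|))//.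
    by rewrite ler_piMl// ?mulr_ge0// cos_max.
  by rewrite ler_wpM2r.
apply: (ler_cvg_to (cvg_cst 0) L).
by apply: nearW => k; have [_ _] := pm k; exact.
Qed.

Definition vshift x (i : 'I_n) (a : R) : Rn R n :=
  [tuple (tnth x j : R) + (if j == i then a else 0) | j < n].

Lemma dot_vshift x i a y : dot (vshift x i a) y = dot x y + a * (tnth y i : R).
Proof.
rewrite /dot (bigD1 i)//= [in RHS](bigD1 i)//= !tnth_mktuple eqxx mulrDl addrAC.
congr (_ + _ + _); apply: eq_bigr => j ji.
by rewrite !tnth_mktuple (negbTE ji) addr0.
Qed.

(** By the addition formula, multiplying by cos(a y_i) replaces the transform by the mean of two
    translates, which stays nonnegative. *)
Lemma pdm_cos_coord i (a : R) : pdm (fun y => cos (a * (tnth y i : R))).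
Proof.
split.
- apply: (@measurableT_comp _ _ _ _ _ _ (@cos R)).
    by apply: continuous_measurable_fun; exact: continuous_cos.
  by apply: measurable_funM => //; exact: measurable_tnth.
- by exists 1 => y; exact: cos_max.
move=> h ih h0 x.
rewrite (_ : ctr _ x = 2^-1 * (ctr h (vshift x i a) + ctr h (vshift x i (- a)))).
  by rewrite mulr_ge0 ?addr_ge0.
rewrite /ctr -RintegralD//; [|exact: integrable_cosM|exact: integrable_cosM].
rewrite -RintegralZl//; last by apply: integrableRD; exact: integrable_cosM.
apply: eq_Rintegral => y _; rewrite !dot_vshift mulNr cosB cosD; field; exact: isT.
Qed.

Lemma pdm_mix (w : measurableTypeR R -> R) (F : measurableTypeR R -> Rn R n -> R) (B : R) :
  lebesgue_measure.-integrable setT (EFin \o w) -> (forall s, 0 <= w s) ->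
  measurable_fun setT (fun sy : measurableTypeR R * Rn R n => F sy.1 sy.2) ->
  (forall s y, `|F s y| <= B) -> (forall s, pdm (F s)) ->
  pdm (fun y => \int[lebesgue_measure]_s (w s * F s y))%R.
Proof.
move=> iw w0 mF FB pF.
have mw : measurable_fun setT w by apply/measurable_EFinP; exact: measurable_int _ iw.
have mFs y : measurable_fun setT (fun s => F s y).
  exact: (measurable_fun2 mF (@measurable_id _ _ _) (measurable_cst y)).
have iwF y : lebesgue_measure.-integrable setT (EFin \o (fun s => w s * F s y)).
  apply: (le_integrable_bound (g := fun s => B * w s)).
  - exact: measurable_funM.
  - exact: integrableRZ.
  by move=> s; rewrite normrM (ger0_norm (w0 s)) mulrC ler_wpM2r.
have mm : measurable_fun setT (fun y => \int[lebesgue_measure]_s (w s * F s y))%R.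
  apply: (@measurable_Rintegral2 _ _ _ _ R (@lebesgue_measure R) (fun ys : Rn R n * measurableTypeR R => w ys.2 * F ys.2 ys.1)).
  apply: measurable_funM; first exact: (measurableT_comp mw).
  exact: (measurable_fun2 mF).
have mB y : `|\int[lebesgue_measure]_s (w s * F s y)|%R <= (B * \int[lebesgue_measure]_s w s)%R.
  apply: (le_trans (le_normr_Rintegral measurableT (iwF y))).
  rewrite -RintegralZl//; apply: le_Rintegral => //.
  - exact: integrable_norm (iwF y).
  - exact: integrableRZ.
  by move=> s _; rewrite normrM (ger0_norm (w0 s)) mulrC ler_wpM2r.
split=> //; first by exists (B * \int[lebesgue_measure]_s w s)%R.
move=> h ih h0 x.
have mh := measurable_sym ih.
have -> : ctr (fun y => (\int[lebesgue_measure]_s (w s * F s y))%R * h y) x =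
    (\int[lebesgue_measure]_s (w s * ctr (fun y => F s y * h y) x))%R.
  rewrite /ctr.
  transitivity (\int[leb]_y \int[lebesgue_measure]_s (w s * (cos (dot x y) * (F s y * h y))))%R.
    apply: eq_Rintegral => y _.
    transitivity (cos (dot x y) * h y * \int[lebesgue_measure]_s (w s * F s y))%R; first by ring.
    by rewrite -RintegralZl//; apply: eq_Rintegral => s _; ring.
  rewrite (@RFubini _ _ _ _ R leb (@lebesgue_measure R) (fun ys : Rn R n * measurableTypeR R =>
     w ys.2 * (cos (dot x ys.1) * (F ys.2 ys.1 * h ys.1))) (fun y => B * `|h y|) w)//.
  - apply: eq_Rintegral => s _; rewrite /= RintegralZl//.
    apply: integrable_cosM; apply: (integrable_bddM _ (FB s)) => //.
    by have [] := pF s.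
  - apply: measurable_funM; first exact: (measurableT_comp mw).
    apply: measurable_funM; first exact: (measurableT_comp (measurable_cosdot0 x)).
    by apply: measurable_funM; [exact: (measurable_fun2 mF)|exact: (measurableT_comp mh)].
  - by apply: integrableRZ; exact: integrable_norm ih.
  move=> y s; rewrite /= normrM (ger0_norm (w0 s)) mulrC ler_wpM2r//.
  rewrite !normrM; apply: (@le_trans _ _ (`|F s y| * `|h y|)); last by rewrite ler_wpM2r.
  by rewrite ler_piMl ?mulr_ge0// cos_max.
apply: Rintegral_ge0 => s _; rewrite mulr_ge0//.
by have [_ _] := pF s; exact.
Qed.

(** A mixture of cosines: 1 / (1 + z^2) is the integral of cos(z s) against the density e^(-|s|) /
    2. *)
Lemma pdm_inv_sqr i (a : R) : pdm (fun y => (1 + (a * (tnth y i : R)) ^+ 2)^-1).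
Proof.
have iw : lebesgue_measure.-integrable setT (EFin \o (fun s : measurableTypeR R => 2^-1 * expR (- (1 * `|s : R|)))).
  exact: (integrableZl measurableT (2^-1) (@integrable_pexp R 1 ltr01)).
have := @pdm_mix (fun s => 2^-1 * expR (- (1 * `|s : R|))) (fun s y => cos ((a * s) * (tnth y i : R))) 1 iw.
have -> : (fun y => (1 + (a * (tnth y i : R)) ^+ 2)^-1) =
  (fun y : Rn R n => \int[lebesgue_measure]_s (2^-1 * expR (- (1 * `|s : R|)) * cos (a * s * (tnth y i : R))))%R.
  apply/funext => y.
  rewrite (_ : (1 + _)^-1 = 2^-1 * (2 * 1 / (1 ^+ 2 + (a * (tnth y i : R)) ^+ 2))); last first.
    by rewrite expr1n mulr1 mulrA mulVf ?mul1r.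
  rewrite -Rintegral_cos_pexp// -RintegralZl//; last first.
    apply: (le_integrable_bound _ (@integrable_pexp R 1 ltr01)).
      apply: measurable_funM; last by apply/measurable_EFinP; exact: measurable_int _ (@integrable_pexp R 1 ltr01).
      apply: (@measurableT_comp _ _ _ _ _ _ (@cos R)); last exact: measurable_funM.
      by apply: continuous_measurable_fun; exact: continuous_cos.
    by move=> s; rewrite normrM (ger0_norm (expR_ge0 _)) ler_piMl ?expR_ge0// cos_max.
  apply: eq_Rintegral => s _; rewrite -!mulrA; congr (_ * _); rewrite mulrC; congr (_ * cos _).
  by rewrite mulrCA mulrC -mulrA mulrCA.
apply.
- by move=> s; rewrite mulr_ge0// expR_ge0.
- apply: (@measurableT_comp _ _ _ _ _ _ (@cos R)).
    by apply: continuous_measurable_fun; exact: continuous_cos.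
  apply: measurable_funM; first exact: measurable_funM.
  exact: (measurableT_comp (measurable_tnth i)).
- by move=> s y; exact: cos_max.
- by move=> s; exact: pdm_cos_coord.
Qed.

Lemma expR_ratio_le (x : R) : 0 <= x -> expR (x / (1 + x)) <= 1 + x.
Proof.
move=> x0; have x1 : 0 < 1 + x by rewrite ltr_pwDl.
have := expR_ge1Dx (- (x / (1 + x))).
have -> : 1 - x / (1 + x) = (1 + x)^-1 by field; rewrite gt_eqF.
by rewrite expRN lef_pV2 ?posrE ?expR_gt0.
Qed.

(** Squeezed between exponentials by e^(x / (1 + x)) <= 1 + x <= e^x with x = u / (k + 1). *)
Lemma cvg_inv_1Dexp (u : R) : 0 <= u ->
  (1 + u / k.+1%:R) ^- k.+1 @[k --> \oo] --> expR (- u).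
Proof.
move=> u0.
have uk k : 0 <= u / k.+1%:R by rewrite divr_ge0.
apply: (@squeeze_cvgr _ _ _ _ (cst (expR (- u))) (fun k => expR (- (u / (1 + u / k.+1%:R))))).
- apply: nearW => k; apply/andP; split.
    rewrite /= -exprVn expRN -{1}(divfK (_ : k.+1%:R != 0 :> R) u)//.
    rewrite expRM_natr -exprVn lerXn2r// ?nnegrE ?invr_ge0 ?expR_ge0 ?addr_ge0//.
    by rewrite lef_pV2 ?posrE ?expR_gt0 ?ltr_pwDl// expR_ge1Dx.
  rewrite -exprVn expRN.
  have -> : u / (1 + u / k.+1%:R) = (u / k.+1%:R) / (1 + u / k.+1%:R) * k.+1%:R.
    by rewrite mulrAC divfK.
  rewrite expRM_natr -exprVn lerXn2r// ?nnegrE ?invr_ge0 ?expR_ge0 ?addr_ge0//.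
  by rewrite lef_pV2 ?posrE ?expR_gt0 ?ltr_pwDl// expR_ratio_le.
- exact: cvg_cst.
- apply: (@cvg_comp _ _ _ (fun k => - (u / (1 + u / k.+1%:R))) expR); last exact: continuous_expR.
  apply: cvgN; rewrite -[X in _ --> X]divr1; apply: cvgM; first exact: cvg_cst.
  apply: cvgV; first exact: oner_neq0.
  have := cvgD (cvg_cst (1 : R)) (cvgM (cvg_cst u) (@cvg_harmonic R)).
  by rewrite mulr0 addr0; exact.
Qed.

(** Each factor e^(-tau y_i^2) is the limit of powers of [pdm_inv_sqr] by Euler's formula, so the
    transform of a Gaussian is never computed. *)
Lemma pdm_gauss (tau : R) : 0 <= tau -> pdm (fun y => expR (- (tau * dot y y))).
Proof.
move=> t0.
have G i : pdm (fun y => expR (- (tau * (tnth y i : R) ^+ 2))).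
  apply: (@pdm_lim (fun k y => (1 + (tau * (tnth y i : R) ^+ 2) / k.+1%:R) ^- k.+1) _ 1).
  - move=> k.
    rewrite (_ : (fun y => _) = (fun y => ((1 + (Num.sqrt (tau / k.+1%:R) * (tnth y i : R)) ^+ 2)^-1) ^+ k.+1)).
      by apply: pdm_exp_nat; exact: pdm_inv_sqr.
    by apply/funext => y; rewrite exprVn exprMn sqr_sqrtr ?divr_ge0// mulrAC.
  - move=> k y; have h : 0 <= tau * (tnth y i : R) ^+ 2 / k.+1%:R.
      by rewrite divr_ge0// mulr_ge0// sqr_ge0.
    rewrite ger0_norm; last by rewrite invr_ge0 exprn_ge0// addr_ge0.
    by rewrite -exprVn exprn_ile1 ?invr_ge0 ?addr_ge0// invf_le1 ?lerDl// ltr_pwDl.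
  - by move=> y; apply: cvg_inv_1Dexp; rewrite mulr_ge0// sqr_ge0.
rewrite (_ : (fun y => _) = (fun y => \prod_(i < n) expR (- (tau * (tnth y i : R) ^+ 2)))).
  exact: pdm_prod.
by apply/funext => y; rewrite dotxxE mulr_sumr -sumrN expR_sum.
Qed.

(** The exponential series has nonnegative coefficients, so its partial sums are multipliers,
    uniformly bounded by the exponential of a bound of [m]. *)
Lemma pdm_expR m : pdm m -> pdm (fun y => expR (m y)).
Proof.
move=> pm; have [mm [B mB] _] := pm.
have B0 : 0 <= B by apply: le_trans (mB vzero).
have S (x : R) K : series (exp_coeff x) K = \sum_(k < K) x ^+ k / k`!%:R.
  by rewrite /series/= big_mkord.
apply: (@pdm_lim (fun K y => \sum_(k < K) m y ^+ k / k`!%:R) _ (expR B)).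
- move=> K; apply: pdm_sum => k.
  apply: pdm_mul; first exact: pdm_exp_nat.
  by apply: pdm_cst; rewrite invr_ge0.
- move=> K y; apply: (le_trans (ler_norm_sum _ _ _)).
  apply: (@le_trans _ _ (\sum_(k < K) B ^+ k / k`!%:R)).
    apply: ler_sum => k _; rewrite normrM (@ger0_norm _ (_^-1)) ?invr_ge0// ler_wpM2r ?invr_ge0//.
    by rewrite normrX lerXn2r ?nnegrE.
  rewrite -S; apply: nondecreasing_cvgn_le; last exact: is_cvg_series_exp_coeff.
  apply/nondecreasing_seqP => k; rewrite !S big_ord_recr/= lerDl.
  by rewrite divr_ge0 ?exprn_ge0.
- move=> y; have := @is_cvg_series_exp_coeff R (m y).
  by move=> h; under eq_fun do rewrite -S; exact: h.
Qed.

(* [lam ^ d] is, up to a constant, the integral of [1 - expR (- s lam)] against the Levy density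
   [s ^ (-1 - d)] of the [d]-stable subordinator; [a > 0] truncates it to a finite measure. *)
Section levy.
Variable d : R.
Hypotheses (d0 : 0 < d) (d1 : d < 1).
Local Notation mu := (@lebesgue_measure R).

Definition levy (a s : R) : R := s `^ (- 1 - d) * (a < s)%R%:R.

Lemma measurable_levy a : measurable_fun setT (levy a : measurableTypeR R -> R).
Proof.
apply: measurable_funM; first exact: measurable_powR.
rewrite (_ : (fun s => _) = \1_(`]a, +oo[%classic : set R)); first exact: measurable_indic.
apply/funext => s; rewrite indicE; congr (_%:R); congr nat_of_bool.
by apply/idP/idP => [sa|/set_mem]; [apply: mem_set; rewrite /= in_itv/= sa|rewrite /= in_itv/= andbT].
Qed.

Lemma levy_ge0 a s : 0 <= levy a s.
Proof. by rewrite mulr_ge0// powR_ge0. Qed.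

Lemma integral_levy a : 0 < a -> mu.-integrable setT (EFin \o levy a).
Proof.
move=> a0.
pose F (s : R) : R := - d^-1 * s `^ (- d).
have dF (s : R) : 0 < s -> is_derive (s : R) 1 F (s `^ (-1 - d)).
  move=> s0; have H := is_derive1_powR (- d) s0.
  apply: is_derive_eq; rewrite /GRing.scale/= (_ : - d - 1 = -1 - d); last by ring.
  by rewrite mulrA mulrNN mulVf ?mul1r// gt_eqF.
have cp (r s : R) : 0 < s -> {for s, continuous (fun s : R => s `^ r)}.
  move=> s0; apply: differentiable_continuous; apply/derivable1_diffP.
  by have [] := is_derive1_powR r s0.
apply: (@integrable_ge0_finite _ _ _ _ _ (0 - F a)); [exact: measurable_levy|exact: levy_ge0|].
have <- : (\int[mu]_(s in `[a, +oo[) (s `^ (-1 - d))%:E = (0 - F a)%:E)%E.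
  rewrite (@ge0_continuous_FTC2y _ _ F a 0)//.
  - by move=> s _; exact: powR_ge0.
  - apply: continuous_in_subspaceT => s; rewrite inE/= in_itv/= andbT => sa.
    by apply: cp; exact: lt_le_trans sa.
  - rewrite -[X in _ --> X](mulr0 (- d^-1)); apply: cvgM; first exact: cvg_cst.
    apply/cvgr0Pnorm_le => eps eps0; near=> s.
    have s0 : 0 < s by near: s; exact: nbhs_pinfty_gt.
    rewrite ger0_norm ?powR_ge0// powRN invf_ple ?posrE ?powR_gt0//.
    have -> : eps^-1 = (eps^-1 `^ d^-1) `^ d.
      by rewrite -powRrM mulVf ?gt_eqF// powRr1// invr_ge0 ltW.
    rewrite ge0_ler_powR ?nnegrE ?powR_ge0 ?(ltW s0) ?(ltW d0)//.
  - by move=> s sa; have [] := dF s (lt_trans a0 sa).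
  - apply: cvg_at_right_filter; apply: cvgM; first exact: cvg_cst.
    exact: cp.
  - move=> s; rewrite in_itv/= andbT => sa; rewrite derive1E.
    by have [_ ->] := dF s (lt_trans a0 sa).
rewrite [leRHS]integral_mkcond; apply: ge0_le_integral => //.
- by move=> s _; rewrite lee_fin levy_ge0.
- by apply/measurable_EFinP; exact: measurable_levy.
- apply/(measurable_restrictT _ _).1 => //; apply: measurable_funTS.
  by apply/measurable_EFinP; exact: measurable_powR.
move=> s _; rewrite patchE /levy; case: ifPn => [|/negP] sa.
  by rewrite lee_fin ler_piMr ?powR_ge0//; case: (_ < _).
rewrite (_ : a < s = false) ?mulr0//.
by apply/negbTE; apply/negP => h; apply: sa; apply: mem_set; rewrite /= in_itv/= andbT ltW.
Unshelve. all: by end_near. Qed.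

(** For a >= 0 the density vanishes on the negative half-line, so [|s|] changes nothing there; it
    keeps the second factor between 0 and 1 on the whole line when lam >= 0. *)
Definition levy_int (a lam s : R) : R := levy a s * (1 - expR (- (`|s| * lam))).

Lemma levy_int_ge0 a lam s : 0 <= lam -> 0 <= levy_int a lam s.
Proof.
by move=> l0; rewrite mulr_ge0 ?levy_ge0// subr_ge0 expR_le1 oppr_le0 mulr_ge0.
Qed.

Lemma measurable_levy_int a lam : measurable_fun setT (levy_int a lam : measurableTypeR R -> R).
Proof.
apply: measurable_funM; first exact: measurable_levy.
apply: measurable_funB => //; apply: (@measurableT_comp _ _ _ _ _ _ expR) => //.
by apply: measurableT_comp => //; apply: measurable_funM => //; exact: measurableT_comp.
Qed.

(** On ]0, 1] the bound 1 - e^(-s lam) <= s lam leaves s^(-d), integrable because d < 1; beyond 1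
    the density itself is integrable because d > 0. *)
Lemma integral_levy_int_lty lam : 0 <= lam ->
  (\int[mu]_s (levy_int 0 lam s)%:E < +oo)%E.
Proof.
move=> l0; have i1 := integral_levy ltr01.
pose g (s : measurableTypeR R) : R := lam * (s `^ (- d) * \1_(`]0, 1]%classic : set R) s) + levy 1 s.
have ms : measurable_fun setT (fun s : measurableTypeR R => s `^ (- d) * \1_(`]0, 1]%classic : set R) s).
  by apply: measurable_funM; [exact: measurable_powR|exact: measurable_indic].
have ig : mu.-integrable setT (EFin \o g).
  apply: integrableRD => //; apply: integrableRZ.
  apply: (@integrable_ge0_finite _ _ _ _ _ (1 `^ (- d + 1) / (- d + 1))) => //.
    by move=> s; rewrite mulr_ge0 ?powR_ge0.
  rewrite -integral_powR0//; last by rewrite ltrN2.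
  rewrite [leRHS]integral_mkcond le_eqVlt; apply/orP; left; apply/eqP.
  apply: eq_integral => s _; rewrite patchE indicE; case: ifPn => _; first by rewrite mulr1.
  by rewrite mulr0.
apply: (le_lt_trans _ (integrable_lty measurableT ig)).
apply: ge0_le_integral => //.
- by move=> s _; rewrite lee_fin levy_int_ge0.
- by apply/measurable_EFinP; exact: measurable_levy_int.
- exact: measurable_int _ ig.
move=> s _; rewrite /= lee_fin /levy_int /g.
have [s0|s0] := leP s 0.
  rewrite {1}/levy ltNge s0/= mulr0 mul0r addr_ge0 ?levy_ge0//.
  by rewrite mulr_ge0// mulr_ge0 ?powR_ge0.
have [s1|s1] := leP s 1.
  rewrite indicE mem_set/=; last by rewrite in_itv/= s0.
  rewrite mulr1 {2}/levy ltNge s1/= mulr0 addr0 /levy s0 mulr1.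
  have -> : lam * s `^ (- d) = s `^ (-1 - d) * (s * lam).
    have -> : s `^ (- d) = s `^ (-1 - d) * s.
      rewrite -{3}(powRr1 (ltW s0)) -powRD; first by congr (_ `^ _); ring.
      by rewrite (gt_eqF s0) implybT.
    by ring.
  rewrite ler_wpM2l ?powR_ge0// gtr0_norm// lerBlDl.
  have := expR_ge1Dx (- (s * lam)); lra.
rewrite indicE memNset/=; last by rewrite in_itv/= s0 leNgt s1.
by rewrite !mulr0 add0r /levy s0 s1 !mulr1 ler_piMr ?powR_ge0// gerBl expR_ge0.
Qed.

(** The substitution s -> lam s exhibits the homogeneity of degree d. The constant is never
    evaluated: only its finiteness and positivity matter. *)
Lemma integral_levy_int_scale lam : 0 < lam ->
  (\int[mu]_s (levy_int 0 lam s)%:E = (lam `^ d)%:E * \int[mu]_s (levy_int 0 1 s)%:E)%E.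
Proof.
move=> l0.
have m1 : measurable_fun setT (fun s : measurableTypeR R => (levy_int 0 1 s)%:E : \bar R).
  by apply/measurable_EFinP; exact: measurable_levy_int.
have ml : measurable_fun setT (fun s : measurableTypeR R => (levy_int 0 lam s)%:E : \bar R).
  by apply/measurable_EFinP; exact: measurable_levy_int.
have := @ge0_integral_affine R lam 0 (fun s => (levy_int 0 1 s)%:E) (lt0r_neq0 l0) m1.
have P0 s : (0 <= (levy_int 0 1 s)%:E)%E by rewrite lee_fin levy_int_ge0.
move=> /(_ P0).
have -> : (\int[mu]_x (levy_int 0 1 (lam * x + 0))%:E = (lam `^ (-1 - d))%:E * \int[mu]_s (levy_int 0 lam s)%:E)%E.
  rewrite -ge0_integralZl_EFin ?powR_ge0//; last by move=> s _; rewrite lee_fin levy_int_ge0// ltW.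
  apply: eq_integral => s _; rewrite -EFinM addr0 /levy_int /levy pmulr_rgt0//.
  have [s0|s0] := ltP 0 (s : R); last by rewrite !mulr0 !mul0r mulr0.
  rewrite powRM ?ltW// !mulr1 normrM (gtr0_norm l0) (mulrC lam `|_|) -!mulrA//.
move/(congr1 (fun z : \bar R => (lam `^ (1 + d))%:E * z)%E); rewrite !muleA -!EFinM.
have lp r1 r2 : lam `^ r1 * lam `^ r2 = lam `^ (r1 + r2).
  by rewrite powRD// (gt_eqF l0) implybT.
rewrite lp (_ : 1 + d + (-1 - d) = 0) ?powRr0 ?mul1e; last by ring.
rewrite (gtr0_norm l0) => ->; congr (_%:E * _)%E.
rewrite -[X in _ * X]powR_inv1 ?(ltW l0)// lp; congr (_ `^ _); ring.
Qed.

Lemma integral_levy_int_gt0 : (0 < \int[mu]_s (levy_int 0 1 s)%:E)%E.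
Proof.
pose c := 2 `^ (-1 - d) * (1 - expR (-1)).
have c0 : 0 < c.
  by rewrite mulr_gt0 ?powR_gt0// subr_gt0 expR_lt1 oppr_lt0.
apply: (@lt_le_trans _ _ (\int[mu]_(s in `]1%R, 2%R]) (c%:E)))%E.
  have E : mu `]1%R, 2%R]%classic = 1%E.
    by rewrite lebesgue_measure_itv/= lte_fin ltr1n -EFinB; congr EFin; ring.
  by rewrite integral_cst// [X in (_ * X)%E]E mule1 lte_fin.
have ml : measurable_fun setT (fun s : measurableTypeR R => (levy_int 0 1 s)%:E : \bar R).
  by apply/measurable_EFinP; exact: measurable_levy_int.
apply: (@le_trans _ _ (\int[mu]_(s in `]1%R, 2%R]) (levy_int 0 1 s)%:E)%E); last first.
  by apply: ge0_subset_integral => // s _; rewrite lee_fin levy_int_ge0.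
apply: ge0_le_integral => //.
- by move=> s _; rewrite lee_fin ltW.
- exact: measurable_funTS.
move=> s; rewrite /= in_itv/= => /andP[s1 s2]; rewrite lee_fin /levy_int /levy.
have s0 : 0 < s by apply: lt_trans s1.
rewrite s0 mulr1 gtr0_norm// mulr1 /c ler_pM ?powR_ge0//.
- rewrite -opprD !powRN lef_pV2 ?posrE ?powR_gt0//.
  by rewrite ge0_ler_powR ?nnegrE ?(ltW s0) ?addr_ge0 ?(ltW d0).
by rewrite lerD2l lerN2 ler_expR lerN2 ltW.
Qed.

(** Compound Poisson approximation: with the Levy density truncated to finite mass, the exponent is
    a constant plus a mixture of Gaussians, whose exponential is a multiplier; monotone convergence
    then removes the truncation. *)
Lemma pdm_stable (t : R) : 0 <= t -> pdm (fun y => expR (- (t * dot y y `^ d))).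
Proof.
move=> t0.
pose G1 := fine (\int[mu]_s (levy_int 0 1 s)%:E)%E.
have G1E : (\int[mu]_s (levy_int 0 1 s)%:E = G1%:E)%E.
  by rewrite fineK// ge0_fin_numE ?integral_levy_int_lty// ltW// integral_levy_int_gt0.
have G10 : 0 < G1 by have := integral_levy_int_gt0; rewrite G1E lte_fin.
(* Normalises the Levy exponent: c times lam^d [G1] is t lam^d. *)
pose c := t / G1.
have c0 : 0 <= c by rewrite divr_ge0// ltW.
pose a (k : nat) : R := harmonic k.
have a0 k : 0 < a k by rewrite /a /harmonic/= invr_gt0.
pose I k lam := (\int[mu]_s (levy_int (a k) lam s))%R.
have ili k lam : 0 <= lam -> mu.-integrable setT (EFin \o levy_int (a k) lam).
  move=> l0; apply: (le_integrable_bound _ (integral_levy (a0 k))); first exact: measurable_levy_int.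
  by move=> s; rewrite ger0_norm ?levy_int_ge0// ler_piMr ?levy_ge0// gerBl expR_ge0.
apply: (@pdm_lim (fun k y => expR (- (c * I k (dot y y)))) _ 1).
- move=> k.
  pose w := levy (a k).
  have pm := @pdm_mix w (fun s y => expR (- (`|s : R| * dot y y))) 1 (integral_levy (a0 k)) (levy_ge0 (a k)).
  rewrite (_ : (fun y => _) = (fun y => expR (- (c * \int[mu]_s w s)) * expR (c * \int[mu]_s (w s * expR (- (`|s : R| * dot y y)))))%R); last first.
    apply/funext => y; rewrite -expRD; congr expR; rewrite /I.
    have i2 : mu.-integrable setT (EFin \o (fun s : measurableTypeR R => w s * expR (- (`|s : R| * dot y y)))).
      apply: (le_integrable_bound _ (integral_levy (a0 k))).
        apply: measurable_funM; first exact: measurable_levy.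
        apply: (@measurableT_comp _ _ _ _ _ _ expR) => //.
        by apply: measurableT_comp => //; apply: measurable_funM => //; exact: measurableT_comp.
      move=> s; have e1 : expR (- (`|s : R| * dot y y)) <= 1.
        by rewrite expR_le1 oppr_le0 mulr_ge0// dotxx_ge0.
      rewrite normrM (ger0_norm (levy_ge0 _ _)) (ger0_norm (expR_ge0 _)).
      by rewrite ler_piMr// levy_ge0.
    have -> : (\int[mu]_s levy_int (a k) (dot y y) s =
        \int[mu]_s w s - \int[mu]_s (w s * expR (- (`|s : R| * dot y y))))%R.
      rewrite -RintegralB//; last exact: integral_levy.
      by apply: eq_Rintegral => s _; rewrite /levy_int mulrBr mulr1.
    by rewrite mulrBr opprB addrC.
  apply: pdm_mul; first by apply: pdm_cst; exact: expR_ge0.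
  apply: pdm_expR; apply: pdm_mul; first exact: pdm_cst.
  apply: pm.
  + apply: (@measurableT_comp _ _ _ _ _ _ expR) => //.
    apply: measurableT_comp => //; apply: measurable_funM.
      by apply: measurableT_comp => //; exact: measurableT_comp.
    exact: (measurableT_comp measurable_dotxx).
  + by move=> s y; rewrite ger0_norm ?expR_ge0// expR_le1 oppr_le0 mulr_ge0// dotxx_ge0.
  + by move=> s; exact: pdm_gauss.
- move=> k y; rewrite ger0_norm ?expR_ge0// expR_le1 oppr_le0 mulr_ge0//.
  by apply: Rintegral_ge0 => s _; rewrite levy_int_ge0// dotxx_ge0.
move=> y; set lam := dot y y; have l0 : 0 <= lam := dotxx_ge0 y.
apply: (@cvg_comp _ _ _ (fun k => - (c * I k lam)) expR); last exact: continuous_expR.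
have -> : t * lam `^ d = c * (lam `^ d * G1) by rewrite /c; field; rewrite gt_eqF.
apply: cvgN; apply: cvgM; first exact: cvg_cst.
have GE : (\int[mu]_s (levy_int 0 lam s)%:E = (lam `^ d * G1)%:E)%E.
  move: l0; rewrite le_eqVlt => /predU1P[<-|l0]; last by rewrite integral_levy_int_scale// G1E.
  rewrite powR0 ?gt_eqF// mul0r.
  under eq_integral do rewrite /levy_int mulr0 oppr0 expR0 subrr mulr0.
  exact: integral0.
apply: (@fine_cvg _ _ _ _ (fun k => \int[mu]_s (levy_int (a k) lam s)%:E)%E).
rewrite -GE.
have LE s : (fun k => (levy_int (a k) lam s)%:E) @ \oo --> (levy_int 0 lam s)%:E.
  apply: cvg_EFin; first exact: nearW.
  apply: cvg_near_cst; have [s0|s0] := ltP 0 s.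
    have : \forall k \near \oo, a k < s by apply: (cvgr_lt _ (@cvg_harmonic R)).
    by apply: filterS => k /= aks; rewrite /levy_int /levy s0 aks.
  apply: nearW => k; rewrite /levy_int /levy /=.
  have -> : (0 < s) = false by apply/negbTE; rewrite -leNgt.
  have -> // : (a k < s) = false by apply/negbTE; rewrite -leNgt (le_trans s0)// ltW.
rewrite (eq_integral (fun s : measurableTypeR R => limn (fun k => (levy_int (a k) lam s)%:E))); last first.
  by move=> s _; apply/esym/cvg_lim => //; exact: LE.
apply: cvg_monotone_convergence => //.
- by move=> k; apply/measurable_EFinP; exact: measurable_levy_int.
- by move=> k s _; rewrite lee_fin levy_int_ge0.
move=> s _ k1 k2 k12; rewrite lee_fin /levy_int ler_wpM2r//.
  by rewrite subr_ge0 expR_le1 oppr_le0 mulr_ge0.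
rewrite /levy ler_wpM2l ?powR_ge0// ler_nat.
have [k1s|_] := ltP (a k1) s; last by [].
rewrite (le_lt_trans _ k1s)// /a /harmonic/= lef_pV2 ?posrE// ler_nat; lia.
Qed.

End levy.

End PD.

(** * The symbol of the heat semigroup and positivity of its kernel *)

Section heat_symbol.
Context {R : realType} {n : nat}.
Local Notation leb := (lebesgue_Rn R n).
Implicit Types (x y z : Rn R n) (d t : R).

Definition heat_symbol d t y : R := expR (- t * enorm y `^ (2 * d)).

Lemma enorm_powR y d : enorm y `^ (2 * d) = dot y y `^ d.
Proof. by rewrite powRrM powR_mulrn ?enorm_ge0// sqr_enorm. Qed.

Lemma heat_symbol_ge0 d t y : 0 <= heat_symbol d t y.
Proof. exact: expR_ge0. Qed.

Lemma heat_symbol_le1 d t y : 0 <= t -> heat_symbol d t y <= 1.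
Proof. by move=> t0; rewrite expR_le1 mulNr oppr_le0 mulr_ge0// powR_ge0. Qed.

Lemma measurable_heat_symbol d t : measurable_fun setT (heat_symbol d t : Rn R n -> R).
Proof.
apply: (@measurableT_comp _ _ _ _ _ _ expR) => //; apply: measurable_funM => //.
by apply: (measurableT_comp (measurable_powR _)); exact: measurable_enorm.
Qed.

Lemma heat_symbol_decay d t (M : nat) : 0 < d -> 0 < t ->
  exists2 C : R, 0 <= C & forall y, (1 + dot y y) ^+ M * heat_symbol d t y <= C.
Proof.
move=> d0 t0.
(* With M <= d m and r >= 1, (1 + r)^M is at most 2^M r^(d m) = 2^M (u / t)^m for u = t r^d, and u^m
   e^(-u) <= m! gives the second term of [C]; the first covers r <= 1. *)
pose m := (Num.truncn (M%:R / d)).+1.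
have Mm : M%:R <= d * m%:R.
  by rewrite mulrC -ler_pdivrMr// ltW// truncnS_gt.
pose C := 2 ^+ M * (1 + m`!%:R / t ^+ m).
exists C; first by rewrite mulr_ge0// addr_ge0// divr_ge0// exprn_ge0// ltW.
move=> y; set r := dot y y; have r0 : 0 <= r := dotxx_ge0 y.
have [r1|r1] := leP r 1.
  rewrite -[leRHS]mulr1 ler_pM ?heat_symbol_ge0 ?exprn_ge0 ?addr_ge0 ?heat_symbol_le1 ?(ltW t0)//.
  rewrite /C (@le_trans _ _ (2 ^+ M))//.
    by rewrite lerXn2r ?nnegrE ?addr_ge0// (_ : 2 = 1 + 1)// lerD2l.
  by rewrite ler_peMr ?exprn_ge0// lerDl divr_ge0// exprn_ge0// ltW.
have rp : 0 < r by apply: lt_trans r1.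
apply: (@le_trans _ _ (2 ^+ M * r `^ (d * m%:R) * heat_symbol d t y)).
  rewrite ler_wpM2r ?heat_symbol_ge0//.
  apply: (@le_trans _ _ ((2 * r) ^+ M)).
    rewrite lerXn2r ?nnegrE ?addr_ge0 ?mulr_ge0//; first lra.
  rewrite exprMn ler_wpM2l ?exprn_ge0// -powR_mulrn// ler_powR//; exact: ltW.
rewrite /C -mulrA ler_wpM2l ?exprn_ge0//.
apply: (@le_trans _ _ (m`!%:R / t ^+ m)); last by rewrite lerDr.
pose u := t * r `^ d.
have u0 : 0 < u by rewrite mulr_gt0// powR_gt0.
have rE : r `^ (d * m%:R) = u ^+ m / t ^+ m.
  rewrite powRrM powR_mulrn ?powR_ge0// /u exprMn mulrAC mulfV ?mul1r//.
  by rewrite expf_neq0// gt_eqF.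
have -> : heat_symbol d t y = (expR u)^-1 by rewrite /heat_symbol enorm_powR -expRN mulNr.
rewrite rE mulrAC ler_wpM2r ?invr_ge0 ?exprn_ge0 ?(ltW t0)//.
rewrite ler_pdivrMr ?expR_gt0//.
have := expR_ge1Dxn m.-1 (ltW u0); rewrite prednK// => h.
have f0 : 0 < m`!%:R :> R by rewrite ltr0n fact_gt0.
rewrite mulrC -ler_pdivrMr//; apply: le_trans h; rewrite lerDr//.
Qed.

Lemma integrable_heat_symbol d t : 0 < d -> 0 < t ->
  leb.-integrable setT (EFin \o heat_symbol d t).
Proof.
move=> d0 t0; have [C C0 hC] := heat_symbol_decay n d0 t0.
apply: (le_integrable_bound (g := fun y => C * weight y)).
- exact: measurable_heat_symbol.
- by apply: integrableRZ; exact: integrable_weight.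
move=> y; rewrite ger0_norm ?heat_symbol_ge0// /weight ler_pdivlMr; first by rewrite mulrC.
by rewrite exprn_gt0// ltr_pwDl// dotxx_ge0.
Qed.

Lemma dot_affxx (e : R) x z : dot (aff e x z) (aff e x z) =
  e * (e * dot z z + dot x z) + (e * dot z x + dot x x).
Proof. by rewrite dot_aff dotC dot_aff (dotC x (aff _ _ _)) dot_aff. Qed.

Lemma cvg_powR_nneg (u : nat -> R) (l p : R) : 0 < p -> (forall k, 0 <= u k) ->
  u @ \oo --> l -> u k `^ p @[k --> \oo] --> l `^ p.
Proof.
move=> p0 u0 ul.
have l0 : 0 <= l by apply: (ler_cvg_to (cvg_cst 0) ul); apply: nearW.
move: l0; rewrite le_eqVlt => /predU1P[l0|l0]; last first.
  have cl : {for l, continuous (fun s : R => s `^ p)}.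
    apply: differentiable_continuous; apply/derivable1_diffP.
    by have [] := is_derive1_powR p l0.
  exact: (@cvg_comp _ _ _ u (fun s : R => s `^ p) _ _ _ ul cl).
rewrite -l0 in ul *; rewrite powR0 ?gt_eqF//.
apply/cvgr0Pnorm_le => eps eps0.
have e0 : 0 < eps `^ p^-1 by rewrite powR_gt0.
have : \forall k \near \oo, u k <= eps `^ p^-1 by apply: (cvgr_le _ ul).
apply: filterS => k uk; rewrite ger0_norm ?powR_ge0//.
have -> : eps = (eps `^ p^-1) `^ p by rewrite -powRrM mulVf ?gt_eqF// powRr1// ltW.
by rewrite ge0_ler_powR ?nnegrE ?(ltW p0)// ltW.
Qed.

Lemma heat_symbol_sym d t : 0 < d -> 0 < t -> symbol (heat_symbol d t : Rn R n -> R).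
Proof.
move=> d0 t0; split.
- by move=> y; rewrite heat_symbol_ge0 heat_symbol_le1// ltW.
- exact: integrable_heat_symbol.
- move=> y; have E : dot (vopp y) (vopp y) = dot y y by rewrite dot_vopp dotC dot_vopp opprK.
  by rewrite /heat_symbol !enorm_powR E.
move=> x z e e0; rewrite /heat_symbol.
apply: (@cvg_comp _ _ _ (fun k => - t * enorm (aff (e k) x z) `^ (2 * d)) expR); last exact: continuous_expR.
apply: cvgM; first exact: cvg_cst.
rewrite enorm_powR; under eq_fun do rewrite enorm_powR.
apply: cvg_powR_nneg => //; first by move=> k; exact: dotxx_ge0.
under eq_fun do rewrite dot_affxx.
have := cvgD (cvgM e0 (cvgD (cvgM e0 (cvg_cst (dot z z))) (cvg_cst (dot x z))))
  (cvgD (cvgM e0 (cvg_cst (dot z x))) (cvg_cst (dot x x))).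
by rewrite !mul0r !add0r; exact.
Qed.

Lemma heat_kernelE d t : heat_kernel d t = fker (heat_symbol d t) :> (Rn R n -> R).
Proof. by []. Qed.

(** The symbol acts as a multiplier on [pexpn], whose transform is the nonnegative Poisson kernel;
    letting the regulariser tend to 1 leaves the transform of the symbol alone. *)
Lemma heat_kernel_ge0 d t x : 0 < d -> d < 1 -> 0 < t -> 0 <= heat_kernel d t x.
Proof.
move=> d0 d1 t0; rewrite heat_kernelE mulr_ge0 ?invr_ge0 ?(ltW pi2_gt0)//.
have ip := integrable_heat_symbol d0 t0.
have [mm _ pm] := pdm_stable d0 d1 (ltW t0) (n := n).
have h0 k : 0 < harmonic k :> R by rewrite /harmonic/= invr_gt0.
have [||||_ _ _ L] := @Rdominated_convergence _ _ R leb (fun k y => cos (dot x y) * (heat_symbol d t y * pexpn (harmonic k) y))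
   (fun y => cos (dot x y) * heat_symbol d t y) (heat_symbol d t).
- move=> k; apply: measurable_funM; first exact: measurable_cosdot0.
  by apply: measurable_funM; [exact: measurable_heat_symbol|exact: measurable_pexpn].
- move=> y; apply: cvgM; first exact: cvg_cst.
  by rewrite -[X in _ --> X]mulr1; apply: cvgM; [exact: cvg_cst|exact: cvg_pexpn].
- exact: ip.
- move=> k y; rewrite !normrM (ger0_norm (heat_symbol_ge0 _ _ _)) (ger0_norm (pexpn_ge0 _ _)).
  apply: (@le_trans _ _ (heat_symbol d t y * pexpn (harmonic k) y)).
    by rewrite ler_piMl ?cos_max// mulr_ge0 ?heat_symbol_ge0 ?pexpn_ge0.
  by rewrite ler_piMr ?heat_symbol_ge0// pexpn_le1// ltW.
apply: (ler_cvg_to (cvg_cst 0) L); apply: nearW => k.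
rewrite (_ : (fun y => _) = (fun y => cos (dot x y) * (expR (- (t * dot y y `^ d)) * pexpn (harmonic k) y))); last first.
  by apply/funext => y; rewrite /heat_symbol enorm_powR mulNr.
apply: pm; first exact: integrable_pexpn.
move=> z; rewrite /ctr.
have := @Rintegral_cos_pexpn R n (harmonic k) 0 z (h0 k).
rewrite cos0 mul1r; under eq_Rintegral do rewrite add0r.
by move=> ->; exact: poisson_ge0.
Qed.

End heat_symbol.

(** * Decay of the polyharmonic heat kernel *)

Lemma cos_lipschitz {R : realType} (a b : R) : `|cos a - cos b| <= `|a - b|.
Proof.
wlog ab : a b / b <= a.
  by move=> H; have [/H//|/ltW/H] := leP b a; rewrite distrC [X in _ <= X]distrC.
move: ab; rewrite le_eqVlt => /predU1P[->|ab]; first by rewrite !subrr.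
have [|c _ ->] := @MVT R cos (fun x => - sin x) _ _ ab (fun x _ => is_derive_cos x).
  by apply: continuous_subspaceT => x; exact: continuous_cos.
by rewrite normrM ler_piMl// normrN sin_max.
Qed.

Lemma is_derive_seq {R : realType} (f : R -> R) (x df : R) (s : nat -> R) :
  is_derive x 1 f df -> (forall k, s k != 0) -> s @ \oo --> (0 : R) ->
  (f (x + s k) - f x) / s k @[k --> \oo] --> df.
Proof.
move=> [dy Dy] sn sc; have := dy; rewrite /derivable => /cvg_ex[l Hl].
have lE : l = df by rewrite -Dy; apply/esym; apply: (cvg_lim _ Hl).
rewrite lE in Hl; move/cvgr_dnbhsP : Hl => /(_ s (conj sn sc)).
rewrite (_ : (fun k => (s k)^-1 *: _) = (fun k => (f (x + s k) - f x) / s k))//.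
by apply/funext => k; rewrite /= /GRing.scale/= mulr1 mulrC (addrC x).
Qed.

Section decay.
Context {R : realType} {n : nat}.
Local Notation leb := (lebesgue_Rn R n).
Implicit Types (h : Rn R n -> R) (x y z : Rn R n).
Variable i : 'I_n.

(** Integration by parts exchanges cosine and sine, that is, shifts the phase by pi / 2; carrying
    the phase makes one family closed under this operation. *)
Definition ptr (tau : R) h x : R := (\int[leb]_y (cos (tau + dot x y) * h y))%R.

Lemma vshiftE y (s : R) : vshift y i s = aff 1 (vshift vzero i s) y.
Proof.
by apply: eq_from_tnth => j; rewrite !tnth_mktuple mul1r add0r.
Qed.

Lemma vshift0 y : vshift y i 0 = y.
Proof. by apply: eq_from_tnth => j; rewrite tnth_mktuple if_same addr0. Qed.

Lemma tnth_vshift y (s : R) : tnth (vshift y i s) i = (tnth y i : R) + s :> R.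
Proof. by rewrite tnth_mktuple eqxx. Qed.

Lemma dot_vshiftxx y (s : R) : dot (vshift y i s) (vshift y i s) =
  dot y y + 2 * (tnth y i : R) * s + s ^+ 2.
Proof. by rewrite dot_vshift tnth_vshift dotC dot_vshift; ring. Qed.

Lemma integrable_cosM_phase tau h x : leb.-integrable setT (EFin \o h) ->
  leb.-integrable setT (EFin \o (fun y => cos (tau + dot x y) * h y)).
Proof.
move=> ih; apply: (le_integrable_bound _ (integrable_norm ih)).
  by apply: measurable_funM; [exact: measurable_cosdot|exact: measurable_sym].
by move=> y; rewrite normrM ler_piMl// cos_max.
Qed.

Lemma ptr_le tau h x : leb.-integrable setT (EFin \o h) ->
  `|ptr tau h x| <= (\int[leb]_y `|h y|)%R.
Proof.
move=> ih; apply: (le_trans (le_normr_Rintegral measurableT (integrable_cosM_phase tau x ih))).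
apply: le_Rintegral => //.
- exact: (integrable_norm (integrable_cosM_phase tau x ih)).
- exact: integrable_norm.
by move=> y _; rewrite normrM ler_piMl// cos_max.
Qed.

(* Integration by parts, obtained by moving a difference quotient from one factor to the other
   by translation invariance. *)
Lemma ptr_deriv h h' (g : Rn R n -> R) tau x :
  leb.-integrable setT (EFin \o h) -> measurable_fun setT h' ->
  leb.-integrable setT (EFin \o g) ->
  (forall y (s : R), is_derive (s : R) (1 : R) (fun s => h (vshift y i s)) (h' (vshift y i s))) ->
  (forall y (s : R), `|s| <= 1 -> `|h' (vshift y i s)| <= g y) ->
  ptr tau h' x = (tnth x i : R) * ptr (tau - pi / 2) h x.
Proof.
move=> ih mh' ig dh hg.
have mh := measurable_sym ih.
set xi : R := tnth x i.
pose s k : R := harmonic k.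
have s0 k : 0 < s k by rewrite /s /harmonic/= invr_gt0.
have s1 k : s k <= 1 by rewrite /s /harmonic/= invf_le1// ler1n.
have ms (r : R) : measurable_fun setT (fun y => h (vshift y i r)).
  rewrite (_ : (fun y => _) = (fun y => h (aff 1 (vshift vzero i r) y))); last by apply/funext => y; rewrite vshiftE.
  exact: (measurableT_comp mh (measurable_aff _ _)).
have mvt y (r : R) : 0 < r -> r <= 1 -> `|(h (vshift y i r) - h y) / r| <= g y.
  move=> r0 r1.
  have [|c] := @MVT R (fun s => h (vshift y i s)) (fun s => h' (vshift y i s)) 0 r r0 (fun s _ => dh y s).
    apply: continuous_subspaceT => z; apply: differentiable_continuous; apply/derivable1_diffP.
    by have [] := dh y z.
  rewrite in_itv/= => /andP[c0 cr]; rewrite vshift0 subr0 => ->.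
  by rewrite mulfK ?gt_eqF// hg// ger0_norm ltW// (lt_le_trans cr).
have [||||_ _ _ L1] := @Rdominated_convergence _ _ R leb
    (fun k y => cos (tau + dot x y) * ((h (vshift y i (s k)) - h y) / s k))
    (fun y => cos (tau + dot x y) * h' y) g.
- move=> k; apply: measurable_funM; first exact: measurable_cosdot.
  by apply: measurable_funM => //; apply: measurable_funB.
- move=> y; apply: cvgM; first exact: cvg_cst.
  have := is_derive_seq (dh y 0) (fun k => lt0r_neq0 (s0 k)) (@cvg_harmonic R).
  rewrite vshift0 (_ : (fun k => _) = (fun k => (h (vshift y i (s k)) - h y) / s k)) //.
  by apply/funext => k; rewrite add0r.
- exact: ig.
- move=> k y; rewrite normrM; apply: (le_trans _ (mvt y _ (s0 k) (s1 k))).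
  by rewrite ler_piMl// cos_max.
(* The translated quotient now falls on the cosine. Its limit, xi times a sine, is written as a
   cosine of phase tau - pi / 2, and the Lipschitz bound for cos supplies the majorant. *)
have [||||_ _ _ L2] := @Rdominated_convergence _ _ R leb
    (fun k y => ((cos (tau + dot x y - xi * s k) - cos (tau + dot x y)) / s k) * h y)
    (fun y => (xi * cos (tau - pi / 2 + dot x y)) * h y) (fun y => `|xi| * `|h y|).
- move=> k; apply: measurable_funM => //; apply: measurable_funM => //.
  apply: measurable_funB; last exact: measurable_cosdot.
  rewrite (_ : (fun y => _) = (fun y => cos ((tau - xi * s k) + dot x y))); first exact: measurable_cosdot.
  by apply/funext => y; rewrite addrAC.
- move=> y; apply: cvgM; last exact: cvg_cst.
  have D : is_derive (0 : R) (1 : R) (fun r : R => cos (tau + dot x y - xi * r)) (xi * sin (tau + dot x y)).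
    apply: is_derive_eq; rewrite /GRing.scale/= mulr0 subr0 mulr1; ring.
  have -> : cos (tau - pi / 2 + dot x y) = sin (tau + dot x y).
    by rewrite (addrAC tau) cosBpihalf.
  have := is_derive_seq D (fun k => lt0r_neq0 (s0 k)) (@cvg_harmonic R).
  rewrite mulr0 subr0.
  rewrite (_ : (fun k => _) = (fun k => (cos (tau + dot x y - xi * s k) - cos (tau + dot x y)) / s k))//.
  by apply/funext => k; rewrite add0r.
- by apply: integrableRZ; exact: integrable_norm.
- move=> k y; rewrite normrM ler_wpM2r// normrM (@ger0_norm _ (_^-1)) ?invr_ge0 ?(ltW (s0 k))//.
  rewrite ler_pdivrMr// (le_trans (cos_lipschitz _ _))//.
  by rewrite addrAC subrr add0r normrN normrM (gtr0_norm (s0 k)).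
rewrite /ptr -RintegralZl//; last exact: integrable_cosM_phase.
under [RHS]eq_Rintegral do rewrite mulrA.
apply: (cvg_unique _ L1) => //.
apply: cvg_trans L2; apply: near_eq_cvg; apply: nearW => k.
have ic := integrable_cosM_phase tau x ih.
have ish : leb.-integrable setT (EFin \o (fun y => h (vshift y i (s k)))).
  have := integrable_aff (vshift vzero i (s k)) (oner_neq0 R) ih.
  by under [X in EFin \o X]eq_fun do rewrite -vshiftE.
have ics := integrable_cosM_phase tau x ish.
transitivity ((s k)^-1 * (\int[leb]_y (cos (tau + dot x y) * h (vshift y i (s k))) -
    \int[leb]_y (cos (tau + dot x y) * h y)))%R; last first.
  rewrite -RintegralB// -RintegralZl//; last exact: integrableRB.
  by apply: eq_Rintegral => y _; ring.
have icm : leb.-integrable setT (EFin \o (fun y => cos (tau - xi * s k + dot x y) * h y)).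
  exact: integrable_cosM_phase.
have -> : (\int[leb]_y (cos (tau + dot x y) * h (vshift y i (s k))) =
   \int[leb]_y (cos (tau - xi * s k + dot x y) * h y))%R.
  have := Rintegral_aff (vshift vzero i (s k)) (oner_neq0 R) icm.
  rewrite normr1 expr1n invr1 mul1r => <-; apply: eq_Rintegral => y _.
  by rewrite -vshiftE; congr (cos _ * _); rewrite (dotC x (vshift _ _ _)) dot_vshift dotC /xi; ring.
rewrite -RintegralB// -RintegralZl//; last exact: integrableRB.
by apply: eq_Rintegral => y _; rewrite (addrAC tau); ring.
Qed.

End decay.

#[local] Instance is_derive_pow {R : realType} (f : R -> R) a (s df : R) :
  is_derive s (1 : R) f df ->
  is_derive s (1 : R) (fun s => f s ^+ a) (a%:R * f s ^+ a.-1 * df).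
Proof.
move=> h; case: a => [|a].
  rewrite (_ : (fun s => _) = cst 1); last by apply/funext => s'; rewrite expr0.
  by apply: is_derive_eq; rewrite !mul0r.
rewrite (_ : (fun s => _) = f ^+ a.+1); last by apply/funext => s'; rewrite fctE.
by apply: is_derive_eq.
Qed.

(** * Repeated integration by parts on monomials times the symbol *)

Section monomials.
Context {R : realType} {n : nat}.
Local Notation leb := (lebesgue_Rn R n).
Implicit Types (x y z : Rn R n).
Variables (i : 'I_n) (k : nat) (t : R).
Hypotheses (k0 : (0 < k)%N) (t0 : 0 < t).

(** Differentiation in the i-th coordinate stays in the span of this family, which the induction
    needs; a = b = 0 is the heat symbol of integer order k. *)
Definition hmon a b y : R := (tnth y i : R) ^+ a * dot y y ^+ b * expR (- t * dot y y ^+ k).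

Let heatE y : expR (- t * dot y y ^+ k) = heat_symbol k%:R t y.
Proof. by rewrite /heat_symbol enorm_powR powR_mulrn// dotxx_ge0. Qed.

Lemma measurable_hmon a b : measurable_fun setT (hmon a b).
Proof.
have md : measurable_fun setT (fun y : Rn R n => dot y y) := measurable_dotxx.
apply: measurable_funM.
  by apply: measurable_funM; apply: measurable_funX => //; exact: measurable_tnth.
apply: (@measurableT_comp _ _ _ _ _ _ expR) => //; apply: measurable_funM => //.
exact: measurable_funX.
Qed.

Lemma hmon_le_weight a b : exists2 C : R, 0 <= C & forall y, `|hmon a b y| <= C * weight y.
Proof.
have kR : 0 < k%:R :> R by rewrite ltr0n.
have [C C0 hC] := heat_symbol_decay (n := n) (a + b + n) kR t0.
exists C => // y; set r := dot y y; have r0 : 0 <= r := dotxx_ge0 y.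
rewrite /weight ler_pdivlMr; last by rewrite exprn_gt0// ltr_pwDl.
apply: le_trans (hC y); rewrite /hmon heatE !normrM (ger0_norm (heat_symbol_ge0 _ _ _)) -/r.
rewrite (mulrC _ (heat_symbol _ _ _)) -mulrA mulrC !exprD ler_wpM2r ?heat_symbol_ge0//.
rewrite ler_wpM2r ?exprn_ge0 ?addr_ge0// ler_pM ?normr_ge0//.
  rewrite normrX lerXn2r ?nnegrE ?addr_ge0//.
  have := sqr_tnth_le_dot y i; rewrite -/r -real_normK ?num_real//.
  set u := `|_|; have u0 : 0 <= u by exact: normr_ge0.
  move=> ur; have [u1|/ltW u1] := leP u 1; first by rewrite (le_trans u1)// lerDl.
  by rewrite (le_trans _ (le_trans ur _)) ?lerDr// expr2 ler_peMr.
by rewrite normrX (ger0_norm r0) lerXn2r ?nnegrE ?addr_ge0// lerDr.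
Qed.

Lemma integrable_hmon a b : leb.-integrable setT (EFin \o hmon a b).
Proof.
have [C C0 hC] := hmon_le_weight a b.
apply: (le_integrable_bound (g := fun y => C * weight y)) => //.
- exact: measurable_hmon.
- by apply: integrableRZ; exact: integrable_weight.
Qed.

(** Truncated predecessors are harmless: when a or b is 0, so is the coefficient of the term
    concerned. *)
Definition dhmon a b y : R :=
  a%:R * hmon a.-1 b y + 2 * b%:R * hmon a.+1 b.-1 y - 2 * t * k%:R * hmon a.+1 (b + k.-1) y.

Lemma is_derive_hmon a b y (s : R) :
  is_derive (s : R) (1 : R) (fun s => hmon a b (vshift y i s)) (dhmon a b (vshift y i s)).
Proof.
set c : R := tnth y i; set r := dot y y.
have E (s' : R) a' b' : hmon a' b' (vshift y i s') = (c + s') ^+ a' * (r + 2 * c * s' + s' ^+ 2) ^+ b' *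
   expR (- t * (r + 2 * c * s' + s' ^+ 2) ^+ k).
  by rewrite /hmon tnth_vshift dot_vshiftxx.
rewrite (_ : (fun s => _) = (fun s' : R => (c + s') ^+ a * (r + 2 * c * s' + s' ^+ 2) ^+ b *
   expR (- t * (r + 2 * c * s' + s' ^+ 2) ^+ k))); last by apply/funext => s'; rewrite E.
have D1 : is_derive s (1 : R) (fun s' : R => c + s') 1.
  rewrite (_ : (fun s' => _) = cst c + id :> (R -> R))//.
  by apply: is_derive_eq; rewrite add0r.
have D2 : is_derive s (1 : R) (fun s' : R => r + 2 * c * s' + s' ^+ 2) (2 * (c + s)).
  by apply: is_derive_eq; rewrite /GRing.scale/=; ring.
have D3 := is_derive_pow b D2.
have D4 := is_derive_pow a D1.
have D5 := is_derive_pow k D2.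
apply: is_derive_eq; rewrite /dhmon !E /GRing.scale/=.
rewrite exprD !exprS.
set p := r + _ + _; set q := c + s; set ex := expR _.
clearbody ex q p.
move: (q ^+ a) (p ^+ b) (q ^+ a.-1) (p ^+ b.-1) (p ^+ k.-1) => qa pb qa' pb' pk.
move: (a%:R : R) (b%:R : R) (k%:R : R) => ar br kr; ring.
Qed.

(** From |y|^2 <= 2 |y + s e_i|^2 + 2 one gets 1 + |y|^2 <= 3 (1 + |y + s e_i|^2). This provides the
    bound, uniform over unit shifts, that [ptr_deriv] asks for. *)
Lemma weight_vshift y (s : R) : `|s| <= 1 -> weight (vshift y i s) <= 3 ^+ n * weight y.
Proof.
move=> s1; rewrite /weight -exprVn -exprVn -exprMn.
have a0 : 0 <= (1 + dot (vshift y i s) (vshift y i s))^-1 by rewrite invr_ge0 addr_ge0 ?dotxx_ge0.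
have b0 : 0 <= 3 / (1 + dot y y) by rewrite mulr_ge0// invr_ge0 addr_ge0 ?dotxx_ge0.
suff h : (1 + dot (vshift y i s) (vshift y i s))^-1 <= 3 / (1 + dot y y).
  by rewrite lerXn2r ?nnegrE.
rewrite -[leLHS]mul1r ler_pdivrMr ?ltr_pwDl ?dotxx_ge0// mulrAC ler_pdivlMr ?ltr_pwDl ?dotxx_ge0// mul1r dot_vshiftxx.
have s2 : s ^+ 2 <= 1 by rewrite -real_normK ?num_real// expr_le1.
have := sqr_tnth_le_dot y i; set c : R := tnth y i; set r := dot y y => cr.
have h : 0 <= (2 * s + c) ^+ 2 by exact: sqr_ge0.
nra.
Qed.

Lemma dhmon_bound a b : exists2 C : R, 0 <= C & forall y, `|dhmon a b y| <= C * weight y.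
Proof.
have [C1 p1 h1] := hmon_le_weight a.-1 b.
have [C2 p2 h2] := hmon_le_weight a.+1 b.-1.
have [C3 p3 h3] := hmon_le_weight a.+1 (b + k.-1).
exists (a%:R * C1 + 2 * b%:R * C2 + 2 * t * k%:R * C3).
  by rewrite !addr_ge0// !mulr_ge0// ltW.
move=> y; rewrite /dhmon (le_trans (ler_normB _ _))// (mulrDl _ _ (weight y)) lerD//.
  rewrite (mulrDl _ _ (weight y)) (le_trans (ler_normD _ _))// lerD//.
    by rewrite normrM (@ger0_norm _ (_%:R))// -mulrA ler_wpM2l// h1.
  by rewrite normrM (@ger0_norm _ (2 * _)) ?mulr_ge0// -[leRHS]mulrA ler_wpM2l ?mulr_ge0// h2.
have tk : 0 <= 2 * t * k%:R by rewrite !mulr_ge0// ltW.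
by rewrite normrM (ger0_norm tk)// -[leRHS]mulrA ler_wpM2l// h3.
Qed.

Lemma measurable_dhmon a b : measurable_fun setT (dhmon a b).
Proof.
apply: measurable_funB; first apply: measurable_funD;
  by apply: measurable_funM => //; exact: measurable_hmon.
Qed.

Lemma ptr_dhmon a b tau x :
  ptr tau (dhmon a b) x = (tnth x i : R) * ptr (tau - pi / 2) (hmon a b) x.
Proof.
have [C C0 hC] := dhmon_bound a b.
apply: (@ptr_deriv _ _ i _ _ (fun y => (C * 3 ^+ n) * weight y)).
- exact: integrable_hmon.
- exact: measurable_dhmon.
- by apply: integrableRZ; exact: integrable_weight.
- by move=> y s; exact: is_derive_hmon.
- move=> y s s1; rewrite (le_trans (hC _))// -mulrA ler_wpM2l// weight_vshift//.
Qed.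

(** Each factor x_i is traded for one derivative at a phase raised by pi / 2, so the constant has to
    be independent of the phase for the induction to go through. *)
Lemma ptr_hmon_decay m a b : exists2 C : R, 0 <= C &
  forall tau x, `|(tnth x i : R) ^+ m * ptr tau (hmon a b) x| <= C.
Proof.
elim: m a b => [|m IH] a b.
  exists (\int[leb]_y `|hmon a b y|)%R; first by apply: Rintegral_ge0.
  by move=> tau x; rewrite mul1r; apply: ptr_le; exact: integrable_hmon.
have [C1 p1 h1] := IH a.-1 b.
have [C2 p2 h2] := IH a.+1 b.-1.
have [C3 p3 h3] := IH a.+1 (b + k.-1)%N.
exists (a%:R * C1 + 2 * b%:R * C2 + 2 * t * k%:R * C3).
  by rewrite !addr_ge0// !mulr_ge0// ltW.
move=> tau x; set xi : R := tnth x i.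
have i1 a' b' := integrable_cosM_phase (tau + pi / 2) x (integrable_hmon a' b').
have -> : xi ^+ m.+1 * ptr tau (hmon a b) x = xi ^+ m * ptr (tau + pi / 2) (dhmon a b) x.
  by rewrite ptr_dhmon addrK exprSr mulrA.
have -> : ptr (tau + pi / 2) (dhmon a b) x =
    a%:R * ptr (tau + pi / 2) (hmon a.-1 b) x + 2 * b%:R * ptr (tau + pi / 2) (hmon a.+1 b.-1) x
    - 2 * t * k%:R * ptr (tau + pi / 2) (hmon a.+1 (b + k.-1)) x.
  rewrite /ptr -!RintegralZl//.
  rewrite -RintegralD//; [|exact: integrableRZ|exact: integrableRZ].
  rewrite -RintegralB//; [|by apply: integrableRD; exact: integrableRZ|exact: integrableRZ].
  by apply: eq_Rintegral => y _; rewrite /dhmon; ring.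
rewrite mulrBr mulrDr (le_trans (ler_normB _ _))// lerD//.
  rewrite (le_trans (ler_normD _ _))// lerD//.
    by rewrite mulrCA normrM (@ger0_norm _ (_%:R))// ler_wpM2l// h1.
  by rewrite mulrCA normrM (@ger0_norm _ (2 * _)) ?mulr_ge0// ler_wpM2l ?mulr_ge0// h2.
have tk : 0 <= 2 * t * k%:R by rewrite !mulr_ge0// ltW.
by rewrite mulrCA normrM (ger0_norm tk)// ler_wpM2l// h3.
Qed.

Lemma ctr_heat_symbol_decay m : exists2 C : R, 0 <= C &
  forall x, `|tnth x i : R| ^+ m * `|ctr (heat_symbol k%:R t) x| <= C.
Proof.
have [C C0 hC] := ptr_hmon_decay m 0 0; exists C => // x.
apply: le_trans (hC 0 x); rewrite -normrX -normrM.
rewrite le_eqVlt; apply/orP; left; apply/eqP; congr (`|_ * _|).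
by apply: eq_Rintegral => y _; rewrite add0r /hmon heatE !expr0 !mul1r.
Qed.
End monomials.

Section integer_kernel.
Context {R : realType} {n : nat}.
Local Notation leb := (lebesgue_Rn R n).

(** Decay in every coordinate separately is turned into decay in the norm through the coordinate of
    largest modulus u: |x|^2 <= n u^2, and 2n integrations by parts match the n-th power in
    [weight]. For u <= 1 the sup bound suffices. *)
Lemma heat_kernel_nat_le_weight (k : nat) (t : R) : (0 < n)%N -> (0 < k)%N -> 0 < t ->
  exists2 C : R, 0 <= C & forall x : Rn R n, `|heat_kernel k%:R t x| <= C * weight x.
Proof.
move=> n0 k0 t0.
have kR : 0 < k%:R :> R by rewrite ltr0n.
pose I := (\int[leb]_y heat_symbol k%:R t y)%R.
have I0 : 0 <= I by apply: Rintegral_ge0 => y _; exact: heat_symbol_ge0.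
have /boolp.choice[C HC] : forall i : 'I_n, exists C : R, 0 <= C /\
    forall x : Rn R n, `|tnth x i : R| ^+ (2 * n) * `|ctr (heat_symbol k%:R t) x| <= C.
  by move=> i; have [C C0 h] := ctr_heat_symbol_decay i k0 t0 (2 * n); exists C.
pose B := I + \sum_(i < n) C i.
have B0 : 0 <= B by rewrite addr_ge0// sumr_ge0// => i _; have [] := HC i.
exists ((2 * pi) ^- n * ((1 + n%:R) ^+ n * B)).
  by rewrite mulr_ge0 ?invr_ge0 ?(ltW pi2_gt0)// mulr_ge0// exprn_ge0// addr_ge0.
move=> x; rewrite heat_kernelE normrM (ger0_norm (_ : 0 <= (2 * pi) ^- n)) ?invr_ge0 ?(ltW pi2_gt0)//.
rewrite -mulrA ler_wpM2l ?invr_ge0 ?(ltW pi2_gt0)//.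
set K := `|ctr _ x|; have K0 : 0 <= K by exact: normr_ge0.
have KI : K <= I by apply: ctr_le; [exact: integrable_heat_symbol|exact: heat_symbol_ge0].
rewrite /weight ler_pdivlMr; last by rewrite exprn_gt0// ltr_pwDl// dotxx_ge0.
pose i0 : 'I_n := Ordinal n0.
pose j := [arg max_(i > i0) `|tnth x i : R|]%O.
have jmax i : `|tnth x i : R| <= `|tnth x j : R|.
  by rewrite /j; case: arg_maxP => // i' _ h; exact: h.
set u := `|tnth x j : R|; have u0 : 0 <= u by exact: normr_ge0.
have du : dot x x <= n%:R * u ^+ 2.
  rewrite dotxxE (@le_trans _ _ (\sum_(i < n) u ^+ 2))//.
    by apply: ler_sum => i _; rewrite -real_normK ?num_real// lerXn2r ?nnegrE ?jmax.
  by rewrite sumr_const card_ord mulr_natl.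
have [u1|/ltW u1] := leP u 1.
  rewrite mulrC ler_pM ?exprn_ge0 ?addr_ge0 ?dotxx_ge0//.
    rewrite lerXn2r ?nnegrE ?addr_ge0 ?dotxx_ge0// lerD2l (le_trans du)//.
    by rewrite ler_piMr// expr_le1.
  by rewrite (le_trans KI)// lerDl sumr_ge0// => i _; have [] := HC i.
apply: (@le_trans _ _ (K * ((1 + n%:R) ^+ n * u ^+ (2 * n)))).
  rewrite ler_wpM2l// exprM -exprMn lerXn2r ?nnegrE ?addr_ge0 ?dotxx_ge0 ?mulr_ge0 ?exprn_ge0 ?addr_ge0//.
  rewrite mulrDl mul1r lerD// expr_ge1//.
rewrite mulrCA ler_wpM2l ?exprn_ge0 ?addr_ge0//.
have [_ /(_ x) h] := HC j; rewrite mulrC (le_trans h)//.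
rewrite /B (bigD1 j)//= addrCA lerDl addr_ge0// sumr_ge0// => i _; by have [] := HC i.
Qed.

Lemma integrable_heat_kernel (d t : R) : (0 < n)%N ->
  (0 < d < 1) \/ (exists k : nat, (0 < k)%N /\ d = k%:R) -> 0 < t ->
  leb.-integrable setT (EFin \o heat_kernel d t).
Proof.
move=> n0 [/andP[d0 d1]|[k [k0 ->]]] t0.
  apply: ge0_fker_integrable; first exact: heat_symbol_sym.
  by move=> x; exact: heat_kernel_ge0.
have kR : 0 < k%:R :> R by rewrite ltr0n.
have [C C0 hC] := heat_kernel_nat_le_weight n0 k0 t0.
apply: (le_integrable_bound (g := fun x => C * weight x)) => //.
- apply: measurable_fker; exact: integrable_heat_symbol.
- by apply: integrableRZ; exact: integrable_weight.
Qed.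

End integer_kernel.

(** * Scaling, norms and convolution law of the heat kernel *)

Section kernel.
Context {R : realType} {n : nat}.
Local Notation leb := (lebesgue_Rn R n).
Variable d : R.
Hypotheses (n0 : (0 < n)%N) (hd : (0 < d < 1) \/ (exists k : nat, (0 < k)%N /\ d = k%:R)).
Local Notation K := (@heat_kernel R n d).

Lemma heat_order_gt0 : 0 < d.
Proof. by case: hd => [/andP[]//|[k [k0 ->]]]; rewrite ltr0n. Qed.
Let d0 := heat_order_gt0.

Lemma enorm_scale (l : R) (x : Rn R n) : 0 <= l -> enorm (aff l vzero x) = l * enorm x.
Proof.
move=> l0; rewrite /enorm (_ : dot _ _ = l ^+ 2 * dot x x); first by rewrite sqrtrM ?sqr_ge0// sqrtr_sqr ger0_norm.
rewrite dotxxE dotxxE mulr_sumr; apply: eq_bigr => i _.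
by rewrite !tnth_mktuple addr0 exprMn.
Qed.

Definition dil (t : R) : R := t `^ (- (2 * d)^-1).

Lemma dil_gt0 t : 0 < t -> 0 < dil t.
Proof. by move=> t0; rewrite powR_gt0. Qed.

Lemma dil_powR t : 0 < t -> t * dil t `^ (2 * d) = 1.
Proof.
move=> t0; rewrite /dil -powRrM mulNr mulVf ?mulf_neq0 ?gt_eqF//.
by rewrite powR_inv1 ?ltW// divff ?gt_eqF.
Qed.

Lemma measurable_heat_kernel t : 0 < t -> measurable_fun setT (K t).
Proof. by move=> t0; apply: measurable_fker; exact: integrable_heat_symbol. Qed.

Lemma heat_kernel_scale t x : 0 < t -> K t x = dil t ^+ n * K 1 (aff (dil t) vzero x).
Proof.
move=> t0; rewrite !heat_kernelE /fker mulrCA; congr (_ * _).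
have l0 := dil_gt0 t0; set l := dil t in l0 *.
have l1 : l != 0 by rewrite gt_eqF.
have ih := @integrable_heat_symbol R n d t d0 t0.
have ic := integrable_cosM x ih.
have H := Rintegral_aff vzero l1 ic; rewrite (gtr0_norm l0) in H.
suff E : l ^- n * ctr (heat_symbol d t) x = ctr (heat_symbol d 1) (aff l vzero x).
  by rewrite -E mulrA divff ?mul1r// expf_neq0.
apply: (etrans (esym H)).
apply: eq_Rintegral => y _; congr (cos _ * expR _).
  by rewrite dotC !dot_aff dotC; congr (_ + _); rewrite /dot !big1// => i _; rewrite tnth_mktuple mul0r.
rewrite enorm_scale ?ltW// powRM ?enorm_ge0 ?(ltW l0)// mulrA mulNr dil_powR//.
Qed.

Lemma integrable_hk t : 0 < t -> leb.-integrable setT (EFin \o K t).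
Proof. by move=> t0; exact: integrable_heat_kernel. Qed.

(** By scaling, the L^1 norm of the kernel at every positive time. It is not 1 when the kernel
    changes sign, so the semigroup is uniformly bounded without being treated as a contraction. *)
Definition hkA : R := (\int[leb]_x `|K 1 x|)%R.
Definition hkB : R := (2 * pi) ^- n * (\int[leb]_x heat_symbol d 1 x)%R.

Lemma hkB_ge0 : 0 <= hkB.
Proof.
by rewrite mulr_ge0 ?invr_ge0 ?(ltW pi2_gt0)// Rintegral_ge0// => y _; exact: heat_symbol_ge0.
Qed.

Lemma hk_L1 t : 0 < t -> (\int[leb]_x `|K t x|)%R = hkA.
Proof.
move=> t0; have l0 := dil_gt0 t0; have l1 : dil t != 0 by rewrite gt_eqF.
have iK := integrable_hk ltr01.
transitivity (\int[leb]_x (dil t ^+ n * `|K 1 (aff (dil t) vzero x)|))%R.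
  by apply: eq_Rintegral => x _; rewrite heat_kernel_scale// normrM ger0_norm// exprn_ge0// ltW.
rewrite RintegralZl//; last first.
  exact: (integrable_aff vzero l1 (integrable_norm iK)).
rewrite (Rintegral_aff vzero l1 (integrable_norm iK)) gtr0_norm// mulrA divff ?mul1r//.
by rewrite expf_neq0.
Qed.

Lemma hk_L1e t : 0 < t -> (\int[leb]_x (`|K t x|)%:E = hkA%:E)%E.
Proof.
move=> t0; rewrite -(hk_L1 t0) /Rintegral fineK//.
by apply: integrable_fin_num => //; exact: (integrable_norm (integrable_hk t0)).
Qed.

Lemma hk_sup t x : 0 < t -> `|K t x| <= t `^ (- (n%:R / (2 * d))) * hkB.
Proof.
move=> t0; rewrite heat_kernel_scale// normrM ger0_norm ?exprn_ge0 ?(ltW (dil_gt0 t0))//.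
rewrite /dil -powR_mulrn ?powR_ge0// -powRrM mulNr (mulrC _ n%:R) ler_wpM2l ?powR_ge0//.
rewrite heat_kernelE /fker normrM ger0_norm ?invr_ge0 ?(ltW pi2_gt0)//.
rewrite ler_wpM2l ?invr_ge0 ?(ltW pi2_gt0)//.
by apply: ctr_le; [exact: integrable_heat_symbol|exact: heat_symbol_ge0].
Qed.

Lemma hk_int t : 0 < t -> (\int[leb]_x K t x = 1)%R.
Proof.
move=> t0; rewrite (Rintegral_fker (heat_symbol_sym d0 t0) (integrable_hk t0)).
rewrite /heat_symbol (_ : enorm vzero = 0); first by rewrite powR0 ?mulr0 ?expR0// mulf_neq0// gt_eqF.
by rewrite /enorm (_ : dot _ _ = 0) ?sqrtr0// /dot big1// => i _; rewrite tnth_mktuple mul0r.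
Qed.

Lemma hk_conv s t x : 0 < s -> 0 < t -> Defs.conv (K s) (K t) x = K (s + t) x.
Proof.
move=> s0 t0; rewrite (conv_fker x (heat_symbol_sym d0 s0) (heat_symbol_sym d0 t0) (integrable_hk t0)).
rewrite heat_kernelE; congr (fker _ _); apply/funext => y.
by rewrite /heat_symbol -expRD -mulrDl opprD.
Qed.

End kernel.

(** * The space [L^q] *)

Section Lq.
Context d (T : measurableType d) {R : realType} (mu : {measure set T -> \bar R}).

(** Hoelder's inequality for the exponents 1/th and 1/(1 - th), phrased with bounds on integrals
    because the later uses split an integrand into a geometric mean. *)
Lemma hoelder_geo (a b : T -> R) (th A B : R) :
  measurable_fun setT a -> measurable_fun setT b ->
  (forall x, 0 <= a x) -> (forall x, 0 <= b x) -> 0 < th < 1 ->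
  (\int[mu]_x (a x)%:E <= A%:E)%E -> (\int[mu]_x (b x)%:E <= B%:E)%E ->
  (\int[mu]_x (a x `^ th * b x `^ (1 - th))%:E <= (A `^ th * B `^ (1 - th))%:E)%E.
Proof.
move=> ma mb a0 b0 /andP[th0 th1] hA hB.
have th1' : 0 < 1 - th by rewrite subr_gt0.
have A0 : 0 <= A by rewrite -lee_fin (le_trans _ hA)// integral_ge0// => x _; rewrite lee_fin.
have B0 : 0 <= B by rewrite -lee_fin (le_trans _ hB)// integral_ge0// => x _; rewrite lee_fin.
have mpow (c : T -> R) r : measurable_fun setT c -> measurable_fun setT (fun x => c x `^ r).
  by move=> mc; exact: (measurableT_comp (measurable_powR r)).
have := @hoelder _ _ _ mu (fun x => a x `^ th) (fun x => b x `^ (1 - th)) th^-1 (1 - th)^-1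
  (mpow _ _ ma) (mpow _ _ mb).
rewrite !invr_gt0 !invrK (addrC th) subrK => /(_ th0 th1' erefl).
have E (c : T -> R) r C : 0 < r -> 0 <= C -> (forall x, 0 <= c x) -> (\int[mu]_x (c x)%:E <= C%:E)%E ->
    ('N[mu]_(r^-1)%:E [EFin \o (fun x => c x `^ r)%R] <= (C `^ r)%:E)%E.
  move=> r0 C0 c0 hC; rewrite unlock invrK.
  rewrite (_ : (\int[mu]_x _)%E = (\int[mu]_x (c x)%:E)%E); last first.
    apply: eq_integral => x _ /=.
    by rewrite ger0_norm ?powR_ge0// -powRrM divff ?gt_eqF// powRr1.
  rewrite -poweR_EFin gt0_ler_poweR ?(ltW r0)//.
  - by rewrite in_itv/= leey andbT integral_ge0// => x _; rewrite lee_fin.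
  - by rewrite in_itv/= leey andbT lee_fin.
move=> H; apply: (le_trans (le_trans _ H)).
  rewrite Lnorm1 le_eqVlt; apply/orP; left; apply/eqP; apply: eq_integral => x _ /=.
  by rewrite ger0_norm// mulr_ge0 ?powR_ge0.
by rewrite EFinM lee_pmul ?Lnorm_ge0 ?E.
Qed.

Variable q : R.
Hypothesis q1 : 1 < q.
Implicit Types f g h : T -> R.
Local Notation Lf := (Lfun mu q%:E).

Definition nmq f : R := fine (Lnorm mu q%:E (EFin \o f)).

Let q0 : 0 < q. Proof. by rewrite (lt_trans _ q1). Qed.

Lemma nmq_ge0 f : 0 <= nmq f.
Proof. by rewrite /nmq fine_ge0// Lnorm_ge0. Qed.

Lemma Lfun_measurable f : f \in Lf -> measurable_fun setT f.
Proof. by rewrite inE => /andP[/[!inE]]. Qed.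

Lemma LnormE f : f \in Lf -> Lnorm mu q%:E (EFin \o f) = (nmq f)%:E.
Proof.
rewrite inE => /andP[_ /[!inE]/= h]; rewrite /nmq fineK// ge0_fin_numE//.
exact: Lnorm_ge0.
Qed.

Lemma integral_nmq f : f \in Lf -> (\int[mu]_x (`|f x| `^ q)%:E = (nmq f `^ q)%:E)%E.
Proof.
move=> fL; have := powR_Lnorm mu (EFin \o f) (lt0r_neq0 q0); rewrite (LnormE fL) poweR_EFin => ->.
by apply: eq_integral => x _.
Qed.

Lemma nmq_bound f C : measurable_fun setT f -> 0 <= C ->
  (\int[mu]_x (`|f x| `^ q)%:E <= (C `^ q)%:E)%E -> f \in Lf /\ nmq f <= C.
Proof.
move=> mf C0 h.
have L : (Lnorm mu q%:E (EFin \o f) <= C%:E)%E.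
  rewrite unlock; have -> : C%:E = ((C `^ q)%:E `^ q^-1)%E.
    by rewrite poweR_EFin -powRrM divff ?gt_eqF// powRr1.
  rewrite gt0_ler_poweR// ?invr_ge0 ?(ltW q0)//.
  - by rewrite in_itv/= leey andbT integral_ge0// => x _; rewrite poweR_ge0.
  - by rewrite in_itv/= leey andbT lee_fin powR_ge0.
split; first by apply/andP; split; rewrite inE//=; exact: le_lt_trans L (ltry _).
by rewrite /nmq -lee_fin fineK// ge0_fin_numE ?Lnorm_ge0//; exact: le_lt_trans L (ltry _).
Qed.

Lemma integral_lty_Lfun f : measurable_fun setT f ->
  (\int[mu]_x (`|f x| `^ q)%:E < +oo)%E -> f \in Lf.
Proof.
move=> mf h.
have I0 : (0 <= \int[mu]_x (`|f x| `^ q)%:E)%E by apply: integral_ge0 => x _; rewrite lee_fin powR_ge0.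
have [//||//] := @nmq_bound f (fine (\int[mu]_x (`|f x| `^ q)%:E) `^ q^-1) mf.
  by rewrite powR_ge0.
by rewrite -powRrM mulVf ?gt_eqF// powRr1 ?fine_ge0// fineK// ge0_fin_numE.
Qed.

Lemma measurable_normpow f r : measurable_fun setT f -> measurable_fun setT (fun x => `|f x| `^ r).
Proof.
by move=> mf; apply: (measurableT_comp (measurable_powR r)); exact: measurableT_comp.
Qed.

Lemma LfunD f g : f \in Lf -> g \in Lf -> (fun x => f x + g x) \in Lf.
Proof.
move=> fL gL; have mf := Lfun_measurable fL; have mg := Lfun_measurable gL.
apply/andP; split; rewrite inE/=; first exact: measurable_funD.
apply: (le_lt_trans (@minkowski_EFin _ _ _ mu f g q mf mg (ltW q1))).
by rewrite (LnormE fL) (LnormE gL) ltry.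
Qed.

Lemma nmqD f g : f \in Lf -> g \in Lf -> nmq (fun x => f x + g x) <= nmq f + nmq g.
Proof.
move=> fL gL; have mf := Lfun_measurable fL; have mg := Lfun_measurable gL.
rewrite -lee_fin -(LnormE (LfunD fL gL)) EFinD -(LnormE fL) -(LnormE gL).
exact: minkowski_EFin (ltW q1).
Qed.

Lemma nmqZ f c : f \in Lf -> (fun x => c * f x) \in Lf /\ nmq (fun x => c * f x) = `|c| * nmq f.
Proof.
move=> fL; have mf := Lfun_measurable fL.
have E : (\int[mu]_x (`|c * f x| `^ q)%:E = ((`|c| * nmq f) `^ q)%:E)%E.
  rewrite powRM ?nmq_ge0// EFinM -(integral_nmq fL) -ge0_integralZl//.
  - by apply: eq_integral => x _; rewrite normrM powRM.
  - by apply/measurable_EFinP; exact: measurable_normpow.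
have cL : (fun x => c * f x) \in Lf.
  by apply: integral_lty_Lfun; [exact: measurable_funM|rewrite E ltry].
split => //; have := integral_nmq cL; rewrite E => -[].
move/(congr1 (fun x => x `^ q^-1)); rewrite -!powRrM divff ?gt_eqF// !powRr1 ?nmq_ge0 ?mulr_ge0 ?nmq_ge0//.
Qed.

Lemma LfunB f g : f \in Lf -> g \in Lf -> (fun x => f x - g x) \in Lf.
Proof.
move=> fL gL; rewrite (_ : (fun x => _) = (fun x => f x + (-1) * g x)).
  by apply: LfunD => //; have [] := nmqZ (-1) gL.
by apply/funext => x; rewrite mulN1r.
Qed.

Lemma nmq_distC f g : nmq (fun x => f x - g x) = nmq (fun x => g x - f x).
Proof.
rewrite /nmq -oppe_Lnorm; congr fine; apply: eq_Lnorm => x /=.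
by rewrite opprB.
Qed.

Lemma nmq_triangle f g h : f \in Lf -> g \in Lf -> h \in Lf ->
  nmq (fun x => f x - h x) <= nmq (fun x => f x - g x) + nmq (fun x => g x - h x).
Proof.
move=> fL gL hL; apply: le_trans (nmqD (LfunB fL gL) (LfunB gL hL)).
by rewrite le_eqVlt; apply/orP; left; apply/eqP; congr (nmq _); apply/funext => x; rewrite subrKA.
Qed.

Lemma le_Lfun f g : measurable_fun setT f -> g \in Lf -> (forall x, `|f x| <= `|g x|) ->
  f \in Lf /\ nmq f <= nmq g.
Proof.
move=> mf gL fg; apply: nmq_bound => //; first exact: nmq_ge0.
rewrite -(integral_nmq gL); apply: ge0_le_integral => //.
- by apply/measurable_EFinP; exact: measurable_normpow.
- by apply/measurable_EFinP; apply: measurable_normpow; exact: Lfun_measurable.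
- by move=> x _; rewrite lee_fin ge0_ler_powR ?(ltW q0).
Qed.

Lemma eq_ae_nmq f g : f \in Lf -> g \in Lf ->
  nmq (fun x => f x - g x) = 0 <-> {ae mu, forall x, f x = g x}.
Proof.
move=> fL gL; have bL := LfunB fL gL; split=> h.
  have := @Lnorm_eq0_eq0 _ _ _ mu (EFin \o (fun x => f x - g x)) q%:E.
  rewrite (LnormE bL) h lte_fin => /(_ _ q0 erefl) H.
  have : ae_eq mu setT (EFin \o (fun x => f x - g x)) (cst 0%E).
    by apply: H; apply/measurable_EFinP; exact: Lfun_measurable.
  by apply: filterS => x /(_ I)/= [] /eqP; rewrite subr_eq0 => /eqP.
have : (\int[mu]_x (`|f x - g x| `^ q)%:E = \int[mu]_x 0)%E.
  apply: ae_eq_integral => //.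
    by apply/measurable_EFinP; apply: measurable_normpow; exact: Lfun_measurable bL.
  by apply: filterS h => x -> _; rewrite subrr normr0 powR0// gt_eqF.
rewrite integral0 (integral_nmq bL) => -[] /eqP; rewrite powR_eq0 => /andP[/eqP//].
Qed.

Lemma nmq_dominated (f_ : nat -> T -> R) f g : (forall k, measurable_fun setT (f_ k)) ->
  (forall x, f_ ^~ x @ \oo --> f x) -> g \in Lf -> (forall k x, `|f_ k x| <= g x) ->
  f \in Lf /\ nmq (fun x => f_ k x - f x) @[k --> \oo] --> 0.
Proof.
move=> mf_ ff gL fg.
have mf : measurable_fun setT f by apply: (measurable_fun_cvg (h := f_)) => [k|x _]; [exact: mf_|exact: ff].
have lf x : `|f x| <= g x.
  by apply: (ler_cvg_to (cvg_norm (ff x)) (cvg_cst (g x))); exact: nearW.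
have g0 x : 0 <= g x by exact: le_trans (lf x).
have fL : f \in Lf by have [|//] := @le_Lfun f g mf gL; move=> x; rewrite (ger0_norm (g0 x)).
split => //.
have fkL k : f_ k \in Lf by have [|//] := @le_Lfun (f_ k) g (mf_ k) gL; move=> x; rewrite (ger0_norm (g0 x)).
have [||||_ _ _ L] := @Rdominated_convergence _ T R mu (fun k x => `|f_ k x - f x| `^ q) (cst 0)
    (fun x => (2 * g x) `^ q).
- by move=> k; apply: measurable_normpow; exact: measurable_funB.
- move=> x; have : `|f_ k x - f x| @[k --> \oo] --> (0 : R) by apply/norm_cvg0P/subr_cvg0/ff.
  by move/(cvg_powR_nneg q0 (fun k => normr_ge0 _)); rewrite powR0 ?gt_eqF.
- have [gL2 _] := nmqZ 2 gL.
  apply: (@integrable_ge0_finite _ _ _ _ _ (nmq (fun x => 2 * g x) `^ q)).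
  + have mg := Lfun_measurable gL2.
    exact: (measurableT_comp (measurable_powR q)).
  + by move=> x; exact: powR_ge0.
  + rewrite -(integral_nmq gL2) le_eqVlt; apply/orP; left; apply/eqP; apply: eq_integral => x _.
    by rewrite ger0_norm// mulr_ge0.
- move=> k x; rewrite ger0_norm ?powR_ge0// ge0_ler_powR ?nnegrE ?(ltW q0) ?mulr_ge0//.
  by rewrite (le_trans (ler_normB _ _))// mulr_natl mulr2n lerD.
have E k : nmq (fun x => f_ k x - f x) = (\int[mu]_x (`|f_ k x - f x| `^ q))%R `^ q^-1.
  by rewrite /Rintegral (integral_nmq (LfunB (fkL k) fL))/= -powRrM divff ?gt_eqF// powRr1 ?nmq_ge0.
rewrite (eq_cvg _ _ E).
have q0' : 0 < q^-1 by rewrite invr_gt0.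
have I0 k : 0 <= (\int[mu]_x (`|f_ k x - f x| `^ q))%R by apply: Rintegral_ge0.
have := cvg_powR_nneg q0' I0; rewrite -{2}(@powR0 R q^-1) ?gt_eqF//; apply.
by move: L; rewrite /Rintegral (_ : (\int[mu]_x (cst 0 x)%:E)%E = 0%E)//; exact: integral0.
Qed.

Lemma fatou_bound (f_ : nat -> T -> R) f (C : R) k0 : (forall k, measurable_fun setT (f_ k)) ->
  (forall k x, 0 <= f_ k x) -> (forall x, f_ ^~ x @ \oo --> f x) ->
  (forall k, (k0 <= k)%N -> (\int[mu]_x (f_ k x)%:E <= C%:E)%E) ->
  (\int[mu]_x (f x)%:E <= C%:E)%E.
Proof.
move=> mf f0 ff hC.
pose F k x := (f_ (k + k0)%N x)%:E.
have mF k : measurable_fun setT (F k) by apply/measurable_EFinP; exact: mf.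
have F0 k x : setT x -> (0 <= F k x)%E by move=> _; rewrite lee_fin.
have := @fatou _ _ R mu setT measurableT F mF F0.
rewrite (_ : (\int[mu]_x limn_einf (F^~ x))%E = (\int[mu]_x (f x)%:E)%E); last first.
  apply: eq_integral => x _; have L : F ^~ x @ \oo --> (f x)%:E.
    apply: cvg_EFin; first exact: nearW.
    by have := ff x; rewrite -(cvg_shiftn k0).
  by rewrite (cvg_limn_einf_sup L).1.
move=> /le_trans; apply; rewrite limn_einf_lim; apply: lime_le.
  by apply: is_cvg_einfs.
apply: nearW => k; apply: ge_ereal_inf.
exists (\int[mu]_x F k x)%E; first by exists k => /=.
by apply: hC; rewrite leq_addl.
Qed.

Lemma nmq_norm f : f \in Lf -> (fun x => `|f x|) \in Lf /\ nmq (fun x => `|f x|) <= nmq f.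
Proof.
move=> fL; have mf := Lfun_measurable fL; apply: le_Lfun => //; first exact: measurableT_comp.
by move=> x; rewrite normr_id.
Qed.

(** Riesz-Fischer for functions instead of classes: along a subsequence with increments at most
    2^(-k), the sum of absolute increments has an integrable q-th power, hence is finite almost
    everywhere; Fatou's lemma returns to the full sequence. *)
Lemma nmq_complete (u : nat -> T -> R) : (forall k, u k \in Lf) ->
  (forall e, 0 < e -> exists k0, forall m k, (k0 <= m)%N -> (k0 <= k)%N ->
     nmq (fun x => u m x - u k x) <= e) ->
  exists2 l, l \in Lf & nmq (fun x => u k x - l x) @[k --> \oo] --> 0.
Proof.
move=> uL uC; have mu_ k := Lfun_measurable (uL k).
have /boolp.choice[phi Hphi] : forall j, exists k0, forall m k, (k0 <= m)%N -> (k0 <= k)%N ->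
    nmq (fun x => u m x - u k x) <= (1 / 2) ^+ j.
  by move=> j; apply: uC; rewrite exprn_gt0.
(* Cumulative sums are monotone and dominate both [phi k] and k, so consecutive terms of the
   subsequence satisfy the Cauchy bound of index k. *)
pose psi k := (\sum_(j < k.+1) (phi j).+1)%N.
have psiS k : (psi k <= psi k.+1)%N by rewrite /psi [leqRHS]big_ord_recr/= leq_addr.
have psige k : (phi k <= psi k)%N by rewrite /psi big_ord_recr/= (leq_trans (leqnSn _))// leq_addl.
have psik k : (k <= psi k)%N.
  elim: k => // k ih; rewrite /psi big_ord_recr/= -/(psi k) addnS ltnS; exact: leq_trans ih (leq_addr _ _).
pose v k := u (psi k).
have vL k : v k \in Lf by exact: uL.
have mv k := Lfun_measurable (vL k).
have vS k : nmq (fun x => v k.+1 x - v k x) <= (1 / 2) ^+ k.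
  by apply: Hphi => //; exact: leq_trans (psige k) (psiS k).
pose g k x := \sum_(j < k) `|v j.+1 x - v j x|.
have gS k : g k.+1 = (fun x => g k x + `|v k.+1 x - v k x|).
  by apply/funext => x; rewrite /g big_ord_recr.
have gL k : g k \in Lf /\ nmq (g k) <= 2 - 2 * (1 / 2) ^+ k.
  elim: k => [|k [gkL gk]].
    have z0 : (\int[mu]_x (`|g 0%N x| `^ q)%:E <= (0 `^ q)%:E)%E.
      rewrite powR0 ?gt_eqF// integral0_eq// => x _.
      by rewrite /g big_ord0 normr0 powR0 ?gt_eqF.
    rewrite expr0 mulr1 subrr; apply: nmq_bound z0 => //.
    by rewrite (_ : g 0%N = cst 0)//; apply/funext => x; rewrite /g big_ord0.
  rewrite gS; have [nL nk] := nmq_norm (LfunB (vL k.+1) (vL k)).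
  split; first exact: LfunD.
  apply: (le_trans (nmqD gkL nL)); apply: (le_trans (lerD gk (le_trans nk (vS k)))).
  by rewrite exprS; move: ((1 / 2) ^+ k) => r; lra.
have g0 k x : 0 <= g k x by apply: sumr_ge0.
have gnd x : nondecreasing_seq (g ^~ x).
  by apply/nondecreasing_seqP => k; rewrite gS lerDl.
pose F k x := (g k x `^ q)%:E.
have mF k : measurable_fun setT (F k).
  apply/measurable_EFinP; apply: (measurableT_comp (measurable_powR q)).
  exact: Lfun_measurable (gL k).1.
have FI k : (\int[mu]_x F k x <= (2 `^ q)%:E)%E.
  have -> : (\int[mu]_x F k x = \int[mu]_x (`|g k x| `^ q)%:E)%E.
    by apply: eq_integral => x _; rewrite ger0_norm.
  rewrite (integral_nmq (gL k).1) lee_fin ge0_ler_powR ?(ltW q0) ?nnegrE ?nmq_ge0//.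
  by rewrite (le_trans (gL k).2)// gerBl mulr_ge0// exprn_ge0.
pose G x := limn_einf (F ^~ x).
have Fnd x : nondecreasing_seq (F ^~ x).
  by move=> i j ij; rewrite lee_fin ge0_ler_powR ?(ltW q0) ?nnegrE//; exact: gnd.
have GE x : G x = ereal_sup (range (F ^~ x)).
  by rewrite /G (cvg_limn_einf_sup (ereal_nondecreasing_cvgn (Fnd x))).1.
have FG k x : (F k x <= G x)%E by rewrite GE; apply: ereal_sup_ubound; exists k.
have mG : measurable_fun setT G by apply: (emeasurable_fun_cvg F) => // x _; rewrite GE; exact: ereal_nondecreasing_cvgn.
have GI : mu.-integrable setT G.
  apply/integrableP; split => //.
  have -> : (\int[mu]_x `|G x| = \int[mu]_x G x)%E.
    apply: eq_integral => x _; rewrite gee0_abs// (le_trans _ (FG 0%N x))// lee_fin powR_ge0//.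
  apply: (@le_lt_trans _ _ (2 `^ q)%:E); last exact: ltry.
  have := @fatou _ _ R mu setT measurableT F mF; move=> /(_ _)/le_trans; apply.
    by move=> k x _; rewrite lee_fin powR_ge0.
  rewrite limn_einf_lim; apply: lime_le; first exact: is_cvg_einfs.
  apply: nearW => k; apply: ge_ereal_inf.
  by exists (\int[mu]_x F k x)%E; [exists k => /=|exact: FI].
pose E : set T := [set x | (G x < +oo)%E].
have mE : measurable E by rewrite -[E]setTI; exact: emeasurable_fun_infty_o.
have aeE : {ae mu, forall x, E x}.
  have := integrable_ae measurableT GI; apply: filterS => x /(_ I).
  by rewrite fin_numElt => /andP[].
(* Cutting off outside the full-measure set [E] makes the subsequence converge at every point, so
   that the pointwise limit is measurable. *)
pose w k x := v k x * \1_E x.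
have mw k : measurable_fun setT (w k) by apply: measurable_funM => //; exact: measurable_indic.
have cw x : cvgn (w ^~ x).
  have [xE|xE] := pselect (E x); last first.
    rewrite /w /= indicE memNset//; under eq_fun do rewrite mulr0; exact: is_cvg_cst.
  have cs : cvgn (series (fun k => v k.+1 x - v k x)).
    apply: (@normed_cvg _ R^o).
    rewrite (_ : [normed series _] = g ^~ x); last first.
      apply/funext => k; rewrite /g.
      by rewrite -(big_mkord xpredT (fun j => `|v j.+1 x - v j x|)).
    apply: nondecreasing_is_cvgn; first exact: gnd.
    have Gf : G x \is a fin_num.
      rewrite ge0_fin_numE//; apply: le_trans (FG 0%N x); rewrite lee_fin powR_ge0//.
    exists (fine (G x) `^ q^-1) => _ [k _ <-].
    have := FG k x; rewrite -(fineK Gf) lee_fin => h.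
    have -> : g k x = (g k x `^ q) `^ q^-1 by rewrite -powRrM divff ?gt_eqF// powRr1.
    rewrite ge0_ler_powR ?invr_ge0 ?(ltW q0) ?nnegrE ?powR_ge0//.
    by apply: le_trans h; rewrite powR_ge0.
  rewrite /w indicE mem_set//; under eq_fun do rewrite mulr1.
  rewrite (_ : (fun k => v k x) = (fun k => v 0%N x + series (fun k => v k.+1 x - v k x) k)).
    by apply: is_cvgD => //; exact: is_cvg_cst.
  by apply/funext => k; rewrite /series/= telescope_sumr// subrKC.
pose l x := limn (w ^~ x).
have ml : measurable_fun setT l by apply: (measurable_fun_cvg (h := w)) => [k|x _]; [exact: mw|exact: cw].
have main e : 0 < e -> exists k0, forall k, (k0 <= k)%N ->
    (\int[mu]_x (`|u k x - l x| `^ q)%:E <= (e `^ q)%:E)%E.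
  move=> e0; have [k0 h0] := uC e e0; exists k0 => k k0k.
  have L x : `|u k x - w j x| `^ q * \1_E x @[j --> \oo] --> `|u k x - l x| `^ q * \1_E x.
    apply: cvgM; last exact: cvg_cst.
    apply: cvg_powR_nneg => //; apply: cvg_norm; apply: cvgB; [exact: cvg_cst|exact: cw].
  have mE1 : measurable_fun setT (\1_E : T -> R) by exact: measurable_indic.
  have mm (h : T -> R) : measurable_fun setT h ->
      measurable_fun setT (fun x => `|u k x - h x| `^ q * \1_E x).
    by move=> mh; apply: measurable_funM => //; apply: measurable_normpow; exact: measurable_funB.
  have H := @fatou_bound (fun j x => `|u k x - w j x| `^ q * \1_E x)
    (fun x => `|u k x - l x| `^ q * \1_E x) (e `^ q) k0 (fun j => mm _ (mw j)) _ L.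
  have -> : (\int[mu]_x (`|u k x - l x| `^ q)%:E = \int[mu]_x (`|u k x - l x| `^ q * \1_E x)%:E)%E.
    apply: ae_eq_integral => //.
    - by apply/measurable_EFinP; apply: measurable_normpow; exact: measurable_funB.
    - by apply/measurable_EFinP; exact: mm.
    - by apply: filterS aeE => x Ex _; rewrite indicE mem_set// mulr1.
  apply: H => [j x|j k0j]; first by rewrite mulr_ge0 ?powR_ge0.
  have bL := LfunB (uL k) (vL j).
  apply: (@le_trans _ _ (nmq (fun x => u k x - v j x) `^ q)%:E).
    rewrite -(integral_nmq bL); apply: ge0_le_integral => //.
    - by apply/measurable_EFinP; exact: mm.
    - by apply/measurable_EFinP; apply: measurable_normpow; exact: Lfun_measurable bL.
    - move=> x _; rewrite lee_fin /w indicE.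
      by case: (x \in E); rewrite ?mulr1// mulr0 powR_ge0.
  rewrite lee_fin ge0_ler_powR ?(ltW q0) ?nnegrE ?nmq_ge0 ?(ltW e0)//.
  by apply: h0 => //; exact: leq_trans k0j (psik j).
have lL : l \in Lf.
  have [k0 /(_ _ (leqnn k0)) h] := main 1 ltr01.
  have [|bL _] := nmq_bound _ ler01 h; first exact: measurable_funB.
  have := LfunB (uL k0) bL; rewrite (_ : (fun x => _) = l)//.
  by apply/funext => x; rewrite opprB subrKC.
exists l => //; apply/cvgr0Pnorm_le => e e0.
have [k0 h] := main e e0; near=> k.
rewrite ger0_norm ?nmq_ge0//.
have [||//] := @nmq_bound (fun x => u k x - l x) e _ (ltW e0) (h k _).
  exact: measurable_funB.
by near: k; exact: nbhs_infty_ge.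
Unshelve. all: by end_near. Qed.

End Lq.

(** * Convolution with the heat kernel *)

Lemma divf_mulVK {F : fieldType} (a b c : F) : a != 0 -> b != 0 -> a / b * (c * (b / a)) = c.
Proof.
by move=> a0 b0; rewrite mulrCA -[a / b]invf_div mulVf ?mulr1// mulf_neq0 ?invr_eq0.
Qed.

Lemma powR1D {R : realType} (x e : R) : 0 <= x -> 0 <= e -> x `^ (1 + e) = x * x `^ e.
Proof.
move=> x0 e0; rewrite powRD ?powRr1//; apply/implyP => /eqP h.
by move: e0; rewrite -(@lerD2l _ 1) h addr0 ler10.
Qed.

Section RFubini_gen.
Context d1 d2 (T1 : measurableType d1) (T2 : measurableType d2) (R : realType).
Variables (m1 : {sigma_finite_measure set T1 -> \bar R}).
Variables (m2 : {sigma_finite_measure set T2 -> \bar R}).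

(** Domination is asked only of the inner L^1 norms, not by a product of functions of one variable;
    composing two convolutions needs this form. *)
Lemma RFubini_gen (f : T1 * T2 -> R) (C : T1 -> R) : measurable_fun setT f ->
  (forall x, m2.-integrable setT (EFin \o (fun y => f (x, y)))) ->
  (forall y, m1.-integrable setT (EFin \o (fun x => f (x, y)))) ->
  (forall x, \int[m2]_y `|f (x, y)| <= C x)%R -> m1.-integrable setT (EFin \o C) ->
  (\int[m1]_x \int[m2]_y f (x, y) = \int[m2]_y \int[m1]_x f (x, y))%R.
Proof.
move=> mf i2x i1y fC iC.
have ifxy : (m1 \x m2)%E.-integrable setT (EFin \o f).
  apply/integrable12ltyP; first exact/measurable_EFinP.
  have [mC fC'] := integrableP _ _ _ iC.
  apply: le_lt_trans fC'; apply: ge0_le_integral => //.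
  - by move=> x _; exact: integral_ge0.
  - apply: (@measurable_fun_fubini_tonelli_F _ _ _ _ _ m2 (fun z => `|(f z)%:E|%E)) => //.
    by apply: measurableT_comp => //; exact/measurable_EFinP.
  - exact: measurableT_comp.
  move=> x _; apply: (@le_trans _ _ (C x)%:E); last by rewrite lee_fin ler_norm.
  have := fC x; rewrite -lee_fin /Rintegral fineK//.
  by apply: integrable_fin_num => //; exact: (integrable_norm (i2x x)).
have := Fubini ifxy; rewrite /Rintegral => E; congr fine.
rewrite (eq_integral (fun x => \int[m2]_y (f (x, y))%:E)%E); last first.
  by move=> x _; rewrite fineK//; exact: integrable_fin_num (i2x x).
rewrite [RHS](eq_integral (fun y => \int[m1]_x (f (x, y))%:E)%E)//.
by move=> y _; rewrite fineK//; exact: integrable_fin_num (i1y y).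
Qed.
End RFubini_gen.

(** * Young's convolution inequality *)

Section young.
Context {R : realType} {n : nat}.
Local Notation leb := (lebesgue_Rn R n).
Implicit Types (x y z : Rn R n) (g : Rn R n -> R).
Variables (K : Rn R n -> R) (A B : R).
Hypotheses (mK : measurable_fun setT K) (B0 : 0 <= B) (KB : forall x, `|K x| <= B)
  (KA : (\int[leb]_x (`|K x|)%:E <= A%:E)%E).

Definition absconv g x : R := (\int[leb]_y (`|K (vsub x y)| * `|g y|))%R.

Lemma measurable_Kvsub : measurable_fun setT (fun z : Rn R n * Rn R n => K (vsub z.1 z.2)).
Proof. exact: (measurableT_comp mK measurable_vsub). Qed.

Lemma measurable_absconv g : measurable_fun setT g -> measurable_fun setT (absconv g).
Proof.
move=> mg; apply: (@measurable_Rintegral2 _ _ _ _ R leb (fun z : Rn R n * Rn R n => `|K (vsub z.1 z.2)| * `|g z.2|)).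
apply: measurable_funM; apply: measurableT_comp => //; first exact: measurable_Kvsub.
exact: (measurableT_comp mg).
Qed.

Lemma measurable_conv g : measurable_fun setT g -> measurable_fun setT (Defs.conv K g).
Proof.
move=> mg; apply: (@measurable_Rintegral2 _ _ _ _ R leb (fun z : Rn R n * Rn R n => K (vsub z.1 z.2) * g z.2)).
by apply: measurable_funM; [exact: measurable_Kvsub|exact: (measurableT_comp mg)].
Qed.

Let A0 : 0 <= A.
Proof. by rewrite -lee_fin (le_trans _ KA)// integral_ge0// => x _; rewrite lee_fin. Qed.

Variables (r q : R).
Hypotheses (r1 : 1 < r) (rq : r <= q).

(** Equal to A^(1 - 1/r + 1/q). Together with B^(1/r - 1/q) it is the interpolated bound of the
    kernel in L^s, where 1 + 1/q = 1/s + 1/r. *)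
Definition young_cst : R := ((A `^ (r - 1)) `^ (q / r) * A) `^ q^-1.

Let r0 : 0 < r. Proof. exact: lt_trans r1. Qed.
Let q1 : 1 < q. Proof. exact: lt_le_trans rq. Qed.
Let q0 : 0 < q. Proof. exact: lt_trans q1. Qed.

(** Only the L^1 and sup bounds of the kernel are used. Splitting |K| |g| as |K|^(1 - 1/r) (|K|
    |g|^r)^(1/r), Hoelder bounds the r-th power of the convolution by A^(r - 1) J with J = |K| conv
    |g|^r. In J^(q/r) one factor J is integrated by Tonelli, the rest is bounded by B G^r. *)
Lemma young g (G : R) : measurable_fun setT g -> 0 <= G ->
  (\int[leb]_x (`|g x| `^ r)%:E <= (G `^ r)%:E)%E ->
  [/\ forall x, leb.-integrable setT (EFin \o (fun y => K (vsub x y) * g y)),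
      absconv g \in Lfun leb q%:E &
      nmq leb q (absconv g) <= young_cst * B `^ (r^-1 - q^-1) * G].
Proof.
move=> mg G0 gG.
have mKx x : measurable_fun setT (fun y => K (vsub x y)) := measurableT_comp mK (measurable_vsubr x).
have mnK x : measurable_fun setT (fun y => `|K (vsub x y)|) by exact: measurableT_comp.
have mgr : measurable_fun setT (fun y => `|g y| `^ r) := measurable_normpow r mg.
pose J x : R := fine (\int[leb]_y (`|K (vsub x y)| * `|g y| `^ r)%:E)%E.
have mKg x : measurable_fun setT (fun y => `|K (vsub x y)| * `|g y| `^ r) by exact: measurable_funM.
have JB x : (\int[leb]_y (`|K (vsub x y)| * `|g y| `^ r)%:E <= (B * G `^ r)%:E)%E.
  rewrite EFinM; apply: (@le_trans _ _ (B%:E * \int[leb]_x (`|g x| `^ r)%:E)%E); last by rewrite lee_wpmul2l ?lee_fin.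
  rewrite -ge0_integralZl//; [|exact/measurable_EFinP].
  apply: ge0_le_integral => //.
  - exact/measurable_EFinP.
  - by apply: emeasurable_funM => //; exact/measurable_EFinP.
  - by move=> y _; rewrite -EFinM lee_fin ler_wpM2r ?powR_ge0.
have JE x : (\int[leb]_y (`|K (vsub x y)| * `|g y| `^ r)%:E = (J x)%:E)%E.
  rewrite /J fineK// ge0_fin_numE; first exact: le_lt_trans (JB x) (ltry _).
  by apply: integral_ge0 => y _; rewrite lee_fin mulr_ge0 ?powR_ge0.
have J0 x : 0 <= J x.
  by rewrite -lee_fin -JE integral_ge0// => y _; rewrite lee_fin mulr_ge0 ?powR_ge0.
have KAx x : (\int[leb]_y (`|K (vsub x y)|)%:E <= A%:E)%E.
  rewrite (@ge0_integral_vsubr R n x (fun y => (`|K y|)%:E))//.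
  by apply/measurable_EFinP; exact: measurableT_comp.
have th : 0 < 1 - r^-1 < 1.
  by rewrite subr_gt0 invf_lt1// r1 gtrBl invr_gt0.
have H x : (\int[leb]_y (`|K (vsub x y)| * `|g y|)%:E <= (A `^ (1 - r^-1) * J x `^ r^-1)%:E)%E.
  have JEx : (\int[leb]_y (`|K (vsub x y)| * `|g y| `^ r)%:E <= (J x)%:E)%E by rewrite JE.
  have KM y : 0 <= `|K (vsub x y)| * `|g y| `^ r by rewrite mulr_ge0 ?powR_ge0.
  have := @hoelder_geo _ _ R leb (fun y => `|K (vsub x y)|) _ _ A (J x) (mnK x) (mKg x) (fun y => normr_ge0 _) KM th (KAx x) JEx.
  rewrite subKr; apply: le_trans; rewrite le_eqVlt; apply/orP; left; apply/eqP; apply: eq_integral => y _.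
  rewrite powRM ?powR_ge0// -(powRrM (`|g y|)) divff ?gt_eqF// (powRr1 (normr_ge0 (g y))) mulrA; congr (_ * _)%:E.
  rewrite -powRD ?subrK ?powRr1//.
  by rewrite oner_eq0.
have iC x : leb.-integrable setT (EFin \o (fun y => `|K (vsub x y)| * `|g y|)).
  apply: (integrable_ge0_finite _ _ (H x)); last by move=> y; rewrite mulr_ge0.
  by apply: measurable_funM => //; exact: measurableT_comp.
have CE x : (\int[leb]_y (`|K (vsub x y)| * `|g y|)%:E = (absconv g x)%:E)%E.
  by rewrite /absconv /Rintegral fineK//; exact: integrable_fin_num (iC x).
have C0 x : 0 <= absconv g x by apply: Rintegral_ge0 => y _; rewrite mulr_ge0.
suff [L1 L2] : absconv g \in Lfun leb q%:E /\
    nmq leb q (absconv g) <= young_cst * B `^ (r^-1 - q^-1) * G.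
  split => // x; apply: (le_integrable_bound _ (iC x)); first exact: measurable_funM.
  by move=> y; rewrite normrM.
apply: (nmq_bound q1 (measurable_absconv mg)); first by rewrite !mulr_ge0 ?powR_ge0.
pose e := (q - r) / r; have e0 : 0 <= e by rewrite divr_ge0 ?subr_ge0 ?(ltW r0).
have qr : q / r = 1 + e by rewrite /e mulrBl divff ?gt_eqF// subrKC.
pose M := (A `^ (r - 1)) `^ (q / r) * (B * G `^ r) `^ e.
have M0 : 0 <= M by rewrite mulr_ge0 ?powR_ge0.
have mJ : measurable_fun setT J.
  apply: (@measurable_Rintegral2 _ _ _ _ R leb (fun z : Rn R n * Rn R n => `|K (vsub z.1 z.2)| * `|g z.2| `^ r)).
  apply: measurable_funM; first by apply: measurableT_comp => //; exact: measurable_Kvsub.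
  exact: (measurableT_comp mgr).
have CJ x : absconv g x `^ q <= M * J x.
  have h1 : absconv g x `^ r <= A `^ (r - 1) * J x.
    have := H x; rewrite CE lee_fin => h.
    apply: (le_trans (ge0_ler_powR (ltW r0) _ _ h)); rewrite ?nnegrE ?mulr_ge0 ?powR_ge0//.
    rewrite powRM ?powR_ge0// -!powRrM mulVf ?gt_eqF// powRr1// mulrBl mulVf ?gt_eqF// mul1r.
    exact: lexx.
  have -> : absconv g x `^ q = (absconv g x `^ r) `^ (q / r).
    by rewrite -powRrM mulrCA divff ?mulr1 ?gt_eqF.
  have qr0 : 0 <= q / r by rewrite divr_ge0 ?(ltW q0) ?(ltW r0).
  apply: (le_trans (ge0_ler_powR qr0 _ _ h1)); rewrite ?nnegrE ?mulr_ge0 ?powR_ge0//.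
  rewrite powRM ?powR_ge0// {2}qr powR1D// /M -mulrA ler_wpM2l ?powR_ge0// mulrC ler_wpM2r//.
  have JBx : J x <= B * G `^ r by rewrite -lee_fin -JE.
  by apply: (ge0_ler_powR e0 _ _ JBx); rewrite nnegrE// mulr_ge0 ?powR_ge0.
have IJ : (\int[leb]_x (J x)%:E <= (A * G `^ r)%:E)%E.
  under eq_integral do rewrite -JE.
  pose F (w : Rn R n * Rn R n) : \bar R := (`|K (vsub w.1 w.2)| * `|g w.2| `^ r)%:E.
  have mF : measurable_fun setT F.
    apply/measurable_EFinP; apply: measurable_funM.
      by apply: measurableT_comp => //; exact: measurable_Kvsub.
    exact: (measurableT_comp mgr).
  have F0 w : (0 <= F w)%E by rewrite lee_fin mulr_ge0 ?powR_ge0.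
  rewrite -[leLHS]/(\int[leb]_x \int[leb]_y F (x, y))%E (fubini_tonelli F mF F0).
  apply: (@le_trans _ _ (\int[leb]_y (A%:E * (`|g y| `^ r)%:E))%E); last first.
    rewrite ge0_integralZl//; [|exact/measurable_EFinP]; by rewrite EFinM lee_wpmul2l ?lee_fin.
  apply: ge0_le_integral => //.
  - by move=> y _; exact: integral_ge0.
  - exact: measurable_fun_fubini_tonelli_G.
  - by apply: emeasurable_funM => //; exact/measurable_EFinP.
  move=> y _; rewrite /F /=; under eq_integral do rewrite mulrC EFinM.
  rewrite ge0_integralZl//; last first.
    apply/measurable_EFinP; apply: measurableT_comp => //.
    exact: (measurable_fun2 measurable_Kvsub (@measurable_id _ _ _) (measurable_cst y)).
  rewrite muleC lee_wpmul2r ?lee_fin ?powR_ge0//.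
  rewrite (@ge0_integral_vsubl R n y (fun y => (`|K y|)%:E))//.
  by apply/measurable_EFinP; exact: measurableT_comp.
apply: (@le_trans _ _ (\int[leb]_x (M%:E * (J x)%:E))%E).
  apply: ge0_le_integral => //.
  - by apply/measurable_EFinP; apply: measurable_normpow; exact: measurable_absconv.
  - by apply: emeasurable_funM => //; exact/measurable_EFinP.
  - by move=> x _; rewrite (ger0_norm (C0 x)) -EFinM lee_fin.
rewrite ge0_integralZl//; [|exact/measurable_EFinP|by move=> x _; rewrite lee_fin].
apply: (@le_trans _ _ (M%:E * (A * G `^ r)%:E)%E); first by rewrite lee_wpmul2l ?lee_fin.
rewrite -EFinM lee_fin.
rewrite le_eqVlt; apply/orP; left; apply/eqP.
rewrite powRM ?mulr_ge0 ?powR_ge0// powRM ?powR_ge0// /young_cst -(powRrM _ q^-1) mulVf ?gt_eqF// powRr1 ?mulr_ge0 ?powR_ge0//.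
rewrite -(powRrM B) mulrBl mulVf ?gt_eqF// (mulrC r^-1) qr addrAC subrr add0r.
rewrite /M powRM ?powR_ge0// qr.
have -> : G `^ q = G `^ r * (G `^ r) `^ e.
  by rewrite -powR1D ?powR_ge0// -powRrM -qr mulrCA divff ?mulr1// gt_eqF.
move: (_ `^ (1 + e)) (B `^ e) (G `^ r) ((_ `^ r) `^ e) => a b c f; ring.
Qed.
End young.

Lemma Rintegral_transZ {R : realType} {n : nat} (b : Rn R n) (c : R) (f : Rn R n -> R) :
  (lebesgue_Rn R n).-integrable setT (EFin \o f) ->
  (\int[lebesgue_Rn R n]_y (f (aff 1 b y) * c) = (\int[lebesgue_Rn R n]_y f y) * c)%R.
Proof.
move=> fi; have := Rintegral_aff b (oner_neq0 R) fi; rewrite normr1 expr1n invr1 mul1r => <-.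
rewrite mulrC -RintegralZl//.
  by apply: eq_Rintegral => y _; rewrite mulrC.
exact: (integrable_aff b (oner_neq0 R) fi).
Qed.

Section heat_conv.
Context {R : realType} {n : nat}.
Local Notation leb := (lebesgue_Rn R n).
Variables (d q : R).
Hypotheses (n0 : (0 < n)%N) (hd : (0 < d < 1) \/ (exists k : nat, (0 < k)%N /\ d = k%:R)).
Hypothesis q1 : 1 < q.
Local Notation K := (@heat_kernel R n d).
Local Notation Lf := (Lfun leb q%:E).
Local Notation nm := (nmq leb q).
Implicit Types (g h : Rn R n -> R) (x y z : Rn R n).

Let mK t (t0 : 0 < t) := measurable_heat_kernel (n := n) hd t0.
Let d0 : 0 < d := heat_order_gt0 hd.

(* [enorm ^ alpha * h] need not belong to any [L^r]; [tame] is what is needed to let the heat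
   semigroup act on it and to compose. *)
Definition tame g := measurable_fun setT g /\ forall t, 0 < t ->
  (forall x, leb.-integrable setT (EFin \o (fun y => K t (vsub x y) * g y))) /\
  absconv (K t) g \in Lf.

Lemma absconv_integrand (J : Rn R n -> R) g x :
  leb.-integrable setT (EFin \o (fun y => J (vsub x y) * g y)) ->
  leb.-integrable setT (EFin \o (fun y => `|J (vsub x y)| * `|g y|)).
Proof. by move=> /integrable_norm; under [X in EFin \o X]eq_fun do rewrite /= normrM. Qed.

Lemma conv_le_absconv (J : Rn R n -> R) g x :
  leb.-integrable setT (EFin \o (fun y => J (vsub x y) * g y)) ->
  `|Defs.conv J g x| <= absconv J g x.
Proof.
move=> ig; apply: (le_trans (le_normr_Rintegral measurableT ig)).
by rewrite le_eqVlt; apply/orP; left; apply/eqP; apply: eq_Rintegral => y _; rewrite normrM.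
Qed.

Lemma tame_conv g t : tame g -> 0 < t -> Defs.conv (K t) g \in Lf /\
  nm (Defs.conv (K t) g) <= nm (absconv (K t) g).
Proof.
move=> [mg tg] t0; have [ig aL] := tg t t0; apply: le_Lfun => //.
  by apply: measurable_conv => //; exact: mK.
move=> x; rewrite [leRHS]ger0_norm ?conv_le_absconv//.
by apply: Rintegral_ge0 => y _; rewrite mulr_ge0.
Qed.

Lemma tame_Lfun g : g \in Lf -> tame g /\ forall t, 0 < t ->
  nm (Defs.conv (K t) g) <= young_cst (@hkA R n d) q q * nm g.
Proof.
move=> gL; have mg := Lfun_measurable gL.
have gG : (\int[leb]_x (`|g x| `^ q)%:E <= (nm g `^ q)%:E)%E by rewrite integral_nmq.
have H t (t0 : 0 < t) : [/\ forall x, leb.-integrable setT (EFin \o (fun y => K t (vsub x y) * g y)),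
      absconv (K t) g \in Lf & nm (absconv (K t) g) <= young_cst (@hkA R n d) q q * nm g].
  have L1 : (\int[leb]_x (`|K t x|)%:E <= (@hkA R n d)%:E)%E by rewrite hk_L1e.
  have B0 : 0 <= t `^ (- (n%:R / (2 * d))) * @hkB R n d by rewrite mulr_ge0 ?powR_ge0 ?hkB_ge0.
  have := young (mK t0) B0 (fun x => hk_sup hd x t0) L1 q1 (lexx q) mg (nmq_ge0 _ _ _) gG.
  by rewrite subrr powRr0 mulr1.
have tg : tame g by split => // t t0; have [] := H t t0.
split => // t t0; have [_ h] := tame_conv tg t0; apply: (le_trans h).
by have [] := H t t0.
Qed.

(** Fubini is justified because [absconv (K t) g] lies in L^q and is therefore itself integrable
    against translates of the kernel at time s; inside, [hk_conv] composes the kernels. *)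
Lemma conv_semigroup g s t x : tame g -> 0 < s -> 0 < t ->
  Defs.conv (K s) (Defs.conv (K t) g) x = Defs.conv (K (s + t)) g x.
Proof.
move=> [mg tg] s0 t0; have [ig aL] := tg t t0; have [_ _] := tg _ (addr_gt0 s0 t0).
have ma := Lfun_measurable aL.
have [[_ /(_ s s0)[ias _]] _] := tame_Lfun aL.
pose f (w : Rn R n * Rn R n) := K s (vsub x w.1) * (K t (vsub w.1 w.2) * g w.2).
have mf : measurable_fun setT f.
  apply: measurable_funM.
    apply: (measurableT_comp (mK s0)).
    exact: (measurable_fun2 measurable_vsub (measurable_cst x) (measurable_fst)).
  apply: measurable_funM; last exact: (measurableT_comp mg).
  exact: (measurableT_comp (mK t0) measurable_vsub).
have i1 y : leb.-integrable setT (EFin \o (fun z => f (y, z))).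
  exact: (integrableRZ (K s (vsub x y)) (ig y)).
have B z (y : Rn R n) := hk_sup hd (vsub y z) t0.
have i2 z : leb.-integrable setT (EFin \o (fun y => f (y, z))).
  apply: (le_integrable_bound (g := fun y => (t `^ (- (n%:R / (2 * d))) * @hkB R n d * `|g z|) * `|K s (vsub x y)|)).
  - exact: (measurable_fun2 mf (@measurable_id _ _ _) (measurable_cst z)).
  - apply: integrableRZ; apply: integrable_norm; apply: integrable_vsub.
    exact: integrable_hk.
  - move=> y; rewrite /f /= (normrM (K s (vsub x y))) (normrM (K t (vsub y z))) [leLHS]mulrC.
    by apply: ler_wpM2r => //; apply: ler_wpM2r => //; exact: (B z y).
have := @RFubini_gen _ _ _ _ R leb leb f (fun y => `|K s (vsub x y)| * `|absconv (K t) g y|) mf i1 i2 _ (absconv_integrand (ias x)).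
move=> E; rewrite /Defs.conv.
transitivity (\int[leb]_y \int[leb]_z f (y, z))%R.
  by apply: eq_Rintegral => y _; rewrite /f /= RintegralZl.
rewrite E.
  apply: eq_Rintegral => z _; rewrite -hk_conv// /Defs.conv.
  have ik : leb.-integrable setT (EFin \o (fun y => K s (vsub (vsub x z) y) * K t y)).
    apply: (le_integrable_bound (g := fun y => (s `^ (- (n%:R / (2 * d))) * @hkB R n d) * `|K t y|)).
    - apply: measurable_funM; last exact: mK.
      exact: (measurableT_comp (mK s0) (measurable_vsubr _)).
    - by apply: integrableRZ; apply: integrable_norm; exact: integrable_hk.
    - by move=> y; rewrite (normrM (K s _)) ler_wpM2r//; exact: (hk_sup hd).
  apply: (etrans _ (Rintegral_transZ (aff (-1) [tuple 0 | i < n] z) (g z) ik)).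
  apply: eq_Rintegral => y _; rewrite -vsubEl /f /= mulrA; congr (K s _ * _ * _).
  by apply: eq_from_tnth => j; rewrite !tnth_mktuple opprB addrA subrK.
move=> y; rewrite [X in _ <= X](_ : _ = `|K s (vsub x y)| * absconv (K t) g y); last first.
  by rewrite (@ger0_norm _ (absconv _ _ _))//; apply: Rintegral_ge0 => z _; rewrite mulr_ge0.
rewrite /absconv -RintegralZl//; last exact: absconv_integrand.
by rewrite le_eqVlt; apply/orP; left; apply/eqP; apply: eq_Rintegral => z _; rewrite /f /= (normrM (K s (vsub x y))) (normrM (K t (vsub y z))).
Qed.

Lemma singular_conv (p alpha : R) : 1 < p -> 0 < - alpha < Num.min (2 * d) n%:R ->
  Num.max (n%:R * (p - 1) / (2 * d + alpha)) (n%:R * p / (n%:R + alpha)) < q ->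
  exists c1 c2 b1 b2 : R, [/\ 0 <= c1, 0 <= c2, 0 <= b1 < 1, 0 <= b2 < 1 &
    forall h (H : R), measurable_fun setT h -> 0 <= H ->
      (\int[leb]_x (`|h x| `^ (q / p))%:E <= (H `^ (q / p))%:E)%E ->
      tame (fun x => enorm x `^ alpha * h x) /\
      forall t, 0 < t -> nm (Defs.conv (K t) (fun x => enorm x `^ alpha * h x)) <=
        (c1 * t `^ (- b1) + c2 * t `^ (- b2)) * H].
Proof.
move=> p1 /andP[a0]; rewrite lt_min => /andP[a2d an]; rewrite gt_max => /andP[hq1 hq2].
have nR : 0 < n%:R :> R by rewrite ltr0n.
have p0 : 0 < p := lt_trans ltr01 p1.
have q0 : 0 < q := lt_trans ltr01 q1.
have da : 0 < 2 * d + alpha by rewrite -(opprK alpha) subr_gt0.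
have na : 0 < n%:R + alpha by rewrite -(opprK alpha) subr_gt0.
rewrite ltr_pdivrMr// (mulrC q) -ltr_pdivrMr// in hq1; rewrite ltr_pdivrMr// (mulrC q) -ltr_pdivrMr// in hq2.
pose N : R := n%:R; rewrite -/N in nR hq1 hq2 na an.
have h1 : - alpha < 2 * d - N * (p - 1) / q.
  by move: hq1; set u := _ / q; lra.
have h2 : - alpha < N - N * p / q.
  by move: hq2; set u := _ / q; lra.
(* Strictness leaves room for gam > - alpha, which puts the part of |x|^alpha in the unit ball into
   L^(N/gam). With 1/r = p/q + gam/N, the first upper bound gives the time exponent
   [N / (2 * d) * e1] < 1, the second gives r > 1. *)
have [gam ga gm] : exists2 gam, - alpha < gam & gam < Num.min (2 * d - N * (p - 1) / q) (N - N * p / q).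
  by exists (((- alpha) + Num.min (2 * d - N * (p - 1) / q) (N - N * p / q)) / 2); rewrite ?midf_lt// lt_min h1.
move: gm; rewrite lt_min => /andP[g1 g2].
have gam0 : 0 < gam := lt_trans a0 ga.
pose ir := p / q + gam / N; pose r := ir^-1.
have ir0 : 0 < ir by rewrite addr_gt0// divr_gt0.
have Nir : N * ir = N * p / q + gam.
  by rewrite /ir mulrDr mulrA (mulrCA N gam) divff ?gt_eqF// mulr1.
have ir1 : ir < 1.
  by rewrite -(ltr_pM2l nR) mulr1 Nir addrC -ltrBrDr.
have r1 : 1 < r by rewrite invf_gt1.
have rq : r <= q.
  rewrite /r -(invrK q) lef_pV2 ?posrE ?invr_gt0// -[leLHS]mul1r.
  apply: (@le_trans _ _ (p / q)); last by rewrite lerDl divr_ge0// ltW.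
  by rewrite ler_pM2r ?invr_gt0// ltW.
have pq1 : 1 < q / p.
  rewrite ltr_pdivlMr// mul1r -(ltr_pM2l nR) -ltr_pdivrMr// (lt_trans hq2)//.
  by rewrite -[ltRHS]addr0 ltrD2l -oppr_gt0.
have pqq : q / p <= q by rewrite ler_pdivrMr// ler_peMr ?ltW.
pose th := r * (gam / N).
have thE : 1 - th = r * (p / q).
  have : r * ir = 1 by rewrite mulVf ?gt_eqF.
  by rewrite /ir mulrDr -/th => <-; rewrite addrK.
have r0 : 0 < r := lt_trans ltr01 r1.
have th01 : 0 < th < 1.
  rewrite mulr_gt0 ?divr_gt0//= -subr_gt0 thE mulr_gt0// divr_gt0//.
pose s := N / gam; have s0 : 0 < s by rewrite divr_gt0.
pose V1 (x : Rn R n) : R := if enorm x <= 1 then enorm x `^ alpha else 0.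
pose V2 (x : Rn R n) : R := if enorm x <= 1 then 0 else enorm x `^ alpha.
have mV : measurable_fun setT (fun x : Rn R n => enorm x `^ alpha).
  exact: (measurableT_comp (measurable_powR alpha) measurable_enorm).
have mc : measurable_fun setT (fun x : Rn R n => enorm x <= 1).
  apply: measurable_fun_ler => //; exact: measurable_enorm.
have mV1 : measurable_fun setT V1 by apply: measurable_fun_ifT.
have mV2 : measurable_fun setT V2 by apply: measurable_fun_ifT.
have V10 x : 0 <= V1 x by rewrite /V1; case: ifP => // _; exact: powR_ge0.
have V20 x : 0 <= V2 x by rewrite /V2; case: ifP => // _; exact: powR_ge0.
have V21 x : V2 x <= 1.
  rewrite /V2; case: ifPn => //; rewrite -ltNge => x1.
  by rewrite -(powRr0 (enorm x)) ler_powR// ltW// -oppr_gt0.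
have [D hD] : exists D : R, (\int[leb]_x (V1 x `^ s)%:E <= D%:E)%E.
  have as0 : 0 <= - alpha * s by rewrite mulr_ge0 ?ltW.
  have asn : - alpha * s < N.
    by rewrite /s mulrA ltr_pdivrMr// mulrC ltr_pM2l.
  have := integral_enorm_powR_lty n0 as0 asn.
  set I := (\int[leb]_x _)%E => Ioo.
  have I0 : (0 <= I)%E by apply: integral_ge0 => x _; case: ifP => _; rewrite lee_fin ?powR_ge0.
  exists (fine I); rewrite fineK ?ge0_fin_numE// le_eqVlt; apply/orP; left; apply/eqP.
  apply: eq_integral => x _; rewrite /V1; case: ifP => _; last by rewrite powR0 ?gt_eqF.
  by rewrite -powRrM mulNr opprK.
have D0 : 0 <= D by rewrite -lee_fin (le_trans _ hD)// integral_ge0// => x _; rewrite lee_fin powR_ge0.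
pose B0 := @hkB R n d; have B00 : 0 <= B0 by exact: hkB_ge0.
pose e1 := ir - q^-1; pose e2 := p / q - q^-1.
have e10 : 0 <= e1.
  rewrite subr_ge0 -(invrK ir) -/r lef_pV2 ?posrE//.
have e20 : 0 <= e2 by rewrite /e2 subr_ge0 ler_peMl ?invr_ge0 ?ltW.
have e21 : e2 <= e1 by rewrite /e1 /e2 lerD2r lerDl divr_ge0// ltW.
have Ne1 : N * e1 < 2 * d.
  rewrite /e1 mulrBr Nir; move: g1; rewrite mulrBr mulr1 mulrBl.
  by set u := N * p / q; set v := N / q; lra.
have d2 : 0 < 2 * d by rewrite mulr_gt0.
have bE e : 0 <= e -> N * e < 2 * d -> 0 <= N / (2 * d) * e < 1.
  move=> ee Ne; rewrite mulr_ge0 ?divr_ge0 ?(ltW nR) ?(ltW d2)//=.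
  by rewrite mulrAC ltr_pdivrMr// mul1r.
exists (young_cst (@hkA R n d) r q * B0 `^ e1 * D `^ (gam / N)), (young_cst (@hkA R n d) (q / p) q * B0 `^ e2),
  (N / (2 * d) * e1), (N / (2 * d) * e2).
split; first by rewrite !mulr_ge0 ?powR_ge0.
- by rewrite !mulr_ge0 ?powR_ge0.
- exact: bE.
- by apply: bE => //; rewrite (le_lt_trans _ Ne1)// ler_pM2l.
move=> h H mh H0 hH.
pose f1 x := V1 x * h x; pose f2 x := V2 x * h x.
have mf1 : measurable_fun setT f1 by exact: measurable_funM.
have mf2 : measurable_fun setT f2 by exact: measurable_funM.
have G10 : 0 <= D `^ (gam / N) * H by rewrite mulr_ge0 ?powR_ge0.
have I1 : (\int[leb]_x (`|f1 x| `^ r)%:E <= ((D `^ (gam / N) * H) `^ r)%:E)%E.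
  have mV1s : measurable_fun setT (fun x => V1 x `^ s) := measurableT_comp (measurable_powR s) mV1.
  have := hoelder_geo mV1s (measurable_normpow (q / p) mh) (fun x => powR_ge0 _ _) (fun x => powR_ge0 _ _) th01 hD hH.
  have Es : s * th = r by rewrite /s /th divf_mulVK ?gt_eqF.
  have Eq : q / p * (1 - th) = r by rewrite thE divf_mulVK ?gt_eqF.
  have -> : (D `^ (gam / N) * H) `^ r = D `^ th * (H `^ (q / p)) `^ (1 - th).
    by rewrite powRM ?powR_ge0// -!powRrM Eq /th (mulrC r).
  apply: le_trans; rewrite le_eqVlt; apply/orP; left; apply/eqP; apply: eq_integral => x _.
  by rewrite -!powRrM Es Eq /f1 normrM (ger0_norm (V10 x)) powRM.
have I2 : (\int[leb]_x (`|f2 x| `^ (q / p))%:E <= (H `^ (q / p))%:E)%E.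
  apply: le_trans hH; apply: ge0_le_integral => //.
  - by apply/measurable_EFinP; exact: measurable_normpow.
  - by apply/measurable_EFinP; exact: measurable_normpow.
  - move=> x _; rewrite lee_fin ge0_ler_powR ?nnegrE ?(ltW (lt_trans ltr01 pq1))//.
    by rewrite /f2 normrM (ger0_norm (V20 x)) ler_piMl.
have fE x : enorm x `^ alpha * h x = f1 x + f2 x.
  by rewrite /f1 /f2 /V1 /V2; case: ifP => _; rewrite mul0r ?addr0 ?add0r.
have fN x : `|enorm x `^ alpha * h x| = `|f1 x| + `|f2 x|.
  by rewrite /f1 /f2 /V1 /V2; case: ifP => _; rewrite mul0r normr0 ?addr0 ?add0r.
have Y t (t0 : 0 < t) :
    [/\ forall x, leb.-integrable setT (EFin \o (fun y => K t (vsub x y) * (enorm y `^ alpha * h y))),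
       absconv (K t) (fun x => enorm x `^ alpha * h x) \in Lf &
       nm (absconv (K t) (fun x => enorm x `^ alpha * h x)) <=
        (young_cst (@hkA R n d) r q * (t `^ (- (N / (2 * d))) * B0) `^ e1 * (D `^ (gam / N) * H) +
         young_cst (@hkA R n d) (q / p) q * (t `^ (- (N / (2 * d))) * B0) `^ e2 * H)].
  have L1 : (\int[leb]_x (`|K t x|)%:E <= (@hkA R n d)%:E)%E by rewrite hk_L1e.
  have Bt : 0 <= t `^ (- (n%:R / (2 * d))) * @hkB R n d by rewrite mulr_ge0 ?powR_ge0 ?hkB_ge0.
  have [i1 a1 n1] := young (mK t0) Bt (fun x => hk_sup hd x t0) L1 r1 rq mf1 G10 I1.
  have [i2 a2 n2] := young (mK t0) Bt (fun x => hk_sup hd x t0) L1 pq1 pqq mf2 H0 I2.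
  have aE : absconv (K t) (fun x => enorm x `^ alpha * h x) = (fun x => absconv (K t) f1 x + absconv (K t) f2 x).
    apply/funext => x; rewrite /absconv -RintegralD//; [|exact: absconv_integrand..].
    by apply: eq_Rintegral => y _; rewrite fN mulrDr.
  split.
  - move=> x; have := integrableRD (i1 x) (i2 x).
    by under [X in EFin \o X]eq_fun do rewrite -mulrDr -fE.
  - by rewrite aE; exact: LfunD.
  - rewrite aE (le_trans (nmqD q1 a1 a2))// lerD//.
      by move: n1; rewrite -/N -/B0 /r (invrK ir) -/e1.
    by move: n2; rewrite invf_div -/N -/B0 -/e2.
have tg : tame (fun x => enorm x `^ alpha * h x).
  by split=> [|t t0]; [exact: measurable_funM|have [] := Y t t0].
split => // t t0; have [_ c1] := tame_conv tg t0; apply: (le_trans c1).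
have [_ _ c2] := Y t t0; apply: (le_trans c2).
have PM e : (t `^ (- (N / (2 * d))) * B0) `^ e = t `^ (- (N / (2 * d) * e)) * B0 `^ e.
  by rewrite (powRM _ (powR_ge0 _ _) B00) -powRrM mulNr.
rewrite !PM.
rewrite le_eqVlt; apply/orP; left; apply/eqP.
move: (t `^ _) (t `^ _) (B0 `^ e1) (B0 `^ e2) (D `^ _) (young_cst _ _ _) (young_cst _ _ _) => u1 u2 u3 u4 u5 u6 u7.
ring.
Qed.

End heat_conv.

(** * Strong continuity of the heat semigroup *)

Lemma powR_lipschitz {R : realType} (p a b : R) : 1 < p -> 0 <= b -> b <= a ->
  a `^ p - b `^ p <= p * (a - b) * a `^ (p - 1).
Proof.
move=> p1 b0 ab; have p0 : 0 < p := lt_trans ltr01 p1.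
have a0 : 0 <= a := le_trans b0 ab.
have aE : a `^ p = a * a `^ (p - 1) by rewrite mulr_powRB1.
move: b0; rewrite le_eqVlt => /predU1P[<-|b0].
  by rewrite powR0 ?gt_eqF// !subr0 aE -mulrA ler_peMl ?(ltW p1)// mulr_ge0// powR_ge0.
move: ab; rewrite le_eqVlt => /predU1P[->|ab]; first by rewrite !subrr mulr0 mul0r.
have [x||c] := @MVT R (fun x => x `^ p) (fun x => p * x `^ (p - 1)) b a ab.
  by rewrite in_itv/= => /andP[bx _]; exact: is_derive1_powR (lt_trans b0 bx).
  apply: derivable_within_continuous => x; rewrite in_itv/= => /andP[bx _].
  by have [] := is_derive1_powR p (lt_le_trans b0 bx).
rewrite in_itv/= => /andP[bc ca] ->.
rewrite [leRHS]mulrAC ler_wpM2r ?subr_ge0 ?(ltW ab)// ler_wpM2l ?(ltW p0)//.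
by rewrite ge0_ler_powR ?nnegrE ?subr_ge0 ?(ltW p1) ?(ltW (lt_trans b0 bc)) ?(ltW ca).
Qed.

(** * Local Lipschitz bound for the power nonlinearity *)

Section nonlinearity.
Context d (T : measurableType d) {R : realType} (mu : {measure set T -> \bar R}).
Variables p q : R.
Hypotheses (p1 : 1 < p) (q1 : 1 < q).
Local Notation nm := (nmq mu q).

(** The mean value bound |a^p - b^p| <= p |a - b| max(a, b)^(p - 1), raised to the power q/p, is a
    geometric mean of |u - v|^q and |u|^q + |v|^q with weights 1/p and 1 - 1/p. *)
Lemma powR_diff_Lfun (u v : T -> R) (M : R) : u \in Lfun mu q%:E -> v \in Lfun mu q%:E ->
  nm u <= M -> nm v <= M ->
  (\int[mu]_x (`| `|u x| `^ p - `|v x| `^ p| `^ (q / p))%:E <=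
    ((p * (2 * M `^ q) `^ ((p - 1) / q) * nm (fun x => (u x - v x)%R)) `^ (q / p))%:E)%E.
Proof.
move=> uL vL uM vM.
have p0 : 0 < p := lt_trans ltr01 p1; have q0 : 0 < q := lt_trans ltr01 q1.
have M0 : 0 <= M := le_trans (nmq_ge0 _ _ _) uM.
have bL := LfunB q1 uL vL.
have mU := measurable_normpow q (Lfun_measurable uL).
have mV := measurable_normpow q (Lfun_measurable vL).
have mB := measurable_normpow q (Lfun_measurable bL).
have mUV : measurable_fun setT (fun x => `|u x| `^ q + `|v x| `^ q) by exact: measurable_funD.
have IB : (\int[mu]_x (`|u x - v x| `^ q)%:E <= (nm (fun x => (u x - v x)%R) `^ q)%:E)%E.
  by rewrite integral_nmq.
have IU : (\int[mu]_x (`|u x| `^ q + `|v x| `^ q)%:E <= (2 * M `^ q)%:E)%E.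
  under eq_integral do rewrite EFinD.
  rewrite ge0_integralD//; [|exact/measurable_EFinP..].
  rewrite !integral_nmq// -EFinD lee_fin mulr_natl mulr2n.
  by rewrite lerD// ge0_ler_powR ?nnegrE ?nmq_ge0 ?(ltW q0).
have th : 0 < p^-1 < 1 by rewrite invr_gt0 p0 invf_lt1.
have H := hoelder_geo mB mUV (fun x => powR_ge0 _ _) (fun x => addr_ge0 (powR_ge0 _ _) (powR_ge0 _ _)) th IB IU.
have qp0 : 0 <= q / p by rewrite divr_ge0 ?ltW.
have E1 : ((p * (2 * M `^ q) `^ ((p - 1) / q) * nm (fun x => (u x - v x)%R)) `^ (q / p)) =
   p `^ (q / p) * ((nm (fun x => (u x - v x)%R) `^ q) `^ p^-1 * (2 * M `^ q) `^ (1 - p^-1)).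
  rewrite powRM ?mulr_ge0 ?powR_ge0 ?nmq_ge0 ?(ltW p0)// powRM ?powR_ge0 ?(ltW p0)// -!powRrM.
  have -> : (p - 1) / q * (q / p) = 1 - p^-1 by rewrite mulrA mulfVK ?gt_eqF// mulrBl divff ?gt_eqF// mul1r.
  by rewrite -mulrA; congr (_ * _); rewrite mulrC.
rewrite E1 EFinM.
set F := fun x => _ in H.
have F0 x : (0 <= F x)%E by rewrite lee_fin mulr_ge0 ?powR_ge0.
have mF : measurable_fun setT F.
  apply/measurable_EFinP; by apply: measurable_funM; [exact: (measurableT_comp (measurable_powR _) mB)|exact: (measurableT_comp (measurable_powR _) mUV)].
have c0 : (0 <= (p `^ (q / p))%:E)%E by rewrite lee_fin powR_ge0.
apply: (@le_trans _ _ ((p `^ (q / p))%:E * \int[mu]_x F x)%E); last first.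
  by apply: lee_wpmul2l.
rewrite -(ge0_integralZl mu measurableT mF (fun x _ => F0 x) c0).
apply: ge0_le_integral => //.
- apply/measurable_EFinP; apply: measurable_normpow; apply: measurable_funB.
    exact: measurable_normpow (Lfun_measurable uL).
  exact: measurable_normpow (Lfun_measurable vL).
- by apply: emeasurable_funM.
move=> x _; rewrite /F -EFinM lee_fin.
have key (a b : R) : 0 <= b -> b <= a ->
   `|a `^ p - b `^ p| `^ (q / p) <= p `^ (q / p) * ((`|a - b| `^ q) `^ p^-1 * (a `^ q + b `^ q) `^ (1 - p^-1)).
  move=> b0 ab; have a0 := le_trans b0 ab.
  have ab0 : 0 <= a - b by rewrite subr_ge0.
  have h := powR_lipschitz p1 b0 ab.
  have h0 : b `^ p <= a `^ p by rewrite ge0_ler_powR ?nnegrE ?(ltW p0).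
  rewrite (ger0_norm ab0) ger0_norm ?subr_ge0//.
  apply: (le_trans (ge0_ler_powR qp0 _ _ h)); rewrite ?nnegrE ?subr_ge0 ?mulr_ge0 ?powR_ge0 ?(ltW p0)//.
  rewrite powRM ?mulr_ge0 ?powR_ge0 ?(ltW p0)// powRM ?(ltW p0)// -mulrA ler_wpM2l ?powR_ge0//.
  rewrite -!powRrM ler_wpM2l ?powR_ge0//.
  have -> : (p - 1) * (q / p) = q * (1 - p^-1).
    by rewrite mulrCA mulrBr mulr1 mulrBl divff ?gt_eqF// mul1r mulrBr mulr1.
  have pi1 : 0 <= 1 - p^-1 by rewrite subr_ge0; have [_ /ltW] := andP th.
  rewrite powRrM; apply: (ge0_ler_powR pi1); rewrite ?nnegrE ?addr_ge0 ?powR_ge0//.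
  by rewrite lerDl powR_ge0.
have tri : `| `|u x| - `|v x| | <= `|u x - v x| by exact: ler_dist_dist.
have fin a b : 0 <= b -> b <= a -> `|a - b| <= `|u x - v x| -> a `^ q + b `^ q = `|u x| `^ q + `|v x| `^ q ->
   `|a `^ p - b `^ p| `^ (q / p) <= p `^ (q / p) * ((`|u x - v x| `^ q) `^ p^-1 * (`|u x| `^ q + `|v x| `^ q) `^ (1 - p^-1)).
  move=> b0 ab h <-; apply: (le_trans (key a b b0 ab)).
  apply: ler_wpM2l; first exact: powR_ge0.
  apply: ler_wpM2r; first exact: powR_ge0.
  have pi0 : 0 <= p^-1 by rewrite invr_ge0 ltW.
  apply: (ge0_ler_powR pi0); rewrite ?nnegrE ?powR_ge0//.
  by apply: (ge0_ler_powR (ltW q0)) h; rewrite nnegrE.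
have [uv|/ltW uv] := leP `|v x| `|u x|; first exact: fin.
by rewrite distrC; apply: fin => //; [rewrite distrC|rewrite addrC].
Qed.

End nonlinearity.

Lemma cvg_minr {R : realType} (u v : nat -> R) (a b : R) : u @ \oo --> a -> v @ \oo --> b ->
  Num.min (u k) (v k) @[k --> \oo] --> Num.min a b.
Proof.
move=> ua vb; rewrite (eq_cvg _ _ (fun k => minr_absE (u k) (v k))) minr_absE.
apply: cvgM; [|exact: cvg_cst]; apply: cvgD; first exact: cvgD.
by apply: cvgN; apply: cvg_norm; exact: cvgB.
Qed.

Lemma cvg_maxr {R : realType} (u v : nat -> R) (a b : R) : u @ \oo --> a -> v @ \oo --> b ->
  Num.max (u k) (v k) @[k --> \oo] --> Num.max a b.
Proof.
move=> ua vb; rewrite (eq_cvg _ _ (fun k => maxr_absE (u k) (v k))) maxr_absE.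
apply: cvgM; [|exact: cvg_cst]; apply: cvgD; first exact: cvgD.
by apply: cvg_norm; exact: cvgB.
Qed.

(** * Continuity of translations in L^q *)

Section translation.
Context {R : realType} {n : nat}.
Local Notation leb := (lebesgue_Rn R n).
Variable q : R.
Hypothesis q1 : 1 < q.
Local Notation Lf := (Lfun leb q%:E).
Local Notation nm := (nmq leb q).
Implicit Types (f g : Rn R n -> R) (x y : Rn R n) (h : nat -> Rn R n) (a b : 'I_n -> R).

Let q0 : 0 < q. Proof. exact: lt_trans q1. Qed.

Lemma Lfun_vsub f y : f \in Lf -> (fun x => f (vsub x y)) \in Lf /\
  nm (fun x => f (vsub x y)) = nm f.
Proof.
move=> fL; have mf := Lfun_measurable fL.
have mv : measurable_fun setT (fun x : Rn R n => vsub x y).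
  exact: (measurable_fun2 measurable_vsub (@measurable_id _ _ _) (measurable_cst y)).
have E : (\int[leb]_x (`|f (vsub x y)| `^ q)%:E = (nm f `^ q)%:E)%E.
  rewrite -(integral_nmq q1 fL) (@ge0_integral_vsubl R n y (fun x => (`|f x| `^ q)%:E))//.
  by apply/measurable_EFinP; exact: measurable_normpow.
have L : (fun x => f (vsub x y)) \in Lf.
  by apply: (integral_lty_Lfun q1); [exact: (measurableT_comp mf)|rewrite E ltry].
split => //; have := integral_nmq q1 L; rewrite E => -[].
by move/(congr1 (fun r => r `^ q^-1)); rewrite -!powRrM divff ?gt_eqF// !powRr1 ?nmq_ge0.
Qed.

(* Increments are confined to the unit cube, which costs nothing in the limit and makes the
   dominating functions explicit. *)
Definition small h := (forall k i, `|tnth (h k) i : R| <= 1) /\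
  forall i, (tnth (h k) i : R) @[k --> \oo] --> (0 : R).

Definition tcont f := f \in Lf /\ forall h, small h ->
  nm (fun x => f (vsub x (h k)) - f x) @[k --> \oo] --> (0 : R).

Lemma tcont_close f : f \in Lf ->
  (forall e, 0 < e -> exists2 g, tcont g & nm (fun x => f x - g x) <= e) -> tcont f.
Proof.
move=> fL H; split => // h sh; apply/cvgr0Pnorm_le => e e0.
have e3 : 0 < e / 3 by rewrite divr_gt0.
have [g [gL tg] fg] := H _ e3.
have /cvgr0Pnorm_le/(_ _ e3) := tg h sh; apply: filterS => k.
rewrite !ger0_norm ?nmq_ge0// => hk.
have [fkL _] := Lfun_vsub (h k) fL; have [gkL _] := Lfun_vsub (h k) gL.
have [_ E] := Lfun_vsub (h k) (LfunB q1 fL gL).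
apply: (le_trans (nmq_triangle q1 fkL gkL fL)); rewrite E.
apply: (le_trans (lerD fg (nmq_triangle q1 gkL gL fL))).
rewrite (nmq_distC _ _ g f); move: hk fg; set u := nm _; set v := nm _ => hk fg.
lra.
Qed.

Lemma tcontD f g : tcont f -> tcont g -> tcont (fun x => f x + g x).
Proof.
move=> [fL tf] [gL tg]; split; first exact: LfunD.
move=> h sh; apply: (squeeze_cvgr _ (cvg_cst 0)); last first.
  by have := cvgD (tf h sh) (tg h sh); rewrite addr0; apply.
apply: nearW => k; rewrite nmq_ge0/=.
have [fkL _] := Lfun_vsub (h k) fL; have [gkL _] := Lfun_vsub (h k) gL.
apply: le_trans (nmqD q1 (LfunB q1 fkL fL) (LfunB q1 gkL gL)).
by rewrite le_eqVlt; apply/orP; left; apply/eqP; congr (nmq _ _ _); apply/funext => x; rewrite opprD addrACA.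
Qed.

Lemma tcontZ f (c : R) : tcont f -> tcont (fun x => c * f x).
Proof.
move=> [fL tf]; split; first by have [] := nmqZ q1 c fL.
move=> h sh; have L : `|c| * nm (fun x => f (vsub x (h k)) - f x) @[k --> \oo] --> (0 : R).
  by rewrite -(mulr0 `|c|); apply: cvgM; [exact: cvg_cst|exact: tf].
apply: cvg_trans L; apply: near_eq_cvg; apply: nearW => k.
have [fkL _] := Lfun_vsub (h k) fL; have [_ <-] := nmqZ q1 c (LfunB q1 fkL fL).
by congr (nmq _ _ _); apply/funext => x; rewrite mulrBr.
Qed.

Lemma tcontB f g : tcont f -> tcont g -> tcont (fun x => f x - g x).
Proof.
move=> tf tg; rewrite (_ : (fun x => _) = (fun x => f x + (-1) * g x)).
  by apply: tcontD => //; exact: tcontZ.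
by apply/funext => x; rewrite mulN1r.
Qed.

Lemma tcont0 : tcont (fun=> 0).
Proof.
have z : (fun=> 0 : R) \in Lf.
  by have [|//] := @nmq_bound _ _ _ leb q q1 (cst 0) 0 (measurable_cst _) (lexx _);
     rewrite powR0 ?gt_eqF// integral0_eq// => x _; rewrite normr0 powR0 ?gt_eqF.
have n0 : nm (fun=> 0) = 0.
  by have [_] := nmqZ q1 0 z; rewrite normr0 mul0r => E; rewrite [LHS]E mul0r.
split => // h sh; rewrite (_ : (fun k => _) = cst 0); first exact: cvg_cst.
by apply/funext => k; rewrite -[RHS]n0; congr (nmq _ _ _); apply/funext => x; rewrite subrr.
Qed.

Definition cube (c : R) : set (Rn R n) := [set x | forall i, `[- c, c]%classic (tnth x i : R)].

Lemma measurable_box (A : 'I_n -> set (measurableTypeR R)) : (forall i, measurable (A i)) ->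
  measurable [set x : Rn R n | forall i, A i (tnth x i)].
Proof.
move=> mA; rewrite (_ : [set x | _] = \bigcap_(i in [set: 'I_n]) ((fun x : Rn R n => tnth x i) @^-1` A i)).
  apply: fin_bigcap_measurable => // i _; rewrite -[X in measurable X]setTI.
  exact: measurable_tnth.
by apply/seteqP; split => x /= h i; [move=> _|]; exact: h.
Qed.

Lemma cube_Lfun c : (\1_(cube c) : Rn R n -> R) \in Lf.
Proof.
have mc : measurable (cube c) by apply: (measurable_box (A := fun=> `[- c, c]%classic)) => i; exact: measurable_itv.
apply: (integral_lty_Lfun q1); first exact: measurable_indic.
rewrite (eq_integral (fun x => (\1_(cube c) x)%:E)); last first.
  move=> x _; rewrite indicE; case: (x \in _); first by rewrite normr1 powR1.
  by rewrite normr0 powR0// gt_eqF.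
rewrite integral_indic// setIT.
pose J : set (measurableTypeR R) := `[- c, c]%classic.
apply: (@le_lt_trans _ _ (\prod_(i < n) lebesgue_measure J)%E).
  rewrite le_eqVlt; apply/orP; left; apply/eqP.
  by apply: (lebesgue_Rn_box (A := fun=> `[- c, c]%classic)) => i; exact: measurable_itv.
have [r ->] : exists r : R, lebesgue_measure J = r%:E.
  by rewrite /J lebesgue_measure_itv; case: ifP => _; [exists (c - - c)|exists 0].
by rewrite prodEFin ltry.
Qed.

(** Continuous functions increasing to the indicator of []a, b[] as k grows: translations of
    products of them converge pointwise, hence in norm by domination. *)
Definition tent (a b : R) (k : nat) (s : R) : R :=
  Num.min 1 (k%:R * Num.max 0 (Num.min (s - a) (b - s))).

Lemma tent_itv (a b : R) k (s : R) : 0 <= tent a b k s <= 1.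
Proof.
rewrite /tent ge_min lexx le_min ler01 mulr_ge0// le_max lexx//.
Qed.

Lemma tent_out (a b : R) k (s : R) : ~~ (a < s < b) -> tent a b k s = 0.
Proof.
move=> H; have M : Num.max 0 (Num.min (s - a) (b - s)) = 0.
  rewrite max_l// ge_min !subr_le0.
  by move: H; rewrite negb_and -!leNgt => /orP[]->; rewrite ?orbT.
by rewrite /tent M mulr0 min_r.
Qed.

Lemma tent_cvg (a b s : R) : a < s < b -> tent a b k s @[k --> \oo] --> (1 : R).
Proof.
move=> /andP[sa sb]; set m := Num.min (s - a) (b - s).
have m0 : 0 < m by rewrite lt_min !subr_gt0 sa.
apply: cvg_near_cst; near=> k.
rewrite /tent -/m max_r ?ltW// min_l// -ler_pdivrMr// div1r.
by near: k; exact: nbhs_infty_ger.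
Unshelve. all: by end_near. Qed.

Lemma cvg_tent (a b : R) k (s : R) (e : nat -> R) : e @ \oo --> (0 : R) ->
  tent a b k (s - e j) @[j --> \oo] --> tent a b k s.
Proof.
move=> e0; have ce : s - e j @[j --> \oo] --> s.
  by rewrite -{2}(subr0 s); apply: cvgB => //; exact: cvg_cst.
apply: cvg_minr; first exact: cvg_cst.
apply: cvgM; first exact: cvg_cst.
apply: cvg_maxr; first exact: cvg_cst.
by apply: cvg_minr; apply: cvgB => //; exact: cvg_cst.
Qed.

Definition obox a b : set (Rn R n) := [set x | forall i, `]a i, b i[%classic (tnth x i : R)].

Definition ntent a b k x : R := \prod_(i < n) tent (a i) (b i) k (tnth x i).

Lemma ntent_itv a b k x : 0 <= ntent a b k x <= 1.
Proof.
apply/andP; split; first by apply: prodr_ge0 => i _; have /andP[] := tent_itv (a i) (b i) k (tnth x i).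
apply: (@le_trans _ _ (\prod_(i < n) 1)); last by rewrite big1.
by apply: ler_prod => i _; exact: tent_itv.
Qed.

Lemma ntent_out a b k x : ~ obox a b x -> ntent a b k x = 0.
Proof.
move=> xb; have : exists i, ~ (`]a i, b i[%classic (tnth x i : R)) by apply/existsNP.
move=> [j]; rewrite /= in_itv/= => /negP h.
by rewrite /ntent (bigD1 j)//= tent_out// mul0r.
Qed.

Lemma cvg_prod_ord (F : nat -> 'I_n -> R) (l : 'I_n -> R) :
  (forall i, F ^~ i @ \oo --> l i) -> \prod_(i < n) F k i @[k --> \oo] --> \prod_(i < n) l i.
Proof.
move=> H; elim: (index_enum _) => [|i s ih].
  by rewrite big_nil; under eq_fun do rewrite big_nil; exact: cvg_cst.
by rewrite big_cons; under eq_fun do rewrite big_cons; exact: cvgM.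
Qed.

Lemma ntent_cvg a b x : ntent a b k x @[k --> \oo] --> (\1_(obox a b) x : R).
Proof.
rewrite indicE; case: (boolP (x \in obox a b)) => [/set_mem xb|/negP xb].
  rewrite -[X in _ --> X](_ : \prod_(i < n) 1 = _); last by rewrite big1.
  by apply: cvg_prod_ord => i; apply: tent_cvg; have := xb i; rewrite /= in_itv.
rewrite (_ : (fun k => _) = cst 0); first exact: cvg_cst.
by apply/funext => k; rewrite ntent_out// => /mem_set.
Qed.

Lemma measurable_ntent a b k : measurable_fun setT (ntent a b k).
Proof.
apply: measurable_prod => i _.
have mt : measurable_fun setT (tent (a i) (b i) k).
  apply: measurable_minr => //; apply: measurable_funM => //.
  by apply: measurable_maxr => //; apply: measurable_minr; apply: measurable_funB.
exact: (measurableT_comp mt (measurable_tnth i)).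
Qed.

Lemma tcont_ntent a b k (c : R) : (forall i, - c <= a i) -> (forall i, b i <= c) ->
  tcont (ntent a b k).
Proof.
move=> ca bc.
have sub x : obox a b x -> cube c x.
  move=> xb i; have := xb i; rewrite /= !in_itv/= => /andP[ax xb'].
  by rewrite (le_trans (ca i) (ltW ax)) (le_trans (ltW xb') (bc i)).
have cube1 x y : (forall i, `|tnth y i : R| <= 1) -> cube c (vsub x y) -> cube (c + 1) x.
  move=> y1 xy i; have := xy i; rewrite /= !in_itv/= !tnth_mktuple => /andP[h1 h2].
  have := y1 i; rewrite ler_norml => /andP[h3 h4].
  move: h1 h2 h3 h4; set u : R := tnth x i; set v : R := tnth y i => *.
  by apply/andP; split; lra.
have cube0 x : cube c x -> cube (c + 1) x.
  move=> xc i; have := xc i; rewrite /= !in_itv/= => /andP[h1 h2].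
  by rewrite (le_trans h2) ?lerDl// andbT (le_trans _ h1)// lerN2 lerDl.
pose G x : R := 2 * \1_(cube (c + 1)) x.
have [GL _] := nmqZ q1 2 (cube_Lfun (c + 1)).
have t1 x : `|ntent a b k x| <= \1_(cube c) x.
  have /andP[n0 n1] := ntent_itv a b k x; rewrite (ger0_norm n0) indicE.
  case: (boolP (x \in cube c)) => // xc; rewrite ntent_out// => /sub/mem_set; exact/negP.
have tL : ntent a b k \in Lf.
  have [|//] := le_Lfun q1 (measurable_ntent a b k) (cube_Lfun c).
  by move=> x; rewrite (le_trans (t1 x))// ler_norm.
split => // h [h1 h0].
have [||||_] := @nmq_dominated _ _ R leb q q1 (fun j x => ntent a b k (vsub x (h j)) - ntent a b k x) (cst 0) G.
- move=> j; apply: measurable_funB; last exact: measurable_ntent.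
  apply: (measurableT_comp (measurable_ntent a b k)).
  exact: (measurable_fun2 measurable_vsub (@measurable_id _ _ _) (measurable_cst (h j))).
- move=> x; apply/subr_cvg0; apply: cvg_prod_ord => i.
  have := @cvg_tent (a i) (b i) k (tnth x i) (fun j => tnth (h j) i) (h0 i).
  apply: cvg_trans; apply: near_eq_cvg; apply: nearW => j.
  by rewrite tnth_mktuple.
- exact: GL.
- move=> j x; apply: (le_trans (ler_normB _ _)); rewrite /G mulr_natl mulr2n lerD//.
    apply: (le_trans (t1 _)); rewrite !indicE.
    case: (boolP (vsub x (h j) \in _)) => // /set_mem/(cube1 _ _ (h1 j))/mem_set ->//.
  apply: (le_trans (t1 _)); rewrite !indicE.
  by case: (boolP (x \in cube c)) => // /set_mem/cube0/mem_set ->.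
apply: cvg_trans; apply: near_eq_cvg; apply: nearW => j.
by congr (nmq _ _ _); apply/funext => x; rewrite subr0.
Qed.

Lemma tcont_obox a b (c : R) : (forall i, - c <= a i) -> (forall i, b i <= c) ->
  tcont (\1_(obox a b)).
Proof.
move=> ca bc.
have sub x : obox a b x -> cube c x.
  move=> xb i; have := xb i; rewrite /= !in_itv/= => /andP[ax xb'].
  by rewrite (le_trans (ca i) (ltW ax)) (le_trans (ltW xb') (bc i)).
have [||||L cv] := @nmq_dominated _ _ R leb q q1 (ntent a b) (\1_(obox a b)) (\1_(cube c)).
- by move=> k; exact: measurable_ntent.
- exact: ntent_cvg.
- exact: cube_Lfun.
- move=> k x; have /andP[n0 n1] := ntent_itv a b k x; rewrite (ger0_norm n0) indicE.
  case: (boolP (x \in cube c)) => // xc; rewrite ntent_out// => /sub/mem_set; exact/negP.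
apply: tcont_close => // e e0.
have /cvgr0Pnorm_le/(_ _ e0)[k _ /(_ _ (leqnn k))/= hk] := cv.
exists (ntent a b k); first exact: tcont_ntent.
by rewrite nmq_distC; move: hk; rewrite ger0_norm ?nmq_ge0.
Qed.

Definition ray a : set (Rn R n) := [set x | forall i, a i < (tnth x i : R)].

(** Rays are stable under intersection, which prepares the Dynkin argument. They generate because
    each half-space in one coordinate is the union over m of rays whose other bounds are -m. *)
Lemma Rn_measurableE : @measurable _ (Rn R n) = <<s [set ray a | a in [set: 'I_n -> R]] >>.
Proof.
set G := [set ray a | a in _]; apply/seteqP; split => [A mA|]; last first.
  apply: smallest_sub; first exact: sigma_algebra_measurable.
  move=> _ [a _ <-].
  rewrite (_ : ray a = [set x | forall i, `]a i, +oo[%classic (tnth x i)]).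
    by apply: (measurable_box (A := fun i => `]a i, +oo[%classic)) => i; exact: measurable_itv.
  by apply/seteqP; split => x /= h i; have := h i; rewrite /= in_itv/= andbT.
pose T' := g_sigma_algebraType G.
have mid : measurable_fun [set: T'] (id : T' -> Rn R n).
  apply/measurable_fun_tnthP => i.
  apply: (@measurability _ _ T' _ setT _ (@RGenOInfty.G R)); first exact: RGenOInfty.measurableE.
  move=> _ [_ [c ->] <-]; rewrite setTI.
  rewrite (_ : _ @^-1` _ = \bigcup_(m : nat) (ray (fun j => if j == i then c else - m%:R))).
    by apply: bigcup_measurable => m _; apply: sub_sigma_algebra; exists (fun j => if j == i then c else - m%:R).
  apply/seteqP; split => x /=; rewrite in_itv/= andbT; last first.
    by move=> [m _] /(_ i); rewrite eqxx.
  move=> cx; pose S := \sum_(j < n) `|tnth x j : R|.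
  have [m Sm] : exists m : nat, S < m%:R by exists (Num.truncn S).+1; rewrite truncnS_gt.
  exists m => // j; case: eqP => [->//|_].
  rewrite ltrNl (le_lt_trans _ Sm)// /S (bigD1 j)//= (le_trans (ler_norm _))// normrN lerDl sumr_ge0//.
by have := mid measurableT A mA; rewrite setTI preimage_id.
Qed.

Lemma ray_setI : setI_closed [set ray a | a in [set: 'I_n -> R]].
Proof.
move=> _ _ [a _ <-] [b _ <-]; exists (fun i => Num.max (a i) (b i)) => //.
apply/seteqP; split => x /= h; first by split => i; have := h i; rewrite gt_max => /andP[].
by move=> i; rewrite gt_max h.1 h.2.
Qed.

(** Dynkin induction from rays. Intersecting with a bounded box keeps every indicator in L^q, so
    that complements become differences with the indicator of the box. *)
Lemma tcont_indic (A : set (Rn R n)) (m : nat) : measurable A ->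
  tcont (\1_(A `&` obox (fun=> - m%:R) (fun=> m%:R))).
Proof.
set Q := obox _ _ => mA.
have mobox : measurable Q by apply: (measurable_box (A := fun=> `]- m%:R, m%:R[%classic)) => i; exact: measurable_itv.
have QT : tcont (\1_Q) by apply: (@tcont_obox _ _ m%:R).
have mA' := mA; rewrite Rn_measurableE in mA'.
move: A mA' {mA}; apply: (dynkin_induction Rn_measurableE ray_setI).
- by rewrite setTI.
- move=> _ [a _ <-].
  rewrite (_ : ray a `&` Q = obox (fun i => Num.max (a i) (- m%:R)) (fun=> m%:R)).
    by apply: tcont_obox => // i; rewrite le_max lexx orbT.
  apply/seteqP; split => x /=.
    by move=> [xa xQ] i; have := xQ i; rewrite /= !in_itv/= gt_max xa.
  move=> h; split => i; have := h i; rewrite /= !in_itv/= gt_max => /andP[/andP[]//].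
  by move=> _ -> ->.
- move=> A mA tA; rewrite (_ : \1_(~` A `&` Q) = (fun x => \1_Q x - \1_(A `&` Q) x)).
    exact: tcontB.
  apply/funext => x; rewrite !indicE !in_setI in_setC.
  by case: (x \in A); case: (x \in Q); rewrite /= ?subr0 ?subrr.
- move=> F mF tF TF.
  pose S k (x : Rn R n) : R := \sum_(j < k) \1_(F j `&` Q) x.
  have TS k : tcont (S k).
    elim: k => [|k ih].
      rewrite (_ : S 0%N = fun=> 0); first exact: tcont0.
      by apply/funext => x; rewrite /S big_ord0.
    rewrite (_ : S k.+1 = (fun x => S k x + \1_(F k `&` Q) x)); first exact: tcontD.
    by apply/funext => x; rewrite /S big_ord_recr.
  have SE k x : S k x = \1_(\bigcup_(j < k) F j `&` Q) x.
    elim: k => [|k ih].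
      rewrite /S big_ord0 indicE memNset// => -[[j /=]]; by rewrite ltn0.
    rewrite /S big_ord_recr/= -/(S k x) ih !indicE.
    case: (boolP (x \in F k `&` Q)) => [/set_mem[xk xQ]|/negP xk].
      rewrite memNset ?mem_set ?add0r//; first by split => //; exists k => //=.
      move=> [[j /= jk xj] _].
      have /trivIsetP/(_ j k I I) := tF; rewrite neq_ltn jk => /(_ isT) E.
      by have : (F j `&` F k) x by []; rewrite E.
    rewrite -[false%:R]/(0 : R) addr0; congr ((nat_of_bool _)%:R); apply/idP/idP => /set_mem[[j /= jk xj] xQ]; apply/mem_set.
      by split => //; exists j => //=; exact: ltnW.
    split => //; exists j => //=; rewrite ltn_neqAle -ltnS jk andbT.
    by apply/eqP => jE; apply: xk; apply/mem_set; rewrite -jE.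
  have mS k : measurable_fun setT (S k) by exact: Lfun_measurable (TS k).1.
  have [||||L cv] := @nmq_dominated _ _ R leb q q1 S (\1_(\bigcup_k F k `&` Q)) (\1_Q).
  + exact: mS.
  + move=> x; under eq_fun do rewrite SE; rewrite indicE.
    case: (boolP (x \in _)) => [/set_mem[[j _ xj] xQ]|/negP xN].
      apply: cvg_near_cst; near=> k; rewrite indicE mem_set//; split => //; exists j => //=.
      by near: k; exact: nbhs_infty_gt.
    rewrite (_ : (fun k => _) = cst 0); first exact: cvg_cst.
    apply/funext => k; rewrite indicE memNset// => -[[j _ xj] xQ].
    by apply: xN; apply/mem_set; split => //; exists j.
  + exact: QT.1.
  + move=> k x; rewrite SE !indicE.
    case: (boolP (x \in \bigcup_(j < k) F j `&` Q)) => [/set_mem[_ /mem_set ->]|_]; first by rewrite normr1.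
    by rewrite normr0.
  apply: tcont_close => // e e0.
  have /cvgr0Pnorm_le/(_ _ e0)[k _ /(_ _ (leqnn k))/= hk] := cv.
  by exists (S k) => //; rewrite nmq_distC; move: hk; rewrite ger0_norm ?nmq_ge0.
Unshelve. all: by end_near. Qed.

Import HBNNSimple.

Lemma tcont_ge0 f : f \in Lf -> (forall x, 0 <= f x) -> tcont f.
Proof.
move=> fL f0; have mf := Lfun_measurable fL.
have mf' : measurable_fun setT (EFin \o f) by exact/measurable_EFinP.
pose g := nnsfun_approx measurableT mf'.
have gcvg x : (fun k => (g k x)%:E) @ \oo --> (f x)%:E.
  by apply: (cvg_nnsfun_approx measurableT mf') => // y _; rewrite lee_fin.
have gr x : (fun k => g k x) @ \oo --> f x by exact: (fine_cvg (gcvg x)).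
have gle k x : g k x <= f x.
  have nd : nondecreasing_seq (fun j => g j x).
    by move=> j l jl; have /lefP := nd_nnsfun_approx measurableT mf' jl; apply.
  by rewrite -(cvg_lim _ (gr x))//; apply: nondecreasing_cvgn_le nd _ k; apply: cvgP (gr x).
(* Cutting the simple approximants off at growing boxes brings their level sets within reach of
   [tcont_indic]. *)
pose Q (k : nat) := obox (fun=> - k%:R) (fun=> k%:R).
pose G k x := g k x * \1_(Q k) x.
have TG k : tcont (G k).
  have [m [c gE]] : exists m (c : 'I_m -> R),
      forall x, g k x = \sum_(i < m) c i * \1_(g k @^-1` [set c i]) x.
    pose r := finmap.enum_fset (fset_set (g k @` setT)).
    by exists (size r), (fun i => nth 0 r i) => x; exact: fimfunEord.
  have E : G k = (fun x => \sum_(i < m) (c i * \1_((g k @^-1` [set c i]) `&` Q k) x)).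
    apply/funext => x; rewrite /G gE mulr_suml; apply: eq_bigr => i _.
    by rewrite -mulrA indicI.
  rewrite E; elim: (index_enum _) => [|i s ih].
    by under eq_fun do rewrite big_nil; exact: tcont0.
  under eq_fun do rewrite big_cons.
  by apply: tcontD => //; apply: tcontZ; apply: tcont_indic; rewrite -[X in measurable X]setTI; exact: measurable_funP.
have [||||L cv] := @nmq_dominated _ _ R leb q q1 G f f.
- by move=> k; exact: Lfun_measurable (TG k).1.
- move=> x; rewrite -[X in _ --> X]mulr1; apply: cvgM.
    exact: gr.
  pose S := \sum_(j < n) `|tnth x j : R|.
  apply: cvg_near_cst; near=> k; rewrite indicE mem_set// => i; rewrite /= in_itv/= -ltr_norml.
  apply: (@le_lt_trans _ _ S); first by rewrite /S (bigD1 i)//= lerDl sumr_ge0.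
  near: k; exact: nbhs_infty_gtr.
- exact: fL.
- move=> k x; rewrite /G normrM indicE.
  case: (x \in _); rewrite ?normr1 ?mulr1 ?normr0 ?mulr0//.
  by rewrite ger0_norm.
apply: tcont_close => // e e0.
have /cvgr0Pnorm_le/(_ _ e0)[k _ /(_ _ (leqnn k))/= hk] := cv.
by exists (G k) => //; rewrite nmq_distC; move: hk; rewrite ger0_norm ?nmq_ge0.
Unshelve. all: by end_near. Qed.

Lemma tcont_Lfun f : f \in Lf -> tcont f.
Proof.
move=> fL; have mf := Lfun_measurable fL.
have mp : measurable_fun setT (fun x => Num.max (f x) 0) by exact: measurable_maxr.
have mn : measurable_fun setT (fun x => Num.max (- f x) 0).
  by apply: measurable_maxr => //; exact: measurableT_comp.
rewrite (_ : f = (fun x => Num.max (f x) 0 - Num.max (- f x) 0)).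
  apply: tcontB; apply: tcont_ge0.
  - have [|//] := le_Lfun q1 mp fL.
    by move=> x; rewrite ger0_norm ?le_max ?lexx ?orbT// ge_max ler_norm normr_ge0.
  - by move=> x; rewrite le_max lexx orbT.
  - have [|//] := le_Lfun q1 mn fL.
    by move=> x; rewrite ger0_norm ?le_max ?lexx ?orbT// ge_max -normrN ler_norm normr_ge0.
  - by move=> x; rewrite le_max lexx orbT.
apply/funext => x; have [h|/ltW h] := leP 0 (f x).
  by rewrite max_r ?oppr_le0// subr0.
by rewrite max_l ?oppr_ge0// opprK add0r.
Qed.

End translation.

(** * The heat kernel as an approximate identity *)

Section strong_continuity.
Context {R : realType} {n : nat}.
Local Notation leb := (lebesgue_Rn R n).
Variables (d q : R).
Hypotheses (n0 : (0 < n)%N) (hd : (0 < d < 1) \/ (exists k : nat, (0 < k)%N /\ d = k%:R)).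
Hypothesis q1 : 1 < q.
Local Notation K := (@heat_kernel R n d).
Local Notation Lf := (Lfun leb q%:E).
Local Notation nm := (nmq leb q).
Implicit Types (f : Rn R n -> R) (x y z : Rn R n).

Let q0 : 0 < q. Proof. exact: lt_trans q1. Qed.
Let d0 : 0 < d := heat_order_gt0 hd.
Let K1 := K 1.
Let mK1 : measurable_fun setT K1 := measurable_heat_kernel hd ltr01.
Let iK1 : leb.-integrable setT (EFin \o K1) := integrable_hk n0 hd ltr01.
Let A := @hkA R n d.

Definition shrink (t : R) z : Rn R n := aff (dil d t)^-1 vzero z.

Lemma vsubK x y : vsub x (vsub x y) = y.
Proof. by apply: eq_from_tnth => i; rewrite !tnth_mktuple subKr. Qed.

Lemma affK (c : R) z : c != 0 -> aff c vzero (aff c^-1 vzero z) = z.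
Proof. by move=> c0; apply: eq_from_tnth => i; rewrite !tnth_mktuple !addr0 mulVKf. Qed.

(** Scaling moves the time from the kernel into a translation of [f], so strong continuity becomes
    continuity of translations averaged against the fixed kernel at time 1. *)
Lemma conv_heat_scale f t x : tame d q f -> 0 < t ->
  leb.-integrable setT (EFin \o (fun z => K1 z * f (vsub x (shrink t z)))) /\
  Defs.conv (K t) f x = (\int[leb]_z (K1 z * f (vsub x (shrink t z))))%R.
Proof.
move=> [mf tf] t0; have [/(_ x) iG _] := tf t t0.
have l0 := dil_gt0 d t0; set l := dil d t in l0.
have l1 : l != 0 by rewrite gt_eqF.
have l1' : l^-1 != 0 by rewrite invr_eq0.
have iH := integrableRZ (l ^- n) (integrable_aff vzero l1' (integrable_vsub x iG)).
have E z : l ^- n * (K t (vsub x (vsub x (aff l^-1 vzero z))) * f (vsub x (aff l^-1 vzero z))) =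
    K1 z * f (vsub x (shrink t z)).
  rewrite vsubK (heat_kernel_scale hd _ t0) -/l affK// mulrA mulrA mulVf ?mul1r//.
  by rewrite expf_neq0.
have Ef : (fun z => l ^- n * (K t (vsub x (vsub x (aff l^-1 vzero z))) * f (vsub x (aff l^-1 vzero z)))) =
    (fun z => K1 z * f (vsub x (shrink t z))) by apply/funext.
split; first by rewrite -Ef.
rewrite -Ef /Defs.conv RintegralZl//; last exact: (integrable_aff vzero l1' (integrable_vsub x iG)).
have H := Rintegral_aff vzero l1' (integrable_vsub x iG).
rewrite H (Rintegral_vsub x iG) mulrA gtr0_norm ?invr_gt0// exprVn invrK mulVf ?mul1r//.
by rewrite expf_neq0.
Qed.

Lemma integral_translate f y : f \in Lf ->
  (\int[leb]_x (`|f (vsub x y) - f x| `^ q)%:E = ((\int[leb]_x (`|f (vsub x y) - f x| `^ q))%R)%:E)%E /\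
  (\int[leb]_x (`|f (vsub x y) - f x| `^ q))%R = nm (fun x => f (vsub x y) - f x) `^ q.
Proof.
move=> fL; have [L _] := Lfun_vsub q1 y fL; have B := LfunB q1 L fL.
by rewrite /Rintegral (integral_nmq q1 B).
Qed.

(** A power form of Minkowski's integral inequality: since the kernel has integral 1, the difference
    is an average of f(x - y) - f(x); Hoelder against |K 1|, of mass A, costs A^(q - 1), and Tonelli
    exchanges the integrals. *)
Lemma heat_conv_le f t : f \in Lf -> 0 < t ->
  (\int[leb]_x (`|Defs.conv (K t) f x - f x| `^ q)%:E <=
   (A `^ (q - 1))%:E * \int[leb]_z (`|K1 z| * (\int[leb]_x (`|f (vsub x (shrink t z)) - f x| `^ q))%R)%:E)%E.
Proof.
move=> fL t0; have mf := Lfun_measurable fL.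
have [tf _] := tame_Lfun n0 hd q1 fL.
pose F (w : Rn R n * Rn R n) : R := f (vsub w.1 (shrink t w.2)) - f w.1.
have mF : measurable_fun setT F.
  apply: measurable_funB; last exact: (measurableT_comp mf).
  apply: (measurableT_comp mf); apply: (measurable_fun2 measurable_vsub measurable_fst).
  exact: (measurableT_comp (measurable_aff _ _) measurable_snd).
have mFx x : measurable_fun setT (fun z => F (x, z)).
  exact: (measurable_fun2 mF (measurable_cst x) (@measurable_id _ _ _)).
have mnK : measurable_fun setT (fun z => `|K1 z|) by exact: measurableT_comp.
pose G (w : Rn R n * Rn R n) : \bar R := (`|K1 w.2| * `|F w| `^ q)%:E.
have mG : measurable_fun setT G.
  apply/measurable_EFinP; apply: measurable_funM; last exact: measurable_normpow.
  exact: (measurableT_comp mnK).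
have G0 w : (0 <= G w)%E by rewrite lee_fin mulr_ge0 ?powR_ge0.
have Kint : (\int[leb]_z K1 z)%R = 1 := hk_int n0 hd ltr01.
have DE x : Defs.conv (K t) f x - f x = (\int[leb]_z (K1 z * F (x, z)))%R.
  have [iKf ->] := conv_heat_scale x tf t0.
  rewrite -[X in _ - X]mulr1 -Kint -RintegralZl// -RintegralB//; last exact: integrableRZ.
  by apply: eq_Rintegral => z _; rewrite /F mulrBr (mulrC (f x)).
have iKF x : leb.-integrable setT (EFin \o (fun z => K1 z * F (x, z))).
  have [iKf _] := conv_heat_scale x tf t0.
  have := integrableRB iKf (integrableRZ (f x) iK1).
  by apply: eq_integrable => // z _ /=; rewrite /F mulrBr (mulrC (f x)).
(* Where the inner integral is infinite, a positive factor is needed for the bound to be +oo, as 0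
   times +oo is 0. *)
have A0 : 0 < A.
  apply: (@lt_le_trans _ _ 1) => //; rewrite -Kint.
  apply: (le_trans (ler_norm _)); exact: (le_normr_Rintegral measurableT iK1).
have Aq : 0 < A `^ (q - 1) by rewrite powR_gt0.
have key x : ((`|Defs.conv (K t) f x - f x| `^ q)%:E <= (A `^ (q - 1))%:E * \int[leb]_z G (x, z))%E.
  have I0 : (0 <= \int[leb]_z G (x, z))%E by apply: integral_ge0 => z _; exact: G0.
  case: (eqVneq (\int[leb]_z G (x, z))%E +oo%E) => [->|nI]; first by rewrite gt0_muley ?lte_fin// leey.
  have [J JE] : exists J : R, (\int[leb]_z G (x, z))%E = J%:E.
    by exists (fine (\int[leb]_z G (x, z))%E); rewrite fineK// ge0_fin_numE// ltey.
  have J0 : 0 <= J by rewrite -lee_fin -JE.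
  rewrite JE -EFinM lee_fin.
  have mb : measurable_fun setT (fun z => `|K1 z| * `|F (x, z)| `^ q).
    by apply: measurable_funM => //; exact: measurable_normpow.
  have th : 0 < 1 - q^-1 < 1 by rewrite subr_gt0 invf_lt1// q1 gtrBl invr_gt0.
  have hA : (\int[leb]_z (`|K1 z|)%:E <= A%:E)%E by rewrite hk_L1e.
  have hJ : (\int[leb]_z (`|K1 z| * `|F (x, z)| `^ q)%:E <= J%:E)%E by rewrite -JE.
  have := hoelder_geo mnK mb (fun z => normr_ge0 _) (fun z => mulr_ge0 (normr_ge0 _) (powR_ge0 _ _)) th hA hJ.
  rewrite subKr.
  rewrite (eq_integral (fun z => (`|K1 z * F (x, z)|)%:E)); last first.
    move=> z _; congr (_%:E).
    rewrite powRM ?powR_ge0// -(powRrM (`|F (x, z)|)) divff ?gt_eqF// (powRr1 (normr_ge0 (F (x, z)))) mulrA (normrM (K1 z)); congr (_ * _).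
    by rewrite -powRD ?subrK ?powRr1// oner_eq0.
  move=> h.
  have hD : `|Defs.conv (K t) f x - f x| <= A `^ (1 - q^-1) * J `^ q^-1.
    rewrite DE; apply: (le_trans (le_normr_Rintegral measurableT (iKF x))).
    rewrite -lee_fin /Rintegral fineK//.
    by apply: integrable_fin_num => //; exact: (integrable_norm (iKF x)).
  apply: (le_trans (ge0_ler_powR (ltW q0) _ _ hD)); rewrite ?nnegrE ?mulr_ge0 ?powR_ge0//.
  rewrite powRM ?powR_ge0// -!powRrM mulVf ?gt_eqF// powRr1// mulrBl mulVf ?gt_eqF// mul1r.
  exact: lexx.
apply: (@le_trans _ _ (\int[leb]_x ((A `^ (q - 1))%:E * \int[leb]_z G (x, z)))%E).
  apply: ge0_le_integral => //.
  - apply/measurable_EFinP; apply: measurable_normpow; apply: measurable_funB => //.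
    exact: Lfun_measurable (tame_conv hd q1 tf t0).1.
  - by apply: emeasurable_funM => //; exact: measurable_fun_fubini_tonelli_F.
have mI : measurable_fun setT (fun x => (\int[leb]_z G (x, z))%E).
  exact: (measurable_fun_fubini_tonelli_F (m2 := leb) G mG G0).
rewrite (ge0_integralZl leb measurableT mI); last 2 first.
- by move=> x _; apply: integral_ge0 => z _; exact: G0.
- by rewrite lee_fin ltW.
rewrite lee_wpmul2l ?lee_fin ?(ltW Aq)//.
rewrite (fubini_tonelli G mG G0) le_eqVlt; apply/orP; left; apply/eqP; apply: eq_integral => z _.
rewrite EFinM -(integral_translate (shrink t z) fL).1 -ge0_integralZl//.
apply/measurable_EFinP; apply: measurable_normpow.
exact: (measurable_fun2 mF (@measurable_id _ _ _) (measurable_cst z)).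
Qed.

Lemma heat_strong f (t : nat -> R) : f \in Lf -> (forall k, 0 < t k) -> t @ \oo --> (0 : R) ->
  nm (fun x => Defs.conv (K (t k)) f x - f x) @[k --> \oo] --> (0 : R).
Proof.
move=> fL t0 tc; have mf := Lfun_measurable fL.
pose W y : R := (\int[leb]_x (`|f (vsub x y) - f x| `^ q))%R.
have WE y : W y = nm (fun x => f (vsub x y) - f x) `^ q by have [] := integral_translate y fL.
have mW : measurable_fun setT W.
  apply: (@measurable_Rintegral2 _ _ _ _ R leb (fun w : Rn R n * Rn R n => `|f (vsub w.2 w.1) - f w.2| `^ q)).
  apply: measurable_normpow; apply: measurable_funB; last exact: (measurableT_comp mf).
  by apply: (measurableT_comp mf); exact: (measurable_fun2 measurable_vsub measurable_snd measurable_fst).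
have W0 y : 0 <= W y by rewrite WE powR_ge0.
have WB y : W y <= (2 * nm f) `^ q.
  rewrite WE ge0_ler_powR ?nnegrE ?(ltW q0) ?mulr_ge0 ?nmq_ge0//.
  have [L E] := Lfun_vsub q1 y fL.
  have [N1 N2] := nmqZ q1 (-1) fL.
  have := nmqD q1 L N1; rewrite N2 E normrN1 mul1r mulr_natl mulr2n; apply: le_trans.
  by rewrite le_eqVlt; apply/orP; left; apply/eqP; congr (nmq _ _ _); apply/funext => x; rewrite mulN1r.
have dilc : (dil d (t k))^-1 @[k --> \oo] --> (0 : R).
  have d2 : 0 < (2 * d)^-1 by rewrite invr_gt0 mulr_gt0.
  have := cvg_powR_nneg d2 (fun k => ltW (t0 k)) tc; rewrite powR0 ?gt_eqF//.
  by apply: cvg_trans; apply: near_eq_cvg; apply: nearW => k; rewrite /dil powRN invrK.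
have Wc z : W (shrink (t k) z) @[k --> \oo] --> (0 : R).
  have coord i : (tnth (shrink (t k) z) i : R) @[k --> \oo] --> (0 : R).
    have L : (dil d (t k))^-1 * (tnth z i : R) @[k --> \oo] --> (0 : R).
      by rewrite -(mul0r (tnth z i : R)); apply: cvgM => //; exact: cvg_cst.
    apply: cvg_trans L; apply: near_eq_cvg; apply: nearW => k.
    by rewrite !tnth_mktuple addr0.
  (* [small] confines all increments to the unit cube, hence the sequence is shifted past the first
     [k0] terms. *)
  have [k0 k0P] : exists k0, forall k, (k0 <= k)%N -> forall i, `|tnth (shrink (t k) z) i : R| <= 1.
    have /boolp.choice[kk kkP] : forall i, exists k0, forall k, (k0 <= k)%N -> `|tnth (shrink (t k) z) i : R| <= 1.
      by move=> i; have /cvgr0Pnorm_le/(_ _ ltr01)[k0 _ h] := coord i; exists k0 => k /h.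
    exists (\max_(i < n) kk i)%N => k hk i; apply: kkP; apply: leq_trans hk.
    exact: (leq_bigmax_cond (F := kk)).
  have sm : small (fun k => shrink (t (k + k0)%N) z).
    split; first by move=> k i; apply: k0P; rewrite leq_addl.
    by move=> i; have := coord i; rewrite -(cvg_shiftn k0).
  have [_ /(_ _ sm) L] := tcont_Lfun q1 fL.
  rewrite -(cvg_shiftn k0) (eq_cvg _ _ (fun k => WE _)).
  by have := cvg_powR_nneg q0 (fun k => nmq_ge0 _ _ _) L; rewrite powR0 ?gt_eqF.
have [||||_ iI _ L] := @Rdominated_convergence _ _ R leb (fun k z => `|K1 z| * W (shrink (t k) z)) (cst 0)
   (fun z => (2 * nm f) `^ q * `|K1 z|).
- move=> k; apply: measurable_funM; first exact: measurableT_comp.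
  exact: (measurableT_comp mW (measurable_aff _ _)).
- by move=> z; rewrite -[X in _ --> X](mulr0 (`|K1 z|)); apply: cvgM => //; exact: cvg_cst.
- by apply: integrableRZ; exact: integrable_norm.
- by move=> k z; rewrite normrM normr_id (ger0_norm (W0 _)) mulrC ler_wpM2r.
have L0 : (\int[leb]_z (`|K1 z| * W (shrink (t k) z)))%R @[k --> \oo] --> (0 : R).
  by move: L; rewrite /Rintegral (_ : (\int[leb]_z (cst 0 z)%:E)%E = 0%E)//; exact: integral0.
pose I k := (\int[leb]_z (`|K1 z| * W (shrink (t k) z)))%R.
have I0 k : 0 <= I k by apply: Rintegral_ge0 => z _; rewrite mulr_ge0.
have L2 : A `^ (q - 1) * I k @[k --> \oo] --> (0 : R).
  by rewrite -(mulr0 (A `^ (q - 1))); apply: cvgM => //; exact: cvg_cst.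
have L3 : (A `^ (q - 1) * I k) `^ q^-1 @[k --> \oo] --> (0 : R).
  have q0' : 0 < q^-1 by rewrite invr_gt0.
  have := cvg_powR_nneg q0' (fun k => mulr_ge0 (powR_ge0 _ _) (I0 k)) L2.
  by rewrite powR0 ?gt_eqF.
apply: (squeeze_cvgr _ (cvg_cst 0) L3); apply: nearW => k; rewrite nmq_ge0/=.
have [tf _] := tame_Lfun n0 hd q1 fL.
have mD : measurable_fun setT (fun x => Defs.conv (K (t k)) f x - f x).
  apply: measurable_funB; last exact: mf.
  exact: Lfun_measurable (tame_conv hd q1 tf (t0 k)).1.
have [//||//] := @nmq_bound _ _ R leb q q1 _ ((A `^ (q - 1) * I k) `^ q^-1) mD.
  exact: powR_ge0.
rewrite -powRrM mulVf ?gt_eqF// powRr1 ?mulr_ge0 ?powR_ge0//.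
apply: (le_trans (heat_conv_le fL (t0 k))).
rewrite EFinM lee_wpmul2l ?lee_fin ?powR_ge0// /I /Rintegral fineK//.
apply: integrable_fin_num => //.
apply: (le_integrable_bound (g := fun z => (2 * nm f) `^ q * `|K1 z|)).
- apply: measurable_funM; first exact: measurableT_comp.
  exact: (measurableT_comp mW (measurable_aff _ _)).
- by apply: integrableRZ; exact: integrable_norm.
- by move=> z; rewrite normrM normr_id (ger0_norm (W0 _)) mulrC ler_wpM2r.
Qed.

End strong_continuity.

(** * Bochner integration in a complete seminormed space *)

Section bochner.
Context {R : realType} (X : lmodType R) (nm : X -> R).
Local Notation mu := (@lebesgue_measure R).
Local Notation T1 := (measurableTypeR R).
Implicit Types (x y : X) (D : set T1) (F : R -> X).

(** A seminorm because functions equal almost everywhere are not identified; limits and integrals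
    are then determined up to elements of seminorm zero. *)
Record complete_seminorm : Prop := CompleteSeminorm {
  snD : forall x y, nm (x + y) <= nm x + nm y ;
  snZ : forall a x, nm (a *: x) = `|a| * nm x ;
  sn_complete : forall u : nat -> X,
    (forall e, 0 < e -> exists k0, forall m k, (k0 <= m)%N -> (k0 <= k)%N -> nm (u m - u k) <= e) ->
    exists l, nm (u k - l) @[k --> \oo] --> (0 : R) }.

Hypothesis sn : complete_seminorm.

Lemma sn0 : nm 0 = 0.
Proof. by rewrite -(scale0r 0) (snZ sn) normr0 mul0r. Qed.

Lemma snN x : nm (- x) = nm x.
Proof. by rewrite -scaleN1r (snZ sn) normrN1 mul1r. Qed.

Lemma sn_ge0 x : 0 <= nm x.
Proof.
have := snD sn x (- x); rewrite subrr sn0 snN -mulr2n pmulrn_lge0//.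
Qed.

Lemma sn_dist x y : nm (x - y) = nm (y - x).
Proof. by rewrite -snN opprB. Qed.

Lemma sn_tri y x z : nm (x - z) <= nm (x - y) + nm (y - z).
Proof. by rewrite -[x in nm x <= _](subrKA y); exact: snD. Qed.

Lemma snB x y : nm (x - y) <= nm x + nm y.
Proof. by rewrite -(snN y); exact: snD. Qed.

Lemma sn_ler_dist x y : `|nm x - nm y| <= nm (x - y).
Proof.
have h1 : nm x <= nm (x - y) + nm y by rewrite -{1}(subrK y x); exact: snD.
have h2 : nm y <= nm (x - y) + nm x by rewrite sn_dist -{1}(subrK x y); exact: snD.
by rewrite ler_norml; apply/andP; split; lra.
Qed.

(** Splitting [D] along [A i] moves [phi i] into the constant [c], so only the real functions s |->
    nm (F s - c) with constant c have to be measurable. *)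
Lemma simple_measurable (I : Type) (l : seq I) (A : I -> set T1) (phi : I -> X) D F c :
  measurable D -> (forall i, measurable (A i)) ->
  (forall c, measurable_fun D (fun s => nm (F s - c))) ->
  measurable_fun D (fun s => nm (F s - (c + \sum_(i <- l) \1_(A i) s *: phi i))).
Proof.
move=> mD mA mF; elim: l D mD c mF => [|i l ih] D mD c mF.
  by under eq_fun do rewrite big_nil addr0; exact: mF.
have mD1 : measurable (D `&` A i) by exact: measurableI.
have mD2 : measurable (D `\` A i) by exact: measurableD.
rewrite -(setUIDK D (A i)); apply/measurable_funU => //; split.
- apply: (@eq_measurable_fun _ _ _ _ _ (fun s => nm (F s - ((c + phi i) + \sum_(j <- l) \1_(A j) s *: phi j)))).
    by move=> s /set_mem[Ds Ais]; rewrite big_cons indicE (mem_set Ais) scale1r addrA.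
  apply: ih => // c'; exact: measurable_funS (mF c').
- apply: (@eq_measurable_fun _ _ _ _ _ (fun s => nm (F s - (c + \sum_(j <- l) \1_(A j) s *: phi j)))).
    by move=> s /set_mem[Ds Ais]; rewrite big_cons indicE (memNset Ais) scale0r add0r.
  apply: ih => // c'; exact: measurable_funS (mF c').
Qed.

(* By induction on the list of sets, splitting the domain along each of them in turn. *)
Lemma simple_norm (I : Type) (l : seq I) (A : I -> set T1) (phi : I -> X) D c :
  measurable D -> (mu D < +oo)%E -> (forall i, measurable (A i)) ->
  ((nm (fine (mu D) *: c + \sum_(i <- l) fine (mu (A i `&` D)) *: phi i))%:E <=
    \int[mu]_(s in D) (nm (c + \sum_(i <- l) \1_(A i) s *: phi i))%:E)%E.
Proof.
move=> mD Dfin mA; elim: l D mD Dfin c => [|i l ih] D mD Dfin c.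
  under eq_integral do rewrite big_nil addr0.
  rewrite integral_cst//= big_nil addr0 (snZ sn) ger0_norm ?fine_ge0//.
  by rewrite mulrC EFinM fineK// ge0_fin_numE.
have mD1 : measurable (D `&` A i) by exact: measurableI.
have mD2 : measurable (D `\` A i) by exact: measurableD.
have fin E : measurable E -> E `<=` D -> (mu E < +oo)%E.
  by move=> mE ED; apply: le_lt_trans Dfin; apply: le_measure; rewrite ?inE.
have D1fin : (mu (D `&` A i) < +oo)%E by apply: fin.
have D2fin : (mu (D `\` A i) < +oo)%E by apply: fin => //; exact: subDsetl.
have split_mu E : measurable E ->
    fine (mu (E `&` D)) = fine (mu (E `&` (D `&` A i))) + fine (mu (E `&` (D `\` A i))).
  move=> mE; rewrite -fineD.
  - rewrite -measureU//; [|exact: measurableI|exact: measurableI|].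
      by rewrite -setIUr setUIDK.
    by apply/seteqP; split => s //= [[_ [_ h]] [_ [_ h']]].
  - by rewrite ge0_fin_numE//; apply: fin; [exact: measurableI|move=> x [_ []]].
  - by rewrite ge0_fin_numE//; apply: fin; [exact: measurableI|move=> x [_ []]].
pose G s := nm (c + \sum_(j <- i :: l) \1_(A j) s *: phi j).
have mG : measurable_fun D (fun s => (G s)%:E).
  apply/measurable_EFinP.
  have := @simple_measurable _ (i :: l) A phi D (fun=> 0) c mD mA.
  by under eq_fun do rewrite sub0r snN; apply=> c'; exact: measurable_cst.
rewrite -[X in (_ <= \int[mu]_(s in X) _)%E](setUIDK D (A i)) ge0_integral_setU//; last 3 first.
- by rewrite setUIDK.
- by move=> s _; rewrite lee_fin sn_ge0.
- by apply/disj_set2P; rewrite setDE setIACA setICr setI0.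
have -> : fine (mu D) *: c + \sum_(j <- i :: l) fine (mu (A j `&` D)) *: phi j =
    (fine (mu (D `&` A i)) *: (c + phi i) + \sum_(j <- l) fine (mu (A j `&` (D `&` A i))) *: phi j) +
    (fine (mu (D `\` A i)) *: c + \sum_(j <- l) fine (mu (A j `&` (D `\` A i))) *: phi j).
  rewrite big_cons.
  have -> : \sum_(j <- l) fine (mu (A j `&` D)) *: phi j =
    \sum_(j <- l) fine (mu (A j `&` (D `&` A i))) *: phi j + \sum_(j <- l) fine (mu (A j `&` (D `\` A i))) *: phi j.
    by rewrite -big_split/=; apply: eq_bigr => j _; rewrite split_mu// scalerDl.
  have := split_mu _ measurableT; rewrite !setTI => ->.
  rewrite (setIC (A i)) scalerDl scalerDr -!addrA; congr (_ + _).
  exact: (etrans (addrCA _ _ _) (congr1 _ (addrCA _ _ _))).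
apply: (@le_trans _ _ (_%:E + _%:E)%E); first by rewrite -EFinD lee_fin; exact: (snD sn).
apply: leeD.
  apply: (le_trans (ih _ mD1 D1fin _)); rewrite le_eqVlt; apply/orP; left; apply/eqP.
  apply: eq_integral => s /set_mem[Ds Ais]; rewrite big_cons indicE (mem_set Ais) scale1r addrA//.
apply: (le_trans (ih _ mD2 D2fin _)); rewrite le_eqVlt; apply/orP; left; apply/eqP.
apply: eq_integral => s /set_mem[Ds Ais]; rewrite big_cons indicE (memNset Ais) scale0r add0r//.
Qed.

Definition step n (A : 'I_n -> set T1) (phi : 'I_n -> X) (s : R) : X := \sum_(j < n) \1_(A j) s *: phi j.
Definition step_int n (A : 'I_n -> set T1) (phi : 'I_n -> X) : X := \sum_(j < n) fine (mu (A j)) *: phi j.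

Definition step_on D n (A : 'I_n -> set T1) := forall j, [/\ measurable (A j), A j `<=` D & (mu (A j) < +oo)%E].

(** Transcribes [is_Bochner] to an abstract space with a real-valued seminorm; [BochnerP] identifies
    the two for L^q. *)
Definition isint D F (g : X) : Prop :=
  exists (n : nat -> nat) (A : forall k, 'I_(n k) -> set T1) (phi : forall k, 'I_(n k) -> X),
    [/\ forall k, step_on D (A k),
        forall k, measurable_fun D (fun s => nm (F s - step (A k) (phi k) s)),
        (\int[mu]_(s in D) (nm (F s - step (A k) (phi k) s))%:E)%E @[k --> \oo] --> 0%E
      & nm (g - step_int (A k) (phi k)) @[k --> \oo] --> (0 : R)].

Definition bounded_linear (C : R) (T : X -> X) :=
  [/\ 0 <= C, forall x y, T (x + y) = T x + T y, forall a x, T (a *: x) = a *: T x & forall x, nm (T x) <= C * nm x].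

Lemma bounded_linear_sum C T n (a : 'I_n -> R) (phi : 'I_n -> X) : bounded_linear C T ->
  T (\sum_(j < n) a j *: phi j) = \sum_(j < n) a j *: T (phi j).
Proof.
move=> [_ TD TZ _]; elim: (index_enum _) => [|j l ih].
  by rewrite !big_nil -(scale0r 0) TZ !scale0r.
by rewrite !big_cons TD TZ ih.
Qed.

Lemma isint_step_cmp D D' F F' C T n (A : 'I_n -> set T1) phi n' (A' : 'I_n' -> set T1) phi' (kappa : R -> R) :
  measurable D -> measurable D' -> (mu D' < +oo)%E -> D `<=` D' -> bounded_linear C T ->
  step_on D A -> step_on D' A' ->
  measurable_fun D (fun s => nm (F s - step A phi s)) ->
  measurable_fun D' (fun s => nm (F' s - step A' phi' s)) ->
  measurable_fun D' kappa -> (forall s, D' s -> 0 <= kappa s) ->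
  (forall s, D s -> nm (F' s - T (F s)) <= kappa s) ->
  (forall s, D' s -> ~ D s -> nm (F' s) <= kappa s) ->
  ((nm (step_int A' phi' - T (step_int A phi)))%:E <=
   \int[mu]_(s in D') (nm (F' s - step A' phi' s))%:E + \int[mu]_(s in D') (kappa s)%:E +
   C%:E * \int[mu]_(s in D) (nm (F s - step A phi s))%:E)%E.
Proof.
move=> mD mD' D'fin DD' bT hA hA' me me' mk k0 kD kD'.
have [C0 TD TZ TC] := bT.
(* Both step functions are merged into one, indexed by the disjoint sum, with the second family
   mapped through - T; [simple_norm] then applies once. *)
pose B (j : 'I_n' + 'I_n) := match j with inl i => A' i | inr i => A i end.
pose psi (j : 'I_n' + 'I_n) := match j with inl i => phi' i | inr i => - T (phi i) end.
have mB j : measurable (B j) by case: j => i; [have [] := hA' i|have [] := hA i].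
have BD j : B j `&` D' = B j.
  apply: setIidl; case: j => i /=; first by have [] := hA' i.
  by apply: subset_trans DD'; have [] := hA i.
have sumE (a : set T1 -> R) : \sum_(j <- index_enum ('I_n' + 'I_n)%type) a (B j) *: psi j =
    \sum_(j < n') a (A' j) *: phi' j - T (\sum_(j < n) a (A j) *: phi j).
  rewrite big_sumType/= (bounded_linear_sum _ _ bT) -sumrN; congr (_ + _).
  by apply: eq_bigr => j _; rewrite scalerN.
have := @simple_norm _ (index_enum ('I_n' + 'I_n)%type) B psi D' 0 mD' D'fin mB.
rewrite scaler0 add0r.
rewrite (eq_bigr (fun j => fine (mu (B j)) *: psi j)); last by move=> j _; rewrite BD.
rewrite (sumE (fun E => fine (mu E))) => /le_trans; apply.
under eq_integral do rewrite add0r (sumE (fun E => \1_E _)).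
have mS : measurable_fun D' (fun s => nm (step A' phi' s - T (step A phi s))).
  have := @simple_measurable _ (index_enum ('I_n' + 'I_n)%type) B psi D' (fun=> 0) 0 mD' mB.
  under eq_fun do rewrite sub0r snN add0r (sumE (fun E => \1_E _)).
  by apply => c; exact: measurable_cst.
pose e s := nm (F s - step A phi s) * \1_D s.
have me1 : measurable_fun D' e.
  have -> : e = (fun s => nm (F s - step A phi s)) \_ D.
    by apply/funext => s; rewrite /e patchE indicE; case: ifP; rewrite ?mulr1 ?mulr0.
  by apply: measurable_funTS; apply/(measurable_restrictT _ mD).
have mEF (h : R -> R) : measurable_fun D' h -> measurable_fun D' (fun s => (h s)%:E).
  by move=> mh; exact/measurable_EFinP.
apply: (@le_trans _ _ (\int[mu]_(s in D') ((nm (F' s - step A' phi' s))%:E + (kappa s)%:E + C%:E * (e s)%:E))%E).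
  apply: ge0_le_integral => //.
  - by move=> s _; rewrite lee_fin sn_ge0.
  - exact: mEF.
  - by apply: emeasurable_funD; [apply: emeasurable_funD; exact: mEF|apply: emeasurable_funM => //; exact: mEF].
  move=> s D's; rewrite -EFinM -!EFinD lee_fin /e indicE -/(step A' phi' s) -/(step A phi s).
  case: (boolP (s \in D)) => [/set_mem Ds|/negP nDs].
    rewrite mulr1; apply: (le_trans (sn_tri (F' s) _ _)); rewrite (sn_dist (step _ _ _)) -addrA lerD2l.
    apply: (le_trans (sn_tri (T (F s)) _ _)); apply: lerD; first exact: kD.
    have -> : T (F s) - T (step A phi s) = T (F s - step A phi s).
      by rewrite TD -scaleN1r -scaleN1r TZ.
    exact: TC.
  have nD : ~ D s by move=> /mem_set.
  rewrite mulr0 mulr0 addr0.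
  have -> : step A phi s = 0.
    rewrite /step big1// => j _; rewrite indicE memNset ?scale0r// => Ajs.
    by apply: nD; have [_ + _] := hA j; apply.
  have -> : T 0 = 0 by rewrite -(scale0r 0) TZ !scale0r.
  rewrite subr0 -{1}(subrK (F' s) (step A' phi' s)); apply: (le_trans (snD sn _ _)).
  by rewrite (sn_dist (step _ _ _)) lerD2l; exact: kD'.
have e0 s : 0 <= e s by rewrite mulr_ge0 ?sn_ge0.
rewrite ge0_integralD//; last 4 first.
- by move=> s D's; rewrite adde_ge0 ?lee_fin ?sn_ge0// k0.
- by apply: emeasurable_funD; exact: mEF.
- by move=> s _; rewrite -EFinM lee_fin mulr_ge0.
- by apply: emeasurable_funM => //; exact: mEF.
rewrite ge0_integralD//; last 3 first.
- by move=> s _; rewrite lee_fin sn_ge0.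
- exact: mEF.
- exact: mEF.
rewrite ge0_integralZl//; last 2 first.
- exact: mEF.
- by move=> s _; rewrite lee_fin.
apply: leeD => //; apply: lee_wpmul2l; first by rewrite lee_fin.
rewrite [leRHS]integral_mkcond [leLHS]integral_mkcond le_eqVlt; apply/orP; left; apply/eqP.
apply: eq_integral => s _; rewrite !patchE /e indicE.
case: (boolP (s \in D)) => [sD|_]; last by case: ifP; rewrite ?mulr0.
by rewrite mulr1 (mem_set (DD' _ (set_mem sD))).
Qed.

(** Passing to the limit in the step functions kills both approximation errors. With T = id this
    gives uniqueness and distance estimates; with T = S (t - a) and nested intervals it compares
    Duhamel integrals at two times. *)
Lemma isint_cmp D D' F F' g g' C T (kappa : R -> R) :
  measurable D -> measurable D' -> (mu D' < +oo)%E -> D `<=` D' -> bounded_linear C T ->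
  isint D F g -> isint D' F' g' ->
  measurable_fun D' kappa -> (forall s, D' s -> 0 <= kappa s) ->
  (forall s, D s -> nm (F' s - T (F s)) <= kappa s) ->
  (forall s, D' s -> ~ D s -> nm (F' s) <= kappa s) ->
  ((nm (g' - T g))%:E <= \int[mu]_(s in D') (kappa s)%:E)%E.
Proof.
move=> mD mD' D'fin DD' bT [n [A [phi [hA me Le Lg]]]] [n' [A' [phi' [hA' me' Le' Lg']]]] mk k0 kD kD'.
have [C0 TD TZ TC] := bT.
set I := (\int[mu]_(s in D') (kappa s)%:E)%E.
have I0 : (0 <= I)%E by apply: integral_ge0 => s D's; rewrite lee_fin k0.
have [->|Ioo] := eqVneq I +oo%E; first exact: leey.
have If : I \is a fin_num by rewrite ge0_fin_numE// ltey.
pose a k := nm (g' - step_int (A' k) (phi' k)).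
pose b k := nm (g - step_int (A k) (phi k)).
have H k : ((nm (g' - T g))%:E <= (a k)%:E + ((\int[mu]_(s in D') (nm (F' s - step (A' k) (phi' k) s))%:E + I +
    C%:E * \int[mu]_(s in D) (nm (F s - step (A k) (phi k) s))%:E) + (C * b k)%:E))%E.
  apply: (@le_trans _ _ ((a k)%:E + ((nm (step_int (A' k) (phi' k) - T (step_int (A k) (phi k))))%:E + (C * b k)%:E))%E).
    rewrite -!EFinD lee_fin; apply: (le_trans (sn_tri (step_int (A' k) (phi' k)) _ _)); rewrite lerD2l.
    apply: (le_trans (sn_tri (T (step_int (A k) (phi k))) _ _)); rewrite lerD2l.
    have -> : T (step_int (A k) (phi k)) - T g = T (step_int (A k) (phi k) - g).
      by rewrite TD -scaleN1r -scaleN1r TZ.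
    by apply: (le_trans (TC _)); rewrite /b (sn_dist g).
  rewrite leeD2l// leeD2r//.
  exact: (isint_step_cmp mD mD' D'fin DD' bT (hA k) (hA' k) (me k) (me' k) mk k0 kD kD').
have L : ((a k)%:E + ((\int[mu]_(s in D') (nm (F' s - step (A' k) (phi' k) s))%:E + I +
    C%:E * \int[mu]_(s in D) (nm (F s - step (A k) (phi k) s))%:E) + (C * b k)%:E))%E @[k --> \oo]
    --> (0%:E + ((0%:E + I + C%:E * 0%:E) + (C * 0)%:E))%E.
  apply: cvgeD => //; first by apply: cvg_EFin => //; exact: nearW.
  apply: cvgeD.
  - by rewrite mule0 adde0 add0e fin_num_adde_defl.
  - apply: cvgeD; first by rewrite add0e mule0 fin_num_adde_defl.
      by apply: cvgeD; [rewrite fin_num_adde_defl|exact: Le'|exact: cvg_cst].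
    by apply: cvgeZl.
  - apply: cvg_EFin; first exact: nearW.
    by apply: cvgM => //; exact: cvg_cst.
rewrite mule0 mulr0 !adde0 !add0e in L.
have LE := cvg_lim _ L; rewrite -(LE (@ereal_hausdorff R)).
apply: lime_ge; first by apply: cvgP L.
exact: nearW.
Qed.

Lemma bounded_linear_id : bounded_linear 1 id.
Proof. by split => // x; rewrite mul1r. Qed.

Lemma isint_dist D F F' g g' (kappa : R -> R) :
  measurable D -> (mu D < +oo)%E -> isint D F g -> isint D F' g' ->
  measurable_fun D kappa -> (forall s, D s -> nm (F' s - F s) <= kappa s) ->
  ((nm (g' - g))%:E <= \int[mu]_(s in D) (kappa s)%:E)%E.
Proof.
move=> mD Dfin ig ig' mk kD.
apply: (isint_cmp mD mD Dfin (@subset_refl _ D) bounded_linear_id ig ig' mk) => // s Ds.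
exact: le_trans (sn_ge0 _) (kD s Ds).
Qed.

Lemma step_int_dist D F n (A : 'I_n -> set T1) phi n' (A' : 'I_n' -> set T1) phi' :
  measurable D -> (mu D < +oo)%E -> step_on D A -> step_on D A' ->
  measurable_fun D (fun s => nm (F s - step A phi s)) ->
  measurable_fun D (fun s => nm (F s - step A' phi' s)) ->
  ((nm (step_int A' phi' - step_int A phi))%:E <=
   \int[mu]_(s in D) (nm (F s - step A' phi' s))%:E + \int[mu]_(s in D) (nm (F s - step A phi s))%:E)%E.
Proof.
move=> mD Dfin hA hA' me me'.
have := @isint_step_cmp D D F F 1 id n A phi n' A' phi' (fun=> 0) mD mD Dfin (@subset_refl _ D)
  bounded_linear_id hA hA' me me' (measurable_cst _) (fun s _ => lexx 0).
rewrite integral0 adde0 mul1e; apply => s Ds; first by rewrite subrr sn0.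
by move=> /(_ Ds).
Qed.

Lemma approx_isint D F : measurable D -> (mu D < +oo)%E ->
  (forall e, 0 < e -> exists n (A : 'I_n -> set T1) phi, [/\ step_on D A,
     measurable_fun D (fun s => nm (F s - step A phi s)) &
     (\int[mu]_(s in D) (nm (F s - step A phi s))%:E <= e%:E)%E]) ->
  exists g, isint D F g.
Proof.
move=> mD Dfin H.
have /boolp.choice[n] : forall k : nat, exists n, exists (A : 'I_n -> set T1) phi, [/\ step_on D A,
     measurable_fun D (fun s => nm (F s - step A phi s)) &
     (\int[mu]_(s in D) (nm (F s - step A phi s))%:E <= (harmonic k)%:E)%E].
  by move=> k; apply: H; rewrite /harmonic/= invr_gt0.
move=> Hn.
(* The types of the sets and values depend on [n k], so the second choice is a dependent one, made
   through [cid]. *)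
pose P k (w : ('I_(n k) -> set T1) * ('I_(n k) -> X)) := [/\ step_on D w.1,
     measurable_fun D (fun s => nm (F s - step w.1 w.2 s)) &
     (\int[mu]_(s in D) (nm (F s - step w.1 w.2 s))%:E <= (harmonic k)%:E)%E].
have HP k : exists w, P k w by have [A [phi h]] := Hn k; exists (A, phi).
pose w k := projT1 (cid (HP k)).
have wP k : P k (w k) := projT2 (cid (HP k)).
pose A k := (w k).1; pose phi k := (w k).2.
have D1 m k : nm (step_int (A m) (phi m) - step_int (A k) (phi k)) <= harmonic m + harmonic k.
  have [hm mm Im] := wP m; have [hk mk Ik] := wP k.
  rewrite -lee_fin EFinD; apply: le_trans (leeD Im Ik).
  exact: (step_int_dist mD Dfin hk hm mk mm).
have [g Lg] : exists g, nm (step_int (A k) (phi k) - g) @[k --> \oo] --> (0 : R).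
  apply: (sn_complete sn) => e e0.
  have e2 : 0 < e / 2 by rewrite divr_gt0.
  have /cvgr0Pnorm_le/(_ _ e2)[k0 _ h] := @cvg_harmonic R.
  exists k0 => m k hm hk; apply: (le_trans (D1 m k)); rewrite (splitr e).
  by apply: lerD; rewrite (le_trans (ler_norm _))//; exact: h.
exists g, n, A, phi; split.
- by move=> k; have [] := wP k.
- by move=> k; have [] := wP k.
- have Lh : (harmonic k : R)%:E @[k --> \oo] --> 0%E by apply: cvg_EFin; [exact: nearW|exact: cvg_harmonic].
  apply: (squeeze_cvge _ (cvg_cst 0%E) Lh); apply: nearW => k; have [_ _ ->] := wP k; rewrite andbT.
  by apply: integral_ge0 => s _; rewrite lee_fin sn_ge0.
- by rewrite (eq_cvg _ _ (fun k => sn_dist g _)).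
Qed.

Definition sn_continuous_on D F := forall s, D s -> forall e, 0 < e -> exists2 del, 0 < del &
  forall s', D s' -> `|s' - s| < del -> nm (F s' - F s) <= e.

Lemma sn_continuous_measurable (a b : R) F c : sn_continuous_on `]a, b[ F ->
  measurable_fun (`]a, b[%classic : set T1) (fun s => nm (F s - c)).
Proof.
move=> cF; apply: open_continuous_measurable_fun; first exact: interval_open.
move=> s /set_mem sab; apply/cvgrPdist_le => e e0.
have [del d0 h] := cF s sab e e0.
have ns : \forall t \near s, `]a, b[%classic t by apply: open_nbhs_nbhs; split => //; exact: interval_open.
near=> t; apply: (le_trans (sn_ler_dist _ _)).
have -> : F s - c - (F t - c) = F s - F t by rewrite opprB addrA subrK.
rewrite sn_dist; apply: h; first by near: t.
by near: t; apply/nbhs_ballP; exists del => //= t; rewrite /ball/= distrC.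
Unshelve. all: by end_near. Qed.

Lemma continuous_isint (a b : R) F (kappa : R -> R) : a < b -> sn_continuous_on `]a, b[ F ->
  mu.-integrable (`]a, b[%classic : set T1) (EFin \o kappa) ->
  (forall s, a < s < b -> nm (F s) <= kappa s) ->
  exists g, isint `]a, b[ F g.
Proof.
move=> ab cF ik Fk; set D : set T1 := `]a, b[%classic.
have mD : measurable D by exact: measurable_itv.
have Dfin : (mu D < +oo)%E by rewrite lebesgue_measure_itv/= lte_fin ab -EFinB ltry.
apply: approx_isint => // e e0.
have ba0 : 0 < b - a by rewrite subr_gt0.
pose e1 := e / 2 / (b - a); have e10 : 0 < e1 by rewrite !divr_gt0.
pose h k : R := (b - a) / k.+1%:R; have h0 k : 0 < h k by rewrite divr_gt0.
pose J k (j : nat) : set T1 := D `&` `[a + h k * j%:R, a + h k * j.+1%:R[%classic.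
have mJ k j : measurable (J k j) by apply: measurableI => //; exact: measurable_itv.
pose good k j c := forall s, J k j s -> nm (F s - c) <= e1.
(* The default 0 on bad cells makes the error there equal to nm (F s), which [kappa] controls. *)
pose ph k j : X := xget 0 (good k j).
pose isg k j := exists c, good k j c.
have phP k j : isg k j -> good k j (ph k j) by move=> [c gc]; exact: (xgetPex 0 (ex_intro _ c gc)).
have ph0 k j : ~ isg k j -> ph k j = 0.
  by move=> ng; rewrite /ph xgetPN// => c gc; apply: ng; exists c.
have idx k s : D s -> exists2 j : 'I_k.+1, J k j s & forall i : 'I_k.+1, J k i s -> i = j.
  move=> Ds; have := Ds; rewrite /D /= in_itv/= => /andP[as_ sb].
  have r0 : 0 <= (s - a) / h k by rewrite divr_ge0 ?subr_ge0 ?ltW.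
  have /andP[t1 t2] := truncn_itv r0; set j := Num.truncn _ in t1 t2.
  have jk : (j < k.+1)%N.
    rewrite -(ltr_nat R); apply: (le_lt_trans t1); rewrite ltr_pdivrMr// /h mulrC divfK//.
    by rewrite ltrD2r.
  exists (Ordinal jk).
    split => //=; rewrite in_itv/= -lerBrDl -ltrBlDl mulrC -ler_pdivlMr// t1/=.
    by rewrite mulrC -ltr_pdivrMr.
  move=> i [_]; rewrite /= in_itv/= -lerBrDl -ltrBlDl mulrC -ler_pdivlMr// (mulrC (h k)) -ltr_pdivrMr// => /andP[i1 i2].
  apply/val_inj => /=; apply/eqP; rewrite eqn_leq -ltnS -(ltr_nat R) (le_lt_trans i1 t2)/=.
  by rewrite -ltnS -(ltr_nat R) (le_lt_trans t1 i2).
have stepE k s (j : 'I_k.+1) : D s -> J k (nat_of_ord j) s -> step (fun j : 'I_k.+1 => J k j) (fun j => ph k j) s = ph k j.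
  move=> Ds Js; have [j0 J0 unq] := idx k s Ds.
  rewrite /step (bigD1 j)//= indicE mem_set// scale1r big1 ?addr0// => i ij.
  by rewrite indicE memNset ?scale0r// => /unq; rewrite -(unq j Js) => ij'; rewrite ij' eqxx in ij.
pose B k : set T1 := \bigcup_(j in [set j | (j < k.+1)%N /\ ~ isg k j]) J k j.
have mB k : measurable (B k).
  apply: fin_bigcup_measurable => // ; apply: (sub_finite_set _ (finite_II k.+1)).
  by move=> j [].
have errB k s : D s -> nm (F s - step (fun j : 'I_k.+1 => J k j) (fun j => ph k j) s) <= e1 + `|kappa s| * \1_(B k) s.
  move=> Ds; have [j Jj _] := idx k s Ds; rewrite (stepE k s j Ds Jj).
  have [gj|ngj] := pselect (isg k j).
    by apply: (le_trans (phP k j gj s Jj)); rewrite lerDl mulr_ge0.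
  rewrite ph0// subr0 indicE mem_set; last by exists (nat_of_ord j).
  rewrite mulr1; have := Ds; rewrite /D /= in_itv/= => /Fk h1.
  by rewrite (le_trans h1)// (le_trans (ler_norm _))// lerDr ltW.
have ik' : mu.-integrable setT (EFin \o (fun s => `|(kappa \_ D) s|)).
  apply: integrable_norm; rewrite -restrict_EFin; apply/integrable_restrict => //=.
  by rewrite setTI.
have mk' := measurable_int _ ik'.
have [||||_ _ _ L] := @Rdominated_convergence _ T1 R mu (fun k s => `|(kappa \_ D) s| * \1_(B k) s) (cst 0)
   (fun s => `|(kappa \_ D) s|).
- move=> k; apply: measurable_funM; first exact/measurable_EFinP.
  exact: measurable_indic.
- move=> s; case: (boolP (s \in D)) => [/set_mem Ds|nDs]; last first.
    rewrite (_ : (fun k => _) = cst 0); first exact: cvg_cst.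
    by apply/funext => k; rewrite patchE (negbTE nDs) normr0 mul0r.
  apply: cvg_near_cst.
  have e12 : 0 < e1 by [].
  have [del d0 hd] := cF s Ds e1 e10.
  near=> k; rewrite indicE memNset ?mulr0// => -[j [jk ng] Jj]; apply: ng; exists (F s) => s' Js'.
  apply: hd; first by have [] := Js'.
  apply: (@lt_trans _ _ (h k)); last first.
    rewrite /h ltr_pdivrMr// mulrC -ltr_pdivrMr//.
    apply: (@lt_trans _ _ (k%:R)); last by rewrite ltr_nat.
    near: k; exact: nbhs_infty_gtr.
  have [_] := Jj; have [_] := Js'; rewrite /= !in_itv/= -(natr1 j) mulrDr mulr1 addrA.
  set u := a + _ => /andP[h1 h2] /andP[h3 h4].
  by rewrite ltr_norml; apply/andP; split; lra.
- exact: ik'.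
- by move=> k s; rewrite ger0_norm ?mulr_ge0// indicE; case: (_ \in _); rewrite ?mulr1 ?mulr0.
have e2 : 0 < e / 2 by rewrite divr_gt0.
have L0 : (\int[mu]_s (`|(kappa \_ D) s| * \1_(B k) s))%R @[k --> \oo] --> (0 : R).
  by move: L; rewrite /Rintegral (_ : (\int[mu]_s (cst 0 s)%:E)%E = 0%E)//; exact: integral0.
have /cvgr0Pnorm_le/(_ _ e2)[k _ /(_ _ (leqnn k)) hk] := L0.
have SD : step_on D (fun j : 'I_k.+1 => J k j).
  move=> j; split; [exact: mJ|by move=> s []|].
  apply: le_lt_trans Dfin; apply: le_measure; rewrite ?inE//; by move=> s [].
have mF c : measurable_fun D (fun s => nm (F s - c)) by exact: sn_continuous_measurable.
have mE : measurable_fun D (fun s => nm (F s - step (fun j : 'I_k.+1 => J k j) (fun j => ph k j) s)).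
  have := @simple_measurable _ (index_enum 'I_k.+1) (fun j : 'I_k.+1 => J k j) (fun j => ph k j) D F 0 mD (fun j => mJ k j) mF.
  by under eq_fun do rewrite add0r.
exists k.+1, (fun j => J k j), (fun j => ph k j); split => //.
have mT : measurable_fun setT (fun s : T1 => `|(kappa \_ D) s| * \1_(B k) s).
  apply: measurable_funM; first exact/measurable_EFinP.
  exact: measurable_indic.
apply: (@le_trans _ _ (\int[mu]_(s in D) (e1%:E + (`|(kappa \_ D) s| * \1_(B k) s)%:E))%E).
  apply: ge0_le_integral => //.
  - by move=> s _; rewrite lee_fin sn_ge0.
  - exact/measurable_EFinP.
  - apply: emeasurable_funD => //; apply/measurable_EFinP; exact: measurable_funTS.
  - move=> s Ds; rewrite -EFinD lee_fin patchE mem_set//; exact: errB.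
rewrite ge0_integralD//; last 2 first.
- by move=> s _; rewrite lee_fin ltW.
- by apply/measurable_EFinP; exact: measurable_funTS.
rewrite integral_cst//= (_ : mu D = (b - a)%:E); last first.
  by rewrite lebesgue_measure_itv/= lte_fin ab -EFinB.
have E1 : e1 * (b - a) = e / 2 by rewrite divfK ?gt_eqF.
rewrite -EFinM E1 [in leRHS](splitr e) EFinD leeD2l//.
apply: (@le_trans _ _ (\int[mu]_s (`|(kappa \_ D) s| * \1_(B k) s)%:E)%E).
  by apply: ge0_subset_integral => //; exact/measurable_EFinP.
move: hk; rewrite ger0_norm; last by apply: Rintegral_ge0 => s _; rewrite mulr_ge0.
rewrite -lee_fin /Rintegral fineK//; apply: integrable_fin_num => //.
apply: (le_integrable_bound mT ik') => s.
by rewrite ger0_norm ?mulr_ge0// indicE; case: (_ \in _); rewrite ?mulr1 ?mulr0.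
Unshelve. all: by end_near. Qed.

End bochner.

(** * Abstract semilinear evolution equations *)

Section reflection.
Context {R : realType}.
Local Notation mu := (@lebesgue_measure R).
Local Notation T1 := (measurableTypeR R).

Lemma ge0_integral_reflect (t : R) (g : T1 -> R) : measurable_fun setT g -> (forall s, 0 <= g s) ->
  (\int[mu]_(s in (`]0%R, t[%classic : set T1)) (g (t - s))%:E =
   \int[mu]_(s in (`]0%R, t[%classic : set T1)) (g s)%:E)%E.
Proof.
move=> mg g0; pose D : set T1 := `]0%R, t[%classic; have mD : measurable D by exact: measurable_itv.
have mind : measurable_fun setT (\1_D : T1 -> R) by exact: measurable_indic.
pose h (s : T1) : \bar R := (g s * \1_D s)%:E.
have mh : measurable_fun setT h by apply/measurable_EFinP; exact: (measurable_funM mg mind).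
have h0 s : (0 <= h s)%E by rewrite lee_fin mulr_ge0.
have N1 : -1 != 0 :> R by rewrite oppr_eq0 oner_eq0.
have H := @ge0_integral_affine R (-1) t h N1 mh h0.
rewrite normrN1 invr1 mul1e in H.
rewrite integral_mkcond [RHS]integral_mkcond.
transitivity (\int[mu]_s h (-1 * s + t)%R)%E.
  apply: eq_integral => s _; rewrite patchE /h indicE.
  have -> : -1 * s + t = t - s by rewrite mulN1r addrC.
  have -> : (t - s \in D) = (s \in D).
    by apply/idP/idP => /set_mem; rewrite /D /= in_itv/= => /andP[h1 h2]; apply/mem_set;
       rewrite /= in_itv/=; apply/andP; split; lra.
  by case: ifP; rewrite ?mulr1 ?mulr0.
rewrite H; apply: eq_integral => s _; rewrite patchE /h indicE.
by case: ifP; rewrite ?mulr1 ?mulr0.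
Qed.

(** For lam = k tending to infinity the weight tends to 0 at every positive time, by domination also
    in the integral. This makes Picard iteration contract on an interval of any length. *)
Lemma exp_weight_small (kap : T1 -> R) (T e : R) : measurable_fun setT kap -> (forall s, 0 <= kap s) ->
  mu.-integrable (`]0%R, T[%classic : set T1) (EFin \o kap) -> 0 < e ->
  exists2 lam, 0 <= lam & (\int[mu]_(s in (`]0%R, T[%classic : set T1)) (kap s * expR (- lam * s))%:E <= e%:E)%E.
Proof.
move=> mk k0 ik e0; set D : set T1 := `]0%R, T[%classic.
have mD : measurable D by exact: measurable_itv.
have mind : measurable_fun setT (\1_D : T1 -> R) by exact: measurable_indic.
have mexp (k : R) : measurable_fun setT (fun s : T1 => expR (- k * s)).
  by apply: (@measurableT_comp _ _ _ _ _ _ (@expR R)) => //; exact: measurable_funM.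
pose g s := kap s * \1_D s.
have ig : mu.-integrable setT (EFin \o g).
  have : mu.-integrable setT (EFin \o (kap \_ D)).
    by rewrite -restrict_EFin; apply/integrable_restrict => //=; rewrite setTI.
  apply: eq_integrable => // s _ /=; rewrite patchE /g indicE.
  by case: ifP; rewrite ?mulr1 ?mulr0.
have [||||_ _ _ L] := @Rdominated_convergence _ T1 R mu (fun k s => g s * expR (- k%:R * s)) (cst 0) g.
- by move=> k; apply: measurable_funM => //; exact: measurable_funM.
- move=> s; rewrite /g indicE; case: (boolP (s \in D)) => [/set_mem|_]; last first.
    rewrite (_ : (fun k => _) = cst 0); first exact: cvg_cst.
    by apply/funext => k; rewrite mulr0 mul0r.
  rewrite /D /= in_itv/= => /andP[s0 _]; rewrite mulr1 -(mulr0 (kap s)).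
  apply: cvgM; first exact: cvg_cst.
  have q1 : `|expR (- s)| < 1 by rewrite gtr0_norm ?expR_gt0// expR_lt1 oppr_lt0.
  have := cvg_expr q1; apply: cvg_trans; apply: near_eq_cvg; apply: nearW => k.
  by rewrite -expRM_natl mulrN mulNr.
- exact: ig.
- move=> k s; rewrite /g indicE; case: (boolP (s \in D)) => [/set_mem|_]; last by rewrite mulr0 mul0r normr0.
  rewrite /D /= in_itv/= => /andP[s0 _]; rewrite mulr1 ger0_norm ?mulr_ge0 ?expR_ge0//.
  by rewrite ler_piMr// -expR0 ler_expR mulNr oppr_le0 mulr_ge0// ltW.
have L0 : (\int[mu]_s (g s * expR (- k%:R * s)))%R @[k --> \oo] --> (0 : R).
  by move: L; rewrite /Rintegral (_ : (\int[mu]_s (cst 0 s)%:E)%E = 0%E)//; exact: integral0.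
have /cvgr0Pnorm_le/(_ _ e0)[k _ /(_ _ (leqnn k)) hk] := L0.
exists k%:R => //.
rewrite integral_mkcond (eq_integral (fun s => (g s * expR (- k%:R * s))%:E)); last first.
  move=> s _; rewrite patchE /g indicE; case: ifP => _; first by rewrite mulr1.
  by rewrite mulr0 mul0r.
have g0 s : 0 <= g s by rewrite mulr_ge0.
move: hk; rewrite ger0_norm; last by apply: Rintegral_ge0 => s _; rewrite mulr_ge0// expR_ge0.
rewrite -lee_fin /Rintegral fineK//; apply: integrable_fin_num => //.
apply: (le_integrable_bound _ ig); first by apply: measurable_funM => //; exact: measurable_funM.
move=> s; rewrite ger0_norm ?mulr_ge0 ?expR_ge0// /g indicE.
case: (boolP (s \in D)) => [/set_mem|_]; last by rewrite mulr0 mul0r.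
rewrite /D /= in_itv/= => /andP[s0 _].
by rewrite mulr1 ler_piMr// -expR0 ler_expR mulNr oppr_le0 mulr_ge0// ltW.
Qed.

Lemma le0_half (x C : R) : (forall k, x <= C * 2^-1 ^+ k) -> x <= 0.
Proof.
move=> h; have L : C * 2^-1 ^+ k @[k --> \oo] --> C * 0.
  apply: cvgM; first exact: cvg_cst.
  by apply: cvg_expr; rewrite gtr0_norm ?invf_lt1// ltr1n.
rewrite mulr0 in L; have LE := cvg_lim (@Rhausdorff R) L; rewrite -LE.
by apply: limr_ge; [exact: cvgP L|exact: nearW].
Qed.

End reflection.

(** * Radial retraction onto a ball *)

Section truncation.
Context {R : realType} (X : lmodType R) (nm : X -> R) (sn : complete_seminorm nm).
Variable M : R.
Hypothesis M0 : 0 < M.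
Implicit Types x y : X.

Definition retract x : X := (M / Num.max M (nm x)) *: x.

Let mx_gt0 x : 0 < Num.max M (nm x). Proof. by rewrite lt_max M0. Qed.

Lemma retract_norm x : nm (retract x) <= M.
Proof.
rewrite /retract (snZ sn) gtr0_norm ?divr_gt0// mulrAC ler_pdivrMr// ler_wpM2l ?(ltW M0)//.
by rewrite le_max lexx orbT.
Qed.

Lemma retract_id x : nm x <= M -> retract x = x.
Proof. by move=> xM; rewrite /retract max_l// divff ?scale1r// gt_eqF. Qed.

(** In a general norm one Lipschitz unit comes from moving the vector and one from changing the
    scaling factor, as the maximum with M is 1-Lipschitz in the norm. *)
Lemma retract_lip x y : nm (retract x - retract y) <= 2 * nm (x - y).
Proof.
set a := Num.max M (nm x); set b := Num.max M (nm y).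
have a0 : 0 < a := mx_gt0 x; have b0 : 0 < b := mx_gt0 y.
have -> : retract x - retract y = (M / a) *: (x - y) + (M / a - M / b) *: y.
  by rewrite /retract -/a -/b scalerBr scalerBl addrA subrK.
apply: (le_trans (snD sn _ _)); rewrite !(snZ sn) mulr_natl mulr2n lerD//.
  rewrite gtr0_norm ?divr_gt0// ler_piMl ?(sn_ge0 sn)// ler_pdivrMr// mul1r /a le_max lexx//.
have -> : M / a - M / b = M * (b - a) / (a * b).
  by rewrite mulrBr mulrBl invfM; congr (_ - _); [rewrite mulrA mulrAC mulfK ?gt_eqF|rewrite mulrA mulfK ?gt_eqF].
rewrite normrM normrM (gtr0_norm M0) normfV normrM (gtr0_norm a0) (gtr0_norm b0).
apply: (@le_trans _ _ `|b - a|).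
  have -> : M * `|b - a| / (a * b) * nm y = M / a * (nm y / b) * `|b - a|.
    by rewrite invfM; move: (a^-1) (b^-1) (`|b - a|) => *; ring.
  have h1 : M / a <= 1 by rewrite ler_pdivrMr// mul1r /a le_max lexx.
  have h2 : nm y / b <= 1 by rewrite ler_pdivrMr// mul1r /b le_max lexx orbT.
  rewrite ler_piMl// mulr_ile1 ?divr_ge0 ?(ltW M0) ?(ltW a0) ?(ltW b0) ?(sn_ge0 sn)//.
apply: (@le_trans _ _ `|nm y - nm x|); last by rewrite distrC (sn_ler_dist sn).
rewrite /a /b; case: (leP M (nm x)) => h1; case: (leP M (nm y)) => h2 //.
- by rewrite !ler0_norm ?subr_le0 ?(le_trans (ltW h2))//; lra.
- by rewrite !ger0_norm ?subr_ge0 ?(le_trans (ltW h1))//; lra.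
- by rewrite subrr normr0.
Qed.

End truncation.

(** * Duhamel integrals for an abstract semigroup *)

Section evolution.
Context {R : realType} (X : lmodType R) (nm : X -> R) (sn : complete_seminorm nm).
Local Notation mu := (@lebesgue_measure R).
Local Notation T1 := (measurableTypeR R).
Implicit Types (x y : X) (u v : R -> X) (T : R).

Definition snc T u := forall t, 0 <= t <= T -> forall e, 0 < e -> exists2 del, 0 < del &
  forall s, 0 <= s <= T -> `|s - t| < del -> nm (u s - u t) <= e.

Lemma sncS T T' u : T' <= T -> snc T u -> snc T' u.
Proof.
move=> TT cu t /andP[t0 tT] e e0; have [|del d0 h] := cu t _ e e0; first by rewrite t0 (le_trans tT).
by exists del => // s /andP[s0 sT]; apply: h; rewrite s0 (le_trans sT).
Qed.

Lemma sncD T u v : snc T u -> snc T v -> snc T (fun t => u t + v t).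
Proof.
move=> cu cv t tT e e0; have e2 : 0 < e / 2 by rewrite divr_gt0.
have [d1 d10 h1] := cu t tT _ e2; have [d2 d20 h2] := cv t tT _ e2.
exists (Num.min d1 d2); first by rewrite lt_min d10.
move=> s sT; rewrite lt_min => /andP[s1 s2]; rewrite opprD addrACA (splitr e).
by apply: (le_trans (snD sn _ _)); apply: lerD; [exact: h1|exact: h2].
Qed.

Lemma snc_eq T u v : (forall t, 0 <= t <= T -> nm (u t - v t) = 0) -> snc T u -> snc T v.
Proof.
move=> uv cu t tT e e0; have [del d0 h] := cu t tT e e0.
exists del => // s sT st; apply: (le_trans (sn_tri sn (u s) _ _)).
rewrite (sn_dist sn (v s)) uv// add0r; apply: (le_trans (sn_tri sn (u t) _ _)).
by rewrite (uv t)// addr0; exact: h.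
Qed.

Lemma snc_bounded T u : 0 <= T -> snc T u -> exists M, forall t, 0 <= t <= T -> nm (u t) <= M.
Proof.
(* Clamping the time to [0, T] extends the norm of u to a continuous function on the line, to which
   the extreme value theorem applies. *)
move=> T0 cu; pose cl t := Num.max 0 (Num.min t T).
have clT t : 0 <= cl t <= T by rewrite /cl le_max lexx/= ge_max T0 ge_min lexx orbT.
have cl1 s t : `|cl s - cl t| <= `|s - t|.
  have mx (a b : R) : `|Num.max 0 a - Num.max 0 b| <= `|a - b|.
    have n1 := ler_norm (a - b); have n2 := ler_norm (b - a); rewrite distrC in n2.
    rewrite ler_norml; case: (leP 0 a) => h1; case: (leP 0 b) => h2; apply/andP; split; lra.
  have mn (a b : R) : `|Num.min a T - Num.min b T| <= `|a - b|.
    have n1 := ler_norm (a - b); have n2 := ler_norm (b - a); rewrite distrC in n2.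
    rewrite ler_norml; case: (leP a T) => h1; case: (leP b T) => h2; apply/andP; split; lra.
  exact: le_trans (mx _ _) (mn _ _).
have cf : continuous (fun t => nm (u (cl t))).
  move=> t; apply/cvgrPdist_le => e e0; have [del d0 h] := cu (cl t) (clT t) e e0.
  near=> s; apply: (le_trans (sn_ler_dist sn _ _)); rewrite (sn_dist sn); apply: h => //.
  apply: (le_lt_trans (cl1 _ _)); near: s; apply/nbhs_ballP; exists del => //= s.
  by rewrite /ball/= distrC.
have [c _ hc] := EVT_max T0 (continuous_subspaceT cf).
exists (nm (u (cl c))) => t /andP[t0 tT].
have := hc t; rewrite in_itv/= t0 tT => /(_ isT).
by rewrite {1}/cl min_l// max_r.
Unshelve. all: by end_near. Qed.

Variables (A : R) (S : R -> X -> X) (zeta kap : T1 -> R) (Phi : R -> X -> X).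
Hypotheses (Slin : forall t, 0 <= t -> bounded_linear nm A (S t))
  (S0 : forall x, S 0 x = x)
  (Ssemi : forall s t x, 0 <= s -> 0 <= t -> nm (S s (S t x) - S (s + t) x) = 0)
  (Scont : forall x e, 0 < e -> exists2 del, 0 < del & forall t, 0 <= t < del -> nm (S t x - x) <= e).

Let A0 : 0 <= A. Proof. by have [] := Slin (lexx 0). Qed.

Lemma SB t x y : 0 <= t -> S t x - S t y = S t (x - y).
Proof. by move=> /Slin[_ SD SZ _]; rewrite SD -scaleN1r -scaleN1r SZ. Qed.

Lemma SA t x : 0 <= t -> nm (S t x) <= A * nm x.
Proof. by move=> /Slin[]. Qed.

Lemma S_unif x e : 0 < e -> exists2 del, 0 < del & forall s t, 0 <= s -> 0 <= t -> `|s - t| < del ->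
  nm (S s x - S t x) <= e.
Proof.
move=> e0; have e1 : 0 < e / (A + 1) by rewrite divr_gt0// ltr_wpDl.
have [del d0 h] := Scont x e1; exists del => //.
have main s t : 0 <= s -> s <= t -> `|s - t| < del -> nm (S s x - S t x) <= e.
  move=> s0 st; rewrite distrC ger0_norm ?subr_ge0// => std.
  have ts0 : 0 <= t - s by rewrite subr_ge0.
  have sem := Ssemi x s0 ts0; rewrite subrKC in sem.
  apply: (le_trans (sn_tri sn (S s (S (t - s) x)) _ _)); rewrite sem addr0 SB// (le_trans (SA _ s0))//.
  rewrite (sn_dist sn); apply: (@le_trans _ _ (A * (e / (A + 1)))).
    by rewrite ler_wpM2l// h// ts0.
  have A1 : 0 < A + 1 by rewrite ltr_wpDl.
  by rewrite mulrCA ler_piMr ?(ltW e0)// ler_pdivrMr// mul1r lerDl.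
move=> s t s0 t0 st; have [h1|/ltW h1] := leP s t; first exact: main.
by rewrite (sn_dist sn); apply: main => //; rewrite distrC.
Qed.

(** The integral of k over [a, t[, in the shape in which [isint_cmp] delivers it: the majorant is 0
    before a, where the integrand at t is the propagated integrand at a. *)
Definition tail_int (k : R -> R) (a t : R) : \bar R :=
  (\int[mu]_(s in (`]0%R, t[%classic : set T1)) (if (s < a)%R then 0 else k s)%:E)%E.

Lemma tail_small (k : T1 -> R) T e : measurable_fun setT k -> (forall s, 0 <= k s) ->
  mu.-integrable (`]0%R, T[%classic : set T1) (EFin \o k) -> 0 < e ->
  exists2 del, 0 < del & forall B : set T1, measurable B -> B `<=` `]0%R, T[%classic ->
    (mu B < del%:E)%E -> (\int[mu]_(s in B) (k s)%:E <= e%:E)%E.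
Proof.
move=> mk k0 ik e0; set D : set T1 := `]0%R, T[%classic.
have mD : measurable D by exact: measurable_itv.
have ik' : mu.-integrable setT (EFin \o (k \_ D)).
  by rewrite -restrict_EFin; apply/integrable_restrict => //=; rewrite setTI.
have [del [d0 hd]] := integral_normr_continuous ik' e0.
exists del => // B mB BD Bd; have := hd B mB Bd.
rewrite /Rintegral (eq_integral (fun s => (k s)%:E)); last first.
  by move=> s /set_mem Bs; rewrite patchE mem_set ?ger0_norm//; exact: BD.
have fin : (\int[mu]_(s in B) (k s)%:E)%E \is a fin_num.
  by apply: integrable_fin_num => //; exact: integrableS ik.
by move=> /ltW h; rewrite -(fineK fin) lee_fin.
Qed.

Lemma tail_intE (k : T1 -> R) a t : measurable_fun setT k -> 0 <= a ->
  tail_int k a t = (\int[mu]_(s in (`]0%R, t[%classic `&` `[a, t[%classic : set T1)) (k s)%:E)%E.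
Proof.
move=> mk a0; rewrite /tail_int integral_mkcond [RHS]integral_mkcond.
apply: eq_integral => s _; rewrite !patchE in_setI.
case: (boolP (s \in (`]0, t[%classic : set T1))) => //= /set_mem; rewrite /= in_itv/= => /andP[s0 st].
have -> : (s \in (`[a, t[%classic : set T1)) = ~~ (s < a).
  rewrite -leNgt; apply/idP/idP => [/set_mem|h]; last by apply/mem_set; rewrite /= in_itv/= h st.
  by rewrite /= in_itv/= => /andP[].
by case: ifP.
Qed.

Lemma isint_empty (F : R -> X) t : t <= 0 -> isint nm (`]0%R, t[%classic : set T1) F 0.
Proof.
move=> t0; have -> : (`]0%R, t[%classic : set T1) = set0 by rewrite set_itv_ge// bnd_simp -leNgt.
exists (fun=> 0%N), (fun k j => set0), (fun k j => 0); split.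
- by move=> k; case.
- by move=> k; exact: measurable_fun_set0.
- by under eq_fun do rewrite integral_set0; exact: cvg_cst.
- rewrite (_ : (fun k => _) = cst 0); first exact: cvg_cst.
  by apply/funext => k; rewrite /step_int big_ord0 subrr (sn0 sn).
Qed.

Lemma isint_empty0 (F : R -> X) t g : t <= 0 -> isint nm (`]0%R, t[%classic : set T1) F g -> nm g = 0.
Proof.
move=> t0 ig; have i0 := isint_empty F t0.
have D0 : measurable (`]0%R, t[%classic : set T1) by exact: measurable_itv.
have Df0 : (mu (`]0%R, t[%classic : set T1) < +oo)%E.
  by rewrite lebesgue_measure_itv/=; case: ifP => _; rewrite -?EFinB ltry.
have := isint_dist sn D0 Df0 i0 ig (measurable_cst (0 : R)).
rewrite subr0 integral0 lee_fin => h; apply: le_anti; rewrite (sn_ge0 sn) andbT; apply: h => s _.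
by rewrite subrr (sn0 sn).
Qed.

(** Continuity in time does not come from the integrand, which is singular at s = t: I(t) differs
    from S(t - a) I(a) by a tail that is small uniformly for a close to t, and S is strongly
    continuous on the single vector I(a). *)
Lemma duhamel T (f k : R -> R -> _) : 0 < T ->
  (forall t, 0 < t <= T -> sn_continuous_on nm (`]0, t[%classic : set T1) (f t)) ->
  (forall t, measurable_fun setT (k t : T1 -> R)) -> (forall t s, 0 <= k t s) ->
  (forall t, 0 < t <= T -> mu.-integrable (`]0%R, t[%classic : set T1) (EFin \o k t)) ->
  (forall t s, 0 < s < t -> t <= T -> nm (f t s) <= k t s) ->
  (forall a t s, 0 < s < a -> a <= t <= T -> nm (f t s - S (t - a) (f a s)) = 0) ->
  (forall e, 0 < e -> exists2 del, 0 < del & forall a t, 0 <= a <= t -> t <= T -> t - a < del ->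
     (tail_int (k t) a t <= e%:E)%E) ->
  exists I : R -> X, [/\ forall t, 0 <= t <= T -> isint nm (`]0%R, t[%classic : set T1) (f t) (I t),
     snc T I & forall a t, 0 <= a <= t -> t <= T ->
       ((nm (I t - S (t - a) (I a)))%:E <= tail_int (k t) a t)%E].
Proof.
move=> T0 cf mk k0 ik fk fS modk.
have /boolp.choice[I HI] : forall t, exists g, 0 <= t <= T -> isint nm (`]0%R, t[%classic : set T1) (f t) g.
  move=> t; have [t0|t0] := leP t 0; first by exists 0 => _; exact: isint_empty.
  have [tT|tT] := leP t T; last by exists 0; rewrite andbF.
  have tT' : 0 < t <= T by rewrite t0.
  have [|g Hg] := continuous_isint sn t0 (cf t tT') (ik t tT').
    by move=> s st; exact: fk.
  by exists g.
have HT a t : 0 <= a <= t -> t <= T -> ((nm (I t - S (t - a) (I a)))%:E <= tail_int (k t) a t)%E.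
  move=> /andP[a0 at_] tT; have t0 : 0 <= t := le_trans a0 at_.
  have Da : measurable (`]0%R, a[%classic : set T1) by exact: measurable_itv.
  have Dt : measurable (`]0%R, t[%classic : set T1) by exact: measurable_itv.
  have Dfin : (mu (`]0%R, t[%classic : set T1) < +oo)%E.
    by rewrite lebesgue_measure_itv/=; case: ifP => _; rewrite -?EFinB ltry.
  have ts0 : 0 <= t - a by rewrite subr_ge0.
  apply: (isint_cmp sn Da Dt Dfin _ (Slin ts0)); [|apply: HI|apply: HI|..].
  - by move=> s; rewrite /= !in_itv/= => /andP[-> h]; rewrite (lt_le_trans h).
  - by rewrite a0 (le_trans at_).
  - by rewrite t0.
  - apply: measurable_funTS; apply: measurable_fun_ifT => //; exact: measurable_fun_ltr.
  - by move=> s _; case: ifP.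
  - move=> s; rewrite /= in_itv/= => /andP[s0 sa]; rewrite sa fS// ?s0 ?at_//.
  - move=> s; rewrite /= !in_itv/= => /andP[s0 st]; rewrite s0/= => /negP; rewrite -leNgt ltNge => ->/=.
    by apply: fk => //; rewrite s0.
exists I; split => // t /andP[t0 tT] e e0.
have e5 : 0 < e / 4 by rewrite divr_gt0.
have [del d0 hd] := modk _ e5.
move: t0; rewrite le_eqVlt => /predU1P[t0|t0].
  subst t; exists del => // s /andP[s0 sT]; rewrite subr0 ger0_norm// => sd.
  have I00 : nm (I 0) = 0 by apply: (isint_empty0 (F := f 0) (lexx 0)); apply: HI; rewrite lexx ltW.
  have h1 : nm (I s - S (s - 0) (I 0)) <= e / 4.
    rewrite -lee_fin; apply: (le_trans (HT 0 s _ sT)); first by rewrite lexx s0.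
    by apply: hd; rewrite ?lexx ?s0// subr0.
  apply: (le_trans (snB sn _ _)); rewrite I00 addr0 -(subrK (S (s - 0) (I 0)) (I s)).
  apply: (le_trans (snD sn _ _)).
  have h2 : nm (S (s - 0) (I 0)) <= 0.
    have s00 : 0 <= s - 0 by rewrite subr0.
    by apply: (le_trans (SA _ s00)); rewrite I00 mulr0.
  by lra.
(* A base time before both t and all nearby s, because S acts only forwards. *)
pose a := Num.max 0 (t - del / 2).
have a0 : 0 <= a by rewrite /a le_max lexx.
have d2 : 0 < del / 2 by rewrite divr_gt0.
have at_ : a < t by rewrite /a gt_max t0 gtrBl.
have ad : t - a <= del / 2 by rewrite lerBlDr -lerBlDl /a le_max lexx orbT.
have [d3 d30 h3] := S_unif (I a) e5.
exists (Num.min d3 (Num.min (t - a) (del / 2))); first by rewrite !lt_min d30 subr_gt0 at_.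
move=> s /andP[s0 sT]; rewrite !lt_min => /andP[st3 /andP[st1 st2]].
have [n1 n2] := (ler_norm (s - t), ler_norm (t - s)); rewrite distrC in n2.
have as_ : a <= s by lra.
have b1 : nm (I s - S (s - a) (I a)) <= e / 4.
  rewrite -lee_fin; apply: (le_trans (HT a s _ sT)); first by rewrite a0 as_.
  by apply: hd; rewrite ?a0 ?as_//; lra.
have b2 : nm (I t - S (t - a) (I a)) <= e / 4.
  rewrite -lee_fin; apply: (le_trans (HT a t _ tT)); first by rewrite a0 ltW.
  have at1 : a <= t by exact: ltW.
  by apply: hd; rewrite ?a0 ?at1//; lra.
have b3 : nm (S (s - a) (I a) - S (t - a) (I a)) <= e / 4.
  by apply: h3; rewrite ?subr_ge0 ?(ltW at_) ?as_// opprB addrA subrK.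
apply: (le_trans (sn_tri sn (S (s - a) (I a)) _ _)).
apply: (le_trans (lerD b1 (sn_tri sn (S (t - a) (I a)) _ _))).
by rewrite (sn_dist sn _ (I t)); lra.
Qed.

Lemma isint_ext D F F' g : (forall s, D s -> nm (F s - F' s) = 0) -> isint nm D F g -> isint nm D F' g.
Proof.
move=> FF [n [B [phi [h1 h2 h3 h4]]]]; exists n, B, phi.
have E x s : D s -> nm (F s - x) = nm (F' s - x).
  move=> Ds; apply: le_anti; apply/andP; split.
    by apply: (le_trans (sn_tri sn (F' s) _ _)); rewrite FF// add0r.
  by apply: (le_trans (sn_tri sn (F s) _ _)); rewrite (sn_dist sn) FF// add0r.
split => //.
- by move=> k; apply: eq_measurable_fun (h2 k) => s /set_mem Ds; exact: E.
- apply: cvg_trans h3; apply: near_eq_cvg; apply: nearW => k.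
  by apply: eq_integral => s /set_mem Ds; rewrite E.
Qed.

(** The Lipschitz constant depends on the ball, while the singular factor [kap] is common to all
    balls. [PhiS] lets any positive lapse be split into a fixed positive part, where the Lipschitz
    bound is finite, and a remainder handled by the semigroup. *)
Hypotheses (mzeta : measurable_fun setT zeta) (zeta0 : forall s, 0 <= zeta s)
  (izeta : forall T, mu.-integrable (`]0%R, T[%classic : set T1) (EFin \o zeta))
  (czeta : forall s : R, 0 < s -> forall e, 0 < e -> exists2 del, 0 < del &
     forall s' : R, `|s' - s| < del -> `|zeta s' - zeta s| <= e)
  (mkap : measurable_fun setT kap) (kap0 : forall s, 0 <= kap s)
  (ikap : forall T, mu.-integrable (`]0%R, T[%classic : set T1) (EFin \o kap))
  (Phi_lip : forall M, 0 <= M -> exists2 L, 0 <= L & forall (t : R) x y, 0 < t -> nm x <= M -> nm y <= M ->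
     nm (Phi t x - Phi t y) <= L * kap t * nm (x - y))
  (Phi0 : forall t, 0 < t -> nm (Phi t 0) = 0)
  (PhiS : forall s t x, 0 <= s -> 0 < t -> nm (S s (Phi t x) - Phi (s + t) x) = 0).
Variables u0 w : X.

Let mitv (a b : R) : measurable (`]a, b[%classic : set T1). Proof. exact: measurable_itv. Qed.
Let fitv (a b : R) : (mu (`]a, b[%classic : set T1) < +oo)%E.
Proof. by rewrite lebesgue_measure_itv/=; case: ifP => _; rewrite -?EFinB ltry. Qed.

Lemma isint_unique (t : R) F g g' : isint nm (`]0%R, t[%classic : set T1) F g ->
  isint nm (`]0%R, t[%classic : set T1) F g' -> nm (g' - g) = 0.
Proof.
move=> i1 i2; have := isint_dist sn (mitv 0 t) (fitv 0 t) i1 i2 (measurable_cst (0 : R)).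
rewrite integral0 lee_fin => h; apply: le_anti; rewrite (sn_ge0 sn) andbT; apply: h => s _.
by rewrite subrr (sn0 sn).
Qed.

Definition fw (t s : R) : X := zeta s *: S (t - s) w.

Lemma tail_zeta T e : 0 < e -> exists2 del, 0 < del & forall a t, 0 <= a <= t -> t <= T -> t - a < del ->
  (tail_int (fun s => (A * nm w * zeta s)%R) a t <= e%:E)%E.
Proof.
have c0 : 0 <= A * nm w by rewrite mulr_ge0// (sn_ge0 sn).
move=> e0; have mz : measurable_fun setT (fun s : T1 => A * nm w * zeta s) by exact: measurable_funM.
have iz : mu.-integrable (`]0%R, T[%classic : set T1) (EFin \o (fun s => A * nm w * zeta s)).
  by have := integrableZl (mitv 0 T) (A * nm w) (izeta T); apply: eq_integrable.
have [del d0 hd] := tail_small mz (fun s => mulr_ge0 c0 (zeta0 s)) iz e0.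
exists del => // a t /andP[a0 at_] tT tad; rewrite tail_intE//; apply: hd.
+ by apply: measurableI; exact: measurable_itv.
+ by move=> s []; rewrite /= !in_itv/= => /andP[-> st] _; rewrite (lt_le_trans st).
+ apply: (@le_lt_trans _ _ (mu (`[a, t[%classic : set T1))).
    by apply: le_measure; rewrite ?inE; [apply: measurableI; exact: measurable_itv|exact: measurable_itv|move=> s []].
  by rewrite lebesgue_measure_itv/= lte_fin; case: ifP => _; rewrite -?EFinB lte_fin.
Qed.

Lemma forcing_on T : 0 < T -> exists I : R -> X, [/\ forall t, 0 <= t <= T -> isint nm (`]0%R, t[%classic : set T1) (fw t) (I t),
     snc T I & forall a t, 0 <= a <= t -> t <= T ->
       ((nm (I t - S (t - a) (I a)))%:E <= tail_int (fun s => (A * nm w * zeta s)%R) a t)%E].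
Proof.
move=> T0; have c0 : 0 <= A * nm w by rewrite mulr_ge0// (sn_ge0 sn).
apply: (@duhamel T fw (fun _ s => A * nm w * zeta s)) => //.
- move=> t /andP[t0 tT] s; rewrite /= in_itv/= => /andP[s0 st] e e0.
  pose e1 := e / 2 / (A * nm w + 1).
  have e10 : 0 < e1 by rewrite !divr_gt0// ltr_wpDl.
  pose e2 := e / 2 / (zeta s + 1).
  have z1 : 0 < zeta s + 1 by rewrite ltr_wpDl.
  have e20 : 0 < e2 by rewrite !divr_gt0.
  have [d1 d10 h1] := czeta s0 e10; have [d2 d20 h2] := S_unif w e20.
  exists (Num.min d1 d2); first by rewrite lt_min d10.
  move=> s'; rewrite /= in_itv/= lt_min => /andP[s'0 s't] /andP[sd1 sd2].
  have -> : fw t s' - fw t s = (zeta s' - zeta s) *: S (t - s') w + zeta s *: (S (t - s') w - S (t - s) w).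
    by rewrite /fw scalerBl scalerBr addrA subrK.
  apply: (le_trans (snD sn _ _)); rewrite !(snZ sn) (splitr e) (ger0_norm (zeta0 s)); apply: lerD.
    apply: (@le_trans _ _ (e1 * (A * nm w))).
      by apply: ler_pM => //; [exact: (sn_ge0 sn)|exact: h1|apply: SA; rewrite subr_ge0 ltW].
    by rewrite /e1 mulrAC ler_pdivrMr ?ltr_wpDl// ler_wpM2l ?lerDl// ltW// divr_gt0.
  apply: (@le_trans _ _ (zeta s * e2)).
    apply: ler_wpM2l => //; apply: h2; rewrite ?subr_ge0 ?ltW//.
    by rewrite opprB addrC subrKA distrC.
  by rewrite /e2 mulrCA ler_piMr ?(ltW (divr_gt0 _ _))// ler_pdivrMr// mul1r lerDl.
- by move=> t; exact: measurable_funM.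
- by move=> t s; rewrite mulr_ge0.
- move=> t _; have := integrableZl (mitv 0 t) (A * nm w) (izeta t).
  by apply: eq_integrable.
- move=> t s /andP[s0 st] tT; rewrite /fw (snZ sn) (ger0_norm (zeta0 s)) mulrC ler_wpM2r//.
  by apply: SA; rewrite subr_ge0 ltW.
- move=> a t s /andP[s0 sa] /andP[at_ tT].
  have ta : 0 <= t - a by rewrite subr_ge0.
  have as_ : 0 <= a - s by rewrite subr_ge0 ltW.
  have [_ _ SZ _] := Slin ta; rewrite /fw SZ -scalerBr (snZ sn) (sn_dist sn).
  by have := Ssemi w ta as_; rewrite addrA subrK => ->; rewrite mulr0.
- by move=> e e0; exact: tail_zeta.
Qed.

Lemma tail_kap c T e : 0 <= c -> 0 < e -> exists2 del, 0 < del & forall a t, 0 <= a <= t -> t <= T -> t - a < del ->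
  (tail_int (fun s => (c * kap (t - s))%R) a t <= e%:E)%E.
Proof.
move=> c0 e0; have mz : measurable_fun setT (fun s : T1 => c * kap s) by exact: measurable_funM.
have z0 (s : T1) : 0 <= c * kap s by rewrite mulr_ge0.
have iz : mu.-integrable (`]0%R, T[%classic : set T1) (EFin \o (fun s => c * kap s)).
  by have := integrableZl (mitv 0 T) (c) (ikap T); apply: eq_integrable.
have [del d0 hd] := tail_small mz z0 iz e0.
exists (Num.min del del) => [|a t /andP[a0 at_] tT]; first by rewrite lt_min d0.
rewrite lt_min => /andP[tad _].
pose g (s : T1) := if t - s < a then 0 else c * kap s.
have mg : measurable_fun setT g.
  by apply: measurable_fun_ifT => //; apply: measurable_fun_ltr => //; exact: measurable_funB.
have g0 s : 0 <= g s by rewrite /g; case: ifP.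
have -> : tail_int (fun s => c * kap (t - s)) a t = (\int[mu]_(s in (`]0%R, t[%classic : set T1)) (g (t - s))%:E)%E.
  by apply: eq_integral => s _; rewrite /g subKr.
rewrite (ge0_integral_reflect t mg g0).
apply: (@le_trans _ _ (\int[mu]_(s in (`]0%R, (t - a)%R]%classic `&` `]0%R, t[%classic : set T1)) (c * kap s)%:E)%E).
  rewrite le_eqVlt; apply/orP; left; apply/eqP.
  rewrite integral_mkcond [RHS]integral_mkcond; apply: eq_integral => s _; rewrite !patchE in_setI /g.
  case: (boolP (s \in (`]0%R, t[%classic : set T1))) => [/set_mem|_]; last by rewrite andbF.
  rewrite /= in_itv/= andbT => /andP[s1 s2].
  have -> : (s \in (`]0%R, t - a]%classic : set T1)) = ~~ (t - s < a).
    rewrite -leNgt; apply/idP/idP => [/set_mem|h]; last apply/mem_set; rewrite /= in_itv/= s1/=; lra.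
  by case: ifP.
apply: hd.
+ by apply: measurableI; exact: measurable_itv.
+ by move=> s []; rewrite /= !in_itv/= => _ /andP[-> st]; rewrite (lt_le_trans st).
+ apply: (@le_lt_trans _ _ (mu (`]0%R, t - a]%classic : set T1))).
    by apply: le_measure; rewrite ?inE; [apply: measurableI; exact: measurable_itv|exact: measurable_itv|move=> s []].
  by rewrite lebesgue_measure_itv/= lte_fin; case: ifP => _; rewrite -?EFinB lte_fin// subr0.
Qed.

(* [r = id] gives mild solutions, [r = retract nm M] the globally Lipschitz truncated problem. *)
Definition gsol (r : X -> X) T u := snc T u /\ forall t, 0 <= t <= T -> exists I1 I2,
  [/\ isint nm (`]0%R, t[%classic : set T1) (fun s => Phi (t - s) (r (u s))) I1,
      isint nm (`]0%R, t[%classic : set T1) (fw t) I2 & nm (u t - (S t u0 + I1 + I2)) = 0].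

Lemma gsolS r T T' u : T' <= T -> gsol r T u -> gsol r T' u.
Proof.
move=> TT [cu su]; split; first exact: sncS cu.
by move=> t /andP[t0 tT]; apply: su; rewrite t0 (le_trans tT).
Qed.

Lemma snc_S T : snc T (fun t => S t u0).
Proof.
move=> t /andP[t0 tT] e e0; have [del d0 h] := S_unif u0 e0.
by exists del => // s /andP[s0 sT] st; exact: h.
Qed.

Lemma subr_add3 (a x y x' y' : X) : a + x + y - (a + x' + y') = (x - x') + (y - y').
Proof. by rewrite -(addrA a) -(addrA a x') opprD addrACA subrr add0r opprD addrACA. Qed.

(** * The truncated, globally Lipschitz problem *)

Section truncated.
Variables (M L : R).
Hypotheses (M0 : 0 < M) (L0 : 0 <= L)
  (LP : forall (t : R) x y, 0 < t -> nm x <= M -> nm y <= M -> nm (Phi t x - Phi t y) <= L * kap t * nm (x - y)).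
Local Notation rho := (retract nm M).

Lemma Phi_rho_bound t x : 0 < t -> nm (Phi t (rho x)) <= L * M * kap t.
Proof.
move=> t0; rewrite -(subrK (Phi t 0) (Phi t (rho x))); apply: (le_trans (snD sn _ _)); rewrite Phi0// addr0.
apply: (le_trans (LP t0 (retract_norm sn M0 x) _)); first by rewrite (sn0 sn) ltW.
by rewrite subr0 mulrAC ler_wpM2r// ler_wpM2l// (retract_norm sn M0).
Qed.

Lemma Phi_rho_lip t x y : 0 < t -> nm (Phi t (rho x) - Phi t (rho y)) <= 2 * L * kap t * nm (x - y).
Proof.
move=> t0; apply: (le_trans (LP t0 (retract_norm sn M0 x) (retract_norm sn M0 y))).
rewrite -!mulrA (mulrCA 2) ler_wpM2l// (mulrCA 2) ler_wpM2l//; exact: (retract_lip sn M0).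
Qed.

Lemma nonlinear_on T u : 0 < T -> snc T u ->
  exists I : R -> X, [/\ forall t, 0 <= t <= T -> isint nm (`]0%R, t[%classic : set T1) (fun s => Phi (t - s) (rho (u s))) (I t),
     snc T I & forall a t, 0 <= a <= t -> t <= T ->
       ((nm (I t - S (t - a) (I a)))%:E <= tail_int (fun s => (L * M * kap (t - s))%R) a t)%E].
Proof.
move=> T0 cu.
have mkt t : measurable_fun setT (fun s : T1 => L * M * kap (t - s)).
  apply: measurable_funM => //; apply: (measurableT_comp mkap).
  by apply: measurable_funB.
have ikt t : mu.-integrable (`]0%R, t[%classic : set T1) (EFin \o (fun s => L * M * kap (t - s))).
  apply/integrableP; split; first by apply/measurable_EFinP; exact: measurable_funTS.
  have [mk fk] := integrableP _ _ _ (integrableZl (mitv 0 t) (L * M) (ikap t)).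
  rewrite (eq_integral (fun s : T1 => (L * M * kap (t - s))%:E)); last first.
    by move=> s _ /=; rewrite ger0_norm// !mulr_ge0// ltW.
  rewrite (@ge0_integral_reflect _ t (fun s => L * M * kap s)).
  + move: fk; rewrite (eq_integral (fun s : T1 => (L * M * kap s)%:E))// => s _ /=.
    by rewrite ger0_norm// !mulr_ge0// ltW.
  + exact: measurable_funM.
  + by move=> s; rewrite !mulr_ge0// ltW.
apply: (@duhamel T (fun t s => Phi (t - s) (rho (u s))) (fun t s => L * M * kap (t - s))) => //.
- move=> t /andP[t0 tT] s; rewrite /= in_itv/= => /andP[s0 st] e e0.
  (* Near s the lapses t - s' vary; all are written as [tau] plus a remainder, so that [Phi] is
     evaluated at the single time [tau] and the variation falls on the strongly continuous S. *)
  pose tau := (t - s) / 2; have tau0 : 0 < tau by rewrite divr_gt0// subr_gt0.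
  have e2 : 0 < e / 2 by rewrite divr_gt0.
  pose c := Phi tau (rho (u s)).
  have [d1 d10 h1] := S_unif c e2.
  pose Q := A * (2 * L * kap tau) + 1.
  have Q0 : 0 < Q by rewrite ltr_wpDl// !mulr_ge0.
  have [|d2 d20 h2] := cu s _ (e / 2 / Q) (divr_gt0 e2 Q0).
    by rewrite ltW//= (le_trans (ltW st)).
  exists (Num.min tau (Num.min d1 d2)); first by rewrite !lt_min tau0 d10.
  move=> s'; rewrite /= in_itv/= !lt_min => /andP[s'0 s't] /and3P[st1 st2 st3].
  have [n1 n2] := (ler_norm (s' - s), ler_norm (s - s')); rewrite distrC in n2.
  have r0 : 0 <= t - s' - tau by rewrite /tau in st1 *; lra.
  have r1 : 0 <= t - s - tau by rewrite /tau; lra.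
  have E1 x := PhiS x r0 tau0; have E2 x := PhiS x r1 tau0.
  have P1 x : nm (S (t - s' - tau) (Phi tau x) - Phi (t - s') x) = 0.
    by have := E1 x; rewrite subrK.
  have P2 x : nm (S (t - s - tau) (Phi tau x) - Phi (t - s) x) = 0.
    by have := E2 x; rewrite subrK.
  apply: (le_trans (sn_tri sn (S (t - s' - tau) (Phi tau (rho (u s')))) _ _)).
  rewrite (sn_dist sn (Phi _ _)) P1 add0r.
  apply: (le_trans (sn_tri sn (S (t - s' - tau) c) _ _)); rewrite (splitr e); apply: lerD.
    rewrite SB//; apply: (le_trans (SA _ r0)).
    apply: (@le_trans _ _ (A * (2 * L * kap tau * (e / 2 / Q)))).
      apply: ler_wpM2l => //; apply: (le_trans (Phi_rho_lip _ _ tau0)).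
      apply: ler_wpM2l; first by rewrite !mulr_ge0.
      by apply: h2 => //; rewrite ltW//= (le_trans (ltW s't)).
    by rewrite mulrA mulrCA mulrA ler_pdivrMr// ler_wpM2l ?(ltW e2)// lerDl.
  apply: (le_trans (sn_tri sn (S (t - s - tau) c) _ _)); rewrite P2 addr0; apply: h1 => //.
  by rewrite opprD addrACA subrr addr0 opprB addrC subrKA distrC.
- by move=> t s; rewrite !mulr_ge0// ltW.
- by move=> t s /andP[s0 st] tT; apply: Phi_rho_bound; rewrite subr_gt0.
- move=> a t s /andP[s0 sa] /andP[at_ tT].
  have ta : 0 <= t - a by rewrite subr_ge0.
  have as_ : 0 < a - s by rewrite subr_gt0.
  by rewrite (sn_dist sn); have := PhiS (rho (u s)) ta as_; rewrite addrA subrK.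
- by move=> e e0; apply: tail_kap; rewrite ?mulr_ge0// ltW.
Qed.


Lemma contraction T : exists2 lam, 0 <= lam & forall t u v I I' B, 0 <= t <= T -> 0 <= B ->
  isint nm (`]0%R, t[%classic : set T1) (fun s => Phi (t - s) (rho (u s))) I ->
  isint nm (`]0%R, t[%classic : set T1) (fun s => Phi (t - s) (rho (v s))) I' ->
  (forall s, 0 < s < t -> nm (v s - u s) <= B * expR (lam * s)) ->
  nm (I' - I) <= B / 2 * expR (lam * t).
Proof.
have L1 : 0 < L + 1 by rewrite ltr_wpDl.
(* Truncation doubles the Lipschitz constant, and 2L / (4 (L + 1)) <= 1/2 is the contraction factor;
   L + 1 avoids division by 0. *)
have e0 : 0 < (4 * (L + 1))^-1 by rewrite invr_gt0 mulr_gt0.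
have [lam lam0 hlam] := exp_weight_small mkap kap0 (ikap T) e0.
exists lam => // t u v I I' B /andP[t0 tT] B0 i1 i2 uv.
pose g (s : T1) := kap s * expR (- lam * s).
have mg : measurable_fun setT g.
  apply: measurable_funM => //.
  by apply: (@measurableT_comp _ _ _ _ _ _ (@expR R)) => //; exact: measurable_funM.
have g0 s : 0 <= g s by rewrite mulr_ge0// expR_ge0.
pose c := 2 * L * B * expR (lam * t).
have c0 : 0 <= c by rewrite !mulr_ge0// expR_ge0.
have H : ((nm (I' - I))%:E <= \int[mu]_(s in (`]0%R, t[%classic : set T1)) (c * g (t - s))%:E)%E.
  apply: (isint_dist sn (mitv 0 t) (fitv 0 t) i1 i2).
    apply: measurable_funTS; apply: measurable_funM => //; apply: (measurableT_comp mg).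
    exact: measurable_funB.
  move=> s; rewrite /= in_itv/= => /andP[s0 st]; have ts0 : 0 < t - s by rewrite subr_gt0.
  apply: (le_trans (Phi_rho_lip _ _ ts0)).
  have -> : c * g (t - s) = 2 * L * kap (t - s) * (B * expR (lam * s)).
    rewrite /c /g (_ : lam * s = lam * t + - lam * (t - s)); last by ring.
    by rewrite expRD; ring.
  by apply: ler_wpM2l; [rewrite !mulr_ge0|apply: uv; rewrite s0].
rewrite (@ge0_integral_reflect _ t (fun s => c * g s)) in H; last 2 first.
- exact: measurable_funM.
- by move=> s; rewrite mulr_ge0.
have mE : measurable_fun (`]0%R, t[%classic : set T1) (EFin \o g).
  by apply/measurable_EFinP; exact: measurable_funTS.
have H2 : (\int[mu]_(s in (`]0%R, t[%classic : set T1)) (g s)%:E <= ((4 * (L + 1))^-1)%:E)%E.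
  apply: le_trans hlam; apply: ge0_subset_integral => //.
  - by apply/measurable_EFinP; exact: measurable_funTS.
  - by move=> s _; rewrite lee_fin.
  - by move=> s; rewrite /= !in_itv/= => /andP[-> st]; rewrite (lt_le_trans st).
have {}H : ((nm (I' - I))%:E <= c%:E * \int[mu]_(s in (`]0%R, t[%classic : set T1)) (g s)%:E)%E.
  by rewrite -ge0_integralZl//; move=> s _; rewrite lee_fin.
have H3 := le_trans H (lee_wpmul2l (_ : (0 <= c%:E)%E) H2).
rewrite -EFinM !lee_fin in H3; apply: (le_trans (H3 c0)).
rewrite /c ler_pdivrMr ?mulr_gt0//.
have -> : B / 2 * expR (lam * t) * (4 * (L + 1)) = 2 * L * B * expR (lam * t) + 2 * (B * expR (lam * t)) by field.
by rewrite lerDl !mulr_ge0 ?expR_ge0.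
Qed.

Lemma trunc_unique T u v : 0 <= T -> gsol rho T u -> gsol rho T v -> forall t, 0 <= t <= T -> nm (u t - v t) = 0.
Proof.
move=> T0 [cu su] [cv sv]; have [lam lam0 hc] := contraction T.
have [B1 hB1] := snc_bounded T0 cu; have [B2 hB2] := snc_bounded T0 cv.
have T00 : (0 : R) <= 0 <= T by rewrite lexx T0.
have B0 : 0 <= B1 + B2.
  by rewrite addr_ge0// (le_trans (sn_ge0 sn _) (hB1 0 T00), le_trans (sn_ge0 sn _) (hB2 0 T00)).
have step k : forall t, 0 <= t <= T -> nm (u t - v t) <= (B1 + B2) * 2^-1 ^+ k * expR (lam * t).
  elim: k => [|k ih] t tT.
    rewrite expr0 mulr1; apply: (le_trans (snB sn _ _)); apply: (le_trans (lerD (hB1 t tT) (hB2 t tT))).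
    by rewrite ler_peMr// -expR0 ler_expR; case/andP: tT => t0 _; exact: mulr_ge0.
  have [I1 [I2 [i1 i2 e1]]] := su t tT; have [J1 [J2 [j1 j2 e2]]] := sv t tT.
  have IJ := isint_unique j2 i2.
  have Bk : 0 <= (B1 + B2) * 2^-1 ^+ k by rewrite mulr_ge0// exprn_ge0// invr_ge0.
  have := hc t v u J1 I1 _ tT Bk j1 i1; have -> : (B1 + B2) * 2^-1 ^+ k / 2 = (B1 + B2) * 2^-1 ^+ k.+1.
    by rewrite exprSr mulrA.
  move=> hI; have {}hI := hI _; apply: le_trans (hI _); last first.
    by move=> s /andP[s0 st]; apply: ih; case/andP: tT => t0 tT; rewrite (ltW s0) (le_trans (ltW st)).
  apply: (le_trans (sn_tri sn (S t u0 + I1 + I2) _ _)); rewrite e1 add0r.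
  apply: (le_trans (sn_tri sn (S t u0 + J1 + J2) _ _)); rewrite (sn_dist sn _ (v t)) e2 addr0.
  rewrite subr_add3; by apply: (le_trans (snD sn _ _)); rewrite IJ addr0.
move=> t tT; apply: le_anti; rewrite (sn_ge0 sn) andbT.
apply: (@le0_half _ _ ((B1 + B2) * expR (lam * t))) => k.
by rewrite mulrAC; exact: step.
Qed.

Lemma trunc_exists T : 0 < T -> exists u, gsol rho T u.
Proof.
move=> T0; have T0' := ltW T0; have [lam lam0 hc] := contraction T.
have [J [iJ cJ _]] := forcing_on T0.
(* Chooses a Duhamel integral for every path at once, with an irrelevant value at discontinuous
   ones, so that Picard iteration is a plain recursion. *)
have /boolp.choice[Nl HN] : forall u, exists I : R -> X, snc T u ->
    [/\ forall t, 0 <= t <= T -> isint nm (`]0%R, t[%classic : set T1) (fun s => Phi (t - s) (rho (u s))) (I t), snc T I &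
     forall a t, 0 <= a <= t -> t <= T ->
       ((nm (I t - S (t - a) (I a)))%:E <= tail_int (fun s => (L * M * kap (t - s))%R) a t)%E].
  move=> u; have [cu|ncu] := pselect (snc T u); last by exists u.
  by have [I hI] := nonlinear_on T0 cu; exists I.
pose h t := S t u0 + J t.
have ch : snc T h by apply: sncD => //; exact: snc_S.
pose U := fix U k := match k with 0%N => h | j.+1 => (fun t => h t + Nl (U j) t) end.
have cU k : snc T (U k).
  by elim: k => [//|k ih] /=; apply: sncD => //; have [] := HN _ ih.
have iN k t : 0 <= t <= T -> isint nm (`]0%R, t[%classic : set T1) (fun s => Phi (t - s) (rho (U k s))) (Nl (U k) t).
  by have [hi _ _] := HN _ (cU k); exact: hi.
have [C1 hC1] : exists M, forall t, 0 <= t <= T -> nm (Nl h t) <= M.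
  by apply: snc_bounded => //; have [] := HN _ ch.
have T00 : (0 : R) <= 0 <= T by rewrite lexx T0'.
have C0 : 0 <= C1 by exact: le_trans (sn_ge0 sn _) (hC1 _ T00).
have e1 t : 0 <= t -> 1 <= expR (lam * t) by move=> t0; rewrite -expR0 ler_expR mulr_ge0.
have pw0 k : 0 <= C1 * 2^-1 ^+ k by rewrite mulr_ge0// exprn_ge0.
have dU k t : 0 <= t <= T -> nm (U k.+1 t - U k t) <= C1 * 2^-1 ^+ k * expR (lam * t).
  elim: k t => [|k ih] t tT.
    rewrite /= expr0 mulr1 addrAC subrr add0r; apply: (le_trans (hC1 t tT)).
    by rewrite ler_peMr// e1//; case/andP: tT.
  have -> : U k.+2 t - U k.+1 t = Nl (U k.+1) t - Nl (U k) t by rewrite /= opprD addrACA subrr add0r.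
  have -> : C1 * 2^-1 ^+ k.+1 = C1 * 2^-1 ^+ k / 2 by rewrite exprSr mulrA.
  apply: (hc t (U k) (U k.+1) _ _ _ tT (pw0 k) (iN k t tT) (iN k.+1 t tT)) => s /andP[s0 st].
  by apply: ih; case/andP: tT => t0 tT; rewrite (ltW s0) (le_trans (ltW st)).
(* The differences b k - b (k + 1) bound the successive increments, so b k bounds the distance from
   the k-th iterate to all later ones, uniformly on [0, T]. *)
pose E := expR (lam * T); pose b k := 2 * C1 * E * 2^-1 ^+ k.
have b0 k : 0 <= b k by rewrite !mulr_ge0// ?expR_ge0// exprn_ge0.
have tele k j t : 0 <= t <= T -> nm (U (k + j)%N t - U k t) <= b k - b (k + j)%N.
  move=> tT; elim: j => [|j ih]; first by rewrite addn0 !subrr (sn0 sn).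
  rewrite addnS; apply: (le_trans (sn_tri sn (U (k + j)%N t) _ _)).
  apply: (le_trans (lerD (dU (k + j)%N t tT) ih)).
  have EE : C1 * 2^-1 ^+ (k + j) * expR (lam * t) <= C1 * 2^-1 ^+ (k + j) * E.
    by rewrite ler_wpM2l// ler_expR ler_wpM2l//; case/andP: tT.
  have -> : b (k + j).+1 = b (k + j)%N - C1 * 2^-1 ^+ (k + j) * E by rewrite /b exprS; field.
  by lra.
have bk k j t : 0 <= t <= T -> nm (U (k + j)%N t - U k t) <= b k.
  by move=> tT; apply: (le_trans (tele k j t tT)); rewrite gerBl.
have Lb : b k @[k --> \oo] --> (0 : R).
  rewrite -(mulr0 (2 * C1 * E)); apply: cvgM; first exact: cvg_cst.
  by apply: cvg_expr; rewrite gtr0_norm ?invf_lt1// ltr1n.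
have bsmall e : 0 < e -> exists k0, forall k, (k0 <= k)%N -> b k <= e.
  move=> ep; have /cvgr0Pnorm_le/(_ _ ep)[k0 _ hk] := Lb.
  by exists k0 => k kk; exact: le_trans (ler_norm _) (hk k kk).
have /boolp.choice[V HV] : forall t, exists l, 0 <= t <= T -> nm (U k t - l) @[k --> \oo] --> (0 : R).
  move=> t; have [tT|ntT] := boolP (0 <= t <= T); last by exists 0.
  have [|l hl] := sn_complete sn (u := fun k => U k t); last by exists l.
  move=> e ep; have e2 : 0 < e / 2 by rewrite divr_gt0.
  have [k0 hk] := bsmall _ e2; exists k0 => m k m0 k1.
  apply: (le_trans (sn_tri sn (U k0 t) _ _)); rewrite (splitr e) (sn_dist sn _ (U k t)).
  apply: lerD; [rewrite -(subnKC m0)|rewrite -(subnKC k1)];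
    by apply: le_trans (hk k0 (leqnn _)); apply: bk.
have UV k t : 0 <= t <= T -> nm (U k t - V t) <= b k.
  move=> tT; have L1 : b k + nm (U j t - V t) @[j --> \oo] --> b k + 0.
    by apply: cvgD; [exact: cvg_cst|exact: HV].
  rewrite addr0 in L1; rewrite -(cvg_lim (@Rhausdorff R) L1); apply: limr_ge; first exact: cvgP L1.
  exists k => // j /= kj; rewrite -(subnKC kj).
  apply: (le_trans (sn_tri sn (U (k + (j - k))%N t) _ _)); rewrite lerD2r (sn_dist sn); exact: bk.
have cV : snc T V.
  move=> t tT e ep; have e3 : 0 < e / 3 by rewrite divr_gt0.
  have [k hk] := bsmall _ e3; have [del d0 hd] := cU k t tT _ e3.
  exists del => // s sT st; apply: (le_trans (sn_tri sn (U k s) _ _)).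
  apply: (le_trans (lerD (le_refl _) (sn_tri sn (U k t) _ _))).
  have h1 := UV k s sT; have h2 := UV k t tT; have h3 := hd s sT st; have h4 := hk k (leqnn _).
  by rewrite (sn_dist sn (V s)); lra.
exists V; split => // t tT; have [iV _ _] := HN _ cV.
exists (Nl V t), (J t); split; [exact: iV|exact: iJ|].
apply: le_anti; rewrite (sn_ge0 sn) andbT.
apply: (@le0_half _ _ (2 * C1 * E * (1 + E))) => k.
have h1 := UV k.+1 t tT.
have h2 : nm (Nl V t - Nl (U k) t) <= b k / 2 * expR (lam * t).
  apply: (hc t (U k) V _ _ _ tT (b0 k) (iN k t tT) (iV t tT)) => s /andP[s0 st].
  rewrite (sn_dist sn); apply: (@le_trans _ _ (b k)).
    by apply: UV; case/andP: tT => t0 tT; rewrite (ltW s0) (le_trans (ltW st)).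
  by rewrite ler_peMr// e1// ltW.
apply: (le_trans (sn_tri sn (U k.+1 t) _ _)); rewrite (sn_dist sn).
have -> : U k.+1 t - (S t u0 + Nl V t + J t) = Nl (U k) t - Nl V t.
  by rewrite /= /h (addrAC _ (Nl V t)) opprD addrACA subrr add0r.
rewrite (sn_dist sn (Nl (U k) t)); apply: (le_trans (lerD h1 h2)).
have h3 : b k / 2 * expR (lam * t) <= b k * E.
  rewrite -mulrA ler_wpM2l// (@le_trans _ _ (expR (lam * t)))//.
    by rewrite ler_piMl ?expR_ge0// invf_le1// ler1n.
  by rewrite ler_expR ler_wpM2l//; case/andP: tT.
have h4 : b k.+1 <= b k by rewrite /b exprS mulrCA ler_piMl ?b0// invf_le1// ler1n.
have -> : 2 * C1 * E * (1 + E) * 2^-1 ^+ k = b k + b k * E by rewrite /b; ring.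
by lra.
Qed.

End truncated.

(** The bound is asked only before T: the Duhamel integral over an open interval does not see its
    end point. Hence a bound on [0, t0[ already identifies the two equations up to and including
    t0. *)
Lemma gsol_retract T u M : 0 < M -> (forall t, 0 <= t < T -> nm (u t) <= M) ->
  gsol id T u <-> gsol (retract nm M) T u.
Proof.
move=> M0 uM; have E t s : t <= T -> `]0%R, t[%classic s ->
    Phi (t - s) (id (u s)) = Phi (t - s) (retract nm M (u s)).
  move=> tT; rewrite /= in_itv/= => /andP[s0 st]; rewrite retract_id//.
  by apply: uM; rewrite ltW//= (lt_le_trans st).
split=> -[cu su]; split => // t tT; have [I1 [I2 [i1 i2 e]]] := su t tT;
  have tT' : t <= T by [case/andP: tT]; exists I1, I2; split => //; apply: isint_ext i1 => s st;
  by rewrite (E t s tT' st) subrr (sn0 sn).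
Qed.

Lemma gsol_unique T u v : 0 <= T -> gsol id T u -> gsol id T v -> forall t, 0 <= t <= T -> nm (u t - v t) = 0.
Proof.
move=> T0 su sv; have [B1 hB1] := snc_bounded T0 su.1; have [B2 hB2] := snc_bounded T0 sv.1.
pose M := Num.max 1 (Num.max B1 B2); have M0 : 0 < M by rewrite lt_max ltr01.
have [L L0 LP] := Phi_lip (ltW M0).
have uM t : 0 <= t < T -> nm (u t) <= M.
  by move=> /andP[t0 tT]; rewrite !le_max hB1 ?orbT// t0 ltW.
have vM t : 0 <= t < T -> nm (v t) <= M.
  by move=> /andP[t0 tT]; rewrite !le_max hB2 ?orbT// t0 ltW.
move/(gsol_retract M0 uM) in su; move/(gsol_retract M0 vM) in sv.
exact: (trunc_unique M0 L0 LP T0 su sv).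
Qed.

Lemma gsol_eq T u v : 0 <= T -> (forall t, 0 <= t <= T -> nm (u t - v t) = 0) -> gsol id T u -> gsol id T v.
Proof.
move=> T0 uv [cu su]; split; first exact: snc_eq cu.
move=> t tT; have [I1 [I2 [i1 i2 e]]] := su t tT; exists I1, I2; split => //.
  apply: isint_ext i1 => s; rewrite /= in_itv/= => /andP[s0 st].
  have sT : 0 <= s <= T by case/andP: tT => t0 tT; rewrite (ltW s0) (le_trans (ltW st)).
  pose M := Num.max (nm (u s)) (nm (v s)); have M0 : 0 <= M by rewrite le_max (sn_ge0 sn).
  have [L L0 LP] := Phi_lip M0; apply: le_anti; rewrite (sn_ge0 sn) andbT.
  have -> : 0 = L * kap (t - s) * nm (u s - v s) by rewrite uv// mulr0.
  by apply: LP; rewrite ?subr_gt0// /M le_max lexx ?orbT.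
apply: le_anti; rewrite (sn_ge0 sn) andbT; apply: (le_trans (sn_tri sn (u t) _ _)).
by rewrite e addr0 (sn_dist sn) uv.
Qed.

(** Strict inequality at t0 and continuity keep the truncated solution in the ball slightly longer.
    It serves at t0 = 0 for local existence and at the supposed final time for continuation. *)
Lemma trunc_extend T M V t0 : 0 < M -> 0 <= t0 < T -> gsol (retract nm M) T V -> nm (V t0) < M ->
  (forall s, 0 <= s < t0 -> nm (V s) <= M) -> exists2 T', t0 < T' & gsol id T' V.
Proof.
move=> M0 /andP[t00 tT] sV Vt Vs; have e0 : 0 < M - nm (V t0) by rewrite subr_gt0.
have [|del d0 hd] := sV.1 t0 _ _ e0; first by rewrite t00 ltW.
exists (Num.min T (t0 + del / 2)); first by rewrite lt_min tT ltrDl divr_gt0.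
apply/(gsol_retract M0); last by apply: gsolS sV; rewrite ge_min lexx.
move=> s /andP[s0]; rewrite lt_min => /andP[sT sd].
have [st|ts] := ltP s t0; first by apply: Vs; rewrite s0.
rewrite -(subrK (V t0) (V s)); apply: (le_trans (snD sn _ _)); rewrite -lerBrDr.
apply: hd; first by rewrite s0 ltW.
by rewrite ger0_norm ?subr_ge0// ltrBlDl (lt_trans sd)// ltrD2l ltr_pdivrMr// ltr_pMr// ltr1n.
Qed.

Lemma local_exists : exists2 T, 0 < T & exists u, gsol id T u.
Proof.
pose M := nm u0 + 1; have M0 : 0 < M by rewrite ltr_wpDl// (sn_ge0 sn).
have [L L0 LP] := Phi_lip (ltW M0).
have [V sV] := trunc_exists M0 L0 LP (@ltr01 R).
have [I1 [I2 [i1 i2 e]]] := sV.2 0 (introT andP (conj (lexx (0 : R)) ler01)).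
have n1 := isint_empty0 (lexx 0) i1; have n2 := isint_empty0 (lexx 0) i2.
have V0 : nm (V 0) <= nm u0.
  rewrite -(subrK (S 0 u0 + I1 + I2) (V 0)); apply: (le_trans (snD sn _ _)); rewrite e add0r.
  apply: (le_trans (snD sn _ _)); rewrite n2 addr0; apply: (le_trans (snD sn _ _)).
  by rewrite n1 addr0 S0.
have z01 : (0 : R) <= (0 : R) < (1 : R) by rewrite lexx/=.
have [|s|T' T'0 sV'] := trunc_extend (T := 1) (t0 := 0) M0 z01 sV.
- by rewrite (le_lt_trans V0)// ltrDl.
- by rewrite leNgt => /andP[/negbTE ->].
- by exists T' => //; exists V.
Qed.

(** Truncation is done at M + 1 to gain strictness: before Ts the truncated solution agrees with U
    up to seminorm zero, so is bounded by M, and at Ts continuity gives less than M + 1. *)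
Lemma continuation Ts U M : 0 < Ts -> (forall T, 0 < T < Ts -> gsol id T U) ->
  (forall t, 0 <= t < Ts -> nm (U t) <= M) -> exists2 T, Ts < T & exists u, gsol id T u.
Proof.
move=> Ts0 sU UM; have M0 : 0 <= M by apply: (le_trans (sn_ge0 sn (U 0))); apply: UM; rewrite lexx.
have M1 : 0 < M + 1 by rewrite ltr_wpDl.
have [L L0 LP] := Phi_lip (ltW M1).
have Ts1 : 0 < Ts + 1 by rewrite ltr_wpDl// ltW.
have [V sV] := trunc_exists M1 L0 LP Ts1.
have VM t : 0 <= t < Ts -> nm (V t) <= M.
  move=> /andP[t0 tT]; pose T := (t + Ts) / 2.
  have tT1 : t < T by rewrite midf_lt.
  have TT : T < Ts by rewrite midf_lt.
  have T0 : 0 < T := le_lt_trans t0 tT1.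
  have sUT : gsol (retract nm (M + 1)) T U.
    apply/(gsol_retract M1); last by apply: sU; rewrite T0.
    move=> s /andP[s0 sT]; apply: (@le_trans _ _ M); last by rewrite lerDl.
    by apply: UM; rewrite s0 (lt_trans sT).
  have sVT : gsol (retract nm (M + 1)) T V by apply: gsolS sV; rewrite (le_trans (ltW TT))// lerDl.
  have tT2 : 0 <= t <= T by rewrite t0 ltW.
  have := trunc_unique M1 L0 LP (ltW T0) sVT sUT tT2.
  rewrite -{2}(subrK (U t) (V t)) => d0; apply: (le_trans (snD sn _ _)); rewrite d0 add0r.
  by apply: UM; rewrite t0.
have VT : nm (V Ts) < M + 1.
  have h1 : (0 : R) < 1 / 2 by [].
  have [|del d0 hd] := sV.1 Ts _ _ h1; first by rewrite ltW//= lerDl.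
  pose s := Ts - Num.min (del / 2) Ts.
  have m0 : 0 < Num.min (del / 2) Ts by rewrite lt_min divr_gt0.
  have sT : 0 <= s < Ts by rewrite /s subr_ge0 ge_min lexx orbT/= gtrBl.
  have d1 : nm (V s - V Ts) <= 1 / 2.
    apply: hd; first by case/andP: sT => -> sT; rewrite (le_trans (ltW sT))// lerDl.
    rewrite /s addrAC subrr add0r normrN gtr0_norm// (@le_lt_trans _ _ (del / 2))//.
      by rewrite ge_min lexx.
    by rewrite ltr_pdivrMr// ltr_pMr// ltr1n.
  have d2 := VM s sT; rewrite (sn_dist sn) in d1.
  rewrite -(subrK (V s) (V Ts)); apply: (le_lt_trans (snD sn _ _)); lra.
have TsT : 0 <= Ts < Ts + 1 by rewrite ltW//= ltrDl.
have [s /VM h|T' T'0 sV'] := trunc_extend M1 TsT sV VT.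
- by rewrite (le_trans h)// lerDl.
- by exists T' => //; exists V.
Qed.

(** Duhamel's formula started at time a, as an inequality: what happened before a enters only
    through S(t - a) u(a), and a bound on u is required only on [a, t[. Retraction is the identity
    there, which gives the bound of [Phi]. *)
Lemma restart T u M L a t : 0 < T -> gsol id T u -> 0 <= a <= t -> t <= T -> 0 < M -> 0 <= L ->
  (forall (t : R) x y, 0 < t -> nm x <= M -> nm y <= M -> nm (Phi t x - Phi t y) <= L * kap t * nm (x - y)) ->
  (forall s, a <= s < t -> nm (u s) <= M) ->
  ((nm (u t - S (t - a) (u a)))%:E <= tail_int (fun s => (L * M * kap (t - s))%R) a t +
     tail_int (fun s => (A * nm w * zeta s)%R) a t)%E.
Proof.
move=> T0 [cu su] /andP[a0 at_] tT M0 L0 LP uM; have t0 := le_trans a0 at_.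
have [J [iJ _ HJ]] := forcing_on T0.
have [|I1 [I2 [i1 i2 e1]]] := su t; first by rewrite t0.
have aT : 0 <= a <= T by rewrite a0 (le_trans at_).
have [J1 [J2 [j1 j2 e2]]] := su a aT.
have ta0 : 0 <= t - a by rewrite subr_ge0.
have [nI n2] : nm (J t - I2) = 0 /\ nm (J a - J2) = 0.
  by split; apply: isint_unique; [exact: i2|apply: iJ; rewrite t0|exact: j2|exact: iJ].
have h2 : ((nm (I2 - S (t - a) J2))%:E <= tail_int (fun s => (A * nm w * zeta s)%R) a t)%E.
  apply: le_trans (HJ a t _ tT); last by rewrite a0.
  rewrite lee_fin; apply: (le_trans (sn_tri sn (J t) _ _)); rewrite (sn_dist sn) nI add0r.
  apply: (le_trans (sn_tri sn (S (t - a) (J a)) _ _)); rewrite gerDl SB//.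
  by rewrite (le_trans (SA _ ta0))// n2 mulr0.
have h1 : ((nm (I1 - S (t - a) J1))%:E <= tail_int (fun s => (L * M * kap (t - s))%R) a t)%E.
  apply: (isint_cmp sn (mitv 0 a) (mitv 0 t) (fitv 0 t) _ (Slin ta0) j1 i1).
  - by move=> s; rewrite /= !in_itv/= => /andP[-> h]; rewrite (lt_le_trans h).
  - apply: measurable_funTS; apply: measurable_fun_ifT => //; first exact: measurable_fun_ltr.
    by apply: measurable_funM => //; apply: (measurableT_comp mkap); exact: measurable_funB.
  - by move=> s _; case: ifP => // _; rewrite !mulr_ge0// ltW.
  - move=> s; rewrite /= in_itv/= => /andP[s0 sa]; rewrite sa.
    have as0 : 0 < a - s by rewrite subr_gt0.
    by rewrite (sn_dist sn); have := PhiS (u s) ta0 as0; rewrite addrA subrK => ->.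
  - move=> s; rewrite /= !in_itv/= => /andP[s0 st]; rewrite s0/= => /negP; rewrite -leNgt => as_.
    rewrite ltNge as_/= -(retract_id M0 (uM s (introT andP (conj as_ st)))).
    by apply: (Phi_rho_bound M0 L0 LP); rewrite subr_gt0.
apply: le_trans (leeD h1 h2); rewrite -EFinD lee_fin.
apply: (le_trans (sn_tri sn (S t u0 + I1 + I2) _ _)); rewrite e1 add0r.
apply: (le_trans (sn_tri sn (S (t - a) (S a u0 + J1 + J2)) _ _)).
have -> : nm (S (t - a) (S a u0 + J1 + J2) - S (t - a) (u a)) = 0.
  apply: le_anti; rewrite (sn_ge0 sn) andbT SB//; apply: (le_trans (SA _ ta0)).
  by rewrite (sn_dist sn) e2 mulr0.
rewrite addr0; have [_ SD _ _] := Slin ta0; rewrite !SD.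
apply: (le_trans (sn_tri sn (S (t - a) (S a u0) + I1 + I2) _ _)).
rewrite subr_add3 -[X in _ <= X]add0r lerD// ?(snD sn)//.
have -> : S t u0 + I1 + I2 - (S (t - a) (S a u0) + I1 + I2) = S t u0 - S (t - a) (S a u0).
  by rewrite !opprD addrACA subrr addr0 addrACA subrr addr0.
by rewrite (sn_dist sn); have := Ssemi u0 ta0 a0; rewrite subrK => ->.
Qed.

Lemma blowup Ts U K : 0 < Ts -> (forall T, 0 < T < Ts -> gsol id T U) ->
  ~ (exists2 T, Ts < T & exists u, gsol id T u) ->
  exists2 del, 0 < del & forall t, Ts - del < t < Ts -> K < nm (U t).
Proof.
move=> Ts0 sU nC; apply: contrapT => H; apply: nC.
have {}H del : 0 < del -> exists2 t, Ts - del < t < Ts & nm (U t) <= K.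
  move=> d0; apply: contrapT => H'; apply: H; exists del => // t tT.
  by rewrite ltNge; apply/negP => h; apply: H'; exists t.
have K0 : 0 <= K by have [t _ h] := H 1 ltr01; apply: le_trans h; exact: (sn_ge0 sn).
have AK : 0 <= A * K by exact: mulr_ge0.
(* A restart from norm at most K with two tails of at most 1/2 ends below A K + 1; M leaves room for
   a further continuity step of 1/2. *)
pose M := A * K + K + 2; have M0 : 0 < M by rewrite /M; lra.
have [L L0 LP] := Phi_lip (ltW M0).
have LM0 : 0 <= L * M by rewrite mulr_ge0// ltW.
have h2 : (0 : R) < 1 / 2 by [].
have [d1 d10 hd1] := tail_kap Ts LM0 h2; have [d2 d20 hd2] := tail_zeta Ts h2.
have [|a] := H (Num.min Ts (Num.min d1 d2)); first by rewrite !lt_min Ts0 d10.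
move=> /andP[a1 aT] aK; have [m1 m2 m3] : [/\ a > 0, Ts - a < d1 & Ts - a < d2].
  move: a1; set mm := Num.min Ts _ => a1.
  have g1 : mm <= Ts by rewrite ge_min lexx.
  have g2 : mm <= d1 by rewrite !ge_min lexx orbT.
  have g3 : mm <= d2 by rewrite !ge_min lexx !orbT.
  by split; lra.
have a0 := ltW m1.
have UM t : a <= t < Ts -> nm (U t) <= M.
  move=> /andP[at1 tT]; rewrite leNgt; apply/negP => tM.
  (* First exit argument. Before the infimum s0 the bound M holds, so the restart gives at most A K
     + 1 at s0; by continuity some point of [E] just after s0 has norm at most A K + 3/2, which is
     less than M. *)
  pose E := [set s | a <= s <= t /\ M < nm (U s)].
  have Et : E t by split; rewrite ?at1 ?lexx.
  have infE : has_inf E by split; [exists t|exists a => s [/andP[]]].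
  pose s0 := inf E.
  have as0 : a <= s0 by apply: lb_le_inf => [|s [/andP[]]//]; exists t.
  have s0t : s0 <= t by apply: ge_inf => //; exists a => s [/andP[]].
  have t0 : 0 < t := lt_le_trans m1 at1.
  have sUt : gsol id t U by apply: sU; rewrite t0.
  have sM s : a <= s < s0 -> nm (U s) <= M.
    move=> /andP[as_ ss0]; rewrite leNgt; apply/negP => h.
    have : s0 <= s by apply: ge_inf; [exists a => x [/andP[]]|split => //; rewrite as_ (le_trans (ltW ss0))].
    by rewrite leNgt ss0.
  have h : nm (U s0) <= A * K + 1.
    have as0' : 0 <= a <= s0 by rewrite a0.
    have s0T : s0 <= Ts := le_trans s0t (ltW tT).
    have R1 := restart t0 sUt as0' s0t M0 L0 LP sM.
    have R2 : ((nm (U s0 - S (s0 - a) (U a)))%:E <= (1 / 2 + 1 / 2)%:E)%E.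
      by apply: (le_trans R1); rewrite EFinD leeD// ?hd1 ?hd2//; lra.
    rewrite lee_fin in R2; rewrite -(subrK (S (s0 - a) (U a)) (U s0)).
    have sa0 : 0 <= s0 - a by rewrite subr_ge0.
    have R3 := SA (U a) sa0; have R4 : A * nm (U a) <= A * K by rewrite ler_wpM2l.
    by apply: (le_trans (snD sn _ _)); lra.
  have [|del d0 hd] := sUt.1 s0 _ _ h2; first by rewrite (le_trans a0).
  have [s [/andP[as_ st] sMs] ss0] := inf_adherent d0 infE.
  have s0s : s0 <= s by apply: ge_inf; [exists a => x [/andP[]]|split => //; rewrite as_].
  have : nm (U s) <= A * K + 3 / 2.
    rewrite -(subrK (U s0) (U s)); apply: (le_trans (snD sn _ _)).
    have h3 : nm (U s - U s0) <= 1 / 2.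
      apply: hd; first by rewrite (le_trans a0).
      by rewrite ger0_norm ?subr_ge0// ltrBlDl.
    by lra.
  by move: sMs; rewrite /M => sMs; lra.
have sUa : gsol id a U by apply: sU; rewrite m1.
have [B hB] := snc_bounded a0 sUa.1.
apply: (continuation (M := Num.max M B) Ts0 sU) => t /andP[t0 tT]; rewrite le_max.
by have [at_|ta] := leP a t; [rewrite UM ?at_|rewrite hB ?orbT// t0 ltW].
Qed.

(** Diagonal construction: choose a solution on [0, t] for each t where one exists and evaluate it
    at its own end point; uniqueness identifies the result with every solution on a longer
    interval. *)
Lemma maximal_exists : exists U, forall T, 0 <= T -> (exists u, gsol id T u) -> gsol id T U.
Proof.
have /boolp.choice[f Hf] : forall t : R, exists v : R -> X, (exists u, gsol id t u) -> gsol id t v.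
  by move=> t; have [[u su]|n] := pselect (exists u, gsol id t u); [exists u|exists (fun=> 0)].
exists (fun t => f t t) => T T0 [u su]; apply: (gsol_eq T0 _ su) => t tT.
have [t0 tT'] := andP tT; have sut := gsolS tT' su.
by apply: (gsol_unique t0 sut (Hf t _)); [exists u|rewrite t0 lexx].
Qed.

End evolution.

(** * Heat semigroup on [L^q] *)

Section time_weights.
Context {R : realType}.
Local Notation mu := (@lebesgue_measure R).
Local Notation T1 := (measurableTypeR R).

Lemma integrable_powR_itv (s T : R) : -1 < s ->
  mu.-integrable (`]0%R, T[%classic : set T1) (EFin \o (fun x : T1 => x `^ s)).
Proof.
move=> s1; have [T0|T0] := leP T 0.
  have -> : (`]0%R, T[%classic : set T1) = set0 by rewrite set_itv_ge// bnd_simp -leNgt.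
  exact: integrable_set0.
have sub : `]0%R, T[%classic `<=` (`]0%R, T]%classic : set T1).
  by move=> x; rewrite /= !in_itv/= => /andP[-> /ltW].
apply: (@integrableS _ _ _ _ (`]0%R, T]%classic : set T1)) => //.
apply/integrableP; split.
  by apply/measurable_EFinP; apply: measurable_funTS; exact: measurable_powR.
rewrite (eq_integral (fun x : T1 => (x `^ s)%:E)); last first.
  by move=> x _; rewrite /= ger0_norm ?powR_ge0.
by rewrite integral_powR0// ltry.
Qed.

Variables (zeta : R -> R) (sigma : R).
Hypotheses (zeta_pos : forall t, 0 < t -> 0 < zeta t)
  (zeta_cont : {in `]0, +oo[, continuous zeta}) (sigma1 : -1 < sigma)
  (zeta_0 : zeta t / t `^ sigma @[t --> 0^'+] --> (1 : R)).

(** The values of [zeta] at nonpositive times are arbitrary; replacing them by 0 gives a nonnegative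
    function measurable on the whole line. *)
Definition pos_part (t : T1) : R := if 0 < t then zeta t else 0.

Lemma measurable_pos_part : measurable_fun setT pos_part.
Proof.
have mz : measurable_fun (`]0%R, +oo[%classic : set T1) zeta.
  by apply: open_continuous_measurable_fun; [exact: interval_open|move=> x /set_mem; exact: zeta_cont].
have mD : measurable (`]0%R, +oo[%classic : set T1) by exact: measurable_itv.
have : measurable_fun setT (zeta \_ (`]0%R, +oo[%classic : set T1)).
  by apply/(measurable_restrict _ mD measurableT); rewrite setTI.
apply: eq_measurable_fun => x _; rewrite patchE /pos_part.
have -> : (x \in (`]0%R, +oo[%classic : set T1)) = (0 < x); last by [].
by apply/idP/idP => [/set_mem|x0]; [rewrite /= in_itv/= andbT|apply/mem_set; rewrite /= in_itv/= andbT].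
Qed.

Lemma pos_part_ge0 t : 0 <= pos_part t.
Proof. by rewrite /pos_part; case: ifP => // /zeta_pos /ltW. Qed.

Lemma pos_part_cont (s : R) : 0 < s -> forall e, 0 < e -> exists2 del, 0 < del &
  forall s' : R, `|s' - s| < del -> `|pos_part s' - pos_part s| <= e.
Proof.
move=> s0 e e0; have cz : {for s, continuous zeta} by apply: zeta_cont; rewrite in_itv/= s0.
move/cvgrPdist_le : cz => /(_ e e0) /nbhs_ballP[del /= d0 hd].
exists (Num.min del s); first by rewrite lt_min d0.
move=> s'; rewrite lt_min => /andP[h1 h2].
have s'0 : 0 < s'.
  by have h := ler_norm (s - s'); rewrite distrC in h; lra.
by rewrite /pos_part s0 s'0 distrC; apply: hd; rewrite /ball/= distrC.
Qed.

(** Near 0 the asymptotics give zeta(t) <= 2 t^sigma with sigma > -1; away from 0 continuity bounds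
    it on a compact interval. *)
Lemma integrable_pos_part (T : R) : mu.-integrable (`]0%R, T[%classic : set T1) (EFin \o pos_part).
Proof.
have n0 : \forall t \near (0 : R)^'+, zeta t <= 2 * t `^ sigma.
  near=> t; have t0 : 0 < t by near: t; exact: nbhs_right_gt.
  rewrite -ler_pdivrMr ?powR_gt0//.
  have h : `|1 - zeta t / t `^ sigma| <= 1.
    by near: t; have /cvgrPdist_le := zeta_0; apply.
  by move: h; rewrite ler_norml => /andP[h1 h2]; lra.
have [del d0 hd] : exists2 del : R, 0 < del & forall t, 0 < t < del -> zeta t <= 2 * t `^ sigma.
  move: n0; rewrite near_withinE => /nbhs_ballP[del /= d0 hd]; exists del => // t /andP[t0 td].
  by apply: hd => //; rewrite /ball/= sub0r normrN gtr0_norm.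
pose b := Num.max (del / 2) T; have d2 : 0 < del / 2 by rewrite divr_gt0.
have db : del / 2 <= b by rewrite le_max lexx.
have cw : {within `[del / 2, b], continuous zeta}.
  apply: continuous_in_subspaceT => x /set_mem; rewrite /= in_itv/= => /andP[x1 _].
  by apply: zeta_cont; rewrite in_itv/= (lt_le_trans d2 x1).
have [c _ hc] := EVT_max db cw.
have mD : measurable (`]0%R, T[%classic : set T1) by exact: measurable_itv.
have ig : mu.-integrable (`]0%R, T[%classic : set T1) (EFin \o (fun x : T1 => 2 * x `^ sigma + `|zeta c|)).
  have i1 := integrableZl mD 2 (integrable_powR_itv T sigma1).
  have i2 : mu.-integrable (`]0%R, T[%classic : set T1) (EFin \o (fun x : T1 => `|zeta c|)).
    apply/integrableP; split; first exact: measurable_cst.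
    rewrite (eq_integral (cst (`|zeta c|%:E)))/=; last by move=> x _; rewrite /= normr_id.
    have fin : (mu (`]0%R, T[%classic : set T1) < +oo)%E.
      by rewrite lebesgue_measure_itv/=; case: ifP => _; rewrite -?EFinB ltry.
    by rewrite integral_cst// lte_mul_pinfty// lee_fin.
  by have := integrableD mD i1 i2; apply: eq_integrable.
apply: le_integrable ig => //.
  by apply/measurable_EFinP; apply: measurable_funTS; exact: measurable_pos_part.
move=> t; rewrite /= in_itv/= => /andP[t0 tT]; rewrite lee_fin ger0_norm ?pos_part_ge0//.
apply: le_trans (ler_norm _); rewrite /pos_part t0.
have [td|td] := ltP t del.
  by apply: (le_trans (hd t _)); [rewrite t0|rewrite lerDl].
have tb : t \in `[del / 2, b].
  rewrite in_itv/= le_max (ltW tT) orbT andbT (le_trans _ td)// ler_pdivrMr// ler_peMr ?(ltW d0)// ler1n//.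
apply: (le_trans (hc t tb)); apply: (le_trans (ler_norm _)); rewrite lerDr mulr_ge0// powR_ge0.
Unshelve. all: by end_near. Qed.

End time_weights.

(** * L^q as an abstract seminormed space *)

Section bridge.
Context {R : realType} {n : nat}.
Local Notation leb := (lebesgue_Rn R n).
Local Notation T1 := (measurableTypeR R).
Local Notation mu := (@lebesgue_measure R).
Variable q : R.
Hypothesis q1 : 1 < q.
Local Notation Lf := (Lfun leb q%:E).

Fact q1e : (1 <= q%:E)%E. Proof. by rewrite lee_fin ltW. Qed.

Definition LX : lmodType R := LfunType leb q1e.
(* [L^q] is kept as the seminormed space of functions, without quotienting by almost everywhere
   equality; [toX] is [0] outside [Lfun]. *)
Definition toX (f : Rn R n -> R) : LX :=
  match pselect (f \in Lf) with left fL => Lfun_Sub q1e fL | right _ => 0 end.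
Definition fromX (x : LX) : Rn R n -> R := (x : LfunType leb q1e).
Definition nmX (x : LX) : R := nmq leb q (fromX x).

Lemma fromX_Lfun x : fromX x \in Lf. Proof. exact: LfunP. Qed.
Lemma toXK f : f \in Lf -> fromX (toX f) = f.
Proof. by rewrite /toX; case: pselect. Qed.
Lemma fromX_inj : injective fromX.
Proof. by move=> x y xy; apply/LfuneqP => z; exact: (congr1 (@^~ z) xy). Qed.
Lemma fromXK x : toX (fromX x) = x.
Proof. by apply: fromX_inj; rewrite toXK//; exact: fromX_Lfun. Qed.
Lemma fromXD x y : fromX (x + y) = (fun z => fromX x z + fromX y z). Proof. by []. Qed.
Lemma fromXZ a x : fromX (a *: x) = (fun z => a * fromX x z). Proof. by []. Qed.
Lemma fromXB x y : fromX (x - y) = (fun z => fromX x z - fromX y z). Proof. by []. Qed.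
Lemma fromX_sum k (F : 'I_k -> LX) : fromX (\sum_(i < k) F i) = (fun z => \sum_(i < k) fromX (F i) z).
Proof.
elim: k F => [|k ih] F; first by rewrite big_ord0; apply/funext => z; rewrite big_ord0.
by rewrite big_ord_recr fromXD ih; apply/funext => z; rewrite big_ord_recr.
Qed.

Lemma nmXB f g : f \in Lf -> g \in Lf -> nmX (toX f - toX g) = nmq leb q (fun z => f z - g z).
Proof. by move=> fL gL; rewrite /nmX fromXB !toXK. Qed.

Lemma nmX_complete : complete_seminorm nmX.
Proof.
split.
- by move=> x y; rewrite /nmX fromXD; apply: nmqD => //; exact: fromX_Lfun.
- by move=> a x; rewrite /nmX fromXZ; have [] := nmqZ q1 a (fromX_Lfun x).
- move=> u hu; have [|l lL L] := @nmq_complete _ _ _ leb q q1 (fun k => fromX (u k)) (fun k => fromX_Lfun (u k)).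
    by move=> e /hu[k0 h]; exists k0.
  by exists (toX l); move: L; apply: cvg_trans; apply: near_eq_cvg; apply: nearW => k; rewrite /nmX fromXB toXK.
Qed.

Lemma Lnorm_nmX (x : LX) : Lnorm leb q%:E (EFin \o fromX x) = (nmX x)%:E.
Proof. by rewrite LnormE//; exact: fromX_Lfun. Qed.

Lemma nmX_ae f g : f \in Lf -> g \in Lf ->
  nmX (toX f - toX g) = 0 <-> {ae leb, forall x, f x = g x}.
Proof. by move=> fL gL; rewrite nmXB//; exact: eq_ae_nmq. Qed.

Lemma cvg_Lnorm0 (I : Type) (F : set_system I) {FF : Filter F} (x : I -> LX) :
  Lnorm leb q%:E (EFin \o fromX (x i)) @[i --> F] --> 0%E <-> nmX (x i) @[i --> F] --> (0 : R).
Proof.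
rewrite fine_cvgP; split=> [[_ //]|h]; split=> //.
by apply: nearW => i; rewrite Lnorm_nmX.
Qed.

Lemma BochnerP (D : set T1) (F : R -> Rn R n -> R) (g : Rn R n -> R) : measurable D ->
  is_Bochner q D F g <->
  [/\ g \in Lf, forall s, D s -> F s \in Lf & isint nmX D (fun s => toX (F s)) (toX g)].
Proof.
move=> mD.
have E1 m (A : 'I_m -> set R) (phi : 'I_m -> LX) (f : Rn R n -> R) s : f \in Lf ->
    (f \- (fun x => \sum_(j < m) \1_(A j) s * fromX (phi j) x)) = fromX (toX f - step A phi s).
  by move=> fL; apply/funext => z; rewrite fromXB toXK// /step fromX_sum.
have E2 m (A : 'I_m -> set R) (phi : 'I_m -> LX) (f : Rn R n -> R) : f \in Lf ->
    (f \- (fun x => \sum_(j < m) fine (mu (A j)) * fromX (phi j) x)) = fromX (toX f - step_int A phi).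
  by move=> fL; apply/funext => z; rewrite fromXB toXK// /step_int fromX_sum.
split.
- move=> [gL FL [m [A [phi [h1 h2 h3 h4]]]]]; split => //.
  have phiE k j : fromX (toX (phi k j)) = phi k j by rewrite toXK//; have [] := h1 k j.
  have N1 k s : D s -> Lnorm leb q%:E (EFin \o (F s \- (fun x => \sum_(j < m k) \1_(A k j) s * phi k j x))) =
      (nmX (toX (F s) - step (A k) (fun j => toX (phi k j)) s))%:E.
    move=> Ds; rewrite -Lnorm_nmX -E1 ?FL//; congr (Lnorm leb q%:E (EFin \o _)); apply/funext => z /=.
    by congr (_ - _); apply: eq_bigr => j _; rewrite phiE.
  exists m, A, (fun k j => toX (phi k j)); split.
  + by move=> k j; have [] := h1 k j.
  + move=> k; apply/measurable_EFinP; apply: eq_measurable_fun (h2 k) => s /set_mem Ds.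
    by rewrite N1.
  + move: h3; apply: cvg_trans; apply: near_eq_cvg; apply: nearW => k.
    by apply: eq_integral => s /set_mem Ds; rewrite N1.
  + apply/cvg_Lnorm0; move: h4; apply: cvg_trans; apply: near_eq_cvg; apply: nearW => k.
    rewrite -E2//; congr (Lnorm leb q%:E (EFin \o _)); apply/funext => z /=.
    by congr (_ - _); apply: eq_bigr => j _; rewrite phiE.
- move=> [gL FL [m [A [phi [h1 h2 h3 h4]]]]]; split => //.
  have N1 k s : D s -> Lnorm leb q%:E (EFin \o (F s \- (fun x => \sum_(j < m k) \1_(A k j) s * fromX (phi k j) x))) =
      (nmX (toX (F s) - step (A k) (phi k) s))%:E.
    by move=> Ds; rewrite -Lnorm_nmX -E1 ?FL.
  exists m, A, (fun k j => fromX (phi k j)); split.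
  + by move=> k j; have [a1 a2 a3] := h1 k j; split => //; exact: fromX_Lfun.
  + move=> k; have /measurable_EFinP := h2 k; apply: eq_measurable_fun => s /set_mem Ds.
    by rewrite N1.
  + move: h3; apply: cvg_trans; apply: near_eq_cvg; apply: nearW => k.
    by apply: eq_integral => s /set_mem Ds; rewrite N1.
  + move/cvg_Lnorm0: h4; apply: cvg_trans; apply: near_eq_cvg; apply: nearW => k.
    by rewrite -E2.
Qed.

Lemma continuousLqP (T : R) (u : R -> Rn R n -> R) :
  continuous_Lq q T u <-> (forall t, 0 <= t <= T -> u t \in Lf) /\ snc nmX T (fun t => toX (u t)).
Proof.
split=> -[uL cu]; split => // t tT.
- move=> e e0; have /fine_cvgP[_ /cvgrPdist_le/(_ e e0)] := cu t tT.
  rewrite near_withinE => /nbhs_ballP[del /= d0 hd]; exists del => // s sT st.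
  have := hd s; rewrite /ball/= distrC => /(_ st); rewrite /= in_itv/= => /(_ sT).
  by rewrite sub0r normrN => h; apply: le_trans h; rewrite nmXB ?uL//; exact: ler_norm.
- apply/fine_cvgP; split.
    rewrite near_withinE; apply: nearW => s; rewrite /= in_itv/= => sT.
    by rewrite (LnormE (LfunB q1 (uL s sT) (uL t tT))).
  apply/cvgrPdist_le => e e0; have [del d0 hd] := cu t tT e e0.
  rewrite near_withinE; apply/nbhs_ballP; exists del => //= s; rewrite /ball/= distrC => st.
  rewrite in_itv/= => sT; rewrite sub0r normrN ger0_norm; last exact: nmq_ge0.
  by have := hd s sT st; rewrite nmXB ?uL.
Qed.

End bridge.

(** * The heat semigroup and the source term in the abstract framework *)

Section heat_evolution.
Context {R : realType} {n : nat}.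
Local Notation leb := (lebesgue_Rn R n).
Local Notation T1 := (measurableTypeR R).
Local Notation mu := (@lebesgue_measure R).
Variables d p alpha q : R.
Hypotheses (n0 : (0 < n)%N) (hd : (0 < d < 1) \/ (exists k : nat, (0 < k)%N /\ d = k%:R)).
Hypotheses (p1 : 1 < p) (q1 : 1 < q).
Local Notation Lf := (Lfun leb q%:E).
Local Notation K t := (@heat_kernel R n d t).
Local Notation X := (@LX R n q q1).
Local Notation toX := (@toX R n q q1).
Local Notation nmX := (@nmX R n q q1).
Local Notation snX := (@nmX_complete R n q q1).

Lemma conv_tameD g h t x : tame d q g -> tame d q h -> 0 < t ->
  Defs.conv (K t) (fun z => g z + h z) x = Defs.conv (K t) g x + Defs.conv (K t) h x.
Proof.
move=> [_ tg] [_ th] t0; have [ig _] := tg t t0; have [ih _] := th t t0.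
rewrite /Defs.conv -RintegralD//; by under eq_Rintegral do rewrite mulrDr.
Qed.

Lemma conv_tameZ (c : R) g t x : tame d q g -> 0 < t ->
  Defs.conv (K t) (fun z => c * g z) x = c * Defs.conv (K t) g x.
Proof.
move=> [_ tg] t0; have [ig _] := tg t t0.
rewrite /Defs.conv -RintegralZl//; by under eq_Rintegral do rewrite mulrCA.
Qed.

Lemma semigroup_Lfun t f : 0 <= t -> f \in Lf -> semigroup d t f \in Lf.
Proof.
move=> t0 fL; rewrite /semigroup; case: ifP => // /negbT tn0.
have t1 : 0 < t by rewrite lt_neqAle eq_sym tn0.
by have [tf _] := tame_Lfun n0 hd q1 fL; have [] := tame_conv hd q1 tf t1.
Qed.

Definition heatX t (x : X) : X := toX (semigroup d t (fromX x)).

(** The maximum with 1 covers t = 0, where the semigroup is the identity rather than a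
    convolution. *)
Definition growth_cst : R := Num.max 1 (young_cst (@hkA R n d) q q).

Lemma fromX_heatX t x : 0 <= t -> fromX (heatX t x) = semigroup d t (fromX x).
Proof. by move=> t0; rewrite toXK// semigroup_Lfun//; exact: fromX_Lfun. Qed.

Lemma heatX0 x : heatX 0 x = x.
Proof. by rewrite /heatX /semigroup eqxx fromXK. Qed.

Lemma heatX_linear t : 0 <= t -> bounded_linear nmX growth_cst (heatX t).
Proof.
have g0 : 0 <= growth_cst by rewrite le_max ler01.
rewrite le_eqVlt => /predU1P[<-|t0].
  split=> // [x y|a x|x]; rewrite !heatX0// ler_peMl ?nmq_ge0//.
  by rewrite le_max lexx.
have t0' := ltW t0.
have tX (x : X) : tame d q (fromX x) by have [] := tame_Lfun n0 hd q1 (fromX_Lfun x).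
have tE f : semigroup d t f = Defs.conv (K t) f by rewrite /semigroup gt_eqF.
split=> // [x y|a x|x].
- apply: fromX_inj; rewrite fromXD !fromX_heatX// !tE fromXD; apply/funext => z.
  exact: conv_tameD.
- by apply: fromX_inj; rewrite fromXZ !fromX_heatX// !tE fromXZ; apply/funext => z; exact: conv_tameZ.
- rewrite /nmX fromX_heatX// tE; have [_ h] := tame_Lfun n0 hd q1 (fromX_Lfun x).
  by apply: (le_trans (h t t0)); rewrite ler_wpM2r ?nmq_ge0// le_max lexx orbT.
Qed.

Lemma semigroup_comp s t (g : Rn R n -> R) : tame d q g -> 0 <= s -> 0 < t ->
  semigroup d s (semigroup d t g) = semigroup d (s + t) g.
Proof.
move=> tg s0 t0; move: s0; rewrite le_eqVlt => /predU1P[<-|s0].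
  by rewrite add0r {1}/semigroup eqxx.
rewrite /semigroup !gt_eqF ?addr_gt0//; apply/funext => x; exact: (conv_semigroup n0 hd q1).
Qed.

Lemma heatX_semi s t x : 0 <= s -> 0 <= t -> nmX (heatX s (heatX t x) - heatX (s + t) x) = 0.
Proof.
move=> s0 t0; suff -> : heatX s (heatX t x) = heatX (s + t) x by rewrite subrr (sn0 snX).
move: t0; rewrite le_eqVlt => /predU1P[<-|t0]; first by rewrite heatX0 addr0.
have st0 : 0 <= s + t by rewrite addr_ge0// ltW.
apply: fromX_inj; apply: etrans (fromX_heatX _ s0) _; apply: etrans _ (esym (fromX_heatX _ st0)).
rewrite (fromX_heatX _ (ltW t0)).
apply: semigroup_comp s0 t0; by have [] := tame_Lfun n0 hd q1 (fromX_Lfun x).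
Qed.

Lemma heatX_cont x e : 0 < e -> exists2 del, 0 < del & forall t, 0 <= t < del -> nmX (heatX t x - x) <= e.
Proof.
(* [heat_strong] is sequential: a failure of the uniform statement yields times t_k < 1 / (k + 1)
   contradicting it. *)
move=> e0; apply: contrapT => H.
have {}H del : 0 < del -> exists2 t, 0 < t < del & e < nmX (heatX t x - x).
  move=> d0; apply: contrapT => H'; apply: H; exists del => // t /andP[]; rewrite le_eqVlt => /predU1P[<- _|t0 td].
    by rewrite heatX0 subrr (sn0 snX) ltW.
  by rewrite leNgt; apply/negP => h; apply: H'; exists t => //; rewrite t0.
have /boolp.choice[t Ht] : forall k : nat, exists t, (0 < t < harmonic k) /\ e < nmX (heatX t x - x).
  by move=> k; have [|t t1 t2] := H (harmonic k); [rewrite /harmonic/= invr_gt0|exists t].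
have t0 k : 0 < t k by have [/andP[]] := Ht k.
have tc : t @ \oo --> (0 : R).
  apply: (squeeze_cvgr _ (cvg_cst 0) (@cvg_harmonic R)); apply: nearW => k.
  by have [/andP[/ltW -> /ltW ->]] := Ht k.
have /cvgr0Pnorm_le/(_ _ e0)[k _ /(_ _ (leqnn k)) hk] := heat_strong n0 hd q1 (fromX_Lfun x) t0 tc.
have [_] := Ht k; rewrite ltNge => /negP; apply; apply: le_trans hk; apply: le_trans (ler_norm _).
by rewrite /nmX fromXB (fromX_heatX _ (ltW (t0 k))) /semigroup (gt_eqF (t0 k)).
Qed.

Variables c1 c2 b1 b2 : R.
Hypotheses (c10 : 0 <= c1) (c20 : 0 <= c2) (b1i : 0 <= b1 < 1) (b2i : 0 <= b2 < 1)
  (Hsing : forall (h : Rn R n -> R) (H : R), measurable_fun setT h -> 0 <= H ->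
      (\int[leb]_x (`|h x| `^ (q / p))%:E <= (H `^ (q / p))%:E)%E ->
      tame d q (fun x => enorm x `^ alpha * h x) /\
      forall t, 0 < t -> nmq leb q (Defs.conv (K t) (fun x => enorm x `^ alpha * h x)) <=
        (c1 * t `^ (- b1) + c2 * t `^ (- b2)) * H).

Let p0 : 0 < p. Proof. exact: lt_trans ltr01 p1. Qed.
Let q0 : 0 < q. Proof. exact: lt_trans ltr01 q1. Qed.

Definition kap (t : T1) : R := c1 * t `^ (- b1) + c2 * t `^ (- b2).

Lemma measurable_kap : measurable_fun setT kap.
Proof. by apply: measurable_funD; apply: measurable_funM => //; exact: measurable_powR. Qed.

Lemma kap_ge0 t : 0 <= kap t.
Proof. by rewrite addr_ge0// mulr_ge0// powR_ge0. Qed.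

Lemma integrable_kap T : mu.-integrable (`]0%R, T[%classic : set T1) (EFin \o kap).
Proof.
have mD : measurable (`]0%R, T[%classic : set T1) by exact: measurable_itv.
have [/andP[_ h1] /andP[_ h2]] := (b1i, b2i).
have i1 : mu.-integrable (`]0%R, T[%classic : set T1) (EFin \o (fun x : T1 => x `^ (- b1))).
  by apply: integrable_powR_itv; rewrite ltrN2.
have i2 : mu.-integrable (`]0%R, T[%classic : set T1) (EFin \o (fun x : T1 => x `^ (- b2))).
  by apply: integrable_powR_itv; rewrite ltrN2.
have := integrableD mD (integrableZl mD c1 i1) (integrableZl mD c2 i2).
by apply: eq_integrable.
Qed.

Definition source (f : Rn R n -> R) : Rn R n -> R := fun x => enorm x `^ alpha * `|f x| `^ p.
(** The semigroup acts here on a function that need not lie in L^q, so this is not [heatX t] of an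
    element of the space; only the result is brought back by [toX]. *)
Definition PhiX t (x : X) : X := toX (semigroup d t (source (fromX x))).

Lemma tame_source f : f \in Lf -> tame d q (source f).
Proof.
move=> fL; have mf := Lfun_measurable fL.
have [|||//] := @Hsing (fun x => `|f x| `^ p) (nmq leb q f `^ p); [exact: measurable_normpow|exact: powR_ge0|].
rewrite le_eqVlt; apply/orP; left; apply/eqP.
rewrite -powRrM (mulrC p) divfK ?gt_eqF// -(integral_nmq q1 fL); apply: eq_integral => x _.
by rewrite ger0_norm ?powR_ge0// -powRrM (mulrC p) divfK ?gt_eqF.
Qed.

Lemma semigroup_source t f : 0 < t -> f \in Lf -> semigroup d t (source f) \in Lf.
Proof.
move=> t0 fL; rewrite /semigroup gt_eqF//.
by have [] := tame_conv hd q1 (tame_source fL) t0.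
Qed.

Lemma PhiX_lip M : 0 <= M -> exists2 L, 0 <= L & forall (t : R) x y, 0 < t -> nmX x <= M -> nmX y <= M ->
  nmX (PhiX t x - PhiX t y) <= L * kap t * nmX (x - y).
Proof.
move=> M0; pose L := p * (2 * M `^ q) `^ ((p - 1) / q); have L0 : 0 <= L by rewrite mulr_ge0 ?powR_ge0// ltW.
exists L => // t x y t0 xM yM; have [xL yL] := (fromX_Lfun x, fromX_Lfun y).
have H := @powR_diff_Lfun _ _ _ leb p q p1 q1 _ _ M xL yL xM yM.
have [|||tD hD] := @Hsing (fun z => `|fromX x z| `^ p - `|fromX y z| `^ p) (L * nmX (x - y)); last first.
- rewrite /PhiX nmXB ?semigroup_source// /semigroup gt_eqF//; apply: le_trans (_ : _ <= kap t * (L * nmX (x - y))) _.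
    apply: le_trans (hD t t0); rewrite le_eqVlt; apply/orP; left; apply/eqP; congr nmq; apply/funext => z.
    have [_ /(_ t t0)[ix _]] := tame_source xL; have [_ /(_ t t0)[iy _]] := tame_source yL.
    rewrite /Defs.conv -RintegralB//; apply: eq_Rintegral => w _.
    by rewrite /source -mulrBr -mulrBr.
  by rewrite mulrCA mulrA.
- exact: H.
- by rewrite mulr_ge0// nmq_ge0.
- by apply: measurable_funB; apply: measurable_normpow; [exact: (Lfun_measurable xL)|exact: (Lfun_measurable yL)].
Qed.

Lemma PhiX0 t : 0 < t -> nmX (PhiX t 0) = 0.
Proof.
move=> t0; have E : semigroup d t (source (fromX (0 : X))) = cst 0.
  rewrite /semigroup gt_eqF//; apply/funext => x; rewrite /Defs.conv.
  have -> : (fun y => K t (vsub x y) * source (fromX (0 : X)) y) = cst 0.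
    by apply/funext => z; rewrite /source /= normr0 powR0 ?gt_eqF// !mulr0.
  by rewrite /Rintegral integral0.
have -> : PhiX t 0 = 0; last exact: (sn0 snX).
by apply: fromX_inj; rewrite /PhiX toXK ?E// -E semigroup_source//; exact: fromX_Lfun.
Qed.

Lemma PhiXS s t x : 0 <= s -> 0 < t -> nmX (heatX s (PhiX t x) - PhiX (s + t) x) = 0.
Proof.
move=> s0 t0; suff -> : heatX s (PhiX t x) = PhiX (s + t) x by rewrite subrr (sn0 snX).
have xL := fromX_Lfun x; have st0 : 0 < s + t by rewrite ltr_wpDl.
apply: fromX_inj; apply: etrans (fromX_heatX _ s0) _.
apply: etrans _ (esym (toXK q1 (semigroup_source st0 xL))).
rewrite /PhiX (toXK q1 (semigroup_source t0 xL)); exact: semigroup_comp (tame_source xL) s0 t0.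
Qed.

Lemma mild_gsol (zeta : R -> R) (u0 w : Rn R n -> R) T u : u0 \in Lf -> w \in Lf ->
  mild_solution_Lq d alpha p q zeta u0 w T u <->
  (forall t, 0 <= t <= T -> u t \in Lf) /\
  gsol nmX heatX (pos_part zeta) PhiX (toX u0) (toX w) id T (fun t => toX (u t)).
Proof.
move=> u0L wL; have mitv t : measurable (`]0%R, t[%classic : set T1) by exact: measurable_itv.
have E1 t s : (forall t, 0 <= t <= T -> u t \in Lf) -> t <= T -> 0 < s < t ->
    toX (semigroup d (t - s) (source (u s))) = PhiX (t - s) (toX (u s)).
  by move=> uL tT /andP[s0 st]; rewrite /PhiX toXK// uL// ltW//= (le_trans (ltW st)).
have E2 t s : 0 < s < t -> (fun x => zeta s * semigroup d (t - s) w x) =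
    fromX (fw heatX (pos_part zeta) (toX w) t s).
  move=> /andP[s0 st]; have ts0 : 0 <= t - s by rewrite subr_ge0 ltW.
  by rewrite /fw fromXZ fromX_heatX// toXK// /pos_part s0.
have E3 t I1 I2 : 0 <= t <= T -> u t \in Lf -> I1 \in Lf -> I2 \in Lf ->
    nmX (toX (u t) - (heatX t (toX u0) + toX I1 + toX I2)) = 0 <->
    {ae leb, forall x, u t x = semigroup d t u0 x + I1 x + I2 x}.
  move=> /andP[t0 tT] uL L1 L2; rewrite -(nmX_ae q1)//; last first.
    by apply: LfunD => //; apply: LfunD => //; exact: semigroup_Lfun.
  rewrite (_ : heatX t (toX u0) + toX I1 + toX I2 = toX (fun x => semigroup d t u0 x + I1 x + I2 x))//.
  apply: fromX_inj; rewrite !fromXD fromX_heatX// !toXK//.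
  by apply: LfunD => //; apply: LfunD => //; exact: semigroup_Lfun.
split.
- move=> [/continuousLqP - /(_ q1)[uL cu] su]; split => //; split => // t tT.
  have [t0 tT'] := andP tT.
  have [I1 [I2 [/BochnerP - /(_ q1 (mitv t))[L1 F1 i1] /BochnerP - /(_ q1 (mitv t))[L2 F2 i2] e]]] := su t tT.
  exists (toX I1), (toX I2); split.
  + apply: (isint_ext snX) i1 => s; rewrite /= in_itv/= => st.
    by rewrite (E1 t s uL tT' st) subrr (sn0 snX).
  + apply: (isint_ext snX) i2 => s; rewrite /= in_itv/= => st.
    by rewrite E2// fromXK subrr (sn0 snX).
  + by apply/E3 => //; exact: uL.
- move=> [uL [cu su]]; split; first by apply/(continuousLqP q1).
  move=> t tT; have [t0 tT'] := andP tT; have [I1 [I2 [i1 i2 e]]] := su t tT.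
  have [L1 L2] := (fromX_Lfun I1, fromX_Lfun I2).
  exists (fromX I1), (fromX I2); split.
  + have [_ B] := BochnerP q1 (fun s => semigroup d (t - s) (source (u s))) (fromX I1) (mitv t).
    apply: B; split; first exact: L1.
      move=> s; rewrite /= in_itv/= => /andP[s0 st]; apply: semigroup_source; first by rewrite subr_gt0.
      by apply: uL; rewrite ltW//= (le_trans (ltW st)).
    rewrite fromXK; apply: (isint_ext snX) i1 => s; rewrite /= in_itv/= => st.
    by rewrite -(E1 t s uL tT' st) subrr (sn0 snX).
  + have [_ B] := BochnerP q1 (fun s x => zeta s * semigroup d (t - s) w x) (fromX I2) (mitv t).
    apply: B; split; first exact: L2.
      by move=> s; rewrite /= in_itv/= => st; rewrite E2//; exact: fromX_Lfun.
    rewrite fromXK; apply: (isint_ext snX) i2 => s; rewrite /= in_itv/= => st.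
    by rewrite E2// fromXK subrr (sn0 snX).
  + by apply/E3; rewrite ?fromXK// uL.
Qed.

End heat_evolution.

(** * Well-posedness and the blow-up alternative for the heat equation *)

Theorem theorem1p3 (R : realType) (N : nat) (d p alpha q sigma m : R)
    (zeta : R -> R) (u0 w : Rn R N -> R)
    (hN : (2 <= N)%N)
    (hd : (0 < d < 1) \/ (exists k : nat, (0 < k)%N /\ d = k%:R))
    (hp : 1 < p)
    (halpha : 0 < - alpha < Num.min (2 * d) N%:R)
    (hq1 : 1 < q)
    (hq : Num.max (N%:R * (p - 1) / (2 * d + alpha)) (N%:R * p / (N%:R + alpha))
          < q)
    (hzeta_pos : forall t, 0 < t -> 0 < zeta t)
    (hzeta_cont : {in `]0, +oo[, continuous zeta})
    (hsigma : -1 < sigma)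
    (hzeta_0 : zeta t / t `^ sigma @[t --> 0^'+] --> (1 : R))
    (hzeta_oo : zeta t / t `^ m @[t --> +oo] --> (1 : R))
    (hu0 : u0 \in Lfun (lebesgue_Rn R N) q%:E)
    (hw : w \in Lfun (lebesgue_Rn R N) q%:E) :
  exists (T : R) (u : R -> Rn R N -> R),
    [/\ 0 < T,
        mild_solution_Lq d alpha p q zeta u0 w T u,
        forall v, mild_solution_Lq d alpha p q zeta u0 w T v ->
          forall t, 0 <= t <= T ->
            {ae lebesgue_Rn R N, forall x, v t x = u t x},
        exists U, maximal_solution d alpha p q zeta u0 w U /\
          forall t, 0 <= t <= T ->
            {ae lebesgue_Rn R N, forall x, U t x = u t x}
      & forall U, maximal_solution d alpha p q zeta u0 w U ->
          (Tmax d alpha p q zeta u0 w < +oo)%E ->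
          Lnorm (lebesgue_Rn R N) q%:E (EFin \o U t)
            @[t --> (fine (Tmax d alpha p q zeta u0 w))^'-] --> +oo%E].
Proof.
have n0 : (0 < N)%N by exact: leq_trans hN.
have [c1 [c2 [b1 [b2 [c10 c20 b1i b2i Hs]]]]] := singular_conv n0 hd hq1 hp halpha hq.
pose kp := kap c1 c2 b1 b2; pose X := @LX R N q hq1.
have snX : complete_seminorm (@nmX R N q hq1) := nmX_complete hq1.
pose S := @heatX R N d q hq1; pose Ph := @PhiX R N d p alpha q hq1; pose z := pos_part zeta.
have Slin t : 0 <= t -> bounded_linear (@nmX R N q hq1) (@growth_cst R N d q) (S t) by exact: heatX_linear.
have S0 x : S 0 x = x by exact: heatX0.
have Ssemi s t x : 0 <= s -> 0 <= t -> nmX (S s (S t x) - S (s + t) x) = 0 by exact: heatX_semi.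
have Scont x e : 0 < e -> exists2 del, 0 < del & forall t, 0 <= t < del -> nmX (S t x - x) <= e.
  exact: heatX_cont.
have mz : measurable_fun setT z := measurable_pos_part hzeta_cont.
have z0 s : 0 <= z s by exact: pos_part_ge0.
have iz T : (@lebesgue_measure R).-integrable (`]0%R, T[%classic : set (measurableTypeR R)) (EFin \o z).
  exact: (integrable_pos_part hzeta_pos hzeta_cont hsigma hzeta_0).
have cz := pos_part_cont hzeta_cont.
have mk : measurable_fun setT kp := measurable_kap c1 c2 b1 b2.
have k0 s : 0 <= kp s by exact: kap_ge0.
have ik T : (@lebesgue_measure R).-integrable (`]0%R, T[%classic : set (measurableTypeR R)) (EFin \o kp).
  exact: integrable_kap.
have Plip := PhiX_lip hd hp hq1 Hs.
have P0 := PhiX0 hd hp hq1 Hs.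
have PS := PhiXS n0 hd hp (q1 := hq1) Hs.
pose G T u := gsol (@nmX R N q hq1) S z Ph (toX hq1 u0) (toX hq1 w) id T u.
have MG T v : mild_solution_Lq d alpha p q zeta u0 w T v <->
    (forall t, 0 <= t <= T -> v t \in Lfun (lebesgue_Rn R N) q%:E) /\ G T (fun t => toX hq1 (v t)).
  exact: (mild_gsol n0 hd hp hq1 Hs).
(* [U] solves on every interval that carries a solution, so its representative [u] serves both as
   the local and as a maximal solution. *)
have [U HU] := maximal_exists snX S z mk k0 ik Plip (toX hq1 u0) (toX hq1 w).
have [T0 T00 [v0 Gv0]] := local_exists snX Slin S0 Ssemi Scont mz z0 iz cz mk k0 ik Plip P0 PS (toX hq1 u0) (toX hq1 w).
pose u t := fromX (U t).
have uE t : toX hq1 (u t) = U t by exact: fromXK.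
have mU T : 0 <= T -> (exists v, G T v) -> mild_solution_Lq d alpha p q zeta u0 w T u.
  move=> Tp ex; apply/MG; split; first by move=> t _; exact: fromX_Lfun.
  by rewrite (_ : (fun t => toX hq1 (u t)) = U); [exact: HU|apply/funext].
have T0p := ltW T00; have mU0 : mild_solution_Lq d alpha p q zeta u0 w T0 u by apply: mU => //; exists v0.
exists T0, u; split => //.
- move=> v /MG[vL Gv] t tT; apply/(nmX_ae hq1); [exact: vL|exact: fromX_Lfun|].
  have [_ Gu] := (MG _ _).1 mU0.
  exact: (gsol_unique snX mk k0 ik Plip T0p Gv Gu tT).
- exists u; split; last by move=> t _; apply: nearW.
  move=> T Tp /ereal_sup_gt[_ [T' [T'0 [v /MG[_ Gv]]] <-]]; rewrite lte_fin => TT'.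
  apply: mU; first exact: ltW.
  by exists (fun t => toX hq1 (v t)); exact: gsolS (ltW TT') Gv.
- move=> V mV Tfin; set Tm := Tmax _ _ _ _ _ _ _ in mV Tfin *.
  have T0m : (T0%:E <= Tm)%E.
    by apply: ereal_sup_ubound; exists T0 => //; split => //; exists u.
  pose Ts := fine Tm; have TsE : Tm = Ts%:E.
    by rewrite fineK// fin_real// Tfin andbT (lt_le_trans _ T0m)// ltNyr.
  have Ts0 : 0 < Ts by rewrite -lte_fin -TsE (lt_le_trans _ T0m).
  have GV T : 0 < T < Ts -> (forall t, 0 <= t <= T -> V t \in Lfun (lebesgue_Rn R N) q%:E) /\
      G T (fun t => toX hq1 (V t)).
    by move=> /andP[Tp TT]; apply/MG; apply: mV => //; rewrite -/Tm TsE lte_fin.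
  have nC : ~ (exists2 T, Ts < T & exists u, G T u).
    move=> [T TsT ex]; have Tp : 0 < T := lt_trans Ts0 TsT.
    have : (T%:E <= Tm)%E.
      by apply: ereal_sup_ubound; exists T => //; split => //; exists u; exact: (mU T (ltW Tp) ex).
    by rewrite TsE lee_fin leNgt TsT.
  apply/cvgeyPge => A.
  have [del d0 hdel] := blowup snX Slin Ssemi Scont mz z0 iz cz mk k0 ik Plip P0 PS A Ts0 (fun T TT => (GV T TT).2) nC.
  near=> t; have tTs : t < Ts by near: t; exact: nbhs_left_lt.
  have t0 : 0 < t by near: t; exact: nbhs_left_gt.
  have td : Ts - del < t by near: t; apply: nbhs_left_gt; rewrite gtrBl.
  have VL : V t \in Lfun (lebesgue_Rn R N) q%:E.
    have tm : 0 < (t + Ts) / 2 < Ts by rewrite midf_lt// andbT divr_gt0// addr_gt0.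
    by apply: (GV _ tm).1; rewrite (ltW t0) ltW// midf_lt.
  rewrite (LnormE VL) lee_fin ltW//.
  by have := hdel t; rewrite td tTs /nmX toXK// => /(_ isT).
Unshelve. all: by end_near. Qed.
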